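(* Assume the following conditions. (i) For some $0<\alpha<1$: $h\in C^{2,\alpha}(\overline{\Omega})$, $g\in C^{2+\alpha,1+\frac{\alpha}{2}}(\overline{\Sigma})$, and the compatibility condition $$\partial_t g(x,0)-\Delta_x h(x)=F(x,0,\sigma(0),h(x)),\qquad x\in\Gamma,$$ holds for the coefficients $\sigma=\sigma_1$ and $\sigma=\sigma_2$ considered below. (ii) $F=F(x,t,\sigma,u)\in C^1(\overline{\Omega}\times\mathbb{R}\times\mathbb{R}\times\mathbb{R})$ is such that $\partial_uF$ and $\partial_\sigma F$ are $C^1$, and $F$ and $\partial_\sigma F$ are $C^2$ with respect to $x$ and $u$. (iii) There exist $M>0$ and $x_0\in\Gamma$ such that $$\inf_{t\in[0,T],\ \sigma\in[-M,M]}|\partial_\sigma F(x_0,t,\sigma,g(x_0,t))|>0.$$ (iv) There exist two nonnegative constants $c$ and $d$ such that, for every $\sigma\in C^1[0,T]$, $$uF(x,t,\sigma(t),u)\leq cu^2+d,\qquad t\in[0,T],\ x\in\overline{\Omega},\ u\in\mathbb{R}.$$ Then, with $M$ as in (iii), there exists a constant $C>0$, depending only on the data ($\Omega,T,F,g,h$) and the fixed number $M$, such that for all such $\sigma_1,\sigma_2\in B(M)$, with $u_i=u(\sigma_i)$ ($i=1,2$), one has $$\|\sigma_2-\sigma_1\|_{L^\infty(0,T)}\leq C\,\|\partial_t\partial_\nu u_2-\partial_t\partial_\nu u_1\|_{L^\infty(\Sigma)}.$$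
   Context: $\Omega$ is a bounded domain of $\mathbb{R}^n$, $n\geq 2$, of class $C^3$; $T>0$; $Q=\Omega\times(0,T)$, $\Gamma=\partial\Omega$, $\Sigma=\Gamma\times(0,T)$. $\partial_\nu$ is the derivative in the direction of the unit outward normal vector to $\Gamma$. $C^{2+\alpha,1+\alpha/2}$ denotes the usual parabolic Hölder space ($2+\alpha$ in $x$, $1+\alpha/2$ in $t$). $B(M)$ is the ball of $C^1[0,T]$ centered at $0$ with radius $M$. For $\sigma\in C^1[0,T]$, $u=u(\sigma)\in C^{2+\alpha,1+\frac{\alpha}{2}}(\overline{Q})$ denotes the unique solution of the semi-linear initial-boundary value problem $$\partial_t u-\Delta_x u=F(x,t,\sigma(t),u(x,t)) \text{ in } Q,\qquad u(x,0)=h(x),\ x\in\Omega,\qquad u(x,t)=g(x,t),\ (x,t)\in\Sigma.$$ If $\partial_t(\partial_\nu u_2-\partial_\nu u_1)$ is not in $L^\infty(\Sigma)$, the right-hand side of the estimate is understood as $+\infty$. *)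

(* Defs.v *)
From HB Require Import structures.
From mathcomp Require Import all_boot all_order all_algebra.
From mathcomp Require Import all_classical all_reals all_analysis.

Set Implicit Arguments.
Unset Strict Implicit.
Unset Printing Implicit Defensive.

Import Order.TTheory GRing.Theory Num.Theory.
Import numFieldNormedType.Exports.

Local Open Scope classical_set_scope.
Local Open Scope ring_scope.

Section Regularity.
Context {R : realType} {V : normedModType R}.
Implicit Types (D dirs : set V) (f : V -> R).

Definition continuous_upto D f : Prop :=
  exists f' : V -> R,
    {within closure D, continuous f'} /\ forall x, D x -> f x = f' x.

(* The value at [x \in closure D] of the continuous extension of [f],
   of which only the values on [D] matter. *)
Definition cont_ext D f (x : V) : R := lim (f y @[y --> within D (nbhs x)]).

(* For [D] open: all iterated derivatives of [f] of order at most [k] in the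
   directions [dirs] exist in [D] and extend continuously to [closure D].
   With [dirs = setT] this is the usual class C^k. *)
Fixpoint C_upto (k : nat) dirs D f : Prop :=
  continuous_upto D f /\
  (if k is k'.+1 then
     forall v, dirs v ->
       (forall x, D x -> derivable f x v) /\ C_upto k' dirs D ('D_v f)
   else True).

(* Same, the values of [f] on [closure D] being those of the extension. *)
Definition C_closure (k : nat) dirs D f : Prop :=
  {within closure D, continuous f} /\ C_upto k dirs D f.

Definition holder (P : V -> V -> Prop) (a : R) f : Prop :=
  exists C : R, forall p q, P p q -> `|f p - f q| <= C * `|p - q| `^ a.

Definition C2_holder_closure (a : R) D f : Prop :=
  C_closure 2 setT D f /\
  forall v w, holder (fun x y => D x /\ D y) a ('D_w ('D_v f)).

Definition laplacian (n : nat) (e : 'I_n -> V) f (x : V) : R :=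
  \sum_(i < n) 'D_(e i) ('D_(e i) f) x.

End Regularity.

Section Euclidean.
Context {R : realType} {n : nat}.
Implicit Types x y : 'rV[R]_n.

Definition dot x y : R := \sum_(i < n) x 0 i * y 0 i.
Definition enorm x : R := Num.sqrt (dot x x).

Definition basis_vec (i : 'I_n) : 'rV[R]_n := delta_mx 0 i.

(* Points of R^n x R are pairs (x, t). *)
Definition space_vec (i : 'I_n) : 'rV[R]_n * R := (basis_vec i, 0).
Definition time_vec : 'rV[R]_n * R := (0, 1).
Definition space_dirs : set ('rV[R]_n * R) := [set v | v.2 = 0].

Definition edist_xt (p q : 'rV[R]_n * R) : R :=
  Num.sqrt (enorm (p.1 - q.1) ^+ 2 + (p.2 - q.2) ^+ 2).

End Euclidean.

Section ParabolicHolder.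
Context {R : realType} {n : nat}.
Implicit Types (D : set 'rV[R]_n) (Q : set ('rV[R]_n * R)).

Definition cylinder D (T : R) : set ('rV[R]_n * R) := D `*` `]0, T[.

Definition holder_x Q (a : R) (f : 'rV[R]_n * R -> R) : Prop :=
  holder (fun p q => [/\ Q p, Q q & p.2 = q.2]) a f.
Definition holder_t Q (a : R) (f : 'rV[R]_n * R -> R) : Prop :=
  holder (fun p q => [/\ Q p, Q q & p.1 = q.1]) a f.

(* The class C^(2+a, 1+a/2) of the closure of [D x (0,T)], as in Ladyzhenskaya,
   Solonnikov and Ural'tseva.  The Hoelder conditions are expressed with the
   library norm of R^n, equivalent to the Euclidean one. *)
Definition parabolic_C2holder D (T a : R) (u : 'rV[R]_n * R -> R) : Prop :=
  let Q := cylinder D T in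
  [/\ C_closure 2 space_dirs Q u,
      C_upto 1 [set time_vec] Q u,
      forall v, space_dirs v -> holder_t Q ((1 + a) / 2) ('D_v u),
      forall v w, space_dirs v -> space_dirs w ->
        holder_x Q a ('D_w ('D_v u)) /\ holder_t Q (a / 2) ('D_w ('D_v u))
    & holder_x Q a ('D_time_vec u) /\ holder_t Q (a / 2) ('D_time_vec u)].

End ParabolicHolder.

Section Domains.
Context {R : realType} {n : nat}.
Implicit Types Omega : set 'rV[R]_n.+1.

Definition frontier Omega : set 'rV[R]_n.+1 := closure Omega `\` Omega°.

Definition is_domain Omega : Prop :=
  [/\ open Omega, connected Omega & Omega !=set0].

(* In the orthonormal frame given by the rows of [O], the first coordinate of a
   point of R^(n+1) is the height and the n other ones parametrize the base. *)
Definition graph_map (O : 'M[R]_(1 + n)) (gamma : 'rV[R]_n -> R)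
    (y : 'rV[R]_n) : 'rV[R]_n.+1 :=
  row_mx (gamma y)%:M y *m O.

(* Inside the ball of centre x0 and radius r, Omega is the part strictly above
   the graph of the C^k function gamma. *)
Definition graph_chart (k : nat) Omega (x0 : 'rV[R]_n.+1)
    (O : 'M[R]_(1 + n)) (gamma : 'rV[R]_n -> R) (r : R) : Prop :=
  [/\ O *m O^T = 1%:M, C_upto k setT setT gamma, 0 < r &
      forall x : 'rV[R]_n.+1, enorm (x - x0) < r ->
        let z : 'rV[R]_(1 + n) := x *m O^T in
        Omega x <-> gamma (rsubmx z) < lsubmx z 0 0].

Definition class_C (k : nat) Omega : Prop :=
  forall x0, frontier Omega x0 ->
    exists O gamma r, graph_chart k Omega x0 O gamma r.

(* The class C^(2+a, 1+a/2) of the closure of [frontier Omega x (0,T)]: near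
   each boundary point, [g] read in a local C^3 graph parametrization of the
   boundary is of that class. *)
Definition lateral_C2holder Omega (T a : R) (g : 'rV[R]_n.+1 * R -> R) : Prop :=
  forall x0, frontier Omega x0 ->
    exists O gamma r, graph_chart 3 Omega x0 O gamma r /\
      exists (y0 : 'rV[R]_n) (rho : R),
        [/\ 0 < rho, graph_map O gamma y0 = x0,
            forall y, ball y0 rho y -> enorm (graph_map O gamma y - x0) < r
          & parabolic_C2holder (ball y0 rho) T a
              (fun p => g (graph_map O gamma p.1, p.2))].

(* nu is unit, orthogonal to the velocities of the curves drawn on the
   boundary through x, and points out of Omega. *)
Definition outward_unit_normal Omega (x nu : 'rV[R]_n.+1) : Prop :=
  [/\ enorm nu = 1,
      forall c : R -> 'rV[R]_n.+1, (forall s, frontier Omega (c s)) ->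
        c 0 = x -> derivable c 0 1 -> dot ('D_1 c 0) nu = 0
    & \forall s \near 0^'+,
        Omega (x - s *: nu) /\ ~ closure Omega (x + s *: nu)].

Definition normal_vec Omega (x : 'rV[R]_n.+1) : 'rV[R]_n.+1 :=
  xget 0 [set nu | outward_unit_normal Omega x nu].

(* The spatial gradient of u on the lateral boundary is the continuous
   extension of the gradient in the open cylinder. *)
Definition normal_derivative Omega (T : R) (u : 'rV[R]_n.+1 * R -> R)
    (p : 'rV[R]_n.+1 * R) : R :=
  \sum_(i < n.+1) normal_vec Omega p.1 0 i *
    cont_ext (cylinder Omega T) ('D_(space_vec i) u) p.

End Domains.

Section Hausdorff.
Context {R : realType} {T : pointedType}.
Variable (d : T -> T -> R).
Local Open Scope ereal_scope.

Definition hdiam (A : set T) : \bar R :=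
  ereal_sup (0 |` [set (d p.1 p.2)%:E | p in A `*` A]).

Lemma hdiam_ge0 A : 0 <= hdiam A.
Proof. by apply: ereal_sup_ubound; left. Qed.

Lemma hdiam0 : hdiam set0 = 0.
Proof.
apply/eqP; rewrite eq_le hdiam_ge0 andbT.
by apply: ge_ereal_sup => x [->//|[p []]].
Qed.

Lemma le_hdiam A B : A `<=` B -> hdiam A <= hdiam B.
Proof.
move=> AB; apply: ereal_sup_le => x [->|[p [Ap1 Ap2] <-]]; first by left.
by right; exists p => //; split; apply: AB.
Qed.

(* Copy of T whose "measurable" sets are the sets of diameter at most delta;
   they form a semiring, whence an outer measure by the library construction. *)
Definition small_sets (delta : {posnum R}) : Type := T.
Definition small_display (delta : {posnum R}) : measure_display.
Proof. exact. Qed.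

Section small.
Variable delta : {posnum R}.
Let small : set (set T) := [set A | hdiam A <= delta%:num%:E].

Let small0 : small set0.
Proof. by rewrite /small/= hdiam0 lee_fin. Qed.

Let smallI : setI_closed small.
Proof. by move=> A B Asm _; apply: le_trans Asm; apply: le_hdiam => x []. Qed.

Let smallD : semi_setD_closed small.
Proof.
apply: setD_semi_setD_closed => A B Asm _.
by apply: le_trans Asm; apply: le_hdiam => x [].
Qed.

HB.instance Definition _ := Pointed.on (small_sets delta).
HB.instance Definition _ := @isSemiRingOfSets.Build (small_display delta)
  (small_sets delta) small small0 smallI smallD.

End small.

(* The (s+1)-dimensional Hausdorff outer measure, without the usual
   dimensional normalization constant. *)
Definition hausdorff (s : nat) (A : set T) : \bar R :=
  ereal_sup [set @mu_ext _ (small_sets delta) R (fun U => hdiam U ^+ s.+1) A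
            | delta in [set: {posnum R}]].

Section hausdorff_outer_measure.
Variable s : nat.

Let w0 : hdiam set0 ^+ s.+1 = 0.
Proof. by rewrite hdiam0 expeS mul0e. Qed.

Let w_ge0 A : 0 <= hdiam A ^+ s.+1.
Proof. exact/expe_ge0/hdiam_ge0. Qed.

Lemma hausdorff_ge0 A : 0 <= hausdorff s A.
Proof.
apply: le_ereal_sup_tmp.
exists (@mu_ext _ (small_sets (PosNum (@ltr01 R))) R
  (fun U => hdiam U ^+ s.+1) A); last exact: mu_ext_ge0.
by exists (PosNum (@ltr01 R)).
Qed.

Lemma hausdorff0 : hausdorff s set0 = 0.
Proof.
apply/eqP; rewrite eq_le hausdorff_ge0 andbT.
by apply: ge_ereal_sup => _ [delta _ <-]; rewrite mu_ext0.
Qed.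

Lemma le_hausdorff : {homo hausdorff s : A B / A `<=` B >-> A <= B}.
Proof.
move=> A B AB; apply: ge_ereal_sup => _ [delta _ <-].
apply: le_ereal_sup_tmp.
exists (@mu_ext _ (small_sets delta) R (fun U => hdiam U ^+ s.+1) B).
  by exists delta.
exact: le_mu_ext.
Qed.

Lemma hausdorff_sigma_subadditive : sigma_subadditive (hausdorff s).
Proof.
move=> F; apply: ge_ereal_sup => _ [delta _ <-].
apply: le_trans (@mu_ext_sigma_subadditive _ (small_sets delta) R _ w_ge0 F) _.
apply: lee_nneseries => i *; first exact: mu_ext_ge0.
by apply: ereal_sup_ubound; exists delta.
Qed.

HB.instance Definition _ := isOuterMeasure.Build R T (hausdorff s)
  hausdorff0 hausdorff_ge0 le_hausdorff hausdorff_sigma_subadditive.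

End hausdorff_outer_measure.
End Hausdorff.

Section LateralBoundary.
Context {R : realType} {n : nat}.

(* Hypersurface measure of R^(n+1) x R: the (n+1)-dimensional Hausdorff measure
   for the Euclidean distance, on Caratheodory-measurable sets.  On a lateral
   boundary it is, up to a positive constant factor, the product of the surface
   measure of the base by dt; neither the L^oo norm nor the weak
   time derivative depends on that factor. *)
Definition surface_outer : {outer_measure set ('rV[R]_n.+1 * R) -> \bar R} :=
  hausdorff (@edist_xt R n.+1) n.
Definition surface_type := caratheodory_type surface_outer.
Definition surface_measure : {measure set surface_type -> \bar R} :=
  surface_outer : set surface_type -> \bar R.

Definition Linf_norm (d : measure_display) (X : measurableType d)
    (mu : {measure set X -> \bar R}) (D : set X) (f : X -> R) : \bar R :=
  ('N[mu]_+oo [EFin \o (f \_ D)])%E.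

(* Restrictions of these functions to the lateral boundary are used as test
   functions there. *)
Definition test_function (T : R) (phi : 'rV[R]_n.+1 * R -> R) : Prop :=
  (forall k, C_upto k setT setT phi) /\
  exists K : set ('rV[R]_n.+1 * R),
    [/\ compact K, K `<=` [set p | 0 < p.2 < T] & forall p, ~ K p -> phi p = 0].

Definition bounded_weak_dt (Omega : set 'rV[R]_n.+1) (T : R)
    (f w : 'rV[R]_n.+1 * R -> R) : Prop :=
  let Sigma := cylinder (frontier Omega) T in
  [/\ measurable_fun (Sigma : set surface_type) (w : surface_type -> R),
      (Linf_norm surface_measure Sigma w < +oo)%E
    & forall phi, test_function T phi ->
        \int[surface_measure]_(p in Sigma) (f p * 'D_time_vec phi p) =
        - \int[surface_measure]_(p in Sigma) (w p * phi p)].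

(* The L^oo norm over the lateral boundary of the weak time derivative of f;
   it is +oo, as the infimum of the empty set, when that derivative does not
   exist as an element of L^oo. *)
Definition dt_Linf_norm (Omega : set 'rV[R]_n.+1) (T : R)
    (f : 'rV[R]_n.+1 * R -> R) : \bar R :=
  ereal_inf [set Linf_norm surface_measure (cylinder (frontier Omega) T) w
            | w in [set w | bounded_weak_dt Omega T f w]].

End LateralBoundary.

Section Problem.
Context {R : realType} {n : nat}.
Implicit Types (Omega : set 'rV[R]_n.+1) (h : 'rV[R]_n.+1 -> R)
  (g u : 'rV[R]_n.+1 * R -> R) (F : 'rV[R]_n.+1 * R * R * R -> R).

Definition C1_itv (T : R) (sigma : R -> R) : Prop :=
  C_closure 1 setT (`]0, T[ : set R) sigma.

Definition C1_norm (T : R) (sigma : R -> R) : R :=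
  sup [set `|sigma t| | t in `[0, T]] + sup [set `|derive1 sigma t| | t in `]0, T[].

Definition C1_ball (T M : R) (sigma : R -> R) : Prop :=
  C1_itv T sigma /\ C1_norm T sigma <= M.

Definition Linf_norm_itv (T : R) (f : R -> R) : \bar R :=
  Linf_norm (@lebesgue_measure R) `]0, T[ f.

(* The arguments of F are (x, t, sigma, u). *)
Definition F_dom Omega : set ('rV[R]_n.+1 * R * R * R) :=
  Omega `*` setT `*` setT `*` setT.
Definition d_sigma F : 'rV[R]_n.+1 * R * R * R -> R := 'D_((0, 0, 1, 0)) F.
Definition d_u F : 'rV[R]_n.+1 * R * R * R -> R := 'D_((0, 0, 0, 1)) F.
Definition xu_dirs : set ('rV[R]_n.+1 * R * R * R) :=
  [set v | v.1.1.2 = 0 /\ v.1.2 = 0].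

Definition nonlinearity_regular Omega F : Prop :=
  [/\ C_closure 1 setT (F_dom Omega) F,
      C_closure 1 setT (F_dom Omega) (d_u F),
      C_closure 1 setT (F_dom Omega) (d_sigma F),
      C_closure 2 xu_dirs (F_dom Omega) F
    & C_closure 2 xu_dirs (F_dom Omega) (d_sigma F)].

Definition compatible Omega (T : R) F h g (sigma : R -> R) : Prop :=
  forall x, frontier Omega x ->
    cont_ext (cylinder (frontier Omega) T) ('D_time_vec g) (x, 0)
      - cont_ext Omega (laplacian basis_vec h) x
    = F (x, 0, sigma 0, h x).

Definition is_solution Omega (T a : R) F h g (sigma : R -> R) u : Prop :=
  [/\ parabolic_C2holder Omega T a u,
      forall x t, Omega x -> 0 < t < T ->
        'D_time_vec u (x, t) - laplacian space_vec u (x, t)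
        = F (x, t, sigma t, u (x, t)),
      forall x, Omega x -> u (x, 0) = h x
    & forall x t, frontier Omega x -> 0 < t < T -> u (x, t) = g (x, t)].

End Problem.

(* Main.v *)
Require Import Defs.
From HB Require Import structures.
From mathcomp Require Import all_boot all_order all_algebra.
From mathcomp Require Import all_classical all_reals all_analysis.
From mathcomp Require Import measurable_realfun ess_sup_inf.
From mathcomp Require Import ring lra.

(** Write u = u2 - u1 and s = sigma2 - sigma1.  Then u_t - Lap u = S, where
    S = F(x, t, sigma2, u2) - F(x, t, sigma1, u1), and u vanishes on the lateral
    boundary and at time 0.  On the lateral boundary u1 = u2, so that near the point x0
    of the nondegeneracy condition the boundary values of S are comparable to s(t).  The
    theorem thus bounds the source S at the boundary by the time derivative of the
    normal derivative of u.  The proof uses the maximum principle with barriers in local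
    charts of the boundary, and no representation of solutions.

    Assume first that the normal derivative of u is D-Lipschitz in time at each
    boundary point.  The gradient of u on the boundary is normal
    ([boundary_gradient]), so the trace of the derivative v of u along a fixed direction
    e transversal to the boundary is Lipschitz in time as well, with a constant of order D
    ([trace_lip]).  Fix a time tau and a small radius rho, and let xh be the boundary
    point near x0 where v(., tau) - K |x - x0|^2 is maximal.  A barrier keeps v(., tau)
    below its boundary value at xh plus a multiple of the height z above the boundary
    ([trace_barrier]); integrating along e, u(., tau) lies below an explicit function
    that it touches to first order at xh ([near_foot]).  Since u_t tends to 0 at the
    boundary ([boundary_dt]), a very negative source near xh would make Lap u
    large, and the boundary point lemma ([hopf]) would forbid the contact.  Hence the
    source cannot be too negative: [source_bound].

    To apply this, choose tau where |s(t)| exp(- t / rho^2) nearly attains its supremum, and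
    exchange the two solutions if necessary so that S is nonpositive near x0.
    With the weight exp(t / rho^2), comparison bounds u and its increments by
    rho^2 |s(tau)| plus a multiple of D ([difference_sup_bound],
    [difference_gradient_bound]), so that [source_bound] reads
    |s(tau)| <= C (rho |s(tau)| + D / rho).  A small rho gives the estimate
    ([stability]).  The constants come from bounds of the solutions that depend only on
    the data and on M: the growth condition bounds the solutions
    ([solution_sup_bound]), and barriers bound the increments of their differences near the
    boundary ([boundary_lipschitz]).

    There remains to see that the continuous function f = d_nu u2 - d_nu u1 is
    D-Lipschitz in time when it has a weak time derivative w with |w| <= D almost
    everywhere ([slope_bound]).  The integral of f against a bump centred at
    (x0, h) has, as a function of h, a derivative bounded by D times the integral of the
    bump, and this integral does not depend on h since translations in time
    preserve the Hausdorff measure; shrinking the bump gives the values of f.  The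
    measure of small pieces of the lateral boundary is finite and positive because they have
    bi-Lipschitz coordinates ([lipschitz_finite], [lipschitz_positive],
    [boundary_coordinates]), and continuous functions are measurable on them because
    closed sets satisfy Caratheodory's condition ([closed_split]). *)

Set Implicit Arguments.
Unset Strict Implicit.
Unset Printing Implicit Defensive.

Import Order.TTheory GRing.Theory Num.Theory.
Import numFieldNormedType.Exports.

Local Open Scope classical_set_scope.
Local Open Scope ring_scope.

(** * Second order jets of functions of one variable *)

Ltac nonneg := repeat first
  [ assumption | apply: ltW; assumption | exact: normr_ge0 | exact: ler01
  | exact: ler0n | exact: expR_ge0 | exact: sqr_ge0 | apply: mulr_ge0
  | apply: addr_ge0 | rewrite invr_ge0 ].

Section Calculus1D.
Context {R : realType}.
Implicit Types f g : R -> R.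

(** The second derivative is only required at 0, as a derivative of f': this is all
    that a maximum principle uses, and it is stable by the operations below. *)
Definition jet2 f (a b : R) : Prop :=
  exists f' : R -> R, [/\ \forall s \near (0 : R), is_derive (s : R) (1 : R) f (f' s),
    f' 0 = a & is_derive (0 : R) (1 : R) f' b].

Lemma is_derive_congr (V W : normedModType R) (f : V -> W) x v d d' :
  is_derive x v f d -> d = d' -> is_derive x v f d'.
Proof. by move=> ? <-. Qed.

Lemma jet2_ext f g a b : f =1 g -> jet2 f a b -> jet2 g a b.
Proof. by move=> /funext ->. Qed.

Lemma jet2_is_derive f a b : jet2 f a b -> is_derive (0 : R) (1 : R) f a.
Proof. by move=> [f' [ff' <- _]]; exact: nbhs_singleton ff'. Qed.

Lemma jet2_cst c : jet2 (fun=> c) 0 0.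
Proof.
exists (fun=> 0); split => //; last exact: is_derive_cst.
by near=> s; exact: is_derive_cst.
Unshelve. all: by end_near.
Qed.

Lemma jet2_id : jet2 id 1 0.
Proof.
exists (fun=> 1); split => //; last exact: is_derive_cst.
by near=> s; exact: is_derive_id.
Unshelve. all: by end_near.
Qed.

Lemma jet2D f g a b c d : jet2 f a b -> jet2 g c d ->
  jet2 (fun s => f s + g s) (a + c) (b + d).
Proof.
move=> [f' [ff' f'0 f'b]] [g' [gg' g'0 g'b]].
exists (fun s => f' s + g' s); split.
- near=> s; apply: (is_deriveD (f := f) (g := g) (df := f' s) (dg := g' s)).
    by near: s.
  by near: s.
- by rewrite f'0 g'0.
- exact: (is_deriveD f'b g'b).
Unshelve. all: by end_near. Qed.

Lemma jet2M f g a b c d : jet2 f a b -> jet2 g c d ->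
  jet2 (fun s => f s * g s) (a * g 0 + f 0 * c)
    (b * g 0 + 2 * a * c + f 0 * d).
Proof.
move=> [f' [ff' f'0 f'b]] [g' [gg' g'0 g'b]].
exists (fun s => f' s * g s + f s * g' s); split.
- near=> s; apply: (is_derive_congr (d := f s *: g' s + g s *: f' s)).
    by apply: (is_deriveM (f := f) (g := g)); near: s.
  by rewrite /GRing.scale/= addrC [g s * _]mulrC.
- by rewrite f'0 g'0.
- have f0 : is_derive (0 : R) 1 f a by rewrite -f'0; exact: nbhs_singleton ff'.
  have g0 : is_derive (0 : R) 1 g c by rewrite -g'0; exact: nbhs_singleton gg'.
  apply: (is_derive_congr (d := (f' 0 *: c + g 0 *: b) + (f 0 *: d + g' 0 *: a))).
  by rewrite /GRing.scale/= f'0 g'0; ring.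
Unshelve. all: by end_near. Qed.

Lemma jet2Z f a b k : jet2 f a b -> jet2 (fun s => k * f s) (k * a) (k * b).
Proof.
move=> ff; have := jet2M (jet2_cst k) ff.
by rewrite mul0r mulr0 !mul0r !add0r.
Qed.

Lemma jet2N f a b : jet2 f a b -> jet2 (fun s => - f s) (- a) (- b).
Proof.
by move=> /(jet2Z (-1)); rewrite !mulN1r; apply: jet2_ext => s; rewrite mulN1r.
Qed.

Lemma jet2B f g a b c d : jet2 f a b -> jet2 g c d ->
  jet2 (fun s => f s - g s) (a - c) (b - d).
Proof. by move=> ff /jet2N; exact: jet2D. Qed.

Lemma jet2_affine c k : jet2 (fun s => c + s * k) k 0.
Proof.
have := jet2D (jet2_cst c) (jet2M jet2_id (jet2_cst k)).
by rewrite add0r !mulr0 !mul0r !mul1r !addr0.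
Qed.

Lemma is_derive_continuous f x a : is_derive (x : R) (1 : R) f a ->
  {for x, continuous f}.
Proof.
by move=> [fx _]; apply: differentiable_continuous; exact/derivable1_diffP.
Qed.

Lemma is_derive_cvg f x a : is_derive (x : R) (1 : R) f a ->
  h^-1 * (f (h + x) - f x) @[h --> (0:R)^'] --> a.
Proof.
move=> [df <-]; have /cvg_ex[l fl] := df.
rewrite /derive (cvg_lim _ fl) //; apply: cvg_trans fl.
by apply: near_eq_cvg; near=> h; rewrite /GRing.scale/= mulr1.
Unshelve. all: by end_near. Qed.

Lemma derive_ge0_left f t a d : 0 < d -> is_derive (t : R) (1 : R) f a ->
  (forall s, t - d <= s <= t -> f s <= f t) -> 0 <= a.
Proof.
move=> d0 /is_derive_cvg fa fmax.
have fa' : h^-1 * (f (h + t) - f t) @[h --> (0:R)^'-] --> a.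
  exact: cvg_dnbhs_at_left.
rewrite -(cvg_lim _ fa')//; apply: limr_ge.
  by apply/cvg_ex; exists a.
near=> h.
have h0 : h < 0 by near: h; exact: nbhs_left_lt.
have hd : - d < h by near: h; apply: nbhs_left_gt; rewrite oppr_lt0.
rewrite nmulr_rge0 ?invr_lt0// subr_le0; apply: fmax; lra.
Unshelve. all: by end_near. Qed.

Lemma derive_le0_right f a d : 0 < d -> is_derive (0 : R) (1 : R) f a ->
  (forall s, 0 <= s <= d -> f s <= f 0) -> a <= 0.
Proof.
move=> d0 /is_derive_cvg fa fmax.
have fa' : h^-1 * (f (h + 0) - f 0) @[h --> (0:R)^'+] --> a.
  exact: cvg_dnbhs_at_right.
rewrite -(cvg_lim _ fa')//; apply: limr_le.
  by apply/cvg_ex; exists a.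
near=> h.
have h0 : 0 < h by near: h; exact: nbhs_right_gt.
have hd : h < d by near: h; apply: nbhs_right_lt.
rewrite pmulr_rle0 ?invr_gt0// subr_le0 addr0; apply: fmax; lra.
Unshelve. all: by end_near. Qed.

(** If the second derivative were positive, the first one would be positive
    on the right of the maximum, where the function would then increase. *)
Lemma jet2_max f a b : jet2 f a b -> (\forall s \near (0:R), f s <= f 0) ->
  a = 0 /\ b <= 0.
Proof.
move=> [f' [ff' f'0 f'b]] fmax.
have [d /= d0 hd] : \forall e \near (0:R)^'+, forall s, `|s| < e ->
    is_derive (s : R) (1 : R) f (f' s) /\ f s <= f 0.
  have /nbhs_ballP[e /= e0 he] : \forall s \near (0:R),
      is_derive (s : R) (1 : R) f (f' s) /\ f s <= f 0 by near=> s; split; near: s.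
  near=> r => s sr; apply: he; rewrite /ball/= sub0r normrN.
  by apply: lt_le_trans sr _; near: r; exact: nbhs_right_le.
have {}hd : forall s, `|s| < d / 2 -> is_derive (s : R) (1 : R) f (f' s) /\ f s <= f 0.
  apply: hd => /=; last by rewrite divr_gt0.
  by rewrite sub0r normrN gtr0_norm ?divr_gt0//; lra.
set e := d / 2 in hd.
have e0 : 0 < e by rewrite divr_gt0.
have f0 : is_derive (0 : R) (1 : R) f a by rewrite -f'0; apply: (hd 0 _).1; rewrite normr0.
have a0 : a = 0.
  apply/eqP; rewrite eq_le; apply/andP; split.
    apply: (derive_le0_right (d := e/2)) f0 _; first by rewrite divr_gt0.
    move=> s /andP[s0 se]; apply: (hd s _).2; rewrite ger0_norm//; lra.
  apply: (derive_ge0_left (d := e/2)) f0 _; first by rewrite divr_gt0.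
  move=> s /andP[]; rewrite sub0r => s0 se; apply: (hd s _).2.
  rewrite ler0_norm//; lra.
split => //; rewrite leNgt; apply/negP => b0.
have /is_derive_cvg cb := f'b.
have cb' : h^-1 * (f' (h + 0) - f' 0) @[h --> (0:R)^'+] --> b.
  exact: cvg_dnbhs_at_right.
have : \forall h \near (0:R)^'+, 0 < h^-1 * (f' (h + 0) - f' 0).
  exact: (cvgr_gt _ cb').
move=> [d' /= d'0 hd'].
pose m := Num.min e d' / 2.
have m0 : 0 < m by rewrite divr_gt0// lt_min e0 d'0.
have /andP[me md'] : (m < e) && (m < d').
  by rewrite -lt_min /m ltr_pdivrMr// ltr_pMr ?ltr1n// lt_min e0.
have dm s : s \in `]0, m[ -> is_derive (s : R) (1 : R) f (f' s).
  rewrite in_itv/= => /andP[s0 sm]; apply: (hd s _).1.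
  by rewrite gtr0_norm//; lra.
have [|c] := MVT m0 dm.
  apply: continuous_in_subspaceT => s; rewrite inE/= in_itv/= => /andP[s0 sm].
  have sd : is_derive (s : R) (1 : R) f (f' s) by apply: (hd s _).1; rewrite ger0_norm//; lra.
  exact: is_derive_continuous sd.
rewrite in_itv/= => /andP[c0 cm]; rewrite subr0 => fm.
have : 0 < c^-1 * (f' (c + 0) - f' 0).
  apply: hd' => //=; rewrite sub0r normrN gtr0_norm//; lra.
rewrite f'0 a0 subr0 addr0 pmulr_rgt0 ?invr_gt0// => f'c.
have : f m <= f 0 by apply: (hd m _).2; rewrite gtr0_norm.
by rewrite leNgt -subr_gt0 fm mulr_gt0.
Unshelve. all: by end_near. Qed.

End Calculus1D.

Section Lines.
Context {R : realType} {V : normedModType R}.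
Implicit Types (f : V -> R) (x v w : V).

Lemma is_derive_line f x v s :
  derivable f (x + s *: v) v ->
  is_derive s 1 (fun s => f (x + s *: v)) ('D_v f (x + s *: v)).
Proof.
move=> df.
have E : (fun h => h^-1 *: (((fun s => f (x + s *: v)) \o shift s) (h *: 1) -
            f (x + s *: v))) =
         (fun h => h^-1 *: ((f \o shift (x + s *: v)) (h *: v) - f (x + s *: v))).
  apply/funext => h /=; congr (_ *: (f _ - _)).
  by rewrite -[h%:A]/(h * 1) mulr1 scalerDl addrCA.
by split; rewrite ?/derivable ?/derive E.
Qed.

Lemma line_is_derive f x v d :
  is_derive (0 : R) (1 : R) (fun s => f (x + s *: v)) d -> is_derive x v f d.
Proof.
move=> [df dd].
have E : (fun h => h^-1 *: ((f \o shift x) (h *: v) - f x)) =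
  (fun h => h^-1 *: (((fun s => f (x + s *: v)) \o shift 0) (h *: 1) - f (x + 0 *: v))).
  apply/funext => h /=; congr (_ *: (f _ - f _)); rewrite ?scale0r ?addr0//.
  by rewrite -[h%:A]/(h * 1) mulr1 addrC.
by split; rewrite ?/derivable ?/derive E.
Qed.

End Lines.

(** * Maximum principle for the heat operator *)

Section Laplacian.
Context {R : realType} {n : nat}.
Implicit Types (f g : 'rV[R]_n -> R) (w : 'rV[R]_n * R -> R) (x : 'rV[R]_n).

(** The Laplacian as a relation: it asks for second derivatives along the coordinate
    axes at the point x alone.  The list a of the first derivatives is recorded for the
    product rule. *)
Definition lap_at f x (a : 'I_n -> R) (l : R) : Prop :=
  exists c : 'I_n -> R,
    (forall i, jet2 (fun s => f (x + s *: basis_vec i)) (a i) (c i)) /\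
    l = \sum_i c i.

Definition heat_at w x (t l : R) : Prop :=
  exists d a l', [/\ is_derive (t : R) (1 : R) (fun t => w (x, t)) d,
    lap_at (fun x => w (x, t)) x a l' & l = d - l'].

Lemma lap_at_cst c x : lap_at (fun=> c) x (fun=> 0) 0.
Proof.
by exists (fun=> 0); split => [i|]; [exact: jet2_cst | rewrite big1].
Qed.

Lemma lap_atD f g x a b k l : lap_at f x a k -> lap_at g x b l ->
  lap_at (fun x => f x + g x) x (fun i => a i + b i) (k + l).
Proof.
move=> [c [fc ->]] [d [gd ->]]; exists (fun i => c i + d i).
by rewrite big_split; split => // i; exact: jet2D.
Qed.

Lemma lap_atM f g x a b k l : lap_at f x a k -> lap_at g x b l ->
  lap_at (fun x => f x * g x) x (fun i => a i * g x + f x * b i)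
    (k * g x + 2 * \sum_i a i * b i + f x * l).
Proof.
move=> [c [fc ->]] [d [gd ->]].
exists (fun i => c i * g x + 2 * a i * b i + f x * d i); split => [i|].
  by have := jet2M (fc i) (gd i); rewrite scale0r addr0.
rewrite !big_split/= mulr_suml !mulr_sumr; congr (_ + _ + _).
by apply: eq_bigr => i _; rewrite mulrA.
Qed.

Lemma lap_atZ f x a k c : lap_at f x a k ->
  lap_at (fun x => c * f x) x (fun i => c * a i) (c * k).
Proof.
move=> [b [fb ->]]; exists (fun i => c * b i); rewrite mulr_sumr.
by split => // i; exact: jet2Z.
Qed.

Lemma lap_atN f x a k : lap_at f x a k ->
  lap_at (fun x => - f x) x (fun i => - a i) (- k).
Proof.
move=> [b [fb ->]]; exists (fun i => - b i); rewrite -sumrN.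
by split => // i; exact: jet2N.
Qed.

Lemma lap_atB f g x a b k l : lap_at f x a k -> lap_at g x b l ->
  lap_at (fun x => f x - g x) x (fun i => a i - b i) (k - l).
Proof. by move=> fk /lap_atN; exact: lap_atD. Qed.

Lemma lap_at_shift f x y a k : lap_at f (x + y) a k ->
  lap_at (fun x => f (x + y)) x a k.
Proof.
move=> [c [fc kc]]; exists c; split => // i.
by apply: jet2_ext (fc i) => s; rewrite addrAC.
Qed.

Lemma jet2_sum (m : nat) (f : 'I_m -> R -> R) (a b : 'I_m -> R) :
  (forall i, jet2 (f i) (a i) (b i)) ->
  jet2 (fun s => \sum_i f i s) (\sum_i a i) (\sum_i b i).
Proof.
elim: m f a b => [|m IH] f a b fab.
  rewrite !big_ord0; apply: jet2_ext (jet2_cst 0) => s.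
  by rewrite big_ord0.
rewrite !big_ord_recl; have := jet2D (fab ord0) (IH _ _ _ (fun i => fab (lift ord0 i))).
by apply: jet2_ext => s; rewrite big_ord_recl.
Qed.

Lemma lap_at_sqdist x0 x :
  lap_at (fun x => dot (x - x0) (x - x0)) x (fun i => 2 * (x - x0) 0 i)
    (2 * n%:R).
Proof.
exists (fun=> 2); split; last by rewrite sumr_const card_ord mulr_natr.
move=> i.
have -> : 2 * (x - x0) 0 i = \sum_(j < n) (2 * (x - x0) 0 j * (i == j)%:R).
  rewrite (bigD1 i)//= eqxx mulr1 big1 ?addr0// => j.
  by rewrite eq_sym => /negbTE ->; rewrite mulr0.
have E2 : 2 = \sum_(j < n) (2 * (i == j)%:R) :> R.
  rewrite (bigD1 i)//= eqxx mulr1 big1 ?addr0// => j.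
  by rewrite eq_sym => /negbTE ->; rewrite mulr0.
rewrite [X in jet2 _ _ X]E2; apply: jet2_sum => j.
have jj := jet2_affine ((x - x0) 0 j) (i == j)%:R.
have := jet2M jj jj; rewrite !mul0r !addr0 mulr0 addr0 add0r.
have -> : (i == j)%:R * (x - x0) 0 j + (x - x0) 0 j * (i == j)%:R =
  2 * (x - x0) 0 j * (i == j)%:R by ring.
have -> : 2 * (i == j)%:R * (i == j)%:R = 2 * (i == j)%:R :> R.
  by case: (i == j); rewrite ?mulr1 ?mulr0.
apply: jet2_ext => s; rewrite !mxE /=.
by congr (_ * _); rewrite eq_sym addrAC.
Qed.

Lemma heat_atD w1 w2 x t k l : heat_at w1 x t k -> heat_at w2 x t l ->
  heat_at (fun p => w1 p + w2 p) x t (k + l).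
Proof.
move=> [d [a [l' [wd wa ->]]]] [d2 [a2 [l2 [wd2 wa2 ->]]]].
exists (d + d2), (fun i => a i + a2 i), (l' + l2); split.
- exact: (is_deriveD wd wd2).
- exact: (lap_atD wa wa2).
- by rewrite opprD addrACA.
Qed.

Lemma heat_atZ w x t k c : heat_at w x t k ->
  heat_at (fun p => c * w p) x t (c * k).
Proof.
move=> [d [a [l' [wd wa ->]]]]; exists (c * d), (fun i => c * a i), (c * l'); split.
- exact: (is_deriveZ c wd).
- exact: (lap_atZ c wa).
- by rewrite mulrBr.
Qed.

Lemma heat_atB w1 w2 x t k l : heat_at w1 x t k -> heat_at w2 x t l ->
  heat_at (fun p => w1 p - w2 p) x t (k - l).
Proof.
move=> h1 /(heat_atZ (-1)) h2; have := heat_atD h1 h2.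
rewrite mulN1r; congr heat_at; apply/funext => p; congr (_ + _).
by rewrite mulN1r.
Qed.

Lemma heat_at_shift w y x t k : heat_at w (x + y) t k ->
  heat_at (fun p => w (p.1 + y, p.2)) x t k.
Proof.
move=> [d [a [l' [wd wa ->]]]]; exists d, a, l'; split => //.
exact: (lap_at_shift (f := fun x => w (x, t))).
Qed.

Lemma heat_at_space f x t a l : lap_at f x a l ->
  heat_at (fun p => f p.1) x t (- l).
Proof.
move=> fl; exists 0, a, l; split => //; last by rewrite sub0r.
exact: (is_derive_cst (f x) t 1).
Qed.

Lemma heat_at_time (f : R -> R) x t d : is_derive (t : R) (1 : R) f d ->
  heat_at (fun p => f p.2) x t d.
Proof.
move=> fd; exists d, (fun=> 0), 0; split => //; last by rewrite subr0.
exact: (lap_at_cst (f t)).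
Qed.

End Laplacian.

Section MaximumPrinciple.
Context {R : realType} {n : nat}.
Implicit Types (w : 'rV[R]_n * R -> R) (x : 'rV[R]_n) (K G : set 'rV[R]_n).

Lemma line_continuous (V : normedModType R) (x v : V) :
  continuous (fun s : R => x + s *: v).
Proof.
move=> s; apply: (@continuousD R V R); first exact: cst_continuous.
by apply: continuousZl.
Qed.

Lemma lap_at_max f G x a l : open G -> G x ->
  (forall y, G y -> f y <= f x) -> lap_at f x a l -> l <= 0.
Proof.
move=> oG Gx fmax [c [fc ->]]; apply: sumr_le0 => i _.
suff /(jet2_max (fc i))[] : \forall s \near (0 : R),
  f (x + s *: basis_vec i) <= f (x + 0 *: basis_vec i) by [].
rewrite scale0r addr0.
have : nbhs x G by exact: open_nbhs_nbhs.
have := @line_continuous _ x (basis_vec i) 0; rewrite /continuous_at scale0r addr0.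
move=> h /h Gs.
by near=> s; apply: fmax; near: s.
Unshelve. all: by end_near. Qed.

(** At a positive maximum of exp(-(L+1)t) w in the interior, or at the final
    time, w_t >= (L+1) w and Lap w <= 0, which contradicts
    w_t - Lap w <= L w. *)
Lemma maximum_principle (K G : set 'rV[R]_n) (tau L : R) w :
  compact K -> open G -> G `<=` K -> 0 <= L ->
  {within K `*` `[0, tau], continuous w} ->
  (forall x (t : R), K x -> 0 <= t <= tau -> ~ G x \/ t = 0 -> w (x, t) <= 0) ->
  (forall x (t : R), G x -> 0 < t <= tau -> 0 < w (x, t) ->
    exists2 l, heat_at w x t l & l <= L * w (x, t)) ->
  forall x (t : R), K x -> 0 <= t <= tau -> w (x, t) <= 0.
Proof.
move=> cK oG GK L0 wc wbd wheat x t Kx tt.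
have [wx|wx] := leP (w (x, t)) 0; first by [].
pose W p := expR (- (L + 1) * p.2) * w p.
have Wc : {within K `*` `[0, tau], continuous W}.
  apply/subspace_continuousP => p Kp; apply: cvgM; last first.
    by move/subspace_continuousP : wc; exact.
  apply: cvg_within_filter.
  apply: continuous_comp; last exact: continuous_expR.
  apply: continuousM; first exact: cst_continuous.
  exact: cvg_snd.
have ne : (K `*` `[0, tau]) !=set0 by exists (x, t); split; rewrite //= in_itv.
have [|[y s] ] := compact_EVT_max ne _ Wc.
  by apply: compact_setX => //; exact: segment_compact.
rewrite inE /= => -[/= Ky]; rewrite in_itv/= => /andP[s0 st] Wmax.
have {}Wmax z r : K z -> 0 <= r <= tau -> W (z, r) <= W (y, s).
  by move=> Kz rt; apply: Wmax; rewrite inE/=; split; rewrite //= in_itv.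
have Wys : 0 < W (y, s).
  by apply: lt_le_trans (Wmax _ _ Kx tt); rewrite mulr_gt0 ?expR_gt0.
have wys : 0 < w (y, s) by move: Wys; rewrite pmulr_rgt0 ?expR_gt0.
have Gy : G y.
  by apply: contrapT => nG; move: wys; rewrite ltNge wbd ?s0//; left.
have {}s0 : 0 < s.
  rewrite lt_neqAle s0 andbT; apply/eqP => e0.
  by move: wys; rewrite ltNge wbd ?s0//; right.
have [|l [d [a [l' [wd wl lE]]]] lL] := wheat y s Gy _ wys; first by rewrite s0.
have l'0 : l' <= 0.
  apply: (lap_at_max oG Gy _ wl) => z Gz.
  have /= := Wmax z s (GK _ Gz).
  by rewrite (ltW s0) st => /(_ isT); rewrite ler_pM2l ?expR_gt0.
have dE : is_derive (s : R) (1 : R) (fun t => W (y, t))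
    (expR (- (L + 1) * s) * (d - (L + 1) * w (y, s))).
  have e1 : is_derive (s : R) (1 : R) (fun t => expR (- (L + 1) * t))
     (expR (- (L + 1) * s) * - (L + 1)).
    have h1 : is_derive (s : R) (1 : R) (fun t : R => - (L + 1) * t) (- (L + 1)).
      apply: (is_derive_congr (is_deriveZ (f := id) (- (L + 1)) (is_derive_id s 1))).
      by rewrite /GRing.scale/= mulr1.
    exact: (is_derive1_comp (f := expR) (g := fun t => - (L + 1) * t)).
  apply: (is_derive_congr (is_deriveM (f := fun t => expR (- (L + 1) * t)) e1 wd)).
  by rewrite /GRing.scale/=; ring.
have : 0 <= expR (- (L + 1) * s) * (d - (L + 1) * w (y, s)).
  apply: (derive_ge0_left s0 dE) => r /andP[r0 rs]; apply: Wmax => //.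
  by rewrite -(subrr s) r0 (le_trans rs st).
rewrite pmulr_rge0 ?expR_gt0// => dL.

move: wys; suff : w (y, s) <= 0 by lra.
have : L * w (y, s) >= d - l' by rewrite -lE.
by lra.
Qed.

End MaximumPrinciple.

(** * Continuous extensions and compactness *)

Section Topology.
Context {R : realType} {V : normedModType R}.
Implicit Types (D K : set V) (f g : V -> R) (x v : V).

Lemma within_continuousP K f : {within K, continuous f} <->
  forall x, K x -> f y @[y --> within K (nbhs x)] --> f x.
Proof. exact: subspace_continuousP. Qed.

Lemma compact_bounded K f : compact K -> {within K, continuous f} ->
  exists2 C : R, 0 < C & forall x, K x -> `|f x| <= C.
Proof.
move=> cK fc; have [K0|/set0P/negP] := pselect (K !=set0); last first.
  by rewrite negbK => /eqP ->; exists 1.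
have nfc : {within K, continuous (fun x => `|f x|)}.
  apply/within_continuousP => x Kx; apply: cvg_norm.
  by move/within_continuousP : fc; exact.
have [c _ hc] := compact_EVT_max K0 cK nfc.
exists (`|f c| + 1); first by rewrite ltr_wpDl.
by move=> x Kx; rewrite (le_trans (hc _ (mem_set Kx)))// lerDl.
Qed.

Lemma within_continuous_le K f : {within K, continuous f} -> forall x, K x ->
  forall e, 0 < e -> exists2 d : R, 0 < d &
    forall y, K y -> `|x - y| < d -> `|f x - f y| < e.
Proof.
move=> /within_continuousP fc x Kx e e0.
have /cvgrPdist_lt/(_ _ e0)/nbhs_normP[d /= d0 hd] := fc x Kx.
by exists d => // y Ky xy; apply: hd.
Qed.

Lemma le_within_continuous K f : (forall x, K x -> forall e, 0 < e ->
    exists2 d : R, 0 < d & forall y, K y -> `|x - y| < d -> `|f x - f y| < e) ->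
  {within K, continuous f}.
Proof.
move=> h; apply/within_continuousP => x Kx; apply/cvgrPdist_lt => e e0.
have [d d0 hd] := h x Kx e e0; apply/nbhs_normP; exists d => //= y xy Ky.
exact: hd.
Qed.

(** A local statement at scale d, stable under decreasing d, holds at one
    common scale on a compact set. *)
Lemma compact_uniform K (P : R -> V -> Prop) : compact K ->
  (forall x, K x -> exists2 r : R, 0 < r &
     forall y d, K y -> `|x - y| < r -> 0 < d -> d < r -> P d y) ->
  exists2 r : R, 0 < r & forall d x, 0 < d -> d < r -> K x -> P d x.
Proof.
move=> cK h.
have [r /= r0 hr] : \forall d \near (0:R)^'+, K `<=` P d.
  apply: (((near_covering_withinP K).2 ((compact_near_coveringP K).1 cK)) R (0:R)^'+ P).
  move=> x Kx; have [r r0 hr] := h x Kx.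
  exists ([set y | `|x - y| < r], [set d | 0 < d < r]) => /=.
    split; first by apply/nbhs_normP; exists r.
    by near=> d; apply/andP; split; near: d; [exact: nbhs_right_gt|exact: nbhs_right_lt].
  by move=> [y d] /= [xy /andP[d0 dr]] Ky; exact: hr.
exists r => // d x d0 dr; apply: hr => //=.
by rewrite sub0r normrN gtr0_norm.
Unshelve. all: by end_near. Qed.

Lemma compact_unif_continuous K f : compact K -> {within K, continuous f} ->
  forall e, 0 < e -> exists2 d : R, 0 < d &
    forall x y, K x -> K y -> `|x - y| < d -> `|f x - f y| < e.
Proof.
move=> cK fc e e0; have e20 : 0 < e / 2 by rewrite divr_gt0.
have [|r r0 hr] := compact_uniform
    (P := fun d x => forall y, K y -> `|x - y| < d -> `|f x - f y| < e) cK.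
  move=> x Kx; have [r r0 hr] := within_continuous_le fc Kx e20.
  exists (r / 2); first by rewrite divr_gt0.
  move=> y d Ky xy d0 dr z Kz yz.
  have xz : `|x - z| < r.
    by rewrite (le_lt_trans (ler_distD y _ _))// [ltRHS]splitr ltrD// (lt_trans yz).
  rewrite (le_lt_trans (ler_distD (f x) _ _))// [ltRHS]splitr ltrD//.
    by rewrite distrC hr// (lt_trans xy)// ltr_pdivrMr// ltr_pMr// ltr1n.
  exact: hr.
exists (r / 2); first by rewrite divr_gt0.
move=> x y Kx; apply: hr => //; first by rewrite divr_gt0.
by rewrite ltr_pdivrMr// ltr_pMr// ltr1n.
Qed.

Lemma cont_extE D f f' x : {within closure D, continuous f'} ->
  (forall x, D x -> f x = f' x) -> closure D x -> cont_ext D f x = f' x.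
Proof.
move=> /within_continuousP f'c ff' Dx.
have ? := within_nbhs_proper Dx.
apply: cvg_lim => //.
have h : f' y @[y --> within D (nbhs x)] --> f' x.
  have := f'c x Dx; apply: cvg_trans; apply: cvg_fmap2.
  move=> A hA; apply: (filterS _ (hA : nbhs x [set y | closure D y -> A y])).
  by move=> y Ay Dy; apply: Ay; exact: subset_closure.
apply: cvg_trans h; apply: near_eq_cvg.
by rewrite near_withinE; near=> y => Dy; rewrite ff'.
Unshelve. all: by end_near.
Qed.

Lemma cont_extP D f : continuous_upto D f ->
  {within closure D, continuous (cont_ext D f)} /\
  forall x, D x -> f x = cont_ext D f x.
Proof.
move=> [f' [f'c ff']]; split => [|x Dx]; last first.
  by rewrite (cont_extE f'c)// ?ff'//; exact: subset_closure.
apply/within_continuousP => x Dx; rewrite (cont_extE f'c ff' Dx).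
have /within_continuousP/(_ x Dx) := f'c; apply: cvg_trans.
apply: near_eq_cvg; rewrite near_withinE; near=> y => Dy.
by rewrite (cont_extE f'c ff' Dy).
Unshelve. all: by end_near. Qed.

Lemma continuous_upto_lin D f g (a b : R) :
  continuous_upto D f -> continuous_upto D g ->
  continuous_upto D (fun x => a * f x + b * g x).
Proof.
move=> [f' [f'c ff']] [g' [g'c gg']]; exists (fun x => a * f' x + b * g' x).
split=> [|x Dx]; last by rewrite ff' ?gg'.
move/within_continuousP : f'c => f'c; move/within_continuousP : g'c => g'c.
apply/within_continuousP => x Dx; apply: cvgD; apply: cvgM;
  [exact: cvg_cst|exact: f'c|exact: cvg_cst|exact: g'c].
Qed.

Lemma cont_ext_lin D f g (a b : R) x :
  continuous_upto D f -> continuous_upto D g -> closure D x ->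
  cont_ext D (fun x => a * f x + b * g x) x = a * cont_ext D f x + b * cont_ext D g x.
Proof.
move=> fc gc Dx; have [fc1 fe] := cont_extP fc; have [gc1 ge] := cont_extP gc.
rewrite (cont_extE (f' := fun x => a * cont_ext D f x + b * cont_ext D g x))//.
  move/within_continuousP : fc1 => f'c; move/within_continuousP : gc1 => g'c.
  apply/within_continuousP => y Dy; apply: cvgD; apply: cvgM;
    [exact: cvg_cst|exact: f'c|exact: cvg_cst|exact: g'c].
by move=> y Dy; rewrite -fe// -ge.
Qed.

Lemma line_MVT f x v (a b : R) : a < b ->
  (forall s, a < s < b -> derivable f (x + s *: v) v) ->
  {within `[a, b], continuous (fun s => f (x + s *: v))} ->
  exists2 c, a < c < b & f (x + b *: v) - f (x + a *: v) =
    'D_v f (x + c *: v) * (b - a).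
Proof.
move=> ab df fc.
have [|c] := @MVT R (fun s => f (x + s *: v)) (fun s => 'D_v f (x + s *: v)) a b ab _ fc.
  by move=> s; rewrite in_itv/= => sab; apply: is_derive_line; exact: df.
by rewrite in_itv/= => cab h; exists c.
Qed.

Lemma line_MVT_open f x v (a b : R) : a < b ->
  (forall s, a <= s <= b -> derivable f (x + s *: v) v) ->
  exists2 c, a < c < b & f (x + b *: v) - f (x + a *: v) =
    'D_v f (x + c *: v) * (b - a).
Proof.
move=> ab df; apply: line_MVT => // [s /andP[? ?]|].
  by apply: df; rewrite !ltW.
apply: continuous_in_subspaceT => s; rewrite inE/= in_itv/= => /df h.
exact: is_derive_continuous (is_derive_line h).
Qed.

Lemma line_within (K : set V) f x v (a b : R) : {within K, continuous f} ->
  (forall s, a <= s <= b -> K (x + s *: v)) ->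
  {within `[a, b], continuous (fun s => f (x + s *: v))}.
Proof.
move=> /within_continuousP fc hK; apply/subspace_continuousP => s /=.
rewrite in_itv/= => sab; have := fc _ (hK s sab).
apply: cvg_comp => A /= hA.
have h := @line_continuous R V x v s _ hA.
apply: (filterS _ (h : nbhs s [set r | K (x + r *: v) -> A (x + r *: v)])).
by move=> r /= Ar; rewrite /= in_itv/= => /hK; exact: Ar.
Qed.

End Topology.

(** * Linearity of the directional derivative in the direction *)

Section DirectionLinearity.
Context {R : realType} {V : normedModType R}.
Implicit Types (D : set V) (f : V -> R) (x v w : V).

Lemma line_MVT_sym f x v (h : R) :
  (forall s, `|s| <= `|h| -> derivable f (x + s *: v) v) ->
  exists2 c, `|c| <= `|h| & f (x + h *: v) - f x = 'D_v f (x + c *: v) * h.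
Proof.
move=> df; have [h0|h0|->] := ltrgt0P h.
- have [|c /andP[c0 ch] E] := line_MVT_open (f := f) (x := x) (v := v) h0.
    by move=> s /andP[s0 sh]; apply: df; rewrite !ger0_norm// (le_trans s0).
  exists c; first by rewrite !gtr0_norm// ltW.
  by move: E; rewrite scale0r addr0 subr0.
- have [|c /andP[c0 ch] E] := line_MVT_open (f := f) (x := x) (v := v) h0.
    move=> s /andP[s0 sh]; apply: df; rewrite !ler0_norm ?lerN2// (le_trans s0)//.
  exists c; first by rewrite !ltr0_norm// lerN2 ltW.
  move: E; rewrite scale0r addr0 sub0r mulrN => /(congr1 -%R).
  by rewrite opprB opprK.
- by exists 0; rewrite ?normr0// scale0r addr0 subrr mulr0.
Qed.

Lemma is_derive_normP (W : normedModType R) (f : V -> W) x v d :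
  is_derive x v f d <-> forall e : R, 0 < e -> exists2 r : R, 0 < r &
    forall h : R, `|h| < r -> `|f (x + h *: v) - f x - h *: d| <= e * `|h|.
Proof.
have key h : h != 0 -> `|d - h^-1 *: (f (x + h *: v) - f x)| * `|h| =
    `|f (x + h *: v) - f x - h *: d|.
  move=> h0; rewrite mulrC -normrZ scalerBr scalerA mulfV// scale1r distrC.
  by [].
have cE : (fun h => h^-1 *: ((f \o shift x) (h *: v) - f x)) =
    (fun h => h^-1 *: (f (x + h *: v) - f x)).
  by apply/funext => h /=; rewrite [h *: v + x]addrC.
split=> [fd e e0|hd].
  have [df dE] := fd.
  have fc : (h^-1 *: (f (x + h *: v) - f x)) @[h --> (0:R)^'] --> d.
    by rewrite -cE; have /cvg_ex[l fl] := df; rewrite -dE /derive (cvg_lim _ fl).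
  have /cvgrPdist_lt/(_ _ e0) := fc.
  rewrite near_withinE => /nbhs_normP[r /= r0 hr]; exists r => // h hlt.
  have [->|h0] := eqVneq h 0.
    by rewrite !scale0r addr0 subrr subr0 !normr0 mulr0.
  rewrite -key// ler_pM2r ?normr_gt0//; apply/ltW/hr => //.
  by rewrite /= sub0r normrN.
have fc : (h^-1 *: ((f \o shift x) (h *: v) - f x)) @[h --> (0:R)^'] --> d.
  rewrite cE; apply/cvgrPdist_le => e e0; have [r r0 hr] := hd e e0.
  rewrite near_withinE; apply/nbhs_normP; exists r => //= h.
  rewrite /= sub0r normrN => /hr hh h0.
  by rewrite -(ler_pM2r (_ : 0 < `|h|)) ?normr_gt0// key.
by split; [apply/cvg_ex; exists d|exact: cvg_lim].
Qed.

Lemma is_derive_epsP f x v d : is_derive x v f d <->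
  forall e : R, 0 < e -> exists2 r : R, 0 < r &
    forall h : R, `|h| < r -> `|f (x + h *: v) - f x - h * d| <= e * `|h|.
Proof. exact: is_derive_normP. Qed.

(** Along v + w, move first along v, then along w: the second increment is a
    value of the derivative along w at a nearby point. *)
Lemma is_derive_dirD D f x v w : open D -> D x ->
  (forall y, D y -> derivable f y v) -> (forall y, D y -> derivable f y w) ->
  {for x, continuous ('D_w f)} ->
  is_derive x (v + w) f ('D_v f x + 'D_w f x).
Proof.
move=> oD Dx dv dw wc; apply/is_derive_epsP => e e0.
have e20 : 0 < e / 2 by rewrite divr_gt0.
have [r1 r10 hv] := (is_derive_epsP _ _ _ _).1 (DeriveDef (dv x Dx) erefl) _ e20.
have Dn : \forall y \near x, D y by exact: open_nbhs_nbhs.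
have /nbhs_normP[r2 /= r20 hw] : \forall y \near x,
    D y /\ `|'D_w f x - 'D_w f y| < e / 2.
  by near=> y; split; near: y => //; move/cvgrPdist_lt : wc; exact.
pose M := `|v| + `|w| + 1.
have M0 : 0 < M by rewrite /M ltr_wpDl// addr_ge0.
exists (Num.min r1 (r2 / M)); first by rewrite lt_min r10 divr_gt0.
move=> h; rewrite lt_min => /andP[h1 h2].
have hs s : `|s| <= `|h| -> `|x - (x + h *: v + s *: w)| < r2.
  move=> sh; rewrite -addrA opprD addNKr normrN.
  rewrite (le_lt_trans (ler_normD _ _))// !normrZ.
  apply: le_lt_trans (_ : `|h| * (`|v| + `|w|) < _).
    by rewrite mulrDr lerD2l ler_wpM2r.
  move: h2; rewrite ltr_pdivlMr//; apply: le_lt_trans.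
  by rewrite ler_wpM2l// /M lerDl.
have [s sh E] := line_MVT_sym (f := f) (x := x + h *: v) (v := w)
  (fun s sh => dw _ (hw _ (hs s sh)).1).
rewrite scalerDr addrA.
have -> : f (x + h *: v + h *: w) - f x - h * ('D_v f x + 'D_w f x) =
  (f (x + h *: v + h *: w) - f (x + h *: v) - 'D_w f x * h) +
  (f (x + h *: v) - f x - h * 'D_v f x) by ring.
rewrite E -mulrBl; apply: le_trans (ler_normD _ _) _.
have -> : e * `|h| = e / 2 * `|h| + e / 2 * `|h| by field.
apply: lerD; last exact: hv.
by rewrite normrM ler_wpM2r// distrC ltW// (hw _ (hs s sh)).2.
Unshelve. all: by end_near. Qed.

Lemma is_derive_dirZ f x v (k : R) : derivable f x v ->
  is_derive x (k *: v) f (k * 'D_v f x).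
Proof.
move=> df; apply: line_is_derive.
have h1 : is_derive (0 : R) (1 : R) (fun s : R => k * s) k.
  apply: (is_derive_congr (is_deriveZ (f := id) k (is_derive_id (0:R) 1))).
  by rewrite /GRing.scale/= mulr1.
have h2 : is_derive (k * 0 : R) (1 : R) (fun s => f (x + s *: v)) ('D_v f x).
  have := @is_derive_line R V f x v 0; rewrite scale0r addr0 mulr0; exact.
have := is_derive1_comp h2 h1; rewrite mulrC.
by congr is_derive; apply/funext => s /=; rewrite scalerA mulrC.
Qed.

End DirectionLinearity.

(** * Charts of the boundary *)

Section EpsDelta.
Context {R : realType} {V W : normedModType R}.

Lemma eps_continuous (f : V -> W) x :
  (forall e : R, 0 < e -> exists2 d : R, 0 < d &
    forall y, `|x - y| < d -> `|f x - f y| < e) -> {for x, continuous f}.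
Proof.
move=> h; apply/cvgrPdist_lt => e /h[d d0 hd].
by apply/nbhs_normP; exists d => // y /=; exact: hd.
Qed.

End EpsDelta.

Section DotProduct.
Context {R : realType} {n : nat}.
Implicit Types (x y v : 'rV[R]_n).

Lemma dot_ge0 x : 0 <= dot x x.
Proof. by apply: sumr_ge0 => i _; rewrite -expr2 sqr_ge0. Qed.

Lemma enorm_ge0 x : 0 <= enorm x. Proof. exact: sqrtr_ge0. Qed.

Lemma sqr_enorm x : enorm x ^+ 2 = dot x x.
Proof. by rewrite sqr_sqrtr// dot_ge0. Qed.

Lemma le_coord_norm x i : `|x 0 i| <= `|x|.
Proof. by rewrite [leRHS]/Num.norm/= mx_normrE (le_bigmax _ _ (0, i)). Qed.

Lemma norm_le_coord x (c : R) : 0 <= c -> (forall i, `|x 0 i| <= c) -> `|x| <= c.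
Proof.
move=> c0 h; rewrite [leLHS]/Num.norm/= mx_normrE.
by apply: bigmax_le => // -[i j] _ /=; rewrite ord1.
Qed.

Lemma norm_le_enorm x : `|x| <= enorm x.
Proof.
apply: norm_le_coord; first exact: enorm_ge0.
move=> i; rewrite -sqrtr_sqr ler_wsqrtr// /dot (bigD1 i)//= expr2 lerDl.
by apply: sumr_ge0 => j _; rewrite -expr2 sqr_ge0.
Qed.

Lemma dot_le_norm x : dot x x <= n%:R * `|x| ^+ 2.
Proof.
apply: le_trans (_ : \sum_(i < n) `|x| ^+ 2 <= _).
  apply: ler_sum => i _; rewrite -expr2 -(real_normK (num_real (x 0 i))).
  by rewrite ler_pXn2r ?nnegrE// le_coord_norm.
by rewrite sumr_const card_ord mulr_natl.
Qed.

Lemma enorm_le_norm x : enorm x <= n.+1%:R * `|x|.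
Proof.
rewrite -(ler_pXn2r (n := 2)) ?nnegrE ?enorm_ge0 ?mulr_ge0// sqr_enorm.
rewrite (le_trans (dot_le_norm x))// exprMn ler_wpM2r ?sqr_ge0//.
rewrite -natrX ler_nat; apply: leq_trans (leqnSn n) _.
by rewrite leq_pmulr.
Qed.

Lemma sum_coordM_le v (a : 'I_n -> R) (L : R) : (forall i, `|a i| <= L) ->
  `|\sum_i v 0 i * a i| <= n%:R * L * `|v|.
Proof.
move=> aL; apply: le_trans (ler_norm_sum _ _ _) _.
apply: le_trans (_ : \sum_(i < n) `|v| * L <= _).
  by apply: ler_sum => i _; rewrite normrM ler_pM// le_coord_norm.
by rewrite sumr_const card_ord -mulrA mulr_natl (mulrC L).
Qed.

Lemma coordC (i : 'I_n) : continuous (fun x : 'rV[R]_n => x 0 i).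
Proof. exact: coord_continuous. Qed.

Lemma cvg_sumR (T : Type) (F : set_system T) {FF : Filter F} (m : nat)
    (f : 'I_m -> T -> R) (a : 'I_m -> R) : (forall i, f i @ F --> a i) ->
  (fun t => \sum_i f i t) @ F --> \sum_i a i.
Proof.
move=> fa; apply: cvg_big => // -[u v].
by apply: cvgD; [exact: cvg_fst|exact: cvg_snd].
Qed.

Lemma dot_continuous x0 : continuous (fun x => dot (x - x0) (x - x0)).
Proof.
move=> x; apply: (cvg_sumR (F := nbhs x)) => i.
have h : (fun y : 'rV[R]_n => (y - x0) 0 i) @ x --> (x - x0) 0 i.
  have -> : (fun y : 'rV[R]_n => (y - x0) 0 i) = (fun y => y 0 i - x0 0 i).
    by apply/funext => y; rewrite !mxE.
  have -> : (x - x0) 0 i = x 0 i - x0 0 i by rewrite !mxE.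
    exact: (cvgB (@coordC i x) (cvg_cst (x0 0 i))).
exact: cvgM.
Qed.

End DotProduct.

Section Chart.
Context {R : realType} {n : nat}.
Local Notation E := 'rV[R]_n.+1.
Implicit Types (Omega : set E).

(** Near x0, Omega is the region z > 0, where z is the vertical height above
    the graph: z grows at unit speed along e. *)
Record chart Omega (x0 : E) (r : R) (e : E) (z : E -> R)
    (zd zdd : 'I_n.+1 -> E -> R) : Prop := Chart {
  chart_r : 0 < r;
  chart_e : dot e e = 1;
  chart_shift : forall x s, z (x + s *: e) = z x + s;
  chart_in : forall x, `|x - x0| < r -> (Omega x <-> 0 < z x);
  chart_dir : forall x v, is_derive x v z (\sum_i v 0 i * zd i x);
  chart_jet : forall x i,
    jet2 (fun s => z (x + s *: basis_vec i)) (zd i x) (zdd i x);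
  chart_zdc : forall i, continuous (zd i);
  chart_zddc : forall i, continuous (zdd i) }.

Lemma continuous_upto_setT (V : normedModType R) (f : V -> R) :
  continuous_upto setT f -> continuous f.
Proof.
move=> [f' [f'c ff']]; have -> : f = f' by apply/funext => x; exact: ff'.
move=> x A hA; move/within_continuousP : f'c => /(_ x); rewrite closureT => /(_ I _ hA) h.
by apply: (filterS _ (h : nbhs x [set y | [set: V] y -> A (f' y)])) => y; apply.
Qed.

Lemma is_derive_dir_sum (m k : nat) (gamma : 'rV[R]_m -> R) (a : 'I_k -> R)
    (w : 'I_k -> 'rV[R]_m) x :
  (forall y v, derivable gamma y v) -> (forall v, continuous ('D_v gamma)) ->
  is_derive x (\sum_i a i *: w i) gamma (\sum_i a i * 'D_(w i) gamma x).
Proof.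
move=> gd gc; elim: k a w => [|k IH] a w.
  rewrite !big_ord0; apply: line_is_derive.
  have -> : (fun s : R => gamma (x + s *: 0)) = cst (gamma x).
    by apply/funext => s; rewrite scaler0 addr0.
  exact: is_derive_cst.
rewrite !big_ord_recr /=.
have h1 := IH (fun i => a (widen_ord (leqnSn k) i)) (fun i => w (widen_ord (leqnSn k) i)).
have h2 := is_derive_dirZ (a ord_max) (gd x (w ord_max)).
have := @is_derive_dirD R _ setT gamma x _ (a ord_max *: w ord_max) openT I
   (fun y _ => gd y (\sum_i a (widen_ord (leqnSn k) i) *: w (widen_ord (leqnSn k) i))) (fun y _ => gd y _) (gc _ x).
by rewrite (derive_val (is_derive := h1)) (derive_val (is_derive := h2)).
Qed.

Section GraphChart.
Variables (Omega : set E) (x0 : E) (O : 'M[R]_(1 + n)) (gamma : 'rV[R]_n -> R)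
  (r : R).

Definition base (x : E) : 'rV[R]_n := rsubmx ((x : 'rV[R]_(1 + n)) *m O^T).
Definition level (x : E) : R := lsubmx ((x : 'rV[R]_(1 + n)) *m O^T) 0 0.
Definition vertical : E := row_mx 1%:M 0 *m O.
Definition height (x : E) : R := level x - gamma (base x).
Definition height_d (i : 'I_n.+1) (x : E) : R :=
  level (basis_vec i) - 'D_(base (basis_vec i)) gamma (base x).
Definition height_dd (i : 'I_n.+1) (x : E) : R :=
  - 'D_(base (basis_vec i)) ('D_(base (basis_vec i)) gamma) (base x).

Lemma base_line x s v : base (x + s *: v) = base x + s *: base v.
Proof. by rewrite /base mulmxDl -scalemxAl linearD linearZ. Qed.

Lemma level_line x s v : level (x + s *: v) = level x + s * level v.
Proof. by rewrite /level mulmxDl -scalemxAl linearD linearZ !mxE. Qed.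

Lemma base_sum (a : 'I_n.+1 -> R) (w : 'I_n.+1 -> E) :
  base (\sum_i a i *: w i) = \sum_i a i *: base (w i).
Proof.
rewrite /base mulmx_suml linear_sum; apply: eq_bigr => i _.
by rewrite -scalemxAl linearZ.
Qed.

Lemma level_sum (a : 'I_n.+1 -> R) (w : 'I_n.+1 -> E) :
  level (\sum_i a i *: w i) = \sum_i a i * level (w i).
Proof.
rewrite /level mulmx_suml linear_sum summxE; apply: eq_bigr => i _.
by rewrite -scalemxAl linearZ mxE.
Qed.

Lemma row_sum_basis (m : nat) (v : 'rV[R]_m) : v = \sum_i v 0 i *: basis_vec i.
Proof. exact: row_sum_delta. Qed.

Lemma norm_mulmxr_le (m k : nat) (x : 'rV[R]_m) (A : 'M[R]_(m, k)) :
  `|x *m A| <= m%:R * `|A| * `|x|.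
Proof.
apply: norm_le_coord; first by rewrite !mulr_ge0.
move=> j; rewrite mxE; apply: sum_coordM_le => i.
by rewrite [leRHS]/Num.norm/= mx_normrE (le_bigmax _ _ (i, j)).
Qed.

Lemma base_continuous : continuous base.
Proof.
move=> x; apply: eps_continuous => e e0.
pose M := n.+1%:R * `|(O^T : 'M[R]_(n.+1, n.+1))| + 1.
have M0 : 0 < M by rewrite ltr_wpDl// mulr_ge0.
exists (e / M); first by rewrite divr_gt0.
move=> y; rewrite ltr_pdivlMr// => xy.
have -> : base x - base y = base (x - y).
  by rewrite -[in RHS]scaleN1r base_line scaleN1r.
apply: le_lt_trans xy; apply: le_trans (_ : `|(x - y) *m O^T| <= _).
  apply: norm_le_coord => // i; rewrite mxE; exact: le_coord_norm.
rewrite mulrC (le_trans (norm_mulmxr_le _ _))// ler_wpM2r// /M lerDl //.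
Qed.

Hypothesis gc : graph_chart 3 Omega x0 O gamma r.

Let OOT : O *m O^T = 1%:M. Proof. by case: gc. Qed.
Let OTO : O^T *m O = 1%:M. Proof. exact: mulmx1C. Qed.

Lemma dotE (m : nat) (x y : 'rV[R]_m) : dot x y = (x *m y^T) 0 0.
Proof. by rewrite mxE; apply: eq_bigr => i _; rewrite mxE. Qed.

Lemma base_vertical : base vertical = 0.
Proof. by rewrite /base /vertical -mulmxA OOT mulmx1 row_mxKr. Qed.

Lemma level_vertical : level vertical = 1.
Proof. by rewrite /level /vertical -mulmxA OOT mulmx1 row_mxKl mxE. Qed.

Lemma dot_vertical : dot vertical vertical = 1.
Proof.
rewrite dotE /vertical trmx_mul mulmxA -(mulmxA _ O) OOT mulmx1.
by rewrite tr_row_mx mul_row_col trmx0 mulmx0 addr0 trmx1 mulmx1 mxE.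
Qed.

Lemma gamma_C2 v : [/\ forall x, derivable gamma x v, continuous ('D_v gamma),
  forall x w, derivable ('D_v gamma) x w &
  forall w, continuous ('D_w ('D_v gamma))].
Proof.
have [_ [_ h] _ _] := gc; have [h1 [h2 h3]] := h v I.
split; [by move=> x; exact: h1|exact: continuous_upto_setT| |].
- by move=> x w; apply: (h3 w I).1.
- by move=> w; have [_ [h4 _]] := h3 w I; exact: continuous_upto_setT.
Qed.

(** In the frame O the height above the graph is level - gamma o base, and a ball of
    the Euclidean norm contains a smaller one of the sup norm. *)
Lemma graph_chart_chart :
  chart Omega x0 (r / n.+2%:R) vertical height height_d height_dd.
Proof.
have [_ _ r0 hin] := gc.
split.
- by rewrite divr_gt0.
- exact: dot_vertical.
- move=> x s; rewrite /height base_line level_line base_vertical scaler0 addr0.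
  by rewrite level_vertical mulr1 addrAC.
- move=> x; rewrite ltr_pdivlMr// => xr.
  rewrite hin/= ?subr_gt0//; apply: le_lt_trans xr.
  by rewrite mulrC enorm_le_norm.
- move=> x v; apply: line_is_derive.
  have gd : is_derive (base x) (base v) gamma
      (\sum_i v 0 i * 'D_(base (basis_vec i)) gamma (base x)).
    have -> : base v = \sum_i v 0 i *: base (basis_vec i).
      by rewrite -base_sum -row_sum_basis.
    apply: is_derive_dir_sum => [y w|w]; first by have [h _ _ _] := gamma_C2 w.
    by have [_ h _ _] := gamma_C2 w.
  have h1 : is_derive (0:R) (1:R) (fun s => gamma (base x + s *: base v))
      (\sum_i v 0 i * 'D_(base (basis_vec i)) gamma (base x)).
    have := @is_derive_line R _ gamma (base x) (base v) 0.
    by rewrite scale0r addr0 (derive_val (is_derive := gd)); apply; case: gd.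
  have h2 : is_derive (0:R) (1:R) (fun s : R => level x + s * level v) (level v).
    exact: jet2_is_derive (jet2_affine _ _).
  have := is_deriveB h2 h1.
  have -> : level v - \sum_i v 0 i * 'D_(base (basis_vec i)) gamma (base x) =
      \sum_i v 0 i * height_d i x.
    rewrite {1}(row_sum_basis v) level_sum -sumrB; apply: eq_bigr => i _.
    by rewrite -mulrBr.
  by congr is_derive; apply/funext => s; rewrite /height base_line level_line.
- move=> x i; have [d1 d2 d3 d4] := gamma_C2 (base (basis_vec i)).
  have jg : jet2 (fun s => gamma (base x + s *: base (basis_vec i)))
      ('D_(base (basis_vec i)) gamma (base x))
      ('D_(base (basis_vec i)) ('D_(base (basis_vec i)) gamma) (base x)).
    exists (fun s => 'D_(base (basis_vec i)) gamma (base x + s *: base (basis_vec i))).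
    split.
    + by near=> s; apply: is_derive_line.
    + by rewrite scale0r addr0.
    + have := @is_derive_line R _ ('D_(base (basis_vec i)) gamma) (base x) (base (basis_vec i)) 0.
      by rewrite scale0r addr0; apply; exact: d3.
  have := jet2B (jet2_affine (level x) (level (basis_vec i))) jg.
  rewrite sub0r; apply: jet2_ext => s.
  by rewrite /height base_line level_line.
- move=> i x; have [_ d2 _ _] := gamma_C2 (base (basis_vec i)).
  have h : {for x, continuous ('D_(base (basis_vec i)) gamma \o base)}.
    by apply: continuous_comp; [exact: base_continuous|exact: d2].
  exact: (cvgB (cvg_cst _) h).
- move=> i x; have [_ _ _ d4] := gamma_C2 (base (basis_vec i)).
  have h : {for x, continuous
      ('D_(base (basis_vec i)) ('D_(base (basis_vec i)) gamma) \o base)}.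
    by apply: continuous_comp; [exact: base_continuous|exact: d4].
  exact: cvgN h.
Unshelve. all: by end_near. Qed.

End GraphChart.

End Chart.

(** * Properties of a chart *)

Lemma closure_normP (R : realType) (V : normedModType R) (D : set V) x :
  closure D x <-> forall d : R, 0 < d -> exists y, D y /\ `|x - y| < d.
Proof.
split=> [cx d d0|h B /nbhs_normP[d /= d0 dB]].
  have [|y [Dy xy]] := cx [set y | `|x - y| < d]; last by exists y.
  by apply/nbhs_normP; exists d.
by have [y [Dy xy]] := h d d0; exists y; split => //; exact: dB.
Qed.

Section ChartFacts.
Context {R : realType} {n : nat}.
Local Notation E := 'rV[R]_n.+1.
Variables (Omega : set E) (x0 : E) (r : R) (e : E) (z : E -> R)
  (zd zdd : 'I_n.+1 -> E -> R).
Hypothesis ch : chart Omega x0 r e z zd zdd.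
Hypothesis oOmega : open Omega.

Lemma frontierE x : frontier Omega x <-> closure Omega x /\ ~ Omega x.
Proof. by rewrite /frontier (_ : Omega° = Omega)//; exact/interior_id. Qed.

Lemma norm_chart_e : `|e| <= 1.
Proof.
apply: le_trans (norm_le_enorm e) _.
by rewrite /enorm (chart_e ch) sqrtr1.
Qed.

Lemma chart_De x : \sum_i e 0 i * zd i x = 1.
Proof.
have [_ <-] := chart_dir ch x e.
have h : is_derive x e z 1.
  apply: line_is_derive.
  have -> : (fun s : R => z (x + s *: e)) = (fun s => z x + s * 1).
    by apply/funext => s; rewrite (chart_shift ch) mulr1.
  exact: jet2_is_derive (jet2_affine _ _).
by rewrite (derive_val (is_derive := h)).
Qed.

(** The slope of z along the unit vector e is 1. *)
Lemma chart_grad_ge1 x : 1 <= \sum_i zd i x * zd i x.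
Proof.
have : 0 <= \sum_i (zd i x - e 0 i) ^+ 2 by apply: sumr_ge0 => i _; exact: sqr_ge0.
have -> : \sum_i (zd i x - e 0 i) ^+ 2 =
  \sum_i zd i x * zd i x - 2 * (\sum_i e 0 i * zd i x) + dot e e.
  rewrite mulr_sumr -sumrB -big_split; apply: eq_bigr => i _ /=; ring.
rewrite chart_De (chart_e ch); lra.
Qed.

Lemma closed_ball_compact (c : E) (a : R) : compact [set x | `|x - c| <= a].
Proof.
apply: bounded_closed_compact.
  exists (a + `|c|); split; first exact: num_real.
  move=> M aM x /= xc; rewrite -(subrK c x) (le_trans (ler_normD _ _))//.
  by rewrite (le_trans _ (ltW aM))// lerD2r.
have -> : [set x : E | `|x - c| <= a] = (fun x : E => `|x - c|) @^-1` [set s | s <= a] by [].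
apply: preimage_closed; last exact: closed_le.
move=> x _; apply: eps_continuous => d d0; exists d => // y xy.
apply: le_lt_trans xy; apply: le_trans (ler_dist_dist _ _) _.
by rewrite opprB addrA subrK.
Qed.

Lemma ball_convex (c x y : E) (a s : R) : `|x - c| <= a -> `|y - c| <= a ->
  0 <= s <= 1 -> `|x + s *: (y - x) - c| <= a.
Proof.
move=> xc yc /andP[s0 s1].
have -> : x + s *: (y - x) - c = (1 - s) *: (x - c) + s *: (y - c).
  by apply/rowP => i; rewrite !mxE; ring.
rewrite (le_trans (ler_normD _ _))// !normrZ (ger0_norm s0) ger0_norm ?subr_ge0//.
have -> : a = (1 - s) * a + s * a by ring.
by rewrite lerD// ler_wpM2l// subr_ge0.
Qed.

Lemma chart_bounds : exists L : R, [/\ 1 <= L,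
  forall x, `|x - x0| <= r -> forall i, `|zd i x| <= L,
  forall x, `|x - x0| <= r -> `|\sum_i zdd i x| <= L,
  forall x, `|x - x0| <= r -> \sum_i zd i x * zd i x <= L &
  forall x y, `|x - x0| <= r -> `|y - x0| <= r -> `|z x - z y| <= L * `|x - y|].
Proof.
have bd (f : 'I_n.+1 -> E -> R) : (forall i, continuous (f i)) ->
    exists2 C : R, 0 < C & forall x i, `|x - x0| <= r -> `|f i x| <= C.
  move=> fc; have h i : exists C : R, 0 < C /\ forall x, `|x - x0| <= r -> `|f i x| <= C.
    have [C C0 hC] := compact_bounded (@closed_ball_compact x0 r)
      (continuous_subspaceT (fc i)).
    by exists C.
  have [C hC] := choice h.
  have sC0 : 0 <= \sum_i C i by apply: sumr_ge0 => i _; apply: ltW; exact: (hC i).1.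
  exists (1 + \sum_i C i); first by rewrite ltr_pwDl.
  move=> x i xr; apply: le_trans ((hC i).2 x xr) _.
  rewrite (bigD1 i)//= addrCA lerDl addr_ge0//.
  by apply: sumr_ge0 => j _; apply: ltW; exact: (hC j).1.
have [C C0 hC] := bd _ (chart_zdc ch); have [D D0 hD] := bd _ (chart_zddc ch).
pose N : R := n.+1%:R.
have N1 : 1 <= N by rewrite ler1n.
have ND : 0 <= N * D by rewrite mulr_ge0 ?ltW.
have NC : C <= N * C by apply: ler_peMl => //; exact: ltW.
have NCC : 0 <= N * (C * C) by rewrite !mulr_ge0 ?ltW.
exists (1 + N * C + N * D + N * (C * C)); split.
- rewrite -!addrA lerDl !addr_ge0//; lra.
- move=> x xr i; apply: le_trans (hC x i xr) _; lra.
- move=> x xr; apply: le_trans (ler_norm_sum _ _ _) _.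
  apply: le_trans (_ : \sum_(i < n.+1) D <= _).
    by apply: ler_sum => i _; exact: hD.
  rewrite sumr_const card_ord -mulr_natl; rewrite -/N; lra.
- move=> x xr; apply: le_trans (_ : \sum_(i < n.+1) C * C <= _).
    apply: ler_sum => i _; apply: le_trans (ler_norm _) _.
    by rewrite normrM ler_pM// hC.
  rewrite sumr_const card_ord -mulr_natl -/N; lra.
- move=> x y xr yr.
  have [|s /andP[s0 s1]] := line_MVT_open (f := z) (x := y) (v := x - y) (@ltr01 R).
    by move=> s _; case: (chart_dir ch (y + s *: (x - y)) (x - y)).
  rewrite scale1r scale0r addr0 subr0 mulr1 [y + (x - y)]addrC subrK => ->.
  rewrite (derive_val (is_derive := chart_dir ch _ _)).
  apply: le_trans (sum_coordM_le (L := C) _ _) _.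
    by move=> i; apply: hC; apply: ball_convex => //; rewrite !ltW.
  rewrite ler_wpM2r// -/N; lra.
Qed.

Lemma chart_z_continuous x : `|x - x0| < r -> {for x, continuous z}.
Proof.
move=> xr; have [L [L1 _ _ _ zL]] := chart_bounds.
have L0 : 0 < L by exact: lt_le_trans L1.
apply: eps_continuous => d d0.
exists (Num.min (d / L) (r - `|x - x0|)).
  by rewrite lt_min divr_gt0//= subr_gt0.
move=> y; rewrite lt_min => /andP[xy1 xy2].
apply: le_lt_trans (zL x y _ _) _; first exact: ltW.
  have -> : y - x0 = - (x - y) + (x - x0) by rewrite opprB addrA subrK.
  rewrite (le_trans (ler_normD _ _))// normrN; lra.
by rewrite mulrC -ltr_pdivlMr.
Qed.

Lemma chart_closure x : `|x - x0| < r -> closure Omega x -> 0 <= z x.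
Proof.
move=> xr /closure_normP cx; rewrite leNgt; apply/negP => zx.
have [L [L1 _ _ _ zL]] := chart_bounds.
have L0 : 0 < L by exact: lt_le_trans L1.
have [|y [Oy]] := cx (Num.min (- z x / L) (r - `|x - x0|)).
  by rewrite lt_min divr_gt0//= ?oppr_gt0// subr_gt0.
rewrite lt_min ltr_pdivlMr// => /andP[xy1 xy2].
have yr : `|y - x0| < r.
  have -> : y - x0 = - (x - y) + (x - x0) by rewrite opprB addrA subrK.
  rewrite (le_lt_trans (ler_normD _ _))// normrN; lra.
have zy := (chart_in ch yr).1 Oy.
have := zL x y (ltW xr) (ltW yr).
rewrite mulrC => /le_lt_trans/(_ xy1); rewrite ltr_norml; lra.
Qed.

Lemma chart_frontier x : `|x - x0| < r -> (frontier Omega x <-> z x = 0).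
Proof.
move=> xr; rewrite frontierE; split => [[cx nO]|zx].
  apply/eqP; rewrite eq_le chart_closure// andbT leNgt.
  by apply/negP => /(chart_in ch xr).2.
split; last by move/(chart_in ch xr); rewrite zx ltxx.
apply/closure_normP => d d0.
pose s := Num.min d (r - `|x - x0|) / 2.
have m0 : 0 < Num.min d (r - `|x - x0|) by rewrite lt_min d0 subr_gt0.
have s0 : 0 < s by rewrite divr_gt0.
have /andP[sd sr] : (s < d) && (s < r - `|x - x0|).
  by rewrite -lt_min /s ltr_pdivrMr// ltr_pMr ?ltr1n.
have es : `|s *: e| <= s.
  rewrite normrZ gtr0_norm//; apply: ler_piMr; [exact: ltW|exact: norm_chart_e].
exists (x + s *: e); split; last first.
  by rewrite opprD addNKr normrN (le_lt_trans es).
apply/(chart_in ch).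
  by rewrite addrAC (le_lt_trans (ler_normD _ _))//; lra.
by rewrite (chart_shift ch) zx add0r.
Qed.

Lemma chart_lap x : lap_at z x (zd^~ x) (\sum_i zdd i x).
Proof. by exists (zdd^~ x); split => // i; exact: (chart_jet ch). Qed.

End ChartFacts.

(** * Closed cylinders and solutions of class C^1 *)

Section ProductNorm.
Context {R : realType} {V : normedModType R}.
Implicit Types (x y : V) (t s d : R).

Lemma pair_norm_lt x y t s d :
  (`|((x, t) : V * R) - (y, s)| < d) = (`|x - y| < d) && (`|t - s| < d).
Proof. by rewrite prod_normE /= gt_max. Qed.

Lemma closure_segment (T : R) : 0 < T ->
  closure (`]0, T[ : set R) = `[0, T]%classic.
Proof.
move=> T0; apply/seteqP; split=> t.
  move=> /closure_normP ct; rewrite /= in_itv/=; apply/andP; split; rewrite leNgt.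
    apply/negP => t0; have [|s [/=]] := ct (- t); first by rewrite oppr_gt0.
    rewrite in_itv/= ltr_norml => /andP[? ?] /andP[]; lra.
  apply/negP => t0; have [|s [/=]] := ct (t - T); first by rewrite subr_gt0.
  rewrite in_itv/= ltr_norml => /andP[? ?] /andP[]; lra.
rewrite /= in_itv/= => /andP[t0 tT]; apply/closure_normP => d d0.
have [tT2|tT2] := leP t (T / 2).
  pose s := Num.min d (T / 2) / 2.
  have m0 : 0 < Num.min d (T / 2) by rewrite lt_min d0 divr_gt0.
  have s0 : 0 < s by rewrite divr_gt0.
  have /andP[sd sr] : (s < d) && (s < T / 2).
    by rewrite -lt_min /s ltr_pdivrMr// ltr_pMr ?ltr1n.
  exists (t + s); rewrite /= in_itv/= opprD addNKr normrN gtr0_norm//.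
  by split => //; lra.
pose s := Num.min d (T / 2) / 2.
have m0 : 0 < Num.min d (T / 2) by rewrite lt_min d0 divr_gt0.
have s0 : 0 < s by rewrite divr_gt0.
have /andP[sd sr] : (s < d) && (s < T / 2).
  by rewrite -lt_min /s ltr_pdivrMr// ltr_pMr ?ltr1n.
exists (t - s); rewrite /= in_itv/= opprD addNKr opprK gtr0_norm//.
by split => //; lra.
Qed.

Lemma closure_setX (A : set V) (B : set R) :
  closure (A `*` B) = closure A `*` closure B.
Proof.
apply/seteqP; split=> -[x t].
  move=> /closure_normP h; split; apply/closure_normP => d d0 /=;
    have [[y s] [[/= Ay Bs]]] := h d d0; rewrite pair_norm_lt => /andP[xy ts].
    by exists y.
  by exists s.
move=> [/= /closure_normP hA /closure_normP hB]; apply/closure_normP => d d0.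
have [y [Ay xy]] := hA d d0; have [s [Bs ts]] := hB d d0.
by exists (y, s); split => //; rewrite pair_norm_lt xy.
Qed.

Lemma open_line (G : set V) x v : open G -> G x ->
  \forall s \near (0 : R), G (x + s *: v).
Proof.
move=> oG Gx; have Gn : nbhs (x + 0 *: v) G.
  by rewrite scale0r addr0; exact: open_nbhs_nbhs.
by have := @line_continuous R V x v 0 _ Gn.
Qed.

End ProductNorm.

Section Cylinder.
Context {R : realType} {n : nat}.
Local Notation E := 'rV[R]_n.+1.
Variables (Omega : set E) (T : R).
Hypothesis T0 : 0 < T.
Hypothesis oOmega : open Omega.
Implicit Types (u w : E * R -> R) (x : E).
Local Notation Q := (cylinder Omega T).

Lemma closure_cylinder : closure Q = closure Omega `*` `[0, T].
Proof. by rewrite /cylinder closure_setX closure_segment. Qed.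

Lemma cylinder_in x t : Q (x, t) <-> Omega x /\ 0 < t < T.
Proof. by rewrite /cylinder/= in_itv. Qed.

Lemma closure_cylinder_in x t : closure Q (x, t) <-> closure Omega x /\ 0 <= t <= T.
Proof. by rewrite closure_cylinder/= in_itv. Qed.

Lemma open_cylinder : open Q.
Proof.
rewrite openE => -[x t] [/= Ox tT]; exists (Omega, `]0, T[%classic) => //=.
split; first exact: open_nbhs_nbhs.
by apply: open_nbhs_nbhs; split => //; exact: itv_open.
Qed.

Lemma closure_Omega_compact : bounded_set Omega -> compact (closure Omega).
Proof.
move=> bO; apply: bounded_closed_compact; last exact: closed_closure.
have [M [_ hM]] := bO; exists (M + 1); split; first exact: num_real.
move=> N MN x /closure_normP/(_ 1 ltr01)[y [Oy xy]].
have yM : `|y| <= N - 1 by apply: hM => //; lra.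
have -> : x = (x - y) + y by rewrite subrK.
by rewrite /= (le_trans (ler_normD _ _))//; lra.
Qed.

(** Only first derivatives: the second ones enter at interior points, through the
    heat operator. *)
Definition cyl_C1 u : Prop :=
  [/\ {within closure Q, continuous u},
      forall v, space_dirs v -> (forall p, Q p -> derivable u p v) /\
        continuous_upto Q ('D_v u)
    & (forall p, Q p -> derivable u p time_vec) /\
        continuous_upto Q ('D_time_vec u)].

Lemma parabolic_cyl_C1 a u : parabolic_C2holder Omega T a u -> cyl_C1 u.
Proof.
move=> [[uc [_ u1]] [_ u2] _ _ _]; split => // [v sv|].
  by have [h1 [h2 _]] := u1 v sv.
by have [h1 [h2 _]] := u2 time_vec erefl.
Qed.

Lemma parabolic_heat a u x t : parabolic_C2holder Omega T a u ->
  Omega x -> 0 < t < T ->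
  heat_at u x t ('D_time_vec u (x, t) - laplacian space_vec u (x, t)).
Proof.
move=> [[uc [_ u1]] [_ u2] _ _ _] Ox tT.
have Qxt : Q (x, t) by exact/cylinder_in.
exists ('D_time_vec u (x, t)), (fun i => 'D_(space_vec i) u (x, t)),
  (laplacian space_vec u (x, t)); split => //.
  have [h1 _] := u2 time_vec erefl.
  have := @is_derive_line R _ u (x, 0) time_vec t.
  have E1 s : (x, 0) + s *: time_vec = (x, s) :> E * R.
    by rewrite /time_vec; congr pair; rewrite /= ?scaler0 ?addr0// add0r /GRing.scale/= mulr1.
  rewrite E1 => /(_ (h1 _ Qxt)); congr is_derive.
  by apply/funext => s; rewrite E1.
exists (fun i => 'D_(space_vec i) ('D_(space_vec i) u) (x, t)); split => // i.
have sv : @space_dirs R n.+1 (space_vec i) by [].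
have [h1 [h2 h3]] := u1 _ sv; have [h4 _] := h3 _ sv.
have E1 s : (x, t) + s *: space_vec i = (x + s *: basis_vec i, t) :> E * R.
  by rewrite /space_vec; congr pair; rewrite /= scaler0 addr0.
exists (fun s => 'D_(space_vec i) u (x + s *: basis_vec i, t)); split.
- have hx : \forall s \near (0:R), Q (x + s *: basis_vec i, t).
    by near=> s; rewrite -E1; near: s; exact: open_line open_cylinder Qxt.
  near=> s.
  have := @is_derive_line R _ u (x, t) (space_vec i) s.
  have Qs : Q (x + s *: basis_vec i, t) by near: s.
  rewrite E1 => /(_ (h1 _ Qs)).
  by congr is_derive; apply/funext => r; rewrite E1.
- by rewrite scale0r addr0.
- have := @is_derive_line R _ ('D_(space_vec i) u) (x, t) (space_vec i) 0.
  rewrite E1 scale0r addr0 => /(_ (h4 _ Qxt)); congr is_derive.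
  by apply/funext => r; rewrite E1.
Unshelve. all: by end_near. Qed.

Lemma derive_lin u w v p (a b : R) : derivable u p v -> derivable w p v ->
  is_derive p v (fun q => a * u q + b * w q) (a * 'D_v u p + b * 'D_v w p).
Proof.
move=> du dw.
exact: (is_deriveD (is_deriveZ a (DeriveDef du erefl)) (is_deriveZ b (DeriveDef dw erefl))).
Qed.

Lemma eq_continuous_upto (D : set (E * R)) u w : (forall p, D p -> u p = w p) ->
  continuous_upto D u -> continuous_upto D w.
Proof.
by move=> uw [f [fc fu]]; exists f; split => // p Dp; rewrite -fu// uw.
Qed.

Lemma cyl_C1_lin u w a b : cyl_C1 u -> cyl_C1 w ->
  cyl_C1 (fun p => a * u p + b * w p).
Proof.
move=> [uc us ut] [wc ws wt]; split.
- move/within_continuousP : uc => uc; move/within_continuousP : wc => wc.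
  apply/within_continuousP => p cp.
  by apply: cvgD; apply: cvgM; [exact: cvg_cst|exact: uc|exact: cvg_cst|exact: wc].
- move=> v sv; have [u1 u2] := us v sv; have [w1 w2] := ws v sv; split.
    by move=> p Qp; case: (derive_lin a b (u1 p Qp) (w1 p Qp)).
  apply: eq_continuous_upto (continuous_upto_lin a b u2 w2) => p Qp.
  by rewrite (derive_val (is_derive := derive_lin a b (u1 p Qp) (w1 p Qp))).
- have [u1 u2] := ut; have [w1 w2] := wt; split.
    by move=> p Qp; case: (derive_lin a b (u1 p Qp) (w1 p Qp)).
  apply: eq_continuous_upto (continuous_upto_lin a b u2 w2) => p Qp.
  by rewrite (derive_val (is_derive := derive_lin a b (u1 p Qp) (w1 p Qp))).
Qed.

End Cylinder.

(** * Increments of the nonlinearity *)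

Section Nonlinearity.
Context {R : realType} {n : nat}.
Local Notation E := 'rV[R]_n.+1.
Variables (Omega : set E) (T : R).
Hypothesis oOmega : open Omega.
Hypothesis bOmega : bounded_set Omega.
Implicit Types (F H : E * R * R * R -> R) (x k : E) (t s b h m M : R).

Definition F_range M m : set (E * R * R * R) :=
  closure Omega `*` `[0, T] `*` `[- M, M] `*` `[- m, m].

Lemma F_range_in M m x t s b : closure Omega x -> 0 <= t <= T -> `|s| <= M ->
  `|b| <= m -> F_range M m (x, t, s, b).
Proof. by move=> cx tT sM bm; rewrite /F_range/= !in_itv/= -!ler_norml. Qed.

Lemma F_range_compact M m : compact (F_range M m).
Proof.
repeat apply: compact_setX; try exact: segment_compact.
exact: closure_Omega_compact.
Qed.

Lemma F_range_closure M m : F_range M m `<=` closure (F_dom Omega).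
Proof.
move=> [[[x t] s] b] [[[/= /closure_normP cx _] _] _].
apply/closure_normP => d d0; have [y [Oy xy]] := cx d d0.
exists (y, t, s, b); split => //.
by rewrite !pair_norm_lt xy !subrr !normr0 d0.
Qed.

Lemma F_domE x t s b : F_dom Omega (x, t, s, b) <-> Omega x.
Proof. by split => [[[[]]]|]. Qed.

Lemma F_range_bounded M m H : continuous_upto (F_dom Omega) H ->
  exists2 C : R, 0 < C & forall x t s b, Omega x -> 0 <= t <= T -> `|s| <= M ->
    `|b| <= m -> `|H (x, t, s, b)| <= C.
Proof.
move=> [H' [H'c HH']].
have H'c' : {within F_range M m, continuous H'}.
  exact: (continuous_subspaceW (@F_range_closure M m) H'c).
have [C C0 hC] := compact_bounded (@F_range_compact M m) H'c'.
exists C => // x t s b Ox tT sM bm; rewrite HH'//; apply: hC.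
by apply: F_range_in => //; exact: subset_closure.
Qed.

Lemma is_derive_x H x k t s b r :
  derivable H (x + r *: k, t, s, b) (k, 0, 0, 0) ->
  is_derive (r : R) (1 : R) (fun r => H (x + r *: k, t, s, b))
    ('D_(k, 0, 0, 0) H (x + r *: k, t, s, b)).
Proof.
have := @is_derive_line R _ H (x, t, s, b) (k, 0, 0, 0) r.
have E1 r' : (x, t, s, b) + r' *: (k, 0, 0, 0) = (x + r' *: k, t, s, b) :> E * R * R * R.
  by congr (_, _, _, _); rewrite /= scaler0 addr0.
rewrite E1 => hd /hd; congr is_derive; apply/funext => q; by rewrite E1.
Qed.

Lemma is_derive_sigma H x t s b :
  derivable H (x, t, s, b) (0, 0, 1, 0) ->
  is_derive (s : R) (1 : R) (fun s => H (x, t, s, b))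
    (d_sigma H (x, t, s, b)).
Proof.
have := @is_derive_line R _ H (x, t, 0, b) (0, 0, 1, 0) s.
have E1 r' : (x, t, 0, b) + r' *: (0, 0, 1, 0) = (x, t, r', b) :> E * R * R * R.
  by congr (_, _, _, _); rewrite /= ?scaler0 ?addr0// add0r /GRing.scale/= mulr1.
rewrite E1 => hd /hd; congr is_derive; apply/funext => q; by rewrite E1.
Qed.

Lemma is_derive_u H x t s b :
  derivable H (x, t, s, b) (0, 0, 0, 1) ->
  is_derive (b : R) (1 : R) (fun b => H (x, t, s, b))
    (d_u H (x, t, s, b)).
Proof.
have := @is_derive_line R _ H (x, t, s, 0) (0, 0, 0, 1) b.
have E1 r' : (x, t, s, 0) + r' *: (0, 0, 0, 1) = (x, t, s, r') :> E * R * R * R.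
  by congr (_, _, _, _); rewrite /= ?scaler0 ?addr0// add0r /GRing.scale/= mulr1.
rewrite E1 => hd /hd; congr is_derive; apply/funext => q; by rewrite E1.
Qed.

Lemma MVT_abs (f f' : R -> R) (a b C m : R) : `|a| <= m -> `|b| <= m ->
  (forall s, `|s| <= m -> is_derive (s : R) (1 : R) f (f' s)) ->
  (forall s, `|s| <= m -> `|f' s| <= C) ->
  `|f b - f a| <= C * `|b - a|.
Proof.
wlog ab : a b / a < b.
  move=> wl am bm fd fC; have [ab|ab|->] := ltgtP a b; first exact: wl.
    by rewrite distrC [in leRHS]distrC; exact: wl.
  by rewrite !subrr normr0 mulr0.
move=> am bm fd fC.
have hm s : a <= s <= b -> `|s| <= m.
  by move: am bm; rewrite !ler_norml => /andP[? ?] /andP[? ?] /andP[? ?]; lra.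
have [s sab| |s sab ->] := @MVT_segment R f f' a b (ltW ab).
- by apply: fd; apply: hm; move: sab; rewrite in_itv/= => /andP[? ?]; rewrite !ltW.
- apply: continuous_in_subspaceT => s; rewrite inE/= in_itv/= => /hm/fd.
  exact: is_derive_continuous.
- rewrite normrM ler_wpM2r//; apply: fC; apply: hm.
  by move: sab; rewrite in_itv.
Qed.

(** Mean value theorem along x and along u; the derivatives are bounded because the
    range of the arguments is compact. *)
Lemma F_range_lipschitz H k M m : C_closure 1 setT (F_dom Omega) H ->
  exists2 C : R, 0 < C & forall x h t s b b', 0 < h ->
    (forall r, 0 <= r <= h -> Omega (x + r *: k)) ->
    0 <= t <= T -> `|s| <= M -> `|b| <= m -> `|b'| <= m ->
    `|H (x + h *: k, t, s, b') - H (x, t, s, b)| <= C * (h + `|b' - b|).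
Proof.
move=> [_ [_ Hd]].
have [dx [cx _]] := Hd (k, 0, 0, 0) I; have [db [cb _]] := Hd (0, 0, 0, 1) I.
have [C C0 hC] := F_range_bounded M m cx; have [D D0 hD] := F_range_bounded M m cb.
exists (C + D); first by rewrite addr_gt0.
move=> x h t s b b' h0 xO tT sM bm b'm.
have Ox : Omega x by have := xO 0; rewrite scale0r addr0; apply; rewrite lexx ltW.
have Ox' : Omega (x + h *: k) by apply: xO; rewrite lexx ltW.
have -> : H (x + h *: k, t, s, b') - H (x, t, s, b) =
  (H (x + h *: k, t, s, b') - H (x + h *: k, t, s, b)) +
  (H (x + h *: k, t, s, b) - H (x, t, s, b)) by ring.
apply: le_trans (ler_normD _ _) _.
have h1 : `|H (x + h *: k, t, s, b') - H (x + h *: k, t, s, b)| <= D * `|b' - b|.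
  apply: (MVT_abs (f := fun b => H (x + h *: k, t, s, b))
    (f' := fun b => d_u H (x + h *: k, t, s, b)) bm b'm) => q qm.
    by apply: is_derive_u; apply: db; exact/F_domE.
  exact: hD.
have h2 : `|H (x + h *: k, t, s, b) - H (x, t, s, b)| <= C * h.
  have dr r : r \in `]0, h[ -> is_derive (r : R) (1 : R)
      (fun r => H (x + r *: k, t, s, b)) ('D_(k, 0, 0, 0) H (x + r *: k, t, s, b)).
    rewrite in_itv/= => /andP[? ?]; apply: is_derive_x; apply: dx; apply/F_domE.
    by apply: xO; rewrite !ltW.
  have [|r] := MVT h0 dr.
    apply: continuous_in_subspaceT => r; rewrite inE/= in_itv/= => rh.
    apply: is_derive_continuous; apply: is_derive_x; apply: dx; apply/F_domE.
    exact: xO.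
  rewrite in_itv/= scale0r addr0 subr0 => /andP[r0 rh] ->.
  rewrite normrM (gtr0_norm h0) ler_wpM2r ?(ltW h0)//; apply: hC => //.
  by apply: xO; rewrite !ltW.
have h3 : 0 <= C * `|b' - b| by nonneg.
have h4 : 0 <= D * h by nonneg.
rewrite mulrDr !mulrDl; lra.
Qed.

Section Increments.
Variables (F : E * R * R * R -> R).
Hypothesis F_reg : nonlinearity_regular Omega F.

Lemma F_derivable x t s b v : Omega x -> derivable F (x, t, s, b) v.
Proof.
by case: F_reg => [[_ [_ h]] _ _ _ _] Ox; apply: (h v I).1; exact/F_domE.
Qed.

(** A second difference of F: the increment between two states, compared at two points.
    Moving sigma first and u next, each part is a value of the increment in space of
    d_sigma F or of d_u F, so that derivatives of F in the state precede those in x. *)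
Lemma F_increment_lipschitz k M m G : 0 <= M -> 0 <= m -> 0 <= G ->
  exists2 C : R, 0 < C & forall x h t s1 s2 a1 a2 b1 b2, 0 < h ->
    (forall r, 0 <= r <= h -> Omega (x + r *: k)) -> 0 <= t <= T ->
    `|s1| <= M -> `|s2| <= M -> `|a1| <= m -> `|a2| <= m -> `|b1| <= m ->
    `|b2| <= m -> `|b1 - a1| <= G * h ->
    `|(F (x + h *: k, t, s2, b2) - F (x + h *: k, t, s1, b1)) -
      (F (x, t, s2, a2) - F (x, t, s1, a1))| <=
    C * (`|s2 - s1| * h + `|a2 - a1| * h + `|(b2 - b1) - (a2 - a1)|).
Proof.
move=> M0 m0 G0; have [_ Fu Fs _ _] := F_reg.
have [C1 C10 hs] := F_range_lipschitz k M (m + m + m) Fs.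
have [C2 C20 hu] := F_range_lipschitz k M (m + m + m) Fu.
have [_ [Fuc _]] := Fu; have [C3 C30 hu3] := F_range_bounded M (m + m + m) Fuc.
exists (C1 * (1 + G + (M + M)) + C2 * (1 + G + (m + m)) + C3).
  by rewrite ltr_wpDl// addr_ge0// mulr_ge0 ?(ltW C10) ?(ltW C20)// !addr_ge0.
move=> x h t s1 s2 a1 a2 b1 b2 h0 xO tT s1M s2M a1m a2m b1m b2m bG.
have Ox : Omega x by have := xO 0; rewrite scale0r addr0; apply; rewrite lexx ltW.
have Ox' : Omega (x + h *: k) by apply: xO; rewrite lexx ltW.
set x' := x + h *: k in Ox' *.
set q := (b2 - b1) - (a2 - a1).
have qE : `|b2 - a2| <= G * h + `|q|.
  have -> : b2 - a2 = (b1 - a1) + q by rewrite /q; ring.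
  by rewrite (le_trans (ler_normD _ _))// lerD2r.
have -> : F (x', t, s2, b2) - F (x', t, s1, b1) - (F (x, t, s2, a2) - F (x, t, s1, a1)) =
  ((F (x', t, s2, b2) - F (x, t, s2, a2)) - (F (x', t, s1, b2) - F (x, t, s1, a2))) +
  ((F (x', t, s1, b1 + 1 * (b2 - b1)) - F (x, t, s1, a1 + 1 * (a2 - a1))) -
   (F (x', t, s1, b1 + 0 * (b2 - b1)) - F (x, t, s1, a1 + 0 * (a2 - a1)))).
  have -> : b1 + 1 * (b2 - b1) = b2 by ring.
  have -> : a1 + 1 * (a2 - a1) = a2 by ring.
  by rewrite !mul0r !addr0; ring.
apply: le_trans (ler_normD _ _) _.
have h1 : `|(F (x', t, s2, b2) - F (x, t, s2, a2)) - (F (x', t, s1, b2) - F (x, t, s1, a2))|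
    <= C1 * (h + `|b2 - a2|) * `|s2 - s1|.
  apply: (MVT_abs (f := fun s => F (x', t, s, b2) - F (x, t, s, a2))
    (f' := fun s => d_sigma F (x', t, s, b2) - d_sigma F (x, t, s, a2)) s1M s2M) => s sM.
    have d1 := is_derive_sigma (F_derivable (v := (0, 0, 1, 0)) Ox').
    have d2 := is_derive_sigma (F_derivable (v := (0, 0, 1, 0)) Ox).
    exact: (is_deriveB (d1 t s b2) (d2 t s a2)).
  apply: hs => //; lra.
set d := a2 - a1 in q qE *.
set d' := b2 - b1 in q qE *.
have dm : `|d| <= m + m by rewrite (le_trans (ler_normB _ _))// lerD.
have dm' : `|d'| <= m + m by rewrite (le_trans (ler_normB _ _))// lerD.
have h2 : `|(F (x', t, s1, b1 + 1 * d') - F (x, t, s1, a1 + 1 * d)) -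
   (F (x', t, s1, b1 + 0 * d') - F (x, t, s1, a1 + 0 * d))| <=
   (C3 * `|q| + C2 * (h + (G * h + `|q|)) * `|d|) * `|1 - 0|.
  have bnd (a e s : R) : `|a| <= m -> `|e| <= m + m -> `|s| <= 1 -> `|a + s * e| <= m + m + m.
    move=> am em s1'; rewrite (le_trans (ler_normD _ _))// normrM.
    have : `|s| * `|e| <= `|e| by rewrite ler_piMl.
    lra.
  apply: (MVT_abs (f := fun s => F (x', t, s1, b1 + s * d') - F (x, t, s1, a1 + s * d))
    (f' := fun s => d_u F (x', t, s1, b1 + s * d') * d' - d_u F (x, t, s1, a1 + s * d) * d)
    (m := 1)); rewrite ?normr0 ?normr1// => s s1'.
    have dd y a e : Omega y -> is_derive (s : R) (1 : R) (fun s => F (y, t, s1, a + s * e))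
       (d_u F (y, t, s1, a + s * e) * e).
      move=> Oy.
      have g1 : is_derive (s : R) (1 : R) (fun s : R => a + s * e) e.
        have [f' [? ? ?]] := jet2_affine a e.
        apply: (is_derive_congr (is_deriveD (is_derive_cst a s 1)
          (is_deriveM (is_derive_id s 1) (is_derive_cst e s 1)))).
        by rewrite scaler0 !add0r /GRing.scale/= mulr1.
      have g2 := is_derive_u (F_derivable (v := (0, 0, 0, 1)) Oy).
      exact: (is_derive1_comp (f := fun b => F (y, t, s1, b))
        (g := fun s => a + s * e) (g2 t s1 (a + s * e)) g1).
    have d1 := dd x' b1 d' Ox'.
    have d2 := dd x a1 d Ox.
    exact: (is_deriveB d1 d2).
  have -> : d_u F (x', t, s1, b1 + s * d') * d' - d_u F (x, t, s1, a1 + s * d) * d =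
    d_u F (x', t, s1, b1 + s * d') * q +
    (d_u F (x', t, s1, b1 + s * d') - d_u F (x, t, s1, a1 + s * d)) * d.
    by rewrite /q; ring.
  rewrite (le_trans (ler_normD _ _))// !normrM lerD// ler_wpM2r//.
    by apply: hu3 => //; exact: bnd.
  apply: le_trans (hu _ _ _ _ _ _ h0 xO tT s1M _ _) _; try exact: bnd.
  rewrite ler_wpM2l ?(ltW C20)// lerD2l.
  have -> : b1 + s * d' - (a1 + s * d) = (b1 - a1) + s * q by rewrite /q; ring.
  rewrite (le_trans (ler_normD _ _))// lerD// normrM ler_piMl//.
have sM : `|s2 - s1| <= M + M by rewrite (le_trans (ler_normB _ _))// lerD.
move: h2; rewrite subr0 normr1 mulr1 => h2.
apply: le_trans (lerD h1 h2) _.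
have q0 : 0 <= `|q| by []. have d0 : 0 <= `|d| by []. have ss0 : 0 <= `|s2 - s1| by [].
have e1 : C1 * (h + `|b2 - a2|) * `|s2 - s1| <= C1 * (1 + G + (M + M)) * (`|s2 - s1| * h + `|q|).
  rewrite -!mulrA ler_wpM2l ?(ltW C10)//.
  apply: le_trans (_ : (h + (G * h + `|q|)) * `|s2 - s1| <= _).
    by rewrite ler_wpM2r// lerD2l.
  have : `|q| * `|s2 - s1| <= (M + M) * `|q| by rewrite mulrC ler_wpM2r.
  have : 0 <= (M + M) * (`|s2 - s1| * h) by nonneg.
  have : 0 <= G * `|q| by nonneg.
  by nra.
have e2 : C2 * (h + (G * h + `|q|)) * `|d| <= C2 * (1 + G + (m + m)) * (`|d| * h + `|q|).
  rewrite -!mulrA ler_wpM2l ?(ltW C20)//.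
  have : `|q| * `|d| <= (m + m) * `|q| by rewrite mulrC ler_wpM2r.
  have : 0 <= (m + m) * (`|d| * h) by nonneg.
  have : 0 <= G * `|q| by nonneg.
  by nra.
have P1 : 0 <= C1 * (1 + G + (M + M)) * (`|d| * h).
  by nonneg.
have P2 : 0 <= C2 * (1 + G + (m + m)) * (`|s2 - s1| * h).
  by nonneg.
have P3 : 0 <= C3 * (`|s2 - s1| * h + `|d| * h).
  by nonneg.
move: e1 e2 P1 P2 P3; rewrite !mulrDl !mulrDr; lra.
Qed.

Lemma F_increment_bound M m : exists2 C : R, 0 < C &
  forall x t s1 s2 a1 a2, Omega x -> 0 <= t <= T -> `|s1| <= M -> `|s2| <= M ->
    `|a1| <= m -> `|a2| <= m ->
    `|F (x, t, s2, a2) - F (x, t, s1, a1)| <= C * (`|s2 - s1| + `|a2 - a1|).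
Proof.
have [_ [_ [Fuc _]] [_ [Fsc _]] _ _] := F_reg.
have [C C0 hC] := F_range_bounded M m Fuc; have [D D0 hD] := F_range_bounded M m Fsc.
exists (C + D); first by rewrite addr_gt0.
move=> x t s1 s2 a1 a2 Ox tT s1M s2M a1m a2m.
have -> : F (x, t, s2, a2) - F (x, t, s1, a1) =
  (F (x, t, s2, a2) - F (x, t, s1, a2)) + (F (x, t, s1, a2) - F (x, t, s1, a1)) by ring.
apply: le_trans (ler_normD _ _) _.
have h1 : `|F (x, t, s2, a2) - F (x, t, s1, a2)| <= D * `|s2 - s1|.
  apply: (MVT_abs (f := fun s => F (x, t, s, a2)) (f' := fun s => d_sigma F (x, t, s, a2)) s1M s2M) => s sM.
    have d1 := is_derive_sigma (F_derivable (v := (0, 0, 1, 0)) Ox).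
    exact: (d1 t s a2).
  exact: hD.
have h2 : `|F (x, t, s1, a2) - F (x, t, s1, a1)| <= C * `|a2 - a1|.
  apply: (MVT_abs (f := fun b => F (x, t, s1, b)) (f' := fun b => d_u F (x, t, s1, b)) a1m a2m) => s sM.
    have d1 := is_derive_u (F_derivable (v := (0, 0, 0, 1)) Ox).
    exact: (d1 t s1 s).
  exact: hC.
have h3 : 0 <= C * `|s2 - s1| by nonneg.
have h4 : 0 <= D * `|a2 - a1| by nonneg.
rewrite mulrDr !mulrDl; lra.
Qed.

End Increments.
End Nonlinearity.

(** * Comparison for solutions and their differences *)

Lemma open_norm (R : realType) (V : normedModType R) (A : set V) :
  (forall x, A x -> exists2 d : R, 0 < d & forall y, `|x - y| < d -> A y) ->
  open A.
Proof.
move=> h; rewrite openE => x /h[d d0 hd]; apply/nbhs_normP.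
by exists d.
Qed.

Section Comparison.
Context {R : realType} {n : nat}.
Local Notation E := 'rV[R]_n.+1.
Variables (Omega : set E) (T : R).
Hypothesis oOmega : open Omega.
Hypothesis bOmega : bounded_set Omega.
Hypothesis T0 : 0 < T.
Implicit Types (u w : E * R -> R) (x k : E) (t : R).
Local Notation Q := (cylinder Omega T).

Lemma closure_split x : closure Omega x -> Omega x \/ frontier Omega x.
Proof.
by move=> cx; have [Ox|nO] := pselect (Omega x); [left|right; exact/frontierE].
Qed.

Lemma cylinder_maximum (tau L : R) w : 0 <= L -> tau <= T ->
  {within closure Q, continuous w} ->
  (forall x t, closure Omega x -> 0 <= t <= tau -> frontier Omega x \/ t = 0 ->
    w (x, t) <= 0) ->
  (forall x t, Omega x -> 0 < t <= tau -> 0 < w (x, t) ->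
    exists2 l, heat_at w x t l & l <= L * w (x, t)) ->
  forall x t, closure Omega x -> 0 <= t <= tau -> w (x, t) <= 0.
Proof.
move=> L0 tauT wc wb wh.
apply: (@maximum_principle _ _ (closure Omega) Omega tau L) => //.
- exact: closure_Omega_compact.
- exact: subset_closure.
- apply: continuous_subspaceW wc; rewrite closure_cylinder// => -[x t] [/= cx].
  rewrite !in_itv/= => /andP[t0 tt]; split => //=.
  by rewrite t0 (le_trans tt).
- move=> x t cx tt [nO|t0]; apply: wb => //; last by right.
  by left; exact/frontierE.
Qed.

Lemma heat_at_exp (c l : R) x t :
  heat_at (fun p => c * expR (l * p.2)) x t (c * (l * expR (l * t))).
Proof.
apply: heat_atZ; apply: (heat_at_time (f := fun t => expR (l * t))).
have h1 : is_derive (t : R) (1 : R) (fun t : R => l * t) l.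
  apply: (is_derive_congr (is_deriveZ (f := id) l (is_derive_id t 1))).
  by rewrite /GRing.scale/= mulr1.
apply: (is_derive_congr (is_derive1_comp (f := expR) (g := fun t => l * t)
  (is_derive_expR (l * t)) h1)).
by rewrite mulrC.
Qed.

Lemma exp_continuous_within (c l : R) (A : set (E * R)) :
  {within A, continuous (fun p => c * expR (l * p.2))}.
Proof.
apply: continuous_subspaceT => p; apply: (cvgM (cvg_cst c)).
have h : {for p, continuous (fun q : E * R => l * q.2)}.
  by apply: (cvgM (cvg_cst l)); exact: cvg_snd.
apply: (@continuous_comp _ _ _ (fun q : E * R => l * q.2) expR p h).
exact: continuous_expR.
Qed.

Lemma within_B (A : set (E * R)) u w : {within A, continuous u} ->
  {within A, continuous w} -> {within A, continuous (fun p => u p - w p)}.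
Proof.
move=> /within_continuousP uc /within_continuousP wc.
by apply/within_continuousP => p Ap; exact: (cvgB (uc p Ap) (wc p Ap)).
Qed.

Lemma within_Z (A : set (E * R)) u (c : R) : {within A, continuous u} ->
  {within A, continuous (fun p => c * u p)}.
Proof.
move=> /within_continuousP uc.
by apply/within_continuousP => p Ap; exact: (cvgM (cvg_cst c) (uc p Ap)).
Qed.

(** Where u exceeds exp((c+d)t), the growth condition gives
    u_t - Lap u <= (c+d) u. *)
Lemma solution_sup_bound (F : E * R * R * R -> R) (sigma : R -> R) (c d m : R) u :
  0 <= c -> 0 <= d -> 0 <= m ->
  (forall x t b, closure Omega x -> 0 <= t <= T ->
     b * F (x, t, sigma t, b) <= c * b ^+ 2 + d) ->
  {within closure Q, continuous u} ->
  (forall x t, Omega x -> 0 < t < T -> heat_at u x t (F (x, t, sigma t, u (x, t)))) ->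
  (forall x t, closure Omega x -> 0 <= t < T -> frontier Omega x \/ t = 0 ->
    `|u (x, t)| <= m) ->
  forall x t, closure Omega x -> 0 <= t < T ->
    `|u (x, t)| <= (1 + m) * expR ((c + d) * T).
Proof.
move=> c0 d0 m0 Fg uc uh ub x tau cx /andP[tau0 tauT].
have cd0 : 0 <= c + d by rewrite addr_ge0.
have key (s : R) : s ^+ 2 = 1 ->
    s * u (x, tau) - (1 + m) * expR ((c + d) * tau) <= 0.
  move=> s2.
  apply: (cylinder_maximum (tau := tau) (L := c + d)
    (w := fun p => s * u p - (1 + m) * expR ((c + d) * p.2))) => //.
  - exact: ltW.
  - by apply: within_B; [exact: within_Z|exact: exp_continuous_within].
  - move=> y t cy /andP[t0 tt] yt; rewrite subr_le0.
    have sm : s * u (y, t) <= m.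
      apply: le_trans (ler_norm _) _; rewrite normrM.
      have -> : `|s| = 1.
        by apply/eqP; rewrite -sqrp_eq1// -normrX s2 normr1.
      by rewrite mul1r; apply: ub => //; rewrite t0 (le_lt_trans tt).
    have : 1 <= expR ((c + d) * t).
      by rewrite -expR0 ler_expR mulr_ge0.
    nra.
  - move=> y t Oy /andP[t0 tt] wpos.
    have tT : 0 < t < T by rewrite t0 (le_lt_trans tt).
    exists (s * F (y, t, sigma t, u (y, t)) -
       (1 + m) * ((c + d) * expR ((c + d) * t))).
      exact: (heat_atB (heat_atZ s (uh _ _ Oy tT)) (heat_at_exp _ _ _ _)).
    have e1 : 1 <= expR ((c + d) * t).
      by rewrite -expR0 ler_expR mulr_ge0// ltW.
    have su1 : 1 <= s * u (y, t).
      have : (1 + m) * expR ((c + d) * t) >= 1 by nra.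
      lra.
    suff : s * F (y, t, sigma t, u (y, t)) <= (c + d) * (s * u (y, t)).
      rewrite mulrBr; lra.
    have := Fg y t (u (y, t)) (subset_closure Oy).
    rewrite ltW//= ltW ?(le_lt_trans tt)// => /(_ isT) hF.
    set b := u (y, t) in su1 hF *; set f := F _ in hF *.
    have b2 : b ^+ 2 = (s * b) ^+ 2 by rewrite exprMn s2 mul1r.
    have bf : b * f = (s * b) * (s * f).
      by rewrite mulrACA -expr2 s2 mul1r.
    move: hF; rewrite b2 bf; set B := s * b in su1 *; set f' := s * f => hF.
    rewrite -(ler_pM2l (_ : 0 < B)); last by lra.
    apply: le_trans hF _.
    have : d <= d * B ^+ 2 by rewrite ler_peMr// expr2; nra.
    have -> : B * ((c + d) * B) = c * B ^+ 2 + d * B ^+ 2 by ring.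
    lra.
  - by rewrite tau0 lexx.
have e2 : (1 + m) * expR ((c + d) * tau) <= (1 + m) * expR ((c + d) * T).
  by rewrite ler_wpM2l ?addr_ge0// ler_expR ler_wpM2l// ltW.
have k1 := key 1 (expr1n _ 2).
have /key k2 : (-1) ^+ 2 = 1 :> R by rewrite sqrrN expr1n.
move: k1 k2; rewrite mul1r mulN1r ler_norml; lra.
Qed.

Section Difference.
Variables (F : E * R * R * R -> R).
Hypothesis F_reg : nonlinearity_regular Omega F.

Definition solves (sigma : R -> R) u : Prop :=
  {within closure Q, continuous u} /\
  forall x t, Omega x -> 0 < t < T -> heat_at u x t (F (x, t, sigma t, u (x, t))).

Definition bounded_by (M m : R) (sigma : R -> R) u : Prop :=
  (forall t, 0 < t < T -> `|sigma t| <= M) /\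
  forall x t, closure Omega x -> 0 <= t < T -> `|u (x, t)| <= m.

Definition same_data u1 u2 : Prop :=
  forall x t, closure Omega x -> 0 <= t < T -> frontier Omega x \/ t = 0 ->
    u1 (x, t) = u2 (x, t).

(** Comparison with (C N / l) exp(l t).  The factor 1 / l makes the difference of
    the solutions negligible against that of the sources when the weight is steep. *)
Lemma difference_sup_bound M m : exists2 C : R, 0 < C &
  forall sigma1 sigma2 u1 u2 (N l : R),
  solves sigma1 u1 -> solves sigma2 u2 -> bounded_by M m sigma1 u1 ->
  bounded_by M m sigma2 u2 -> same_data u1 u2 -> 0 <= N -> C <= l ->
  (forall t, 0 < t < T -> `|sigma2 t - sigma1 t| <= N * expR (l * t)) ->
  forall x t, closure Omega x -> 0 <= t < T ->
    `|u2 (x, t) - u1 (x, t)| <= C * N / l * expR (l * t).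
Proof.
have [C C0 hC] := F_increment_bound T bOmega F_reg M m.
exists (2 * C); first by rewrite mulr_gt0.
move=> sigma1 sigma2 u1 u2 N l [u1c u1h] [u2c u2h] [s1M u1m] [s2M u2m] u12 N0 Cl sN
  x tau cx /andP[tau0 tauT].
have l0 : 0 < l by apply: lt_le_trans Cl; rewrite mulr_gt0.
pose kap := 2 * C * N / l.
have kap0 : 0 <= kap by rewrite /kap mulr_ge0// ?invr_ge0; nonneg.
have kapl : kap * l = 2 * C * N by rewrite /kap mulfVK// gt_eqF.
have key (s : R) : s = 1 \/ s = -1 ->
    s * (u2 (x, tau) - u1 (x, tau)) - kap * expR (l * tau) <= 0.
  move=> s1.
  apply: (cylinder_maximum (tau := tau) (L := C)
    (w := fun p => s * (u2 p - u1 p) - kap * expR (l * p.2))) => //.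
  - exact: ltW.
  - exact: ltW.
  - by apply: within_B; [apply: within_Z; exact: within_B|exact: exp_continuous_within].
  - move=> y t cy /andP[t0 tt] yt; rewrite u12//; last by rewrite t0 (le_lt_trans tt).
    by rewrite subrr mulr0 sub0r oppr_le0 mulr_ge0// expR_ge0.
  - move=> y t Oy /andP[t0 tt] wpos.
    have tT : 0 < t < T by rewrite t0 (le_lt_trans tt).
    have [_ tT2] := andP tT.
    have cy := subset_closure Oy.
    exists (s * (F (y, t, sigma2 t, u2 (y, t)) - F (y, t, sigma1 t, u1 (y, t))) -
       kap * (l * expR (l * t))).
      apply: heat_atB; last exact: heat_at_exp.
      by apply: heat_atZ; exact: (heat_atB (u2h _ _ Oy tT) (u1h _ _ Oy tT)).
    have hF := hC y t (sigma1 t) (sigma2 t) (u1 (y, t)) (u2 (y, t)) Oy.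
    have {hF} : `|F (y, t, sigma2 t, u2 (y, t)) - F (y, t, sigma1 t, u1 (y, t))| <=
        C * (`|sigma2 t - sigma1 t| + `|u2 (y, t) - u1 (y, t)|).
      by apply: hF; rewrite ?s1M ?s2M ?u1m ?u2m// ltW//= ltW.
    set f := F _ - F _; set q := u2 _ - u1 _ in wpos *.
    have sf : s * f <= `|f|.
      by case: s1 => ->; rewrite ?mul1r ?mulN1r ?ler_norm// -normrN ler_norm.
    have e0 := expR_gt0 (l * t).
    have sq : `|q| = s * q.
      have sq0 : 0 < s * q.
        have : 0 <= kap * expR (l * t) by rewrite mulr_ge0// ltW.
        lra.
      by rewrite -(gtr0_norm sq0) normrM; case: s1 => ->; rewrite ?normrN ?normr1 mul1r.
    rewrite sq mulrDr => hf.
    have h1 : C * `|sigma2 t - sigma1 t| <= C * (N * expR (l * t)).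
      by rewrite ler_wpM2l ?(ltW C0)// sN.
    have -> : kap * (l * expR (l * t)) = 2 * C * N * expR (l * t) by rewrite mulrA kapl.
    rewrite [C * (s * q - _)]mulrBr /=.
    suff : C * (kap * expR (l * t)) <= C * N * expR (l * t) by lra.
    rewrite -(mulrA C) ler_wpM2l ?(ltW C0)// ler_wpM2r ?(ltW e0)//.
    rewrite /kap ler_pdivrMr//.
    have : 2 * C * N <= l * N by rewrite ler_wpM2r.
    lra.
  - by rewrite tau0 lexx.
have := key 1 (or_introl erefl); have := key (-1) (or_intror erefl).
rewrite -/kap mul1r mulN1r ler_norml; lra.
Qed.

Lemma open_segments k (h : R) : 0 <= h ->
  open [set x | forall r, 0 <= r <= h -> Omega (x + r *: k)].
Proof.
move=> h0; apply: open_norm => x /= xO.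
have k0 : 0 < 2 * (1 + `|k|) by rewrite mulr_gt0// ltr_pwDl.
have [|r r0 hr] := compact_uniform (V := R) (K := `[0, h]%classic)
  (P := fun d s => forall y, `|x - y| < d -> Omega (y + s *: k)) (segment_compact (a := 0) (b := h)).
  move=> s; rewrite /= in_itv/= => /xO Os.
  have /nbhs_normP[d /= d0 hd] : nbhs (x + s *: k) Omega by exact: open_nbhs_nbhs.
  exists (d / (2 * (1 + `|k|))); first by rewrite divr_gt0.
  move=> r d' _ sr d'0 d'd y xy; apply: hd => /=.
  have -> : x + s *: k - (y + r *: k) = (x - y) + (s - r) *: k.
    by apply/rowP => i; rewrite !mxE; ring.
  apply: le_lt_trans (ler_normD _ _) _; rewrite normrZ.
  have := lt_trans xy d'd; move: sr; rewrite !ltr_pdivlMr//.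
  have : 0 <= `|k| by []. have : 0 <= `|x - y| by [].
  nra.
have rr : 0 < r / 2 by rewrite divr_gt0.
exists (r / 2) => //.
move=> y /= xy s sh; apply: (hr (r / 2) s) => //.
  by rewrite ltr_pdivrMr// ltr_pMr// ltr1n.
Qed.

Lemma compact_segments k (h : R) :
  compact [set x | forall r, 0 <= r <= h -> closure Omega (x + r *: k)] \/ h < 0.
Proof.
have [h0|h0] := leP 0 h; [left|by right].
apply: (@subclosed_compact _ _ (closure Omega)).
- have -> : [set x | forall r, 0 <= r <= h -> closure Omega (x + r *: k)] =
     \bigcap_(r in [set r | 0 <= r <= h]) ((fun x => x + r *: k) @^-1` closure Omega).
    by apply/seteqP; split => x /=.
  apply: closed_bigI => r _; apply: preimage_closed; last exact: closed_closure.
  move=> x _; apply: eps_continuous => d d0; exists d => // y.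
  by rewrite opprD addrACA subrr addr0.
- exact: closure_Omega_compact.
- by move=> x /(_ 0); rewrite lexx scale0r addr0; apply.
Qed.

(** Comparison for the increments of u = u2 - u1 along k, on the set of points
    x such that the segment from x to x + h k stays in Omega; on its boundary the segment
    meets the frontier, where u vanishes. *)
Lemma difference_gradient_bound k M m G : 0 <= M -> 0 <= m -> 0 <= G -> `|k| <= 1 ->
  exists2 C : R, 0 < C &
  forall sigma1 sigma2 u1 u2 (N l B h0 : R),
  solves sigma1 u1 -> solves sigma2 u2 -> bounded_by M m sigma1 u1 ->
  bounded_by M m sigma2 u2 -> same_data u1 u2 -> 0 <= N -> C <= l -> 0 <= B ->
  (forall t, 0 < t < T -> `|sigma2 t - sigma1 t| <= N * expR (l * t)) ->
  (forall x t (h : R), 0 < h -> (forall r, 0 <= r <= h -> Omega (x + r *: k)) ->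
    0 < t < T -> `|u1 (x + h *: k, t) - u1 (x, t)| <= G * h) ->
  (forall y x t, frontier Omega y -> closure Omega x -> 0 <= t < T ->
    `|x - y| <= h0 -> `|u2 (x, t) - u1 (x, t)| <= B * `|x - y|) ->
  forall x t (h : R), 0 < h -> h <= h0 ->
    (forall r, 0 <= r <= h -> Omega (x + r *: k)) -> 0 <= t < T ->
    `|(u2 (x + h *: k, t) - u1 (x + h *: k, t)) - (u2 (x, t) - u1 (x, t))| <=
      (2 * B + C * N / l) * h * expR (l * t).
Proof.
move=> M0 m0 G0 k1.
have [C C0 hC] := F_increment_lipschitz T bOmega F_reg k M0 m0 G0.
have [D D0 hD] := difference_sup_bound M m.
exists (4 * C + D); first by rewrite addr_gt0// mulr_gt0.
move=> sigma1 sigma2 u1 u2 N l B h0 sol1 sol2 bd1 bd2 u12 N0 Cl B0 sN uG uB.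
have Dl : D <= l by apply: le_trans Cl; rewrite lerDr mulr_ge0// ltW.
have uN := hD _ _ _ _ _ _ sol1 sol2 bd1 bd2 u12 N0 Dl sN.
have [u1c u1h] := sol1; have [u2c u2h] := sol2.
have [s1M u1m] := bd1; have [s2M u2m] := bd2.
move=> x tau h hpos hh0 xO /andP[tau0 tauT].
have l0 : 0 < l by apply: lt_le_trans Dl.
have l4C : 4 * C <= l by apply: le_trans Cl; rewrite lerDl ltW.
pose kap := 2 * B + 4 * C * N / l.
have kap1 : 0 <= 4 * C * N / l by rewrite mulr_ge0 ?invr_ge0 ?(ltW l0)//; nonneg.
have kap0 : 0 <= kap by rewrite addr_ge0// mulr_ge0.
pose Kh := [set x | forall r, 0 <= r <= h -> closure Omega (x + r *: k)].
pose Gh := [set x | forall r, 0 <= r <= h -> Omega (x + r *: k)].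
pose v p := (u2 (p.1 + h *: k, p.2) - u1 (p.1 + h *: k, p.2)) - (u2 p - u1 p).
have Kend y : Kh y -> closure Omega y /\ closure Omega (y + h *: k).
  move=> Ky; have := Ky 0; have := Ky h; rewrite !lexx (ltW hpos) scale0r addr0.
  by move=> /(_ isT) ? /(_ isT).
have cyl y t : closure Omega y -> 0 <= t <= tau -> closure Q (y, t).
  move=> cy /andP[t0 tt]; apply/closure_cylinder_in => //; split=> //.
  by rewrite t0 (le_trans tt)// ltW.
have vc : {within Kh `*` `[0, tau], continuous v}.
  have sh w : {within closure Q, continuous w} ->
      {within Kh `*` `[0, tau], continuous (fun p => w (p.1 + h *: k, p.2))}.
    move=> wc; apply: le_within_continuous => -[y t] [/= Ky].
    rewrite in_itv/= => tt d d0.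
    have [r r0 hr] := within_continuous_le wc (cyl _ _ (Kend _ Ky).2 tt) d0.
    exists r => // -[y' t'] [/= Ky']; rewrite in_itv/= => tt'.
    rewrite pair_norm_lt => hyp; apply: hr; first by apply: cyl => //; exact: (Kend _ Ky').2.
    by rewrite pair_norm_lt opprD addrACA subrr addr0.
  have nsh w : {within closure Q, continuous w} -> {within Kh `*` `[0, tau], continuous w}.
    apply: continuous_subspaceW => -[y t] [/= Ky]; rewrite in_itv/= => tt.
    by apply: cyl => //; exact: (Kend _ Ky).1.
  apply: within_B; first by apply: within_B; exact: sh.
  by apply: within_B; exact: nsh.
have key (s : R) : s = 1 \/ s = -1 -> s * v (x, tau) - kap * h * expR (l * tau) <= 0.
  move=> s1.
  have s1n q : s * q <= `|q|.
    by case: s1 => ->; rewrite ?mul1r ?mulN1r ?ler_norm// -normrN ler_norm.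
  apply: (maximum_principle (K := Kh) (G := Gh) (tau := tau) (L := C)
    (w := fun p => s * v p - kap * h * expR (l * p.2))).
  - by case: (compact_segments k h) => //; rewrite ltNge ltW.
  - by apply: open_segments; exact: ltW.
  - by move=> y Gy r rh; apply: subset_closure; exact: Gy.
  - exact: ltW.
  - by apply: within_B; [exact: within_Z|exact: exp_continuous_within].
  - move=> y t Ky /andP[t0 tt] yt; rewrite subr_le0.
    have tT : 0 <= t < T by rewrite t0 (le_lt_trans tt).
    have [cy cyh] := Kend _ Ky.
    have et : 1 <= expR (l * t) by rewrite -expR0 ler_expR mulr_ge0// ltW.
    have kh0 : 0 <= kap * h by rewrite mulr_ge0// ltW.
    apply: le_trans (s1n _) _; rewrite /v/=.
    case: yt => [nG|->]; last first.
      rewrite !u12 ?lexx//; [|by right|by right].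
      by rewrite !subrr normr0 mulr_ge0// expR_ge0.
    have [r rh nOr] : exists2 r, 0 <= r <= h & ~ Omega (y + r *: k).
      by apply: contrapT => hn; apply: nG => r rh; apply: contrapT => nO; apply: hn; exists r.
    have fr : frontier Omega (y + r *: k) by apply/(frontierE oOmega); split; [exact: (Ky r rh)|exact: nOr].
    have /andP[r0 rh2] := rh.
    have a1 : `|u2 (y + h *: k, t) - u1 (y + h *: k, t)| <= B * h.
      have d1 : `|y + h *: k - (y + r *: k)| <= h.
        rewrite opprD addrACA subrr add0r -scalerBl normrZ ger0_norm ?subr_ge0//.
        have : 0 <= `|k| by []. nra.
      apply: le_trans (uB _ _ t fr cyh tT (le_trans d1 hh0)) _.
      by rewrite ler_wpM2l.
    have a2 : `|u2 (y, t) - u1 (y, t)| <= B * h.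
      have d1 : `|y - (y + r *: k)| <= h.
        rewrite opprD addNKr normrN normrZ ger0_norm//.
        have : 0 <= `|k| by []. nra.
      apply: le_trans (uB _ _ t fr cy tT (le_trans d1 hh0)) _.
      by rewrite ler_wpM2l.
    apply: le_trans (ler_normB _ _) _; apply: le_trans (lerD a1 a2) _.
    have b1 : B * h + B * h <= kap * h.
      rewrite /kap mulrDl. have : 0 <= 4 * C * N / l * h by rewrite mulr_ge0// ltW.
      lra.
    apply: le_trans b1 _; exact: ler_peMr.
  - move=> y t Gy /andP[t0 tt] wpos.
    have tT : 0 < t < T by rewrite t0 (le_lt_trans tt).
    have tT1 : 0 <= t <= T by case/andP: tT => *; rewrite !ltW.
    have tT2 : 0 <= t < T by case/andP: tT => ? ->; rewrite ltW.
    have Oy : Omega y by have := Gy 0; rewrite scale0r addr0; apply; rewrite lexx ltW.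
    have Oyh : Omega (y + h *: k) by apply: Gy; rewrite lexx ltW.
    have cy := subset_closure Oy; have cyh := subset_closure Oyh.
    exists (s * ((F (y + h *: k, t, sigma2 t, u2 (y + h *: k, t)) -
                  F (y + h *: k, t, sigma1 t, u1 (y + h *: k, t))) -
                 (F (y, t, sigma2 t, u2 (y, t)) - F (y, t, sigma1 t, u1 (y, t)))) -
       kap * h * (l * expR (l * t))).
      apply: heat_atB; last exact: heat_at_exp.
      apply: heat_atZ; apply: heat_atB; last exact: (heat_atB (u2h _ _ Oy tT) (u1h _ _ Oy tT)).
      apply: (heat_at_shift (w := fun p => u2 p - u1 p)).
      exact: (heat_atB (u2h _ _ Oyh tT) (u1h _ _ Oyh tT)).
    have := hC y h t (sigma1 t) (sigma2 t) (u1 (y, t)) (u2 (y, t))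
      (u1 (y + h *: k, t)) (u2 (y + h *: k, t)) hpos Gy tT1 (s1M _ tT) (s2M _ tT)
      (u1m _ _ cy tT2) (u2m _ _ cy tT2) (u1m _ _ cyh tT2) (u2m _ _ cyh tT2)
      (uG _ _ _ hpos Gy tT).
    set f := _ - _ - (_ - _) => hf.
    have := s1n f => sf.
    have e0 := expR_gt0 (l * t).
    move: wpos; rewrite [v _]/v /=; set q := _ - _ - (_ - _) in hf * => wpos.
    have sq : `|q| = s * q.
      have sq0 : 0 < s * q.
        have : 0 <= kap * h * expR (l * t) by nonneg.
        lra.
      by rewrite -(gtr0_norm sq0) normrM; case: s1 => ->; rewrite ?normrN ?normr1 mul1r.
    rewrite sq in hf.
    have h1 := sN _ tT.
    have h2 : `|u2 (y, t) - u1 (y, t)| <= N * expR (l * t).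
      apply: le_trans (uN _ _ cy tT2) _; rewrite ler_wpM2r ?(ltW e0)//.
      by rewrite ler_pdivrMr// mulrC ler_wpM2l.
    set X := h * expR (l * t).
    have X0 : 0 <= X by rewrite /X; nonneg.
    have h3 : s * f <= C * (N * X + N * X + s * q).
      apply: le_trans sf _; apply: le_trans hf _.
      rewrite ler_wpM2l ?(ltW C0)// lerD2r lerD// /X.
        by rewrite [h * _]mulrC mulrA ler_wpM2r// ltW.
      by rewrite [h * _]mulrC mulrA ler_wpM2r// ltW.
    have -> : kap * h * (l * expR (l * t)) = kap * l * X by rewrite /X; ring.
    have -> : kap * h * expR (l * t) = kap * X by rewrite /X; ring.
    have h4 : 2 * C * N + C * kap <= kap * l.
      have h5 : 4 * C * kap <= l * kap by rewrite ler_wpM2r.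
      have h6 : 4 * C * N <= kap * l.
        have h7 : 4 * C * N / l * l = 4 * C * N by rewrite mulfVK ?gt_eqF.
        rewrite /kap [(_ + _) * l]mulrDl h7 lerDr; nonneg.
      have h7 : 0 <= C * kap by nonneg.
      lra.
    have := ler_wpM2r X0 h4; rewrite mulrDl; lra.
  - by move=> r rh; apply: subset_closure; exact: xO.
  - by rewrite tau0 lexx.
have := key 1 (or_introl erefl); have := key (-1) (or_intror erefl).
rewrite mul1r mulN1r [v _]/v /= => k2 k3.
have h8 : kap * h * expR (l * tau) <= (2 * B + (4 * C + D) * N / l) * h * expR (l * tau).
  rewrite ler_wpM2r ?expR_ge0// ler_wpM2r ?(ltW hpos)// lerD2l.
  by rewrite ler_wpM2r ?invr_ge0 ?(ltW l0)// ler_wpM2r// lerDl ltW.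
rewrite ler_norml; lra.
Qed.

End Difference.
End Comparison.

(** * Barriers at the boundary *)

Section UniformCharts.
Context {R : realType} {n : nat}.
Local Notation E := 'rV[R]_n.+1.
Variable (Omega : set E).
Hypothesis oOmega : open Omega.
Hypothesis bOmega : bounded_set Omega.
Implicit Types (x : E) (L r d : R).

Definition chart_bounded L x r (z : E -> R) (zd zdd : 'I_n.+1 -> E -> R) : Prop :=
  [/\ 1 <= L,
  forall y, `|y - x| <= r -> forall i, `|zd i y| <= L,
  forall y, `|y - x| <= r -> `|\sum_i zdd i y| <= L,
  forall y, `|y - x| <= r -> \sum_i zd i y * zd i y <= L &
  forall y y', `|y - x| <= r -> `|y' - x| <= r -> `|z y - z y'| <= L * `|y - y'|].

Lemma chart_recenter x0 x r r' e z zd zdd : chart Omega x0 r e z zd zdd ->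
  0 < r' -> `|x - x0| + r' <= r -> chart Omega x r' e z zd zdd.
Proof.
move=> ch r'0 xr; split => //; [exact: (chart_e ch)|exact: (chart_shift ch)| |
  exact: (chart_dir ch)|exact: (chart_jet ch)|exact: (chart_zdc ch)|exact: (chart_zddc ch)].
move=> y yx; apply: (chart_in ch).
have -> : y - x0 = (y - x) + (x - x0) by rewrite addrA subrK.
by rewrite (le_lt_trans (ler_normD _ _))// (lt_le_trans _ xr)// addrC ltrD2l.
Qed.

Lemma chart_bounded_recenter L x0 x r r' z zd zdd : chart_bounded L x0 r z zd zdd ->
  `|x - x0| + r' <= r -> chart_bounded L x r' z zd zdd.
Proof.
move=> [L1 h1 h2 h3 h4] xr.
have sub y : `|y - x| <= r' -> `|y - x0| <= r.
  move=> yx; have -> : y - x0 = (y - x) + (x - x0) by rewrite addrA subrK.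
  by rewrite (le_trans (ler_normD _ _))// (le_trans _ xr)// addrC lerD2l.
by split => // [y /sub/h1|y /sub/h2|y /sub/h3|y y' /sub yr /sub y'r]//; exact: h4.
Qed.

Lemma chart_bounded_weaken L L' x r z zd zdd : L <= L' ->
  chart_bounded L x r z zd zdd -> chart_bounded L' x r z zd zdd.
Proof.
move=> LL [L1 h1 h2 h3 h4]; split.
- exact: le_trans LL.
- by move=> y yr i; exact: le_trans (h1 y yr i) LL.
- by move=> y yr; exact: le_trans (h2 y yr) LL.
- by move=> y yr; exact: le_trans (h3 y yr) LL.
- by move=> y y' yr y'r; apply: le_trans (h4 y y' yr y'r) _; rewrite ler_wpM2r.
Qed.

Lemma frontier_compact : compact (frontier Omega).
Proof.
apply: (subclosed_compact _ (closure_Omega_compact bOmega)).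
  rewrite /frontier setDE; apply: closedI; first exact: closed_closure.
  by apply: open_closedC; exact: open_interior.
by move=> x [].
Qed.

Lemma uniform_charts : class_C 3 Omega -> exists L d, [/\ 1 <= L, 0 < d &
  forall x, frontier Omega x -> exists e z zd zdd,
    chart Omega x d e z zd zdd /\ chart_bounded L x d z zd zdd].
Proof.
move=> C3.
have [|d d0 hd] := compact_uniform (P := fun d x => exists e z zd zdd,
    chart Omega x d e z zd zdd /\ chart_bounded d^-1 x d z zd zdd) frontier_compact.
  move=> x fx; have [A0 [gamma [r gc]]] := C3 x fx; have ch := graph_chart_chart gc.
  move: (r / _) (vertical A0) (height A0 gamma) (height_d A0 gamma) (height_dd A0 gamma) ch
    => r' e z zd zdd ch.
  have r'0 := chart_r ch.
  have [L bd] := chart_bounds ch.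
  have L0 : 0 < L by case: bd => L1 *; exact: lt_le_trans L1.
  exists (Num.min (r' / 2) L^-1); first by rewrite lt_min divr_gt0//= invr_gt0.
  move=> y d _ xy d0; rewrite lt_min => /andP[dr dL].
  have yr : `|y - x| + d <= r'.
    by rewrite distrC; move: xy; rewrite lt_min => /andP[? ?]; lra.
  exists e, z, zd, zdd; split; first exact: chart_recenter yr.
  apply: (@chart_bounded_weaken L); first by rewrite -[L]invrK lef_pV2 ?posrE ?invr_gt0// ltW.
  exact: chart_bounded_recenter bd yr.
exists (Num.max 1 (d / 2)^-1), (d / 2).
have d20 : 0 < d / 2 by rewrite divr_gt0.
split => //; first by rewrite le_max lexx.
move=> x fx; have [|e [z [zd [zdd [ch bd]]]]] := hd (d / 2) x d20 _ fx.
  by rewrite ltr_pdivrMr// ltr_pMr// ltr1n.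
exists e, z, zd, zdd; split => //; apply: chart_bounded_weaken bd.
by rewrite le_max lexx orbT.
Qed.

End UniformCharts.

Section Barrier.
Context {R : realType} {n : nat}.
Local Notation E := 'rV[R]_n.+1.
Variables (Omega : set E) (T : R).
Hypothesis oOmega : open Omega.
Hypothesis bOmega : bounded_set Omega.
Hypothesis T0 : 0 < T.
Local Notation Q := (cylinder Omega T).
Local Notation N := (n.+1%:R : R).

Definition cap (c : E) (rho : R) : set E :=
  closure Omega `&` [set x | dot (x - c) (x - c) <= rho ^+ 2].
Definition capo (c : E) (rho : R) : set E :=
  Omega `&` [set x | dot (x - c) (x - c) < rho ^+ 2].

Definition barrier_const (L rho CR m : R) : R :=
  (CR + 2 * N * (m / rho ^+ 2)) * L * rho * L + m / rho ^+ 2 * N * rho + 1.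

Section LocalChart.
Variables (c : E) (r : R) (e : E) (z : E -> R) (zd zdd : 'I_n.+1 -> E -> R) (L : R).
Hypothesis ch : chart Omega c r e z zd zdd.
Hypothesis bd : chart_bounded L c r z zd zdd.
Hypothesis fc : frontier Omega c.

Lemma zc0 : z c = 0.
Proof.
by apply/(chart_frontier ch oOmega) => //; rewrite subrr normr0 (chart_r ch).
Qed.

Lemma dot_norm (x : E) (rho : R) : 0 <= rho -> dot x x <= rho ^+ 2 -> `|x| <= rho.
Proof.
move=> rho0 xr; apply: le_trans (norm_le_enorm x) _.
by rewrite /enorm -(ger0_norm rho0) -sqrtr_sqr ler_wsqrtr.
Qed.

Lemma cap_compact rho : compact (cap c rho).
Proof.
apply: (subclosed_compact _ (closure_Omega_compact bOmega)); last by move=> x [].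
apply: closedI; first exact: closed_closure.
have -> : [set x : E | dot (x - c) (x - c) <= rho ^+ 2] =
  (fun x : E => dot (x - c) (x - c)) @^-1` [set s | s <= rho ^+ 2] by [].
apply: preimage_closed; last exact: closed_le.
by move=> x _; exact: dot_continuous.
Qed.

Lemma capo_open rho : open (capo c rho).
Proof.
apply: openI => //.
have -> : [set x : E | dot (x - c) (x - c) < rho ^+ 2] =
  (fun x : E => dot (x - c) (x - c)) @^-1` [set s | s < rho ^+ 2] by [].
apply: open_comp; last exact: open_lt.
by move=> x _; exact: dot_continuous.
Qed.

Lemma capo_cap rho : capo c rho `<=` cap c rho.
Proof. by move=> x [Ox /= xr]; split; [exact: subset_closure|exact: ltW]. Qed.

Lemma cap_z rho x : 0 < rho -> rho < r -> cap c rho x ->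
  [/\ `|x - c| <= rho, 0 <= z x, z x <= L * `|x - c| & z x <= L * rho].
Proof.
move=> rho0 rhor [cx xr]; have [L1 _ _ _ zL] := bd.
have xc := dot_norm (ltW rho0) xr.
have zx : z x <= L * `|x - c|.
  have := zL x c; rewrite zc0 subr0 subrr normr0 (ltW (chart_r ch)).
  move=> /(_ (ltW (le_lt_trans xc rhor)) isT); apply: le_trans; exact: ler_norm.
split => //; first by apply: (chart_closure ch) => //; exact: le_lt_trans rhor.
by apply: le_trans zx _; rewrite ler_wpM2l// (le_trans _ L1).
Qed.

Lemma cap_split rho x : cap c rho x -> ~ capo c rho x ->
  frontier Omega x \/ dot (x - c) (x - c) = rho ^+ 2.
Proof.
move=> [cx xr] nx; have [|fx] := closure_split oOmega cx; last by left.
move=> Ox; right; apply/eqP; rewrite eq_le xr /= leNgt.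
by apply/negP => h; apply: nx.
Qed.

Lemma lap_z_quad (A B : R) x : exists a,
  lap_at (fun x => A * z x - B * (z x * z x)) x a
   (A * (\sum_i zdd i x) - B * (2 * (z x * \sum_i zdd i x) + 2 * \sum_i zd i x * zd i x)).
Proof.
have lz := chart_lap ch x.
eexists; have := lap_atB (lap_atZ A lz) (lap_atZ B (lap_atM lz lz)).
by congr lap_at; congr (_ - _ * _); ring.
Qed.

(** The barrier A z - B z^2 + K |x - c|^2 is nonnegative near c in Omega,
    at least m on the sphere of radius rho, and its Laplacian is at most - CR
    because the slope of z is at least 1. *)
Lemma barrier_bound (rho CR m : R) : 0 < rho -> rho < r -> 3 * L ^+ 2 * rho <= 1 ->
  0 <= CR -> 0 <= m -> forall w,
  {within closure Q, continuous w} ->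
  (forall x t, Omega x -> 0 < t < T -> exists2 l, heat_at w x t l & `|l| <= CR) ->
  (forall x t, closure Omega x -> 0 <= t < T -> `|w (x, t)| <= m) ->
  (forall x t, closure Omega x -> 0 <= t < T -> frontier Omega x \/ t = 0 -> w (x, t) = 0) ->
  forall x t, closure Omega x -> 0 <= t < T -> dot (x - c) (x - c) <= rho ^+ 2 ->
    `|w (x, t)| <= barrier_const L rho CR m * `|x - c|.
Proof.
move=> rho0 rhor rhoL CR0 m0; have [L1 _ bzdd _ _] := bd.
have L0 : 0 < L by exact: lt_le_trans L1.
pose K := m / rho ^+ 2.
have K0 : 0 <= K by rewrite divr_ge0// sqr_ge0.
have Krho : K * rho ^+ 2 = m by rewrite /K mulfVK// gt_eqF// exprn_gt0.
pose B := CR + 2 * N * K.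
have N0 : 0 <= N by [].
have B0 : 0 <= B by rewrite /B; nonneg.
pose A := B * L * rho.
have A0 : 0 <= A by rewrite /A; nonneg.
move=> w wc wh wm w0 x tau cx /andP[tau0 tauT] xrho.
pose b x := A * z x - B * (z x * z x) + K * dot (x - c) (x - c).
have zcont y : `|y - c| < r -> {for y, continuous z} by exact: (chart_z_continuous ch).
have b0 y : cap c rho y -> 0 <= b y.
  move=> /(cap_z rho0 rhor)[yc z0 _ zr]; rewrite /b addr_ge0//; last first.
    by rewrite mulr_ge0// dot_ge0.
  have -> : A * z y - B * (z y * z y) = B * z y * (L * rho - z y) by rewrite /A; ring.
  by rewrite mulr_ge0 ?subr_ge0//; nonneg.
have key (s : R) : s = 1 \/ s = -1 -> s * w (x, tau) - b x <= 0.
  move=> s1.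
  have s1n q : s * q <= `|q|.
    by case: s1 => ->; rewrite ?mul1r ?mulN1r ?ler_norm// -normrN ler_norm.
  apply: (maximum_principle (K := cap c rho) (G := capo c rho) (tau := tau) (L := 0)
    (w := fun p => s * w p - b p.1)) => //.
  - exact: cap_compact.
  - exact: capo_open.
  - exact: capo_cap.
  - apply: within_B.
      apply: within_Z; apply: continuous_subspaceW wc => -[y t] [/= [cy _]].
      rewrite in_itv/= => /andP[t0 tt]; apply/closure_cylinder_in => //; split => //.
      by rewrite t0 (le_trans tt)// ltW.
    apply/within_continuousP => -[y t] [/= /(cap_z rho0 rhor)[yc _ _ _] _].
    apply: cvg_within_filter.
    have yz := zcont y (le_lt_trans yc rhor).
    have h : {for y, continuous b}.
      have hd : {for y, continuous (fun x : E => dot (x - c) (x - c))} by exact: dot_continuous.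
      exact: (cvgD (cvgB (cvgM (cvg_cst A) yz) (cvgM (cvg_cst B) (cvgM yz yz)))
        (cvgM (cvg_cst K) hd)).
    have hf : {for (y, t), continuous (fst : E * R -> E)} by exact: cvg_fst.
    exact: (@continuous_comp _ _ _ fst b (y, t) hf h).
  - move=> y t cy /andP[t0 tt] yt; rewrite subr_le0 /=.
    have tT : 0 <= t < T by rewrite t0 (le_lt_trans tt).
    have [/= cly _] := cy.
    case: yt => [nG|t00]; last by rewrite w0// ?mulr0 ?b0//; right.
    have [fy|yrho] := cap_split cy nG; first by rewrite w0// ?mulr0 ?b0//; left.
    apply: le_trans (s1n _) _; apply: le_trans (wm _ _ cly tT) _.
    have [yc z0 _ zr] := cap_z rho0 rhor cy.
    rewrite /b yrho Krho lerDr.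
    have -> : A * z y - B * (z y * z y) = B * z y * (L * rho - z y) by rewrite /A; ring.
    by rewrite mulr_ge0 ?subr_ge0//; nonneg.
  - move=> y t Gy /andP[t0 tt] _; rewrite mul0r.
    have tT : 0 < t < T by rewrite t0 (le_lt_trans tt).
    have [yc z0 _ zr] := cap_z rho0 rhor (capo_cap Gy).
    have [l wl lC] := wh y t Gy.1 tT.
    have [a qa] := lap_z_quad A B y.
    exists (s * l - (- (A * (\sum_i zdd i y) -
        B * (2 * (z y * \sum_i zdd i y) + 2 * \sum_i zd i y * zd i y) + K * (2 * N)))).
      apply: heat_atB; first exact: heat_atZ.
      apply: (heat_at_space (f := b)).
      exact: (lap_atD qa (lap_atZ K (lap_at_sqdist c y))).
    have sl := s1n l.
    have g1 := chart_grad_ge1 ch y.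
    have := bzdd y (ltW (le_lt_trans yc rhor)); set lz := \sum_i zdd i y => /ler_normlP[lz1 lz2].
    set S := \sum_i zd i y * zd i y in g1 *.
    have e1 : A * lz <= B * (L ^+ 2 * rho).
      have -> : B * (L ^+ 2 * rho) = A * L by rewrite /A; ring.
      by rewrite ler_wpM2l.
    have e2 : - (B * (2 * (z y * lz))) <= B * (2 * (L ^+ 2 * rho)).
      rewrite -mulrN ler_wpM2l// -mulrN ler_wpM2l//.
      have -> : L ^+ 2 * rho = (L * rho) * L by ring.
      by rewrite -mulrN; apply: le_trans (_ : z y * L <= _); [rewrite ler_wpM2l|rewrite ler_wpM2r// ltW].
    have e3 : B * 2 <= B * (2 * S) by rewrite ler_wpM2l//; lra.
    have e4 : B * (3 * L ^+ 2 * rho) <= B * 1 by rewrite ler_wpM2l.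
    have e5 : B = CR + 2 * N * K by [].
    rewrite mulrDr; lra.
  - by rewrite tau0 lexx.
have := key 1 (or_introl erefl); have := key (-1) (or_intror erefl).
rewrite mul1r mulN1r => k2 k3.
have [xc z0 zx zr] := cap_z rho0 rhor (conj cx xrho).
have bx : b x <= (A * L + K * N * rho + 1) * `|x - c|.
  have h1 : A * z x <= A * (L * `|x - c|) by rewrite ler_wpM2l.
  have h2 : 0 <= B * (z x * z x) by nonneg.
  have h3 : K * dot (x - c) (x - c) <= K * (N * rho * `|x - c|).
    rewrite ler_wpM2l//; apply: le_trans (dot_le_norm _) _.
    by rewrite -mulrA ler_wpM2l// expr2 ler_wpM2r.
  have h4 : 0 <= `|x - c| by [].
  have -> : (A * L + K * N * rho + 1) * `|x - c| =
      A * (L * `|x - c|) + K * (N * rho * `|x - c|) + `|x - c| by ring.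
  rewrite /b; move: h1 h2 h3 h4; set p := A * (L * _); set q := K * (_ * _ * _).
  by set p' := A * z x; set q' := K * dot _ _; lra.
rewrite /barrier_const -/K -/B -/A ler_norml; lra.
Qed.

End LocalChart.

(** The constants of the barriers are the same at all boundary points since the charts
    are uniform. *)
Lemma boundary_lipschitz (CR m : R) : class_C 3 Omega -> 0 <= CR -> 0 <= m ->
  exists A h0 : R, [/\ 0 < A, 0 < h0 & forall w,
  {within closure Q, continuous w} ->
  (forall x t, Omega x -> 0 < t < T -> exists2 l, heat_at w x t l & `|l| <= CR) ->
  (forall x t, closure Omega x -> 0 <= t < T -> `|w (x, t)| <= m) ->
  (forall x t, closure Omega x -> 0 <= t < T -> frontier Omega x \/ t = 0 -> w (x, t) = 0) ->
  forall y x t, frontier Omega y -> closure Omega x -> 0 <= t < T -> `|x - y| <= h0 ->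
    `|w (x, t)| <= A * `|x - y|].
Proof.
move=> C3 CR0 m0; have [L [d [L1 d0 hL]]] := uniform_charts bOmega C3.
have L0 : 0 < L by exact: lt_le_trans L1.
have L3 : 0 < 3 * L ^+ 2 by rewrite mulr_gt0// exprn_gt0.
pose rho := Num.min (d / 2) (3 * L ^+ 2)^-1.
have rho0 : 0 < rho by rewrite lt_min divr_gt0//= invr_gt0.
have rhod : rho < d.
  by apply: le_lt_trans (_ : d / 2 < _); [rewrite ge_min lexx|lra].
have rhoL : 3 * L ^+ 2 * rho <= 1.
  by rewrite mulrC -ler_pdivlMr// div1r ge_min lexx orbT.
pose N1 : R := n.+2%:R.
have N10 : 0 < N1 by [].
exists (barrier_const L rho CR m), (rho / N1); split.
- have K0 : 0 <= m / rho ^+ 2 by rewrite divr_ge0// sqr_ge0.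
  have N0 : 0 <= N by [].
  by rewrite ltr_wpDl//; nonneg.
- by rewrite divr_gt0.
move=> w wc wh wm w0 y x t fy cx tT xy.
have [e [z [zd [zdd [ch bd]]]]] := hL y fy.
apply: (barrier_bound ch bd fy rho0 rhod rhoL CR0 m0 wc wh wm w0 cx tT).
rewrite -sqr_enorm ler_pXn2r ?nnegrE ?enorm_ge0 ?(ltW rho0)//.
by apply: le_trans (enorm_le_norm _) _; rewrite mulrC -ler_pdivlMr.
Qed.

End Barrier.

(** * The gradient on the boundary of a function vanishing there *)

(** Limit of a ratio: f s = g Z are two expressions of one increment, over lengths s
    and Z with Z close to a s, while F and G are the limits of f and g. *)
Lemma ratio_estimate (R : realType) (F G f g a d s Z : R) : 0 < s -> 0 < Z ->
  0 <= a -> `|F - f| < d -> `|G - g| < d -> f * s = g * Z ->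
  `|Z - s * a| <= d * s -> Z <= (a + 1) * s ->
  `|F - a * G| <= d * (1 + (a + 1) + `|G|).
Proof.
move=> s0 Z0 a0 b1 b2 fg zsa Zs.
rewrite -(ler_pM2r s0) -{1}(gtr0_norm s0) -normrM.
have -> : (F - a * G) * s = (F - f) * s + ((g - G) * Z + G * (Z - s * a)).
  by rewrite !mulrBl fg mulrBr; ring.
have n1 : `|(F - f) * s| <= d * s by rewrite normrM (gtr0_norm s0) ler_wpM2r// ltW.
have n2 : `|(g - G) * Z| <= d * ((a + 1) * s).
  rewrite normrM (gtr0_norm Z0) distrC; apply: ler_pM => //; exact: ltW.
have n3 : `|G * (Z - s * a)| <= `|G| * (d * s) by rewrite normrM ler_wpM2l.
apply: le_trans (ler_normD _ _) _.
have n4 := ler_normD ((g - G) * Z) (G * (Z - s * a)).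
have -> : d * (1 + (a + 1) + `|G|) * s = d * s + (d * ((a + 1) * s) + `|G| * (d * s)) by ring.
lra.
Qed.

Lemma le_small_eq (R : realType) (x k : R) : 0 < k ->
  (forall d : R, 0 < d -> d < 1 -> `|x| <= d * k) -> x = 0.
Proof.
move=> k0 h; apply/eqP; rewrite -normr_le0 leNgt; apply/negP => x0.
have k20 : 0 < 2 * k by rewrite mulr_gt0.
have := h (Num.min (1 / 2) (`|x| / (2 * k))).
rewrite lt_min divr_gt0//= divr_gt0// gt_min (_ : 1 / 2 < 1 :> R); last by lra.
move=> /(_ isT isT); rewrite leNgt => /negP; apply.
apply: le_lt_trans (_ : `|x| / (2 * k) * k < _).
  by rewrite ler_wpM2r ?(ltW k0)// ge_min lexx orbT.
rewrite -mulrA (_ : (2 * k)^-1 * k = 2^-1); first by lra.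
by rewrite invfM -mulrA mulVf ?mulr1// gt_eqF.
Qed.

Section BoundaryGradient.
Context {R : realType} {n : nat}.
Local Notation E := 'rV[R]_n.+1.
Variables (Omega : set E) (T : R).
Hypothesis oOmega : open Omega.
Hypothesis T0 : 0 < T.
Local Notation Q := (cylinder Omega T).
Implicit Types (u : E * R -> R) (x v : E) (t : R).

Lemma space_line x v t (s : R) : (x, t) + s *: (v, 0) = (x + s *: v, t) :> E * R.
Proof. by congr pair; rewrite /= scaler0 addr0. Qed.

Lemma cyl_MVT u x v t (h : R) : cyl_C1 Omega T u -> 0 < h -> 0 < t < T ->
  closure Omega x -> closure Omega (x + h *: v) ->
  (forall s, 0 < s < h -> Omega (x + s *: v)) ->
  exists2 c, 0 < c < h & u (x + h *: v, t) - u (x, t) =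
    'D_(v, 0) u (x + c *: v, t) * h.
Proof.
move=> [uc us _] h0 tT cx cxh hO.
have [du _] := us (v, 0) erefl.
have tT' : 0 <= t <= T by case/andP: tT => ? ?; rewrite !ltW.
have [||c ch] := line_MVT (f := u) (x := (x, t)) (v := (v, 0)) h0.
- by move=> s /hO Os; rewrite space_line; apply: du; exact/cylinder_in.
- apply: (line_within uc) => s /andP[s0 sh]; rewrite space_line.
  apply/(closure_cylinder_in Omega T0); split; last exact: tT'.
  have [->|sn0] := eqVneq s 0; first by rewrite scale0r addr0.
  have [->//|snh] := eqVneq s h.
  by apply: subset_closure; apply: hO; rewrite !lt_neqAle s0 sh eq_sym sn0 snh.
rewrite !space_line scale0r addr0 subr0 => e; by exists c.
Qed.

Lemma continuous_upto_interior (D : set (E * R)) f p : open D -> D p ->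
  continuous_upto D f -> {for p, continuous f}.
Proof.
move=> oD Dp /cont_extP[fc fe]; apply: eps_continuous => d d0.
have [r r0 hr] := within_continuous_le fc (subset_closure Dp) d0.
have /nbhs_normP[r' /= r'0 hr'] : nbhs p D by exact: open_nbhs_nbhs.
exists (Num.min r r'); first by rewrite lt_min r0.
move=> q; rewrite lt_min => /andP[q1 q2].
by rewrite (fe _ Dp) (fe _ (hr' _ q2)); apply: hr => //; apply: subset_closure; exact: hr'.
Qed.

Lemma D_space_addZ u v w (K : R) p : cyl_C1 Omega T u -> Q p ->
  'D_(v + K *: w, 0) u p = 'D_(v, 0) u p + K * 'D_(w, 0) u p.
Proof.
move=> [_ us _] Qp.
have [dv _] := us (v, 0) erefl; have [dw cw] := us (w, 0) erefl.
have [dKw cKw] := us (K *: w, 0) erefl.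
have hK := is_derive_dirZ K (dw _ Qp).
have EK : K *: (w, 0) = (K *: w, 0) :> E * R by congr pair; rewrite /= scaler0.
have := is_derive_dirD (@open_cylinder R n Omega T oOmega) Qp dv dKw
  (continuous_upto_interior (@open_cylinder R n Omega T oOmega) Qp cKw).
have -> : (v, 0) + (K *: w, 0) = (v + K *: w, 0) :> E * R by congr pair; rewrite /= addr0.
by move=> h; rewrite (derive_val (is_derive := h)) -EK (derive_val (is_derive := hK)).
Qed.

Section LocalChart.
Variables (c : E) (r : R) (e : E) (z : E -> R) (zd zdd : 'I_n.+1 -> E -> R).
Hypothesis ch : chart Omega c r e z zd zdd.
Hypothesis fc : frontier Omega c.

Let ext u v := cont_ext Q ('D_(v, 0) u).

(** Near c the value of u at c + s v is the increment along v, and also the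
    increment along the vertical segment issued from the foot of the point on the
    boundary, whose length is z(c + s v) = a s + o(s). *)
Lemma boundary_derivative_pos u v t (a : R) : cyl_C1 Omega T u -> 0 < t < T ->
  (forall x, frontier Omega x -> u (x, t) = 0) ->
  a = \sum_i v 0 i * zd i c -> 0 < a -> ext u v (c, t) = a * ext u e (c, t).
Proof.
move=> uC tT u0 aE a0; have [uc us _] := uC.
have tT' : 0 <= t <= T by case/andP: tT => ? ?; rewrite !ltW.
have [L [L1 _ _ _ zL]] := chart_bounds ch.
have L0 : 0 < L by exact: lt_le_trans L1.
have zc := zc0 oOmega ch fc.
have r0 := chart_r ch.
have [cc _] := (frontierE oOmega c).1 fc.
have Qc : closure Q (c, t) by exact/(closure_cylinder_in Omega T0).
have [_ cv] := us (v, 0) erefl; have [_ ce] := us (e, 0) erefl.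
have [vc vE] := cont_extP cv; have [ec eE] := cont_extP ce.
pose F := ext u v (c, t); pose G := ext u e (c, t).
have main : forall d : R, 0 < d -> d < 1 -> `|F - a * G| <= d * (1 + (a + 1) + `|G|).
  move=> d d0 d1.
  have [r1 r10 hr1] := within_continuous_le vc Qc d0.
  have [r2 r20 hr2] := within_continuous_le ec Qc d0.
  pose dd := Num.min d (a / 2).
  have dd0 : 0 < dd by rewrite lt_min d0 divr_gt0.
  have dda : dd < a by apply: le_lt_trans (_ : a / 2 < a); [rewrite ge_min lexx orbT|lra].
  have ddd : dd <= d by rewrite ge_min lexx.
  have zdv := chart_dir ch c v; rewrite -aE in zdv.
  have [r3 r30 hr3] := (is_derive_epsP _ _ _ _).1 zdv dd dd0.
  pose m := Num.min (Num.min r1 r2) (Num.min r3 r).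
  have m0 : 0 < m by rewrite !lt_min r10 r20 r30 r0.
  pose V := (1 + L) * (1 + `|v|).
  have V1 : 1 <= V by have := normr_ge0 v; rewrite /V; nra.
  have V0 : 0 < V by exact: lt_le_trans V1.
  have [s s0 sV] : exists2 s : R, 0 < s & s * V < m.
    exists (m / (2 * V)); first by rewrite divr_gt0// mulr_gt0.
    rewrite -mulrA (_ : (2 * V)^-1 * V = 2^-1); first by lra.
    by rewrite invfM -mulrA mulVf ?mulr1// gt_eqF.
  have /andP[/andP[m1 m2] /andP[m3 m4]] : ((m <= r1) && (m <= r2)) && ((m <= r3) && (m <= r)).
    by rewrite /m !ge_min !lexx !orbT.
  have sle y : 0 <= y -> y <= s -> y * `|v| * (1 + L) < m /\ y < r3 /\ y * `|v| < m.
    move=> y0 ys; have nv : 0 <= `|v| by [].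
    have yV : y * V < m by apply: le_lt_trans sV; rewrite ler_wpM2r// ltW.
    have e1 : y * V = y + y * `|v| + (y * L + y * `|v| * L) by rewrite /V; ring.
    have p1 : 0 <= y * `|v| by nonneg.
    have p2 : 0 <= y * L by nonneg.
    have p3 : 0 <= y * `|v| * L by nonneg.
    have p4 : y * `|v| * (1 + L) = y * `|v| + y * `|v| * L by ring.
    clear - e1 p1 p2 p3 p4 yV y0 m3; rewrite p4.
    by split; [lra|split; lra].
  have zpos y : 0 < y -> y <= s -> [/\ 0 < z (c + y *: v), Omega (c + y *: v) &
      `|z (c + y *: v) - y * a| <= dd * y].
    move=> y0 ys; have [q1 [q2 q3]] := sle y (ltW y0) ys.
    have := hr3 y; rewrite zc subr0 gtr0_norm// => /(_ q2) zy.
    have zp : 0 < z (c + y *: v).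
      move: zy; rewrite ler_norml => /andP[zy _].
      have : dd * y < y * a by rewrite mulrC ltr_pM2l.
      lra.
    split => //; apply/(chart_in ch) => //.
    by rewrite addrC addKr normrZ gtr0_norm// (lt_le_trans q3).
  have [zs Os zsa] := zpos s s0 (lexx _).
  have [q1 [q2 q3]] := sle s (ltW s0) (lexx _).
  have [y1 /andP[y10 y1s] E1] : exists2 y, 0 < y < s &
      u (c + s *: v, t) - u (c, t) = 'D_(v, 0) u (c + y *: v, t) * s.
    apply: cyl_MVT => //; first exact: subset_closure.
    by move=> y /andP[y0 ys]; have [] := zpos y y0 (ltW ys).
  have [_ Oy1 _] := zpos y1 y10 (ltW y1s).
  rewrite u0// subr0 (vE (c + y1 *: v, t)) in E1; last exact/cylinder_in.
  pose Z := z (c + s *: v); pose p := c + s *: v - Z *: e.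
  have zb y : `|z (c + y *: v)| <= L * (`|y| * `|v|) \/ r < `|y| * `|v|.
    have [h|h] := leP (`|y| * `|v|) r; [left|by right].
    have := zL (c + y *: v) c; rewrite zc subr0 [c + _]addrC addrK normrZ; apply => //.
    by rewrite subrr normr0 ltW.
  have ZL : Z <= L * (s * `|v|).
    have := zb s; rewrite (gtr0_norm s0) => -[zs1|].
      exact: le_trans (ler_norm _) zs1.
    by rewrite ltNge (ltW (lt_le_trans q3 m4)).
  have e1 := norm_chart_e ch.
  have pin y : 0 <= y -> y <= Z -> `|c - (p + y *: e)| < m.
    move=> y0 yZ; have -> : c - (p + y *: e) = - (s *: v) + (Z - y) *: e.
      by apply/rowP => i; rewrite !mxE; ring.
    apply: le_lt_trans (ler_normD _ _) _; rewrite normrN normrZ normrZ (gtr0_norm s0) (ger0_norm (_ : 0 <= Z - y)) ?subr_ge0//.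
    have : (Z - y) * `|e| <= Z - y by rewrite ler_piMr// subr_ge0.
    have -> : s * `|v| = s * `|v| * (1 + L) - L * (s * `|v|) by ring.
    lra.
  have zp y : z (p + y *: e) = y.
    by rewrite /p -addrA -scaleNr -scalerDl (chart_shift ch) -/Z; ring.
  have fp : frontier Omega p.
    apply/(chart_frontier ch oOmega); last by have := zp 0; rewrite scale0r addr0.
    by have := pin 0 (lexx _) (ltW zs); rewrite scale0r addr0 distrC => /lt_le_trans; apply.
  have pZ : p + Z *: e = c + s *: v by rewrite /p subrK.
  have Op y : 0 < y -> y <= Z -> Omega (p + y *: e).
    move=> y0 yZ; apply/(chart_in ch); last by rewrite zp.
    by rewrite distrC (lt_le_trans (pin y (ltW y0) yZ)).
  have [y2 /andP[y20 y2Z] E2] : exists2 y, 0 < y < Z &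
      u (p + Z *: e, t) - u (p, t) = 'D_(e, 0) u (p + y *: e, t) * Z.
    apply: cyl_MVT => //; first exact: ((frontierE oOmega p).1 fp).1.
      by rewrite pZ; exact: subset_closure.
    by move=> y /andP[y0 yZ]; apply: Op => //; exact: ltW.
  have Op2 := Op y2 y20 (ltW y2Z).
  rewrite pZ (u0 p)// subr0 (eE (p + y2 *: e, t)) in E2; last exact/cylinder_in.
  have b1 : `|F - ext u v (c + y1 *: v, t)| < d.
    apply: hr1; first by apply: subset_closure; exact/cylinder_in.
    rewrite pair_norm_lt subrr normr0 r10 andbT opprD addNKr normrN normrZ gtr0_norm//.
    apply: lt_le_trans m1; apply: le_lt_trans q3.
    by rewrite ler_wpM2r// ltW.
  have b2 : `|G - ext u e (p + y2 *: e, t)| < d.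
    apply: hr2; first by apply: subset_closure; exact/cylinder_in.
    rewrite pair_norm_lt subrr normr0 r20 andbT (lt_le_trans (pin y2 _ _) m2)// ltW//.
  set f := ext u v (c + y1 *: v, t) in b1; set g := ext u e (p + y2 *: e, t) in b2.
  have fg : f * s = g * Z by exact: etrans (esym E1) E2.
  apply: (ratio_estimate s0 zs _ b1 b2 fg); first exact: ltW.
    by apply: le_trans zsa _; rewrite ler_wpM2r// ltW.
  move: zsa; rewrite ler_norml => /andP[_ h].
  rewrite mulrDl mul1r [a * s]mulrC -lerBlDl; apply: le_trans h _.
  by rewrite ler_piMl ?(ltW s0)// (le_trans ddd)// ltW.
have H0 : 0 < 1 + (a + 1) + `|G| by rewrite ltr_wpDr//; lra.
apply/eqP; rewrite -subr_eq0; apply/eqP; exact: le_small_eq H0 main.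
Qed.

Lemma sum_basis (a : 'I_n.+1 -> R) i :
  \sum_j (basis_vec i : E) 0 j * a j = a i.
Proof.
rewrite (bigD1 i)//= big1 ?addr0; first by rewrite mxE !eqxx mul1r.
by move=> j ji; rewrite mxE (negbTE ji) andbF mul0r.
Qed.

(** Adding a large multiple of e to v reduces to a direction entering the domain. *)
Lemma boundary_gradient u v t : cyl_C1 Omega T u -> 0 < t < T ->
  (forall x, frontier Omega x -> u (x, t) = 0) ->
  ext u v (c, t) = (\sum_i v 0 i * zd i c) * ext u e (c, t).
Proof.
move=> uC tT u0; pose b := \sum_i v 0 i * zd i c; pose K := 1 + `|b|.
pose a := b + K.
have a0 : 0 < a by rewrite /a /K; have := ler_norm (- b); rewrite normrN; lra.
have aE : a = \sum_j (v + K *: e) 0 j * zd j c.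
  transitivity (\sum_j (v 0 j * zd j c + K * (e 0 j * zd j c))).
    by rewrite big_split /= -mulr_sumr (chart_De ch) mulr1.
  by apply: eq_bigr => j _; rewrite !mxE; ring.
have h := boundary_derivative_pos uC tT u0 aE a0.
have [_ us _] := uC; have [_ c1] := us (v, 0) erefl; have [_ c2] := us (e, 0) erefl.
have tT' : 0 <= t <= T by case/andP: tT => ? ?; rewrite !ltW.
have Qc : closure Q (c, t).
  by apply/(closure_cylinder_in Omega T0); split => //; exact: ((frontierE oOmega c).1 fc).1.
have := cont_ext_lin 1 K c1 c2 Qc; rewrite mul1r.
have -> : cont_ext Q (fun x : E * R => 1 * 'D_(v, 0) u x + K * 'D_(e, 0) u x) (c, t) =
  ext u (v + K *: e) (c, t).
  have [_ c3] := us (v + K *: e, 0) erefl.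
  have [c3c c3E] := cont_extP c3.
  apply: cont_extE c3c _ Qc => p Qp; rewrite -c3E// mul1r.
  by rewrite D_space_addZ.
rewrite h /a mulrDl => /(congr1 (fun y => y - K * ext u e (c, t))).
by rewrite /ext !addrK => ->.
Qed.

End LocalChart.
End BoundaryGradient.

(** * The normal vector and the normal derivative *)

Section Normal.
Context {R : realType} {n : nat}.
Local Notation E := 'rV[R]_n.+1.
Variables (Omega : set E).
Hypothesis oOmega : open Omega.

Section LocalChart.
Variables (c : E) (r : R) (e : E) (z : E -> R) (zd zdd : 'I_n.+1 -> E -> R).
Hypothesis ch : chart Omega c r e z zd zdd.
Hypothesis fc : frontier Omega c.

Definition slope (x : E) : R := Num.sqrt (\sum_i zd i x * zd i x).

Lemma slope_ge1 x : 1 <= slope x.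
Proof. by rewrite -sqrtr1 ler_wsqrtr// (chart_grad_ge1 ch). Qed.

Lemma sqr_slope x : slope x * slope x = \sum_i zd i x * zd i x.
Proof.
rewrite -expr2 sqr_sqrtr//; apply: le_trans (chart_grad_ge1 ch x); exact: ler01.
Qed.

Let nu : E := \row_i (- zd i c / slope c).

Let G0 : 0 < slope c. Proof. exact: lt_le_trans (slope_ge1 c). Qed.

Lemma chart_closed_below x : `|x - c| < r -> z x < 0 -> ~ closure Omega x.
Proof. by move=> xr zx /(chart_closure ch xr); rewrite leNgt zx. Qed.

Lemma chart_line (v : E) (a : R) : a = \sum_i v 0 i * zd i c ->
  forall d : R, 0 < d -> exists2 h0 : R, 0 < h0 & forall s : R, `|s| < h0 ->
    `|c + s *: v - c| < r /\ `|z (c + s *: v) - s * a| <= d * `|s|.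
Proof.
move=> aE d d0; have zc := zc0 oOmega ch fc.
have zdv := chart_dir ch c v; rewrite -aE in zdv.
have [h1 h10 hr] := (is_derive_epsP _ _ _ _).1 zdv d d0.
have r0 := chart_r ch.
have V0 : 0 < 1 + `|v| by rewrite ltr_pwDl.
exists (Num.min h1 (r / (1 + `|v|))); first by rewrite lt_min h10 divr_gt0.
move=> s; rewrite lt_min ltr_pdivlMr// => /andP[s1 s2]; split.
  rewrite addrC addKr normrZ; apply: le_lt_trans s2.
  by rewrite ler_wpM2l// lerDr.
by have := hr s s1; rewrite zc subr0.
Qed.

(** z vanishes along a curve drawn on the boundary. *)
Lemma tangent_curve (gam : R -> E) : (forall s, frontier Omega (gam s)) ->
  gam 0 = c -> derivable gam 0 1 -> \sum_i ('D_1 gam 0) 0 i * zd i c = 0.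
Proof.
move=> gf g0 gd; set w := 'D_1 gam 0; set a := \sum_i _.
have [L [L1 _ _ _ zL]] := chart_bounds ch.
have L0 : 0 < L by exact: lt_le_trans L1.
apply: (le_small_eq (k := 1 + L)); first by rewrite addr_gt0.
move=> d d0 d1.
have [h1 h10 hz] := chart_line (erefl : a = _) d0.
have [h2 h20 hg] := (is_derive_normP _ _ _ _).1 (DeriveDef gd erefl) d d0.
have r0 := chart_r ch.
have W0 : 0 < 2 + `|w| by rewrite ltr_pwDl.
pose m := Num.min (Num.min h1 h2) (r / (2 + `|w|)).
have m0 : 0 < m by rewrite !lt_min h10 h20 divr_gt0.
have [s s0 sm] : exists2 s : R, 0 < s & s < m by exists (m / 2); lra.
move: sm; rewrite !lt_min -andbA => /and3P[s1 s2 s3].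
have ss1 : `|s| < h1 by rewrite gtr0_norm.
have [zr zs] := hz s ss1; rewrite (gtr0_norm s0) in zs.
have {hg} := hg s; rewrite gtr0_norm// => /(_ s2).
rewrite -[s *: 1]/(s * 1) mulr1 add0r g0 -/w => gs.
have gr : `|gam s - c| < r.
  have -> : gam s - c = (gam s - c - s *: w) + s *: w by rewrite subrK.
  apply: le_lt_trans (ler_normD _ _) _; rewrite normrZ gtr0_norm//.
  move: s3; rewrite ltr_pdivlMr// mulrDr.
  have : d * s <= 1 * s by rewrite ler_wpM2r ?ltW.
  lra.
have zg : z (gam s) = 0 by apply/(chart_frontier ch oOmega).
have := zL (c + s *: w) (gam s) (ltW zr) (ltW gr).
have -> : c + s *: w - gam s = - (gam s - c - s *: w).
  by apply/rowP => i; rewrite !mxE; ring.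
rewrite normrN zg subr0 => zz.
have zz2 : `|z (c + s *: w)| <= L * (d * s) by apply: le_trans zz _; rewrite ler_wpM2l// ltW.
rewrite -(ler_pM2l s0) -{1}(gtr0_norm s0) -normrM.
have -> : s * a = z (c + s *: w) - (z (c + s *: w) - s * a) by rewrite opprB addrCA subrr addr0.
apply: le_trans (ler_normB _ _) _.
have -> : s * (d * (1 + L)) = L * (d * s) + d * s by ring.
exact: lerD.
Qed.

Lemma dot_nu x : dot x nu = - (\sum_i x 0 i * zd i c) / slope c.
Proof.
rewrite /dot -sumrN mulr_suml; apply: eq_bigr => i _.
by rewrite mxE mulrA mulrN.
Qed.

Lemma nu_slope : \sum_i nu 0 i * zd i c = - slope c.
Proof.
under eq_bigr do rewrite mxE mulrAC mulNr.
by rewrite -mulr_suml sumrN -sqr_slope -mulNr mulfK// gt_eqF.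
Qed.

Lemma nu_outward : outward_unit_normal Omega c nu.
Proof.
split.
- rewrite /enorm dot_nu nu_slope opprK divff ?sqrtr1// gt_eqF//.
- by move=> gam gf g0 gd; rewrite dot_nu (tangent_curve gf g0 gd) oppr0 mul0r.
have G20 : 0 < slope c / 2 by rewrite divr_gt0.
have [h1 h10 hz] := chart_line (esym nu_slope) G20.
near=> s.
have s0 : 0 < s by near: s; exact: nbhs_right_gt.
have sh : s < h1 by near: s; exact: nbhs_right_lt.
have sG : 0 < s * slope c by rewrite mulr_gt0.
split.
  have sn : `|- s| < h1 by rewrite normrN gtr0_norm.
  have [xr] := hz (- s) sn; rewrite scaleNr in xr *.
  rewrite normrN (gtr0_norm s0) => /ler_normlP[h _].
  by apply/(chart_in ch) => //; lra.
have sn : `|s| < h1 by rewrite gtr0_norm.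
have [xr] := hz s sn; rewrite (gtr0_norm s0) => /ler_normlP[_ h].
by apply: chart_closed_below => //; lra.
Unshelve. all: by end_near. Qed.

(** A tangent direction tau is the velocity at c of the curve obtained by
    projecting the line c + s tau vertically onto the boundary; s is
    truncated to stay in the chart. *)
Lemma nu_unique nu' : outward_unit_normal Omega c nu' -> nu' = nu.
Proof.
move=> [n1 n2 n3].
pose a := \sum_i nu' 0 i * zd i c; pose S := \sum_i zd i c * zd i c.
have S1 : 1 <= S by exact: chart_grad_ge1 ch c.
have S0 : 0 < S by exact: lt_le_trans S1.
pose k := a / S.
pose tau : E := nu' - k *: (\row_i zd i c).
have tau0 : \sum_i tau 0 i * zd i c = 0.
  under eq_bigr do rewrite !mxE mulrBl.
  rewrite sumrB -/a; under [X in _ - X]eq_bigr do rewrite -mulrA.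
  by rewrite -mulr_sumr -/S /k mulfVK ?subrr// gt_eqF.
have nuE : nu' = k *: (\row_i zd i c).
  have [L [L1 _ _ _ zL]] := chart_bounds ch.
  have L0 : 0 < L by exact: lt_le_trans L1.
  have zc := zc0 oOmega ch fc.
  have r0 := chart_r ch; have e1 := norm_chart_e ch.
  pose V := (1 + L) * (1 + `|tau|).
  have V0 : 0 < V by have := normr_ge0 tau; rewrite /V; nra.
  have [q q0 qV] : exists2 q : R, 0 < q & q * V < r.
    exists (r / (2 * V)); first by rewrite divr_gt0// mulr_gt0.
    rewrite -mulrA (_ : (2 * V)^-1 * V = 2^-1); first by lra.
    by rewrite invfM -mulrA mulVf ?mulr1// gt_eqF.
  pose psi (s : R) := Num.max (- q) (Num.min q s).
  have psiq s : `|psi s| <= q.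
    by rewrite ler_norml le_max lexx /= ge_max ge_min lexx /= andbT lerNl (le_trans _ (ltW q0))// oppr_le0 ltW.
  have psis s : `|s| < q -> psi s = s.
    rewrite ltr_norml => /andP[sq1 sq2]; rewrite /psi (min_idPr (ltW sq2)).
    by apply/max_idPr; exact: ltW.
  pose y s := c + psi s *: tau.
  have yc s : `|y s - c| * (1 + L) < r.
    rewrite /y addrC addKr normrZ; apply: le_lt_trans qV; rewrite /V.
    have p1 : `|psi s| * `|tau| <= q * (1 + `|tau|) by rewrite ler_pM// lerDr.
    by rewrite [(1 + L) * _]mulrC mulrA ler_wpM2r//; nonneg.
  have ycr s : `|y s - c| < r.
    apply: le_lt_trans (yc s); rewrite mulrDr mulr1 lerDl; nonneg.
  have zy s : `|z (y s)| <= L * `|y s - c|.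
    have := zL (y s) c (ltW (ycr s)); rewrite zc subr0; apply.
    by rewrite subrr normr0 ltW.
  pose gam s := y s - z (y s) *: e.
  have gf s : frontier Omega (gam s).
    apply/(chart_frontier ch oOmega); last by rewrite /gam -scaleNr (chart_shift ch) subrr.
    rewrite /gam addrAC; apply: le_lt_trans (yc s).
    apply: le_trans (ler_normB _ _) _; rewrite normrZ mulrDr mulr1 lerD2l mulrC.
    apply: le_trans (_ : `|e| * (L * `|y s - c|) <= _); first by rewrite ler_wpM2l.
    by rewrite mulrC -mulrA [_ * L]mulrC mulrA mulrC [L * _]mulrC; apply: ler_piMl => //; nonneg.
  have g0 : gam 0 = c.
    by rewrite /gam /y psis ?normr0// scale0r addr0 zc scale0r subr0.
  have gd : is_derive (0 : R) (1 : R) gam tau.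
    apply/is_derive_normP => d d0.
    have [h1 h10 hz] := chart_line (esym tau0) d0.
    exists (Num.min h1 q); first by rewrite lt_min h10.
    move=> h; rewrite lt_min => /andP[hh1 hq].
    rewrite -[h *: 1]/(h * 1) mulr1 add0r g0 /gam /y psis//.
    have [_] := hz h hh1; rewrite mulr0 subr0 => zh.
    have -> : c + h *: tau - z (c + h *: tau) *: e - c - h *: tau = - (z (c + h *: tau) *: e).
      by apply/rowP => i; rewrite !mxE; ring.
    rewrite normrN normrZ; apply: le_trans (ler_wpM2l _ e1) _ => //.
    by rewrite mulr1.
  have [gd1 gd2] := gd.
  have := n2 gam gf g0 gd1; rewrite gd2 => tn.
  have tt : dot tau tau = 0.
    have -> : dot tau tau = dot tau nu' - k * \sum_i tau 0 i * zd i c.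
      rewrite /dot mulr_sumr -sumrB; apply: eq_bigr => i _; rewrite /tau !mxE; ring.
    by rewrite tn tau0 mulr0 subrr.
  have tau00 : tau = 0.
    apply/eqP; rewrite -normr_le0; apply: le_trans (norm_le_enorm _) _.
    by rewrite /enorm tt sqrtr0.
  by apply/eqP; rewrite -subr_eq0; apply/eqP.
have a0 : a < 0.
  rewrite ltNge; apply/negP => a0.
  have [a00|an0] := eqVneq a 0.
    move: n1; rewrite nuE /k a00 mul0r scale0r /enorm /dot big1 ?sqrtr0.
      by move/eqP; rewrite eq_sym oner_eq0.
    by move=> i _; rewrite mxE mul0r.
  have {an0} a0 : 0 < a by rewrite lt_neqAle eq_sym an0.
  have a20 : 0 < a / 2 by rewrite divr_gt0.
  have [h1 h10 hz] := chart_line (erefl : a = _) a20.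
  have [q /= q0 hq] := n3.
  have m0 : 0 < Num.min q h1 by rewrite lt_min q0.
  have [s s0] : exists2 s : R, 0 < s & s < Num.min q h1 by exists (Num.min q h1 / 2); lra.
  rewrite lt_min => /andP[sq sh1].
  have [|] := hq s _ s0; first by rewrite /= sub0r normrN gtr0_norm.
  have sn : `|- s| < h1 by rewrite normrN gtr0_norm.
  have [xr] := hz (- s) sn; rewrite scaleNr in xr *.
  rewrite normrN (gtr0_norm s0) => /ler_normlP[h1' h].
  have sa : 0 < s * a by rewrite mulr_gt0.
  move=> /(chart_in ch xr).1 zp _.
  lra.
have kE : k = - (slope c)^-1.
  have k0 : k < 0 by rewrite /k pmulr_llt0// invr_gt0.
  have : (- k * slope c) ^+ 2 = 1.
    have n11 : dot nu' nu' = 1 by rewrite -sqr_enorm n1 expr1n.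
    move: n11; rewrite nuE /dot.
    under eq_bigr do rewrite !mxE mulrACA.
    by rewrite -mulr_sumr -sqr_slope => <-; ring.
  move/eqP; rewrite sqrp_eq1; last by rewrite mulr_ge0 ?oppr_ge0 ?ltW.
  move/eqP => kG; rewrite -[k]opprK; congr (- _).
  by apply: (mulIf (lt0r_neq0 G0)); rewrite kG mulVf// gt_eqF.
rewrite nuE kE; apply/rowP => i; rewrite !mxE.
by rewrite mulNr mulrC mulNr.
Qed.

Lemma normal_vecE i : normal_vec Omega c 0 i = - zd i c / slope c.
Proof.
have -> : normal_vec Omega c = nu; last by rewrite mxE.
rewrite /normal_vec; case: xgetP => [nu' _ h|h]; first exact: nu_unique.
by exfalso; exact: (h nu nu_outward).
Qed.

End LocalChart.

(** The gradient of u2 - u1 is its e-derivative times the gradient of z, and the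
    outward normal is minus the normalized gradient of z. *)
Lemma normal_derivative_diff T c r e z zd zdd u1 u2 t :
  0 < T -> chart Omega c r e z zd zdd -> frontier Omega c -> 0 < t < T ->
  cyl_C1 Omega T u1 -> cyl_C1 Omega T u2 ->
  (forall x, frontier Omega x -> u2 (x, t) = u1 (x, t)) ->
  normal_derivative Omega T u2 (c, t) - normal_derivative Omega T u1 (c, t) =
  - (slope zd c * cont_ext (cylinder Omega T)
      ('D_(e, 0) (fun p => 1 * u2 p + (-1) * u1 p)) (c, t)).
Proof.
move=> T0 ch fc tT u1C u2C u12.
set u := fun p => 1 * u2 p + (-1) * u1 p.
have uC : cyl_C1 Omega T u by exact: cyl_C1_lin.
have u0 x : frontier Omega x -> u (x, t) = 0.
  by move=> fx; rewrite /u u12//; ring.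
have tT' : 0 <= t <= T by case/andP: tT => ? ?; rewrite !ltW.
have Qc : closure (cylinder Omega T) (c, t).
  by apply/(closure_cylinder_in Omega T0); split => //; exact: ((frontierE oOmega c).1 fc).1.
rewrite /normal_derivative -sumrB /=.
have G0 : 0 < slope zd c by apply: lt_le_trans (slope_ge1 ch c).
transitivity (\sum_i (- zd i c / slope zd c * (zd i c *
    cont_ext (cylinder Omega T) ('D_(e, 0) u) (c, t)))).
  apply: eq_bigr => i _; rewrite (normal_vecE ch fc).
  rewrite -mulrBr; congr (_ * _).
  have := boundary_gradient oOmega T0 ch fc (basis_vec i) uC tT u0.
  rewrite sum_basis => <-.
  have [_ us1 _] := u1C; have [_ us2 _] := u2C.
  have [d1 c1] := us1 (space_vec i) erefl; have [d2 c2] := us2 (space_vec i) erefl.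
  have := cont_ext_lin 1 (-1) c2 c1 Qc; rewrite mul1r mulN1r => <-.
  have [_ us _] := uC; have [_ c3] := us (space_vec i) erefl.
  have [c3c c3E] := cont_extP c3.
  apply: cont_extE c3c _ Qc => p Qp; rewrite -c3E//.
  by rewrite (derive_val (is_derive := derive_lin 1 (-1) (d2 p Qp) (d1 p Qp))).
set g := cont_ext _ _ _.
transitivity (- (\sum_i zd i c * zd i c) / slope zd c * g).
  rewrite -sumrN !mulr_suml; apply: eq_bigr => i _; ring.
by rewrite -(sqr_slope ch c) -mulNr mulfK ?gt_eqF// mulNr.
Qed.

End Normal.

(** * Traces in time and the boundary point lemma *)

Section TimeTrace.
Context {R : realType} {n : nat}.
Local Notation E := 'rV[R]_n.+1.
Variables (Omega : set E) (T : R).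
Hypothesis oOmega : open Omega.
Hypothesis bOmega : bounded_set Omega.
Hypothesis T0 : 0 < T.
Local Notation Q := (cylinder Omega T).
Variable u : E * R -> R.
Hypothesis uC : cyl_C1 Omega T u.
Hypothesis u0 : forall x t, closure Omega x -> 0 <= t < T ->
  frontier Omega x \/ t = 0 -> u (x, t) = 0.

Lemma Qcl x t : closure Omega x -> 0 <= t < T -> closure Q (x, t).
Proof.
move=> cx /andP[t0 tT]; apply/(closure_cylinder_in Omega T0); split=> //.
by rewrite t0 ltW.
Qed.

(** At a boundary point the time derivative is a limit of difference quotients
    at interior points, where u tends to 0. *)
Lemma boundary_dt x t : frontier Omega x -> 0 < t < T ->
  cont_ext Q ('D_time_vec u) (x, t) = 0.
Proof.
move=> fx /andP[t0 tT]; have [uc _ [ud cd]] := uC.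
have cx : closure Omega x by have [] := (frontierE oOmega x).1 fx.
have [dc dE] := cont_extP cd.
have tT0 : 0 <= t < T by rewrite ltW.
have Qx := Qcl cx tT0.
apply: (le_small_eq (k := 3)) => // d d0 _.
have [r r0 hr] := within_continuous_le dc Qx d0.
have m0 : 0 < Num.min r (T - t) by rewrite lt_min r0 subr_gt0.
have [h h0] : exists2 h : R, 0 < h & h < Num.min r (T - t).
  by exists (Num.min r (T - t) / 2); lra.
rewrite lt_min => /andP[hr1 hT].
have thT : 0 <= t + h < T by lra.
have dh0 : 0 < d * h by rewrite mulr_gt0.
have [r1 r10 hr1'] := within_continuous_le uc Qx dh0.
have [r2 r20 hr2] := within_continuous_le uc (Qcl cx thT) dh0.
have mm0 : 0 < Num.min r (Num.min r1 r2) by rewrite !lt_min r0 r10.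
have [y [Oy]] := (closure_normP Omega x).1 cx _ mm0.
rewrite !lt_min => /and3P[xy xy1 xy2].
have cy := subset_closure Oy.
have a1 : `|u (y, t)| < d * h.
  have := hr1' (y, t) (Qcl cy tT0); rewrite pair_norm_lt subrr normr0 xy1 r10 => /(_ isT).
  by rewrite u0 ?sub0r ?normrN//; left.
have a2 : `|u (y, t + h)| < d * h.
  have := hr2 (y, t + h) (Qcl cy thT); rewrite pair_norm_lt subrr normr0 xy2 r20 => /(_ isT).
  by rewrite u0 ?sub0r ?normrN//; left.
have E1 s : (y, 0) + s *: time_vec = (y, s) :> E * R.
  by rewrite /time_vec; congr pair; rewrite /= ?scaler0 ?addr0// add0r /GRing.scale/= mulr1.
have [||s sh] := line_MVT_open (f := u) (x := (y, 0)) (v := time_vec) (a := t) (b := t + h).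
- by lra.
- by move=> s sh; rewrite E1; apply: ud; apply/cylinder_in; split => //; lra.
rewrite !E1 addrAC subrr add0r => E2.
have Qys : Q (y, s) by apply/cylinder_in; split => //; lra.
have a3 : `|'D_time_vec u (y, s)| <= d + d.
  rewrite -(ler_pM2r h0) -{1}(gtr0_norm h0) -normrM -E2 mulrDl.
  by rewrite (le_trans (ler_normB _ _))// lerD// ltW.
have a4 : `|cont_ext Q ('D_time_vec u) (x, t) - 'D_time_vec u (y, s)| < d.
  rewrite (dE _ Qys); apply: hr; first exact: subset_closure.
  by rewrite pair_norm_lt xy ltr_norml; lra.
set X := cont_ext _ _ _ in a4 *.
have -> : X = (X - 'D_time_vec u (y, s)) + 'D_time_vec u (y, s) by rewrite subrK.
apply: le_trans (ler_normD _ _) _; lra.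
Qed.

(** u vanishes identically at time 0. *)
Lemma initial_derivative v x : closure Omega x -> cont_ext Q ('D_(v, 0) u) (x, 0) = 0.
Proof.
move=> cx; have [uc us _] := uC; have [_ cd] := us (v, 0) erefl.
have [dc dE] := cont_extP cd.
have t00 : 0 <= (0 : R) < T by rewrite lexx.
have Qx := Qcl cx t00.
apply: (le_small_eq (k := 3)) => // d d0 _.
have [r r0 hr] := within_continuous_le dc Qx d0.
have r20 : 0 < r / 2 by rewrite divr_gt0.
have [y [Oy xy]] := (closure_normP Omega x).1 cx _ r20.
have /nbhs_normP[q /= q0 hq] : nbhs y Omega by exact: open_nbhs_nbhs.
have V0 : 0 < 1 + `|v| by rewrite ltr_pwDl.
have m0 : 0 < Num.min q (r / 2) / (1 + `|v|) by rewrite divr_gt0// lt_min q0.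
have [h h0 hm] : exists2 h : R, 0 < h & h < Num.min q (r / 2) / (1 + `|v|).
  by exists (Num.min q (r / 2) / (1 + `|v|) / 2); lra.
have hv s : 0 <= s <= h -> Omega (y + s *: v) /\ `|s *: v| < r / 2.
  move=> /andP[s0 sh]; have : `|s *: v| < Num.min q (r / 2).
    rewrite normrZ ger0_norm//; move: hm; rewrite ltr_pdivlMr//; apply: le_lt_trans.
    by rewrite ler_pM// lerDr.
  rewrite lt_min => /andP[sq sr]; split => //; apply: hq => /=.
  by rewrite opprD addNKr normrN.
have dh0 : 0 < d * h by rewrite mulr_gt0.
have hh : 0 <= h <= h by rewrite lexx ltW.
have [Oyh _] := hv h hh.
have [r1 r10 hr1] := within_continuous_le uc (Qcl (subset_closure Oy) t00) dh0.
have [r2 r20' hr2] := within_continuous_le uc (Qcl (subset_closure Oyh) t00) dh0.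
have mm0 : 0 < Num.min (Num.min r1 r2) (Num.min r T) by rewrite !lt_min r10 r20' r0.
have [t t0] : exists2 t : R, 0 < t & t < Num.min (Num.min r1 r2) (Num.min r T).
  by exists (Num.min (Num.min r1 r2) (Num.min r T) / 2); lra.
rewrite !lt_min => /andP[/andP[tr1 tr2] /andP[tr tT]].
have tT0 : 0 <= t < T by rewrite ltW.
have nt : `|0 - t| = t by rewrite sub0r normrN gtr0_norm.
have a1 : `|u (y, t)| < d * h.
  have := hr1 (y, t) (Qcl (subset_closure Oy) tT0); rewrite pair_norm_lt subrr normr0 nt tr1 r10 => /(_ isT).
  by rewrite u0 ?sub0r ?normrN//; [exact: subset_closure|right].
have a2 : `|u (y + h *: v, t)| < d * h.
  have := hr2 (y + h *: v, t) (Qcl (subset_closure Oyh) tT0); rewrite pair_norm_lt subrr normr0 nt tr2 r20' => /(_ isT).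
  by rewrite u0 ?sub0r ?normrN//; [exact: subset_closure|right].
have tT' : 0 < t < T by rewrite t0.
have [|s /andP[s0 sh] E2] := cyl_MVT T0 uC h0 tT' (subset_closure Oy) (subset_closure Oyh).
  by move=> s /andP[s0 sh]; apply: (hv s _).1; rewrite !ltW.
have /hv[Os sr] : 0 <= s <= h by rewrite !ltW.
have Qys : Q (y + s *: v, t) by apply/cylinder_in.
have a3 : `|'D_(v, 0) u (y + s *: v, t)| <= d + d.
  rewrite -(ler_pM2r h0) -{1}(gtr0_norm h0) -normrM -E2 mulrDl.
  by rewrite (le_trans (ler_normB _ _))// lerD// ltW.
have a4 : `|cont_ext Q ('D_(v, 0) u) (x, 0) - 'D_(v, 0) u (y + s *: v, t)| < d.
  rewrite (dE _ Qys); apply: hr; first exact: subset_closure.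
  rewrite pair_norm_lt nt tr andbT opprD addrA.
  by apply: le_lt_trans (ler_normB _ _) _; lra.
set X := cont_ext _ _ _ in a4 *; set X2 := 'D__ _ _ in a3 a4.
have -> : X = (X - X2) + X2 by rewrite subrK.
apply: le_trans (ler_normD _ _) _; lra.
Qed.

End TimeTrace.

Section Hopf.
Context {R : realType} {n : nat}.
Local Notation E := 'rV[R]_n.+1.
Variables (Omega : set E).
Hypothesis oOmega : open Omega.
Hypothesis bOmega : bounded_set Omega.

(** Boundary point lemma in chart form: a subsolution with a strictly positive
    Laplacian that vanishes at a boundary maximum point decreases linearly into
    the domain; the comparison function is - mu z + kappa |x - c|^2. *)
Lemma hopf c r (e : E) z zd zdd L (w : E -> R) (rho l0 : R) :
  chart Omega c r e z zd zdd -> chart_bounded L c r z zd zdd -> frontier Omega c ->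
  0 < rho -> rho < r -> 0 < l0 ->
  {within cap Omega c rho, continuous w} ->
  (forall x, cap Omega c rho x -> w x <= 0) ->
  (forall x, capo Omega c rho x -> exists a l, lap_at w x a l /\ l0 <= l) ->
  exists mu kappa : R, [/\ 0 < mu, 0 <= kappa &
    forall s, 0 < s < rho -> capo Omega c rho (c + s *: e) ->
      w (c + s *: e) <= - mu * s + kappa * s ^+ 2].
Proof.
move=> ch bd fc rho0 rhor l00 wc w0 wl; have [L1 _ bzdd _ _] := bd.
have L0 : 0 < L by exact: lt_le_trans L1.
pose k : R := l0 / (4 * n.+1%:R).
have k0 : 0 < k by rewrite divr_gt0.
have kN : k * (2 * n.+1%:R) = l0 / 2.
  have N0 : n.+1%:R != 0 :> R by rewrite pnatr_eq0.
  by rewrite /k; field.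
pose m := Num.min (l0 / (4 * L)) (k * rho / L).
have m0 : 0 < m by rewrite lt_min !divr_gt0// ?mulr_gt0.
have mL : m * L <= l0 / 4.
  rewrite -ler_pdivlMr//; apply: le_trans (_ : l0 / (4 * L) <= _); first by rewrite ge_min lexx.
  by rewrite invfM mulrA.
have mrho : m * L <= k * rho by rewrite -ler_pdivlMr// ge_min lexx orbT.
exists m, k; split => //; first exact: ltW.
pose b x := - m * z x + k * dot (x - c) (x - c).
pose g x := w x - b x.
have gc : {within cap Omega c rho, continuous g}.
  apply/within_continuousP => x Cx; apply: (cvgB (f := w)); first exact: ((within_continuousP _ _).1 wc).
  apply: cvg_within_filter.
  have [xc _ _ _] := cap_z oOmega ch bd fc rho0 rhor Cx.
  have xz := chart_z_continuous ch (le_lt_trans xc rhor).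
  have hd : {for x, continuous (fun x : E => dot (x - c) (x - c))} by exact: dot_continuous.
  exact: (cvgD (cvgM (cvg_cst (- m)) xz) (cvgM (cvg_cst k) hd)).
have cc : cap Omega c rho c.
  split; first by have [] := (frontierE oOmega c).1 fc.
  by rewrite /= subrr /dot big1 ?sqr_ge0// => i _; rewrite mxE mul0r.
have [xm] := compact_EVT_max (ex_intro _ c cc) (@cap_compact R n Omega bOmega c rho) gc.
rewrite inE => Cxm xmax.
have gm : g xm <= 0.
  have [xc z0 _ zr] := cap_z oOmega ch bd fc rho0 rhor Cxm.
  have [Gx|nG] := pselect (capo Omega c rho xm); last first.
    apply: le_trans (_ : - b xm <= 0); first by rewrite gerDr w0.
    rewrite oppr_le0 /b; have [fx|->] := cap_split oOmega Cxm nG.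
      rewrite ((chart_frontier ch oOmega (le_lt_trans xc rhor)).1 fx) mulr0 add0r.
      by rewrite mulr_ge0 ?dot_ge0// ltW.
    rewrite mulNr addrC subr_ge0; apply: le_trans (_ : m * (L * rho) <= _).
      by rewrite ler_wpM2l// ltW.
    by rewrite mulrA expr2 mulrA ler_wpM2r// ltW.
  have [a [l [la ll]]] := wl xm Gx.
  have bl := lap_atD (lap_atZ (- m) (chart_lap ch xm)) (lap_atZ k (lap_at_sqdist c xm)).
  have := lap_at_max (@capo_open R n Omega oOmega c rho) Gx _ (lap_atB la bl).
  have hmax y : capo Omega c rho y -> w y - b y <= w xm - b xm.
    by move=> Gy; apply: xmax; rewrite inE; exact: capo_cap.
  move=> /(_ hmax); have /ler_normlP[z1 z2] := bzdd xm (ltW (le_lt_trans xc rhor)).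
  have : m * - (\sum_i zdd i xm) <= m * L by rewrite ler_wpM2l// ltW.
  move: kN mL ll l00; set lz := \sum_i _; rewrite mulNr mulrN => -> h1 h2 h3 h4 h5; exfalso.
  by move: h1 h2 h3 h4 h5; set p := m * lz; clear; set q := m * L; lra.
move=> s /andP[s0 sr] Gs.
have : g (c + s *: e) <= 0 by apply: le_trans gm; apply: xmax; rewrite inE; exact: capo_cap.
rewrite /g subr_le0 => /le_trans; apply.
rewrite /b (chart_shift ch) (zc0 oOmega ch fc) add0r addrAC subrr add0r.
have -> : dot (s *: e) (s *: e) = s ^+ 2 * dot e e.
  by rewrite /dot mulr_sumr; apply: eq_bigr => i _; rewrite !mxE; ring.
by rewrite (chart_e ch) mulr1.
Qed.

End Hopf.

(** * A bound for the source near the boundary *)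

(** Inequalities between real numbers that conclude the estimates of this part. *)
Section LinearArithmetic.
Context {R : realType}.
Implicit Types (a b c d x y z w s t m k e : R).

Lemma subB_split a b x y : a - x - (b - y) = (a - b) + (y - x). Proof. ring. Qed.

Lemma penal_contradiction x t m c v : - x <= c -> c = v - (2 * t + 2) * m -> v <= x ->
  x <= t * m -> 0 < m -> False.
Proof. by rewrite mulrDl -mulrA; lra. Qed.

Lemma norm_le_3t2 x t m c : - x <= c -> c <= x -> x <= t * m -> 0 < m -> 0 < t * m ->
  `|c| <= (3 * t + 2) * m.
Proof. by move=> *; rewrite ler_norml mulrDl -mulrA; lra. Qed.

Lemma initial_bound v c b k x e : v <= c -> - v <= x -> 0 <= k -> 0 <= b -> 0 < e ->
  0 <= c + k + b + (x + e).
Proof. lra. Qed.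

Lemma chain_bound v w z c k b x e : v - w <= e -> w - z <= x -> z <= c + k -> 0 <= b ->
  v <= c + k + b + (x + e).
Proof. lra. Qed.

Lemma side_bound x t m c b d e : - x <= c -> x <= t * m -> 0 < t * m -> 0 < m ->
  0 <= b -> 0 <= d -> 0 < e -> m <= c + (2 * t + 2) * m + b + (d + e).
Proof. by rewrite mulrDl -mulrA; lra. Qed.

Lemma heat_bound b2 y d k m l r s z2 : b2 = y + d + 2 * m * k ->
  l <= b2 * r -> - (b2 * z2) <= b2 * (2 * r) -> b2 * 2 <= b2 * (2 * s) ->
  b2 * (3 * r) <= b2 * 1 ->
  y <= - (0 + k * (2 * m) + (l - b2 * (z2 + 2 * s))) + - d.
Proof. by rewrite mulrDr => ->; lra. Qed.

Lemma barrier_limit v b : (forall e, 0 < e -> v <= b + 2 * e) -> v <= b.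
Proof. by move=> h; apply/ler_addgt0Pr => e e0; have := h (e / 2); lra. Qed.

Lemma foot_bound v z c k q m p s b : 0 <= z -> v <= c + k * q + b * s -> 0 <= b -> s <= z ->
  0 <= k -> q <= p + 2 * m * z -> v * z <= z * (c + k * p) + (b + 2 * m * k) * (z * z).
Proof.
move=> z0 h b0 sz k0 qp; rewrite mulrC.
have -> : z * (c + k * p) + (b + 2 * m * k) * (z * z) =
  z * (c + k * (p + 2 * m * z) + b * z) by ring.
by rewrite ler_wpM2l// (le_trans h)// lerD ?ler_wpM2l// lerD2l ler_wpM2l.
Qed.

Lemma mulr_le_bound a b x y : `|a| <= x -> `|b| <= y -> a * b <= x * y.
Proof.
by move=> ax bx; apply: le_trans (ler_norm _) _; rewrite normrM ler_pM.
Qed.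

Lemma quad_bound a b c d s : a <= b -> b <= d -> c <= d -> s <= c -> a + 2 * s + a <= 4 * d.
Proof. lra. Qed.

Lemma source_gap d r z e k l m : - d < e -> r <= - z + e -> r = d - k -> l <= m ->
  e = (z - m) / 4 -> 0 < e -> e <= k - l.
Proof. lra. Qed.

Lemma contact_contradiction v w f g p s m k : v - w < m / 4 -> g - f < m / 4 -> v = f ->
  s * (p + k) < m / 4 -> w <= g + p * s - m + k * s -> 0 < m -> False.
Proof. by rewrite mulrDr ![s * _]mulrC; lra. Qed.

End LinearArithmetic.

Section LocalEstimate.
Context {R : realType} {n : nat}.
Local Notation E := 'rV[R]_n.+1.
Variables (Omega : set E) (T : R).
Hypothesis oOmega : open Omega.
Hypothesis bOmega : bounded_set Omega.
Hypothesis T0 : 0 < T.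
Local Notation Q := (cylinder Omega T).
Local Notation N := (n.+1%:R : R).

Variables (c : E) (r : R) (e : E) (z : E -> R) (zd zdd : 'I_n.+1 -> E -> R) (L : R).
Hypothesis ch : chart Omega c r e z zd zdd.
Hypothesis bd : chart_bounded L c r z zd zdd.
Hypothesis fc : frontier Omega c.

Variables (u Rs : E * R -> R) (tau D M Y rho : R).
Hypothesis uC : cyl_C1 Omega T u.
Hypothesis uh : forall x t, Omega x -> 0 < t < T -> heat_at u x t (Rs (x, t)).
Hypothesis u0 : forall x t, closure Omega x -> 0 <= t < T ->
  frontier Omega x \/ t = 0 -> u (x, t) = 0.
Hypothesis tauT : 0 < tau < T.
Hypothesis D0 : 0 < D.
Hypothesis DM : D <= M.
Hypothesis Y0 : 0 <= Y.
Hypothesis rho0 : 0 < rho.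
Hypothesis rho1 : rho <= 1.
Hypothesis rhor : 2 * rho < r.
Hypothesis rhoL : 3 * L ^+ 2 * rho <= 1.

Let v := cont_ext Q ('D_(e, 0) u).
Let q (x : E) := dot (x - c) (x - c).

Hypothesis v_lip : forall x t, frontier Omega x -> 0 <= t <= tau ->
  `|v (x, t) - v (x, tau)| <= D * (tau - t).
Hypothesis u_lip : exists2 h0 : R, 0 < h0 & forall x t (h : R), 0 < h -> h <= h0 ->
  (forall s, 0 <= s <= h -> Omega (x + s *: e)) -> 0 <= t <= tau ->
  `|u (x + h *: e, t) - u (x, t)| <= M * h.
Hypothesis Rs_lip : exists2 h0 : R, 0 < h0 & forall x t (h : R), 0 < h -> h <= h0 ->
  (forall s, 0 <= s <= h -> Omega (x + s *: e)) -> 0 < t <= tau ->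
  `|Rs (x + h *: e, t) - Rs (x, t)| <= Y * h.

(** penal rho^2 exceeds the oscillation of the trace v, so that the penalized maximum
    is attained inside the ball of radius rho.  barrier2 dominates the slope Y of the
    source, the slope D in time and the Laplacian of the penalization; barrier1 makes barrier1 z - barrier2 z^2
    nonnegative where z <= L rho; primitive2 is a coefficient for its primitive in z. *)
Definition penal := (2 * T + 2) * M / rho ^+ 2.
Definition barrier2 := Y + D + 2 * N * penal.
Definition barrier1 := barrier2 * L * rho.
Definition primitive2 := barrier1 + 2 * N * rho * penal.

Let L1 : 1 <= L. Proof. by case: bd. Qed.
Let L0 : 0 < L. Proof. exact: lt_le_trans L1. Qed.
Let M0 : 0 < M. Proof. exact: lt_le_trans DM. Qed.
Let K0 : 0 < penal.
Proof. by rewrite /penal divr_gt0 ?exprn_gt0// mulr_gt0 ?addr_gt0 ?mulr_gt0. Qed.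
Let Krho : penal * rho ^+ 2 = (2 * T + 2) * M.
Proof. by rewrite /penal mulfVK// gt_eqF// exprn_gt0. Qed.
Let B0 : 0 <= barrier2. Proof. by rewrite /barrier2; nonneg. Qed.
Let rhor1 : rho < r. Proof. by apply: le_lt_trans rhor; rewrite ler_peMl ?(ltW rho0)// ler1n. Qed.
Let tau0 : 0 < tau. Proof. by case/andP: tauT. Qed.

Let in_T t : 0 <= t <= tau -> 0 <= t < T.
Proof. by move: tauT => /andP[_ h] /andP[-> tt]; exact: le_lt_trans tt h. Qed.

Let vc : {within closure Q, continuous v}.
Proof. by have [_ us _] := uC; have [_ /cont_extP[]] := us (e, 0) erefl. Qed.

Let vE x t : Omega x -> 0 < t < T -> 'D_(e, 0) u (x, t) = v (x, t).
Proof.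
have [_ us _] := uC; have [_ /cont_extP[_ h]] := us (e, 0) erefl.
by move=> Ox tt; rewrite h//; exact/cylinder_in.
Qed.

Let clQ x t : closure Omega x -> 0 <= t <= tau -> closure Q (x, t).
Proof. by move=> cx tt; apply: Qcl => //; exact: in_T. Qed.

Let v_initial x : closure Omega x -> v (x, 0) = 0.
Proof. exact: (initial_derivative oOmega T0 uC u0). Qed.

Let v_bound x : frontier Omega x -> `|v (x, tau)| <= D * T.
Proof.
move=> fx; have [cx _] := (frontierE oOmega x).1 fx.
have := v_lip fx (_ : 0 <= 0 <= tau); rewrite lexx (ltW tau0) => /(_ isT).
rewrite v_initial// sub0r normrN subr0 => /le_trans; apply.
by rewrite ler_wpM2l ?(ltW D0)// ltW//; case/andP: tauT.
Qed.

Let u_increment x t (h : R) : closure Omega x -> 0 < h -> 0 < t <= tau ->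
  (forall s, 0 < s <= h -> Omega (x + s *: e)) ->
  exists2 s, 0 < s < h & u (x + h *: e, t) - u (x, t) = v (x + s *: e, t) * h.
Proof.
move=> cx h0 /andP[t0 tt] hO.
have tt' : 0 < t < T by rewrite t0 (le_lt_trans tt)//; case/andP: tauT.
have hh : 0 < h <= h by rewrite h0 lexx.
have [|s sh ->] := cyl_MVT T0 uC h0 tt' cx (subset_closure (hO h hh)).
  by move=> s /andP[s0 sh]; apply: hO; rewrite s0 ltW.
exists s => //; rewrite vE//; apply: hO; case/andP: sh => -> sh; exact: ltW.
Qed.

Let capE x : cap Omega c rho x ->
  [/\ `|x - c| <= rho, 0 <= z x, z x <= L * `|x - c| & z x <= L * rho].
Proof. exact: (cap_z oOmega ch bd fc rho0 rhor1). Qed.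

Let cap_up x s : cap Omega c rho x -> 0 < s <= rho -> Omega (x + s *: e).
Proof.
move=> /capE[xc zx _ _] /andP[s0 sr]; apply/(chart_in ch); last first.
  by rewrite (chart_shift ch) ltr_wpDl.
rewrite addrAC; apply: le_lt_trans (ler_normD _ _) _; rewrite normrZ gtr0_norm//.
have : s * `|e| <= s by rewrite ler_piMr ?(ltW s0)// (norm_chart_e ch).
by move=> h; apply: le_lt_trans (lerD xc (le_trans h sr)) _; rewrite -mulr2n -mulr_natl.
Qed.

(** The maximum point xh of the penalized trace of v = d_e u makes the barrier
    lie above v on the boundary at time tau, hence at earlier times up to
    D (tau - t); the comparison is done on difference quotients of u. *)
Lemma trace_barrier : exists xh c0, [/\ frontier Omega xh, q xh < rho ^+ 2,
  v (xh, tau) = c0 + penal * q xh, `|c0| <= (3 * T + 2) * M &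
  forall x, capo Omega c rho x -> v (x, tau) <= c0 + penal * q x + barrier1 * z x].
Proof.
have cqc : q c = 0 by rewrite /q /dot big1// => i _; rewrite subrr mxE mul0r.
pose Gc := frontier Omega `&` [set x | q x <= rho ^+ 2].
have cG : compact Gc.
  apply: (subclosed_compact _ (frontier_compact bOmega)); last by move=> x [].
  apply: closedI.
    rewrite /frontier setDE; apply: closedI; first exact: closed_closure.
    by apply: open_closedC; exact: open_interior.
  have -> : [set x : E | q x <= rho ^+ 2] = q @^-1` [set s | s <= rho ^+ 2] by [].
  apply: preimage_closed; last exact: closed_le.
  by move=> x _; exact: dot_continuous.
have tau01 : 0 <= tau <= tau by rewrite lexx ltW.
have qc0 : {within Gc, continuous q} by apply: continuous_subspaceT; exact: dot_continuous.
have gc : {within Gc, continuous (fun x => v (x, tau) - penal * q x)}.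
  apply: le_within_continuous => x Gx d d0.
  have d20 : 0 < d / 2 by rewrite divr_gt0.
  have dK : 0 < d / 2 / penal by exact: divr_gt0 d20 K0.
  have cx : closure Omega x by have [] := (frontierE oOmega x).1 Gx.1.
  have [r1 r10 h1] := within_continuous_le vc (clQ cx tau01) d20.
  have [r2 r20 h2] := within_continuous_le qc0 Gx dK.
  exists (Num.min r1 r2); first by rewrite lt_min r10.
  move=> y Gy; rewrite lt_min => /andP[xy1 xy2].
  have cy : closure Omega y by have [] := (frontierE oOmega y).1 Gy.1.
  have a1 : `|v (x, tau) - v (y, tau)| < d / 2.
    by apply: h1; [exact: clQ|rewrite pair_norm_lt xy1 subrr normr0].
  have a2 : `|penal * q y - penal * q x| < d / 2.
    rewrite -mulrBr normrM (gtr0_norm K0) mulrC -(ltr_pdivlMr _ _ K0) distrC.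
    exact: h2.
  rewrite subB_split.
  by apply: le_lt_trans (ler_normD _ _) _; rewrite [ltRHS]splitr ltrD.
have Gcc : Gc c by split => //=; rewrite cqc ltW// exprn_gt0.
have [xh] := compact_EVT_max (ex_intro _ c Gcc) cG gc.
rewrite inE => -[fxh qxh] xmax.
pose c0 := v (xh, tau) - penal * q xh.
have c0max x : frontier Omega x -> q x <= rho ^+ 2 -> v (x, tau) <= c0 + penal * q x.
  by move=> fx qx; rewrite -lerBlDr; apply: xmax; rewrite inE.
have DTM : D * T <= T * M by rewrite mulrC ler_wpM2l// ltW.
have c0lb : - (D * T) <= c0.
  have := c0max c fc; rewrite cqc mulr0 addr0 => /(_ (ltW (exprn_gt0 _ rho0))) h.
  apply: le_trans h; have /ler_normlP[+ _] := v_bound fc; lra.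
have q0 x : 0 <= q x by exact: dot_ge0.
have c0ub : c0 <= D * T.
  have /ler_normlP[_ h] := v_bound fxh; apply: le_trans h.
  by rewrite /c0 gerBl mulr_ge0// ltW.
have Kq0 x : 0 <= penal * q x by rewrite mulr_ge0// ltW.
(* On the sphere the penalization, (2 T + 2) M, would make c0 less than - D T. *)
have qlt : q xh < rho ^+ 2.
  rewrite lt_neqAle qxh andbT; apply/eqP => qe.
  have : c0 = v (xh, tau) - (2 * T + 2) * M by rewrite /c0 qe Krho.
  have /ler_normlP[_ h] := v_bound fxh.
  move=> ce; exact: penal_contradiction c0lb ce h DTM M0.
exists xh, c0; split => //; first by rewrite /c0 subrK.
  have TM0 : 0 < T * M by rewrite mulr_gt0.
  exact: norm_le_3t2 c0lb c0ub DTM M0 TM0.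
have [h1 h10 hu] := u_lip; have [h2 h20 hR] := Rs_lip.
have cQ : compact (closure Q).
  by rewrite closure_cylinder//; apply: compact_setX; [exact: closure_Omega_compact|exact: segment_compact].
pose b x := c0 + penal * q x + (barrier1 * z x - barrier2 * (z x * z x)).
have bq x : cap Omega c rho x -> 0 <= barrier1 * z x - barrier2 * (z x * z x).
  move=> /capE[_ zx _ zr].
  have -> : barrier1 * z x - barrier2 * (z x * z x) = barrier2 * z x * (L * rho - z x).
    by rewrite /barrier1; ring.
  by rewrite mulr_ge0 ?subr_ge0//; nonneg.
have main (eps : R) : 0 < eps -> forall x, capo Omega c rho x -> v (x, tau) <= b x + 2 * eps.
  move=> eps0 x Cx.
  have [dl dl0 hv] := compact_unif_continuous cQ vc eps0.
  pose h := Num.min (Num.min h1 h2) (Num.min dl rho) / 2.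
  have m0 : 0 < Num.min (Num.min h1 h2) (Num.min dl rho) by rewrite !lt_min h10 h20 dl0.
  have hm : h < Num.min (Num.min h1 h2) (Num.min dl rho) by rewrite /h; lra.
  have hpos : 0 < h by rewrite /h divr_gt0.
  clearbody h; move: hm; rewrite !lt_min => /andP[/andP[hh1 hh2] /andP[hdl hrho]].
  have cup y s : cap Omega c rho y -> 0 < s <= h -> Omega (y + s *: e).
    move=> Cy /andP[s0 sh]; apply: (cap_up Cy); rewrite s0; apply: le_trans sh _; exact: ltW.
  have vnear y t s : closure Omega y -> closure Omega (y + s *: e) -> 0 <= t <= tau ->
      0 < s < h -> `|v (y, t) - v (y + s *: e, t)| < eps.
    move=> cy cys tt /andP[s0 sh]; apply: hv; [exact: clQ|exact: clQ|].
    rewrite pair_norm_lt subrr normr0 dl0 andbT opprD addNKr normrN normrZ gtr0_norm//.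
    apply: le_lt_trans (_ : s < dl); last exact: lt_trans hdl.
    by rewrite ler_piMr ?(ltW s0)// (norm_chart_e ch).
  (* D (tau - t) pays for the motion of the trace from t to tau, and eps for the
     replacement of v by a difference quotient of u. *)
  pose w p := (u (p.1 + h *: e, p.2) - u p) - h * (b p.1 + (D * (tau - p.2) + eps)).
  have wle : w (x, tau) <= 0.
    apply: (maximum_principle (K := cap Omega c rho) (G := capo Omega c rho) (tau := tau) (L := 0)).
    - exact: cap_compact.
    - exact: capo_open.
    - exact: capo_cap.
    - by [].
    - apply: within_B.
        have [uc _ _] := uC.
        apply: within_B.
          apply: le_within_continuous => -[y t] [/= Cy]; rewrite in_itv/= => tt d d0.
          have hh : 0 < h <= h by rewrite hpos lexx.
          have [r' r'0 hr'] := within_continuous_le uc (clQ (subset_closure (cup y h Cy hh)) tt) d0.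
          exists r' => // -[y' t'] [/= Cy']; rewrite in_itv/= => tt'.
          rewrite pair_norm_lt => hyp; apply: hr'.
            by apply: clQ => //; apply: subset_closure; exact: cup.
          by rewrite pair_norm_lt opprD addrACA subrr addr0.
        apply: continuous_subspaceW uc => -[y t] [/= [cy _]]; rewrite in_itv/= => tt.
        exact: clQ.
      apply: within_Z; apply/within_continuousP => -[y t] [/= Cy _].
      have [yc _ _ _] := capE Cy.
      apply: cvg_within_filter.
      have yz := chart_z_continuous ch (le_lt_trans yc rhor1).
      have hq : {for y, continuous q} by exact: dot_continuous.
      have hb : {for y, continuous b}.
        exact: (cvgD (cvgD (cvg_cst c0) (cvgM (cvg_cst penal) hq))
          (cvgB (cvgM (cvg_cst barrier1) yz) (cvgM (cvg_cst barrier2) (cvgM yz yz)))).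
      have hf : {for (y, t), continuous (fst : E * R -> E)} by exact: cvg_fst.
      have hs : {for (y, t), continuous (snd : E * R -> R)} by exact: cvg_snd.
      apply: (cvgD (@continuous_comp _ _ _ fst b (y, t) hf hb)).
      exact: (cvgD (cvgM (cvg_cst D) (cvgB (cvg_cst tau) hs)) (cvg_cst eps)).
    - move=> y t Cy tt nGt; rewrite /w /= subr_le0.
      have [cy qy] := Cy; have /andP[t0 ttau] := tt.
      have Dt0 : 0 <= D * (tau - t) by rewrite mulr_ge0 ?subr_ge0// ltW.
      have byq := bq y Cy; have Kqy := Kq0 y.
      have [t00|tn0] := eqVneq t 0.
        have hh : 0 < h <= h by rewrite hpos lexx.
        rewrite t00 !u0 ?lexx//; [|by right|exact: subset_closure (cup y h Cy hh)|by right].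
        rewrite subrr mulr_ge0// ?(ltW hpos)// subr0.
        have := c0max c fc; rewrite cqc mulr0 addr0 => /(_ (ltW (exprn_gt0 _ rho0))) hc.
        have := v_lip fc (_ : 0 <= 0 <= tau); rewrite lexx (ltW tau0) => /(_ isT).
        rewrite v_initial; last by have [] := (frontierE oOmega c).1 fc.
        rewrite sub0r normrN subr0 => /ler_normlP[hc2 _].
        exact: initial_bound hc hc2 Kqy byq eps0.
      have tpos : 0 < t by rewrite lt_neqAle eq_sym tn0.
      have tpos' : 0 < t <= tau by rewrite tpos.
      case: nGt => [nG|]; last by move/eqP; rewrite (negbTE tn0).
      have [fy|qe] := cap_split oOmega Cy nG.
        have [s sh ->] := u_increment cy hpos tpos' (fun s => cup y s Cy).
        rewrite mulrC ler_wpM2l ?(ltW hpos)//.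
        have cys : closure Omega (y + s *: e).
          by apply: subset_closure; apply: (cup y s Cy); case/andP: sh => -> /ltW.
        have := vnear y t s cy cys tt sh; rewrite distrC => /ltW/ler_normlP[_ k1].
        have /ler_normlP[_ k2] := v_lip fy tt.
        have k3 := c0max y fy qy.
        exact: chain_bound k1 k2 k3 byq.
      have [Oy|fy] := closure_split oOmega cy; last first.
        have [s sh ->] := u_increment cy hpos tpos' (fun s => cup y s Cy).
        rewrite mulrC ler_wpM2l ?(ltW hpos)//.
        have cys : closure Omega (y + s *: e).
          by apply: subset_closure; apply: (cup y s Cy); case/andP: sh => -> /ltW.
        have := vnear y t s cy cys tt sh; rewrite distrC => /ltW/ler_normlP[_ k1].
        have /ler_normlP[_ k2] := v_lip fy tt.
        have k3 := c0max y fy qy.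
        exact: chain_bound k1 k2 k3 byq.
      have seg s : 0 <= s <= h -> Omega (y + s *: e).
        move=> /andP[s0 sh]; have [->|sn0] := eqVneq s 0; first by rewrite scale0r addr0.
        by apply: (cup y s Cy); rewrite lt_neqAle eq_sym sn0 s0.
      have /ler_normlP[_ k1] := hu y t h hpos (ltW hh1) seg tt.
      apply: le_trans k1 _; rewrite mulrC ler_wpM2l ?(ltW hpos)//.
      have k2 : penal * q y = (2 * T + 2) * M by rewrite -Krho -qe.
      rewrite /b k2; have TM0 : 0 < T * M by rewrite mulr_gt0.
      exact: side_bound c0lb DTM TM0 M0 byq Dt0 eps0.
    - move=> y t Gy /andP[t0 ttau] _; rewrite mul0r.
      have Cy := capo_cap Gy; have Oy : Omega y := Gy.1.
      have [yc zy zyL zyr] := capE Cy.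
      have tt : 0 < t < T by rewrite t0 (le_lt_trans ttau)//; case/andP: tauT.
      have hh : 0 < h <= h by rewrite hpos lexx.
      have Oyh := cup y h Cy hh.
      have seg s : 0 <= s <= h -> Omega (y + s *: e).
        move=> /andP[s0 sh]; have [->|sn0] := eqVneq s 0; first by rewrite scale0r addr0.
        by apply: (cup y s Cy); rewrite lt_neqAle eq_sym sn0 s0.
      have tt2 : 0 < t <= tau by rewrite t0.
      have /ler_normlP[_ k1] := hR y t h hpos (ltW hh2) seg tt2.
      have [a qa] := lap_z_quad ch barrier1 barrier2 y.
      set lz := \sum_i zdd i y in qa *; set S := \sum_i zd i y * zd i y in qa *.
      exists (Rs (y + h *: e, t) - Rs (y, t) - h * (- (0 + penal * (2 * N) +
         (barrier1 * lz - barrier2 * (2 * (z y * lz) + 2 * S))) + - D)).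
        apply: heat_atB.
          apply: heat_atB; last exact: uh.
          by apply: (heat_at_shift (w := u)); exact: uh.
        apply: heat_atZ; apply: heat_atD.
          apply: (heat_at_space (f := b)).
          exact: (lap_atD (lap_atD (lap_at_cst c0 y) (lap_atZ penal (lap_at_sqdist c y))) qa).
        have td : is_derive (t : R) (1 : R) (fun t => D * (tau - t) + eps) (- D).
          apply: (is_derive_congr (is_deriveD (is_deriveZ D (is_deriveB (is_derive_cst tau t 1)
             (is_derive_id t 1))) (is_derive_cst eps t 1))).
          by rewrite sub0r addr0 /GRing.scale/= mulrN1.
        exact: (heat_at_time (f := fun t => D * (tau - t) + eps)).
      have g1 : 1 <= S := chart_grad_ge1 ch y.
      have [_ _ bzdd _ _] := bd.
      have /ler_normlP[lz1 lz2] := bzdd y (ltW (le_lt_trans yc rhor1)).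
      rewrite -/lz in lz1 lz2.
      have r2 : barrier2 * (L ^+ 2 * rho) = barrier1 * L by rewrite /barrier1; ring.
      have b10 : 0 <= barrier1 by rewrite /barrier1; nonneg.
      have e1 : barrier1 * lz <= barrier2 * (L ^+ 2 * rho) by rewrite r2 ler_wpM2l.
      have e2 : - (barrier2 * (2 * (z y * lz))) <= barrier2 * (2 * (L ^+ 2 * rho)).
        rewrite -mulrN ler_wpM2l// -mulrN ler_wpM2l//.
        have -> : L ^+ 2 * rho = (L * rho) * L by ring.
        by rewrite -mulrN; apply: le_trans (_ : z y * L <= _); [rewrite ler_wpM2l//|rewrite ler_wpM2r// ltW]; rewrite // lerNl.
      have e3 : barrier2 * 2 <= barrier2 * (2 * S) by rewrite ler_wpM2l// ler_peMr.
      have e4 : barrier2 * (3 * (L ^+ 2 * rho)) <= barrier2 * 1 by rewrite ler_wpM2l// mulrA.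
      have := heat_bound (erefl : barrier2 = Y + D + 2 * N * penal) e1 e2 e3 e4.
      move=> /(ler_wpM2l (ltW hpos)); rewrite [h * Y]mulrC => k2.
      rewrite subr_le0; apply: le_trans k1 _; apply: le_trans k2 _.
      by rewrite mulrDr mulrN mulrDr.
    - exact: capo_cap.
    - by rewrite (ltW tau0) lexx.
  have Cx' := capo_cap Cx; have Ox : Omega x := Cx.1.
  have tauh : 0 < tau <= tau by rewrite tau0 lexx.
  have [s sh E1] := u_increment (subset_closure Ox) hpos tauh (fun s => cup x s Cx').
  move: wle; rewrite /w /= E1 subrr mulr0 add0r subr_le0 mulrC ler_pM2l// => k1.
  have cxs : closure Omega (x + s *: e).
    by apply: subset_closure; apply: (cup x s Cx'); case/andP: sh => -> /ltW.
  have := vnear x tau s (subset_closure Ox) cxs tau01 sh => /ltW/ler_normlP[_ k2].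
  rewrite (mulr_natl eps 2) mulr2n addrA; apply: le_trans (_ : v (x + s *: e, tau) + eps <= _).
    by rewrite -lerBlDl.
  by rewrite lerD2r.
move=> x Cx.
have bx : v (x, tau) <= b x.
  by apply: barrier_limit => eps eps0; exact: main.
apply: le_trans bx _; rewrite /b.
have [_ zx _ _] := capE (capo_cap Cx).
by rewrite lerD2l gerBl; nonneg.
Qed.

(** Above a foot p on the boundary, u is the integral of v along the chart
    direction, so the barrier for v integrates to one for u. *)
Lemma near_foot xh c0 : frontier Omega xh -> q xh < rho ^+ 2 ->
  (forall x, capo Omega c rho x -> v (x, tau) <= c0 + penal * q x + barrier1 * z x) ->
  exists2 d : R, 0 < d & forall x, Omega x -> `|x - xh| < d ->
    q x < rho ^+ 2 /\
    u (x, tau) <= z x * (c0 + penal * q x) + primitive2 * (z x * z x).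
Proof.
move=> fxh qxh hv; have [_ _ _ _ zL] := bd.
have hq : {for xh, continuous q} by exact: dot_continuous.
have g0 : 0 < rho ^+ 2 - q xh by rewrite subr_gt0.
have /nbhs_normP[d1 /= d10 hd1] : \forall x \near xh, q x < rho ^+ 2.
  have /cvgrPdist_lt/(_ _ g0) := hq; apply: filterS => x.
  by rewrite distrC => /ltr_normlP[_]; rewrite ltrD2r.
have near_cap y : `|y - xh| < d1 -> q y < rho ^+ 2 by move=> h; apply: hd1; rewrite /= distrC.
have qc y : q y < rho ^+ 2 -> `|y - c| <= rho by move=> /ltW/(dot_norm (ltW rho0)).
exists (d1 / (1 + L)); first by rewrite divr_gt0// addr_gt0.
move=> x Ox; rewrite ltr_pdivlMr ?addr_gt0// mulrDr mulr1 => xd.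
have xd1 : `|x - xh| < d1 by apply: le_lt_trans xd; rewrite lerDl mulr_ge0// ltW.
have qx := near_cap x xd1; split => //.
have xc := qc x qx; have xr := le_lt_trans xc rhor1.
have zx0 : 0 < z x by apply/(chart_in ch xr).
have zxh : z xh = 0.
  by apply/(chart_frontier ch oOmega) => //; apply: le_lt_trans rhor1; exact: qc.
have zxd : z x + `|x - xh| < d1.
  apply: le_lt_trans xd; rewrite addrC lerD2l mulrC.
  have := zL x xh (ltW xr) (ltW (le_lt_trans (qc _ qxh) rhor1)).
  by rewrite zxh subr0; apply: le_trans; exact: ler_norm.
pose p := x - z x *: e.
have pse s : p + s *: e = x - (z x - s) *: e.
  by rewrite /p scalerBl opprB addrA addrAC.
have pnear s : 0 <= s <= z x -> `|p + s *: e - xh| < d1.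
  move=> /andP[s0 sz]; rewrite pse addrAC; apply: le_lt_trans (ler_normB _ _) _.
  apply: le_lt_trans zxd; rewrite [leRHS]addrC lerD2l normrZ ger0_norm ?subr_ge0//.
  apply: le_trans (_ : z x - s <= _); last by rewrite gerBl.
  by rewrite ler_piMr ?subr_ge0// (norm_chart_e ch).
have zp s : z (p + s *: e) = s by rewrite pse -scaleNr (chart_shift ch) opprB addrC subrK.
have pr s : 0 <= s <= z x -> `|p + s *: e - c| < r.
  by move=> sz; apply: le_lt_trans rhor1; apply: qc; apply: near_cap; exact: pnear.
have pO s : 0 < s <= z x -> Omega (p + s *: e).
  move=> /andP[s0 sz]; have sz' : 0 <= s <= z x by rewrite ltW.
  by apply/(chart_in ch (pr s sz')); rewrite zp.
have fp : frontier Omega p.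
  have h0 : 0 <= (0 : R) <= z x by rewrite lexx ltW.
  apply/(chart_frontier ch oOmega); first by have := pr 0 h0; rewrite scale0r addr0.
  by have := zp 0; rewrite scale0r addr0.
have cp : closure Omega p by have [] := (frontierE oOmega p).1 fp.
have tauh : 0 < tau <= tau by rewrite tau0 lexx.
have [s /andP[s0 sz]] := u_increment cp zx0 tauh pO.
rewrite {1}/p subrK u0 ?subr0; [|exact: cp|by apply: in_T; rewrite lexx ltW|by left].
move=> ->; have sz' : 0 <= s <= z x by rewrite !ltW.
set y := p + s *: e.
have Oy : Omega y by apply: pO; rewrite s0 ltW.
have qy := near_cap y (pnear s sz').
have yc := qc y qy.
have hvy := hv y (conj Oy qy); rewrite zp in hvy.
rewrite /primitive2 -(mulrA 2 N) .
apply: (foot_bound (s := s) (q := q y)) => //; [exact: ltW| |exact: ltW|exact: ltW|].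
  by rewrite /barrier1; nonneg.
have yx : `|y - x| <= z x.
  rewrite /y pse addrAC subrr add0r normrN normrZ ger0_norm ?subr_ge0 ?(ltW sz)//.
  apply: le_trans (_ : z x - s <= _); last by rewrite gerBl ltW.
  by rewrite ler_piMr ?subr_ge0 ?(ltW sz)// (norm_chart_e ch).
have -> : 2 * (N * rho) * z x = \sum_(i < n.+1) (rho + rho) * z x.
  by rewrite sumr_const card_ord -mulr_natr; ring.
rewrite /q /dot -big_split/=; apply: ler_sum => i _.
have -> : (y - c) 0 i * (y - c) 0 i =
  (x - c) 0 i * (x - c) 0 i + ((y - c) 0 i + (x - c) 0 i) * (y - x) 0 i.
  by rewrite !mxE; ring.
rewrite lerD2l; apply: le_trans (ler_norm _) _; rewrite normrM ler_pM//.
  apply: le_trans (ler_normD _ _) _.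
  by rewrite lerD// (le_trans (le_coord_norm _ _)).
by apply: le_trans (le_coord_norm _ _) _.
Qed.

Definition source_const : R :=
  L * (5 * T + 4) + 6 * N * L * (2 * T + 2) +
  4 * L ^+ 2 * (L + (2 * N * L + 2 * N) * (2 * T + 2)).

(** M / rho absorbs penal rho and c0. *)
Lemma lap_barrier c0 x : `|c0| <= (3 * T + 2) * M -> cap Omega c rho x ->
  exists a l, lap_at (fun x => z x * (c0 + penal * q x) + primitive2 * (z x * z x)) x a l /\
    l <= source_const * (L * rho * Y + M / rho).
Proof.
move=> c0M Cx; have [_ bzd bzdd bS _] := bd.
have [xc zx _ zr] := capE Cx; have [_ qx] := Cx.
have xr : `|x - c| <= r by exact: ltW (le_lt_trans xc rhor1).
have lz := chart_lap ch x.
have lq := lap_atD (lap_at_cst c0 x) (lap_atZ penal (lap_at_sqdist c x)).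
do 2!eexists; split; first exact: (lap_atD (lap_atM lz lq) (lap_atZ primitive2 (lap_atM lz lz))).
move: (bzdd x xr) (bS x xr) (bzd x xr).
set l := \sum_i zdd i x; set S := \sum_i zd i x * zd i x => lL SL zdL.
set V := \sum_i _.
have q0 : 0 <= dot (x - c) (x - c) by exact: dot_ge0.
have Kr : penal * rho = (2 * T + 2) * (M / rho).
  by rewrite /penal; field; rewrite gt_eqF.
have Mr : M <= M / rho by rewrite ler_pdivlMr// ler_piMr// ltW.
have Mr0 : 0 <= M / rho by rewrite divr_ge0// ltW.
have N0 : 0 <= N by [].
have T00 := ltW T0; have L00 := ltW L0; have r00 := ltW rho0; have K00 := ltW K0.
have e1 : l * (c0 + penal * dot (x - c) (x - c)) <= L * ((5 * T + 4) * M).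
  apply: mulr_le_bound => //; apply: le_trans (ler_normD _ _) _.
  have -> : (5 * T + 4) * M = (3 * T + 2) * M + (2 * T + 2) * M by ring.
  rewrite lerD// ger0_norm; last by rewrite mulr_ge0.
  by rewrite -Krho ler_wpM2l.
have e2 : V <= N * (2 * L * (penal * rho)).
  have -> : N * (2 * L * (penal * rho)) = \sum_(i < n.+1) (L * (penal * (2 * rho))).
    by rewrite sumr_const card_ord -mulr_natr; ring.
  apply: ler_sum => i _; apply: mulr_le_bound; first exact: zdL.
  rewrite add0r normrM (ger0_norm K00) ler_wpM2l// normrM ger0_norm// ler_wpM2l//.
  exact: le_trans (le_coord_norm _ _) xc.
have e3 : z x * (0 + penal * (2 * N)) <= L * rho * (penal * (2 * N)).
  by rewrite add0r ler_wpM2r// mulr_ge0// mulr_ge0.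
have e4 : l * z x <= L * (L * rho) by apply: mulr_le_bound; rewrite // ger0_norm.
have P0 : 0 <= primitive2.
  by rewrite /primitive2 /barrier1; nonneg.
have Lr : L * (L * rho) <= L * L by rewrite ler_wpM2l// ler_piMr.
have LL : L <= L * L by rewrite ler_peMr.
have e5 : primitive2 * (l * z x + 2 * S + z x * l) <= primitive2 * (4 * L ^+ 2).
  rewrite ler_wpM2l// [z x * l]mulrC expr2.
  exact: quad_bound e4 Lr LL SL.
have e6 : primitive2 <= L * rho * Y + M / rho * (L + (2 * N * L + 2 * N) * (2 * T + 2)).
  have -> : primitive2 = L * rho * Y + L * (rho * D) + (2 * N * L + 2 * N) * (penal * rho).
    by rewrite /primitive2 /barrier1 /barrier2; ring.
  rewrite Kr -addrA lerD2l mulrDr; apply: lerD; last by rewrite (mulrC (M / rho)) mulrA.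
  rewrite mulrC ler_wpM2r//; apply: le_trans (_ : M <= _) => //.
  by apply: le_trans DM; rewrite ler_piMl// ltW.
have e7 : primitive2 * (4 * L ^+ 2) <= 4 * L ^+ 2 *
    (L * rho * Y + M / rho * (L + (2 * N * L + 2 * N) * (2 * T + 2))).
  by rewrite mulrC ler_wpM2l// mulr_ge0// exprn_ge0.
have e8 : L * ((5 * T + 4) * M) <= L * (5 * T + 4) * (M / rho).
  by rewrite mulrA ler_wpM2l//; nonneg.
have G1 : 1 <= L + (2 * N * L + 2 * N) * (2 * T + 2) by rewrite ler_wpDr//; nonneg.
have e9 : 4 * L ^+ 2 * (L * rho * Y) <= source_const * (L * rho * Y).
  rewrite ler_wpM2r//; first by nonneg.
  rewrite /source_const ler_wpDl//; first by nonneg.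
  by rewrite ler_peMr//; nonneg.
have e10 : L * (5 * T + 4) * (M / rho) + 6 * N * L * ((2 * T + 2) * (M / rho)) +
  4 * L ^+ 2 * (M / rho * (L + (2 * N * L + 2 * N) * (2 * T + 2))) = source_const * (M / rho).
  by rewrite /source_const; ring.
rewrite [leRHS]mulrDr -e10.
apply: le_trans (_ : L * ((5 * T + 4) * M) + 2 * (N * (2 * L * (penal * rho))) +
  L * rho * (penal * (2 * N)) + primitive2 * (4 * L ^+ 2) <= _).
  by apply: lerD => //; apply: lerD => //; apply: lerD => //; rewrite ler_wpM2l.
have -> : L * ((5 * T + 4) * M) + 2 * (N * (2 * L * (penal * rho))) +
  L * rho * (penal * (2 * N)) = L * ((5 * T + 4) * M) + 6 * N * L * (penal * rho) by ring.
rewrite Kr; apply: le_trans (lerD (lerD e8 (lexx _)) e7) _.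
by rewrite [4 * L ^+ 2 * (_ + _)]mulrDr [leLHS]addrCA lerD2r.
Qed.

(** At xh the barrier touches u to first order.  If the source were too
    negative near xh, u minus the barrier would have a positive Laplacian
    there, and the boundary point lemma would make the contact strict. *)
Lemma source_bound Z :
  (forall xh, frontier Omega xh -> q xh < rho ^+ 2 -> forall eps : R, 0 < eps ->
    exists2 d : R, 0 < d & forall x, Omega x -> `|x - xh| < d ->
      Rs (x, tau) <= - Z + eps) ->
  Z <= source_const * (L * rho * Y + M / rho).
Proof.
move=> hZ; have [xh [c0 [fxh qxh vxh c0M hv]]] := trace_barrier.
rewrite leNgt; apply/negP; set lam := source_const * _ => lamZ.
(* Two of the four eps are spent on the source and on u_t; the Laplacian of the
   difference keeps the others. *)
pose eps := (Z - lam) / 4.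
have eps0 : 0 < eps by rewrite /eps divr_gt0// subr_gt0.
have [d1 d10 hR] := hZ xh fxh qxh eps eps0.
have [d2 d20 hu] := near_foot fxh qxh hv.
have [uc us [udt cdt]] := uC.
have cxh : closure Omega xh by have [] := (frontierE oOmega xh).1 fxh.
have tau01 : 0 <= tau <= tau by rewrite lexx ltW.
have [dtc dtE] := cont_extP cdt.
have [d3 d30 hdt] := within_continuous_le dtc (clQ cxh tau01) eps0.
have xhc : `|xh - c| <= rho by apply: dot_norm; exact: ltW.
pose d := Num.min (Num.min d1 d2) (Num.min d3 (r - `|xh - c|)).
have dpos : 0 < d by rewrite !lt_min d10 d20 d30 subr_gt0 (le_lt_trans xhc).
have dm : d <= r - `|xh - c| by rewrite !ge_min lexx !orbT.
have chx := chart_recenter ch dpos (_ : `|xh - c| + d <= r).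
have bdx := chart_bounded_recenter bd (_ : `|xh - c| + d <= r).
have xr : `|xh - c| + d <= r by rewrite addrC -lerBrDr.
have rd0 : 0 < d / 2 by rewrite divr_gt0.
have rdd : d / 2 < d by rewrite ltr_pdivrMr// ltr_pMr// ltr1n.
pose B x := z x * (c0 + penal * q x) + primitive2 * (z x * z x).
have capd x : cap Omega xh (d / 2) x -> `|x - xh| < d.
  by move=> [_ /= h]; apply: le_lt_trans rdd; apply: dot_norm => //; exact: ltW.
have d_lt x : `|x - xh| < d -> [/\ `|x - xh| < d1, `|x - xh| < d2, `|x - xh| < d3 &
    `|x - c| < r].
  rewrite !lt_min => /andP[/andP[-> ->] /andP[-> h]]; split => //.
  rewrite -[x - c](subrKA xh); apply: le_lt_trans (ler_normD _ _) _.
  by rewrite -ltrBrDr.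
have [|||mu [kp [mu0 kp0 hopf_le]]] := hopf oOmega bOmega (chx xr) (bdx xr) fxh rd0 rdd
  (w := fun x => u (x, tau) - B x) eps0.
- apply/within_continuousP => x Cx; apply: (cvgB (f := fun x => u (x, tau))).
    apply: (within_continuousP _ _).1 x Cx; apply: le_within_continuous => y [cy _] k k0.
    have [k1 k10 hk] := within_continuous_le uc (clQ cy tau01) k0.
    exists k1 => // y' [cy' _] yy; apply: hk; first exact: clQ.
    by rewrite pair_norm_lt yy subrr normr0.
  apply: cvg_within_filter.
  have [_ _ _ xr'] := d_lt x (capd x Cx).
  have xz := chart_z_continuous ch xr'.
  have hq : {for x, continuous q} by exact: dot_continuous.
  exact: (cvgD (cvgM xz (cvgD (cvg_cst c0) (cvgM (cvg_cst penal) hq)))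
    (cvgM (cvg_cst primitive2) (cvgM xz xz))).
- move=> x Cx; have [_ xd2 _ xr'] := d_lt x (capd x Cx).
  have [Ox|fx] := closure_split oOmega Cx.1; first by rewrite subr_le0; have [] := hu x Ox xd2.
  rewrite /B ((chart_frontier ch oOmega xr').1 fx) !mul0r mulr0 addr0 subr0.
  by rewrite u0//; [exact: Cx.1|exact: in_T|left].
- move=> x Gx; have Cx := capo_cap Gx; have Ox : Omega x := Gx.1.
  have [xd1 xd2 xd3 xr'] := d_lt x (capd x Cx).
  have [qx _] := hu x Ox xd2.
  have CO : cap Omega c rho x by split; [exact: subset_closure|exact: ltW].
  have [a2 [l2 [hl2 l2le]]] := lap_barrier c0M CO.
  have tauT' : 0 < tau < T by [].
  have [dt [a1 [l1 [udx hl1 E1]]]] := uh Ox tauT'.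
  exists (fun i => a1 i - a2 i), (l1 - l2); split; first exact: lap_atB.
  have Qx : Q (x, tau) by exact/cylinder_in.
  have dtv : dt = 'D_time_vec u (x, tau).
    have E2 t : (x, 0) + t *: time_vec = (x, t) :> E * R.
      by rewrite /time_vec; congr pair; rewrite /= ?scaler0 ?addr0// add0r /GRing.scale/= mulr1.
    have := @is_derive_line R _ u (x, 0) time_vec tau; rewrite E2 => /(_ (udt _ Qx)) hD.
    have [_ <-] := udx; have [_ <-] := hD; congr ('D_1 _ tau).
    by apply/funext => t; rewrite E2.
  have := hdt (x, tau) (subset_closure Qx).
  rewrite pair_norm_lt distrC xd3 subrr normr0 d30 => /(_ isT).
  rewrite (boundary_dt oOmega T0 uC u0 fxh tauT) sub0r normrN -dtE// -dtv.
  move=> /ltr_normlP[dt2 _]; have hRx := hR x Ox xd1.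
  exact: source_gap dt2 hRx E1 l2le (erefl eps) eps0.
(* On the vertical line through xh, u and the barrier have the same slope, whereas the
   boundary point lemma separates them by mu s. *)
have m40 : 0 < mu / 4 by rewrite divr_gt0.
have [k1 k10 hk1] := within_continuous_le vc (clQ cxh tau01) m40.
have hf : {for xh, continuous (fun x => c0 + penal * q x)}.
  have hq : {for xh, continuous q} by exact: dot_continuous.
  exact: (cvgD (cvg_cst c0) (cvgM (cvg_cst penal) hq)).
have /nbhs_normP[k2 /= k20 hk2] : \forall x \near xh, (c0 + penal * q x) - (c0 + penal * q xh) < mu / 4.
  have /cvgrPdist_lt/(_ _ m40) := hf; apply: filterS => x.
  by rewrite distrC => /ltr_normlP[_].
have P0 : 0 <= primitive2 by rewrite /primitive2 /barrier1; nonneg.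
have Pk : 0 < primitive2 + kp + 1 by rewrite ltr_wpDl// addr_ge0.
pose m := Num.min (Num.min k1 k2) (Num.min (d / 2) (mu / 4 / (primitive2 + kp + 1))).
have m0 : 0 < m by rewrite !lt_min k10 k20 rd0 divr_gt0.
pose s := m / 2.
have s0 : 0 < s by rewrite divr_gt0.
have sm : s < m by rewrite ltr_pdivrMr// ltr_pMr// ltr1n.
move: sm; rewrite !lt_min => /andP[/andP[sk1 sk2] /andP[sd]].
rewrite ltr_pdivlMr// => sP.
have nrm a : 0 < a <= s -> `|xh + a *: e - xh| <= a.
  move=> /andP[a0 _]; rewrite addrAC subrr add0r normrZ gtr0_norm//.
  by rewrite ler_piMr ?(ltW a0)// (norm_chart_e ch).
have xO a : 0 < a <= s -> Omega (xh + a *: e).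
  move=> ha; have /andP[a0 as_] := ha; have h := nrm a ha.
  have hd : `|xh + a *: e - xh| < d.
    by apply: le_lt_trans h _; apply: le_lt_trans as_ _; exact: lt_trans rdd.
  have [_ _ _ hr] := d_lt _ hd; apply/(chart_in ch hr).
  rewrite (chart_shift ch) ltr_wpDl//.
  by rewrite ((chart_frontier ch oOmega (le_lt_trans xhc rhor1)).1 fxh).
have ss : 0 < s <= s by rewrite s0 lexx.
have tauh : 0 < tau <= tau by rewrite tau0 lexx.
have [a /andP[a0 as_] Ea] := u_increment cxh s0 tauh xO.
have ha : 0 < a <= s by rewrite a0 ltW.
rewrite (u0 cxh) ?subr0 in Ea; [|exact: in_T|by left].
have Gs : capo Omega xh (d / 2) (xh + s *: e).
  split; first exact: xO.
  rewrite /= addrAC subrr add0r.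
  have -> : dot (s *: e) (s *: e) = s ^+ 2 * dot e e.
    by rewrite /dot mulr_sumr; apply: eq_bigr => i _; rewrite !mxE; ring.
  by rewrite (chart_e ch) mulr1 ltrXn2r ?nnegrE// ltW.
have sd' : 0 < s < d / 2 by rewrite s0.
have := hopf_le s sd' Gs.
rewrite /B Ea (chart_shift ch).
rewrite ((chart_frontier ch oOmega (le_lt_trans xhc rhor1)).1 fxh) add0r => hle.
have w1 : v (xh + a *: e, tau) <= c0 + penal * q (xh + s *: e) + primitive2 * s - mu + kp * s.
  rewrite -(ler_pM2r s0).
  have -> : (c0 + penal * q (xh + s *: e) + primitive2 * s - mu + kp * s) * s =
    (- mu * s + kp * s ^+ 2) + (s * (c0 + penal * q (xh + s *: e)) + primitive2 * (s * s)) by ring.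
  by rewrite -lerBlDr.
have w2 : v (xh, tau) - v (xh + a *: e, tau) < mu / 4.
  have h : `|v (xh, tau) - v (xh + a *: e, tau)| < mu / 4.
    apply: hk1; first by apply: clQ => //; apply: subset_closure; exact: xO.
    rewrite pair_norm_lt subrr normr0 k10 andbT distrC; apply: le_lt_trans (nrm a ha) _.
    exact: lt_trans sk1.
  exact: le_lt_trans (ler_norm _) h.
have w3 : c0 + penal * q (xh + s *: e) - (c0 + penal * q xh) < mu / 4.
  by apply: hk2; rewrite /= distrC; apply: le_lt_trans (nrm s ss) _.
have w4 : s * (primitive2 + kp) < mu / 4.
  by apply: le_lt_trans sP; rewrite ler_wpM2l ?(ltW s0)// lerDl.
exact: contact_contradiction w2 w3 vxh w4 w1 mu0.
Qed.

End LocalEstimate.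

(** * Stability for a normal derivative that is Lipschitz in time *)

(** With W the supremum of the weighted unknown and J of order D + rho^2 W, the right
    side is of order rho W + D / rho, and a small rho absorbs its first term. *)
Lemma absorb (R : realType) (S L C1 C2 C3 W A J rho delta D K : R) : 0 <= S -> 0 <= L -> 0 <= C1 ->
  0 <= C3 -> 0 <= W -> 0 <= J -> 0 < rho -> rho <= 1 -> 0 < delta -> J = A * D + C2 * rho ^+ 2 * W ->
  8 * (S * (L * C3 * (1 + C1) + (L * C3 + 1) * C2)) / delta * rho <= 1 ->
  K = 8 / delta * (S * (L * C3 + 1) * A / rho) ->
  delta / 2 * (W / 2) <= S * (L * rho * (C3 * (W + C1 * rho ^+ 2 * W + J)) + J / rho) ->
  W <= K * D.
Proof.
move=> S0 L0 C10 C30 W0 J0 r0 r1 d0 JE small KE.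
set K3 := S * _ in small.
have r2 : rho ^+ 2 <= 1 by rewrite exprn_ile1// ltW.
have JJ : rho * J <= J / rho.
  by rewrite ler_pdivlMr// mulrC mulrA -expr2 ler_piMl.
have b1 : S * (L * rho * (C3 * (W + C1 * rho ^+ 2 * W + J)) + J / rho) <=
   S * (L * C3 * (1 + C1) * (rho * W) + (L * C3 + 1) * (J / rho)).
  rewrite ler_wpM2l//.
  have -> : L * C3 * (1 + C1) * (rho * W) + (L * C3 + 1) * (J / rho) =
    L * C3 * (rho * W + C1 * (rho * W) + J / rho) + J / rho by ring.
  rewrite lerD2r.
  have -> : L * rho * (C3 * (W + C1 * rho ^+ 2 * W + J)) =
    L * C3 * (rho * W + C1 * (rho ^+ 2 * (rho * W)) + rho * J) by ring.
  by rewrite ler_wpM2l ?mulr_ge0// lerD// lerD2l ler_wpM2l// ler_piMl// mulr_ge0// ltW.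
have Jr' : J / rho = A * D / rho + C2 * (rho * W).
  by rewrite JE; field; rewrite gt_eqF.
have b2 : S * (L * C3 * (1 + C1) * (rho * W) + (L * C3 + 1) * (J / rho)) =
   K3 * rho * W + delta / 8 * (K * D).
  by rewrite Jr' KE /K3; field; rewrite !gt_eqF.
have b3 : K3 * rho * W <= delta / 8 * W.
  rewrite ler_wpM2r//; have -> : K3 * rho = delta / 8 * (8 * K3 / delta * rho).
    by field; rewrite gt_eqF.
  by rewrite ler_piMr// divr_ge0// ltW.
move=> h; have d80 : 0 < delta / 8 by rewrite divr_gt0.
rewrite -(ler_pM2l d80).
have h2 : delta / 2 * (W / 2) <= delta / 8 * W + delta / 8 * (K * D).
  by apply: le_trans h _; apply: le_trans b1 _; rewrite b2 lerD2r.
have e : delta / 2 * (W / 2) = delta / 8 * W + delta / 8 * W by field.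
by move: h2; rewrite e lerD2l.
Qed.

Lemma small_radius (R : realType) (d L C1 C2 rho1 K : R) : 0 < d -> 0 < C1 -> 0 < C2 ->
  0 < rho1 -> 0 <= K -> exists rho : R, [/\ 0 < rho, rho <= 1, 4 * rho <= d,
   3 * L ^+ 2 * rho <= 1 & [/\ C1 * rho <= 1, C2 * rho <= 1, rho <= rho1 & K * rho <= 1]].
Proof.
move=> d0 C10 C20 r10 K0; have L0 := sqr_ge0 L.
have i0 : 0 < d^-1 by rewrite invr_gt0.
have j0 : 0 < rho1^-1 by rewrite invr_gt0.
pose P := 1 + 4 * d^-1 + 3 * L ^+ 2 + C1 + C2 + rho1^-1 + K.
have P0 : 0 < P by rewrite /P; lra.
have le1 X : X <= P -> X * P^-1 <= 1 by move=> h; rewrite ler_pdivrMr// mul1r.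
exists P^-1; split; first by rewrite invr_gt0.
- by rewrite -[P^-1]mul1r le1// /P; lra.
- by rewrite mulrC ler_pdivrMl// mulrC -ler_pdivrMl// mulrC /P; lra.
- by rewrite le1// /P; lra.
- split; [by rewrite le1// /P; lra|by rewrite le1// /P; lra| |by rewrite le1// /P; lra].
  by rewrite -[P^-1]mul1r ler_pdivrMr// -ler_pdivrMl// mulr1 /P; lra.
Qed.

Lemma convex_between (R : realType) (T a t r : R) : 0 <= r <= 1 -> 0 < a < T -> 0 < t < T ->
  0 < a + r * (t - a) < T.
Proof.
move=> /andP[r0 r1] /andP[a0 aT] /andP[t0 tT].
have [at_|ta] := leP a t.
  have : 0 <= r * (t - a) <= t - a by rewrite mulr_ge0 ?subr_ge0// ler_piMl ?subr_ge0.
  lra.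
have h : 0 <= r * (a - t) <= a - t.
  by rewrite mulr_ge0 ?subr_ge0 ?(ltW ta)// ler_piMl ?subr_ge0 ?(ltW ta).
have -> : r * (t - a) = - (r * (a - t)) by ring.
lra.
Qed.

Lemma four_mul (R : realType) (L : R) : 1 <= L ->
  [/\ 1 <= 4 * (1 + L), 2 <= 4 * (1 + L), 2 + L <= 4 * (1 + L) & L <= 4 * (1 + L)].
Proof. by move=> L1; split; lra. Qed.

Section Stability.
Context {R : realType} {n : nat}.
Local Notation E := 'rV[R]_n.+1.
Local Notation N := (n.+1%:R : R).
Variables (Omega : set E) (T : R).
Hypothesis oOmega : open Omega.
Hypothesis bOmega : bounded_set Omega.
Hypothesis T0 : 0 < T.
Hypothesis C3 : class_C 3 Omega.
Local Notation Q := (cylinder Omega T).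

Definition normal_jump (u1 u2 : E * R -> R) (p : E * R) : R :=
  normal_derivative Omega T u2 p - normal_derivative Omega T u1 p.

Lemma normal_jumpN u1 u2 p : normal_jump u2 u1 p = - normal_jump u1 u2 p.
Proof. by rewrite /normal_jump opprB. Qed.

Definition normal_jump_lip (D : R) (u1 u2 : E * R -> R) : Prop :=
  forall x t t', frontier Omega x -> 0 < t < T -> 0 < t' < T ->
    `|normal_jump u1 u2 (x, t) - normal_jump u1 u2 (x, t')| <= D * `|t - t'|.

Definition diff (u1 u2 : E * R -> R) : E * R -> R := fun p => 1 * u2 p + (-1) * u1 p.

Lemma diffE u1 u2 p : diff u1 u2 p = u2 p - u1 p.
Proof. by rewrite /diff mul1r mulN1r. Qed.

Section TwoSolutions.
Variables (u1 u2 : E * R -> R) (D : R).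
Hypothesis u1C : cyl_C1 Omega T u1.
Hypothesis u2C : cyl_C1 Omega T u2.
Hypothesis u12 : same_data Omega T u1 u2.
Hypothesis D0 : 0 <= D.
Hypothesis lipD : normal_jump_lip D u1 u2.

Lemma diff_C1 : cyl_C1 Omega T (diff u1 u2).
Proof. exact: cyl_C1_lin. Qed.

Lemma diff0 x t : closure Omega x -> 0 <= t < T -> frontier Omega x \/ t = 0 ->
  diff u1 u2 (x, t) = 0.
Proof. by move=> cx tT xt; rewrite diffE u12// subrr. Qed.

Lemma frontier_closure x : frontier Omega x -> closure Omega x.
Proof. by move=> /(frontierE oOmega)[]. Qed.

(** The jump of the gradient is normal, so its component along any direction
    of norm at most 1 is controlled by the jump of the normal derivative. *)
Lemma trace_lip k x t t' : `|k| <= 1 -> frontier Omega x -> 0 <= t <= t' -> t' < T ->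
  `|cont_ext Q ('D_(k, 0) (diff u1 u2)) (x, t) -
    cont_ext Q ('D_(k, 0) (diff u1 u2)) (x, t')| <= N * D * (t' - t).
Proof.
move=> k1 fx; have cx := frontier_closure fx.
set v := cont_ext Q _.
have pos s s' : 0 < s -> s <= s' -> s' < T -> `|v (x, s) - v (x, s')| <= N * D * (s' - s).
  move=> s0 ss sT.
  have sT1 : 0 < s < T by rewrite s0 (le_lt_trans ss).
  have sT2 : 0 < s' < T by rewrite (lt_le_trans s0).
  have [L [d [_ d0 hL]]] := uniform_charts bOmega C3.
  have [e [z [zd [zdd [ch _]]]]] := hL x fx.
  have u0 r : 0 < r < T -> forall y, frontier Omega y -> diff u1 u2 (y, r) = 0.
    move=> /andP[r0 rT] y fy; apply: diff0; [exact: frontier_closure|by rewrite ltW|by left].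
  have eqd r : 0 < r < T -> forall y, frontier Omega y -> u2 (y, r) = u1 (y, r).
    by move=> hr y fy; have := u0 r hr y fy; rewrite diffE => /subr0_eq.
  have vE r : 0 < r < T -> v (x, r) = (\sum_i k 0 i * zd i x) * cont_ext Q ('D_(e, 0) (diff u1 u2)) (x, r).
    by move=> hr; exact: (boundary_gradient oOmega T0 ch fx k diff_C1 hr (u0 r hr)).
  have := lipD fx sT1 sT2.
  have E1 r : 0 < r < T ->
      normal_jump u1 u2 (x, r) =
      - (slope zd x * cont_ext Q ('D_(e, 0) (diff u1 u2)) (x, r)).
    by move=> hr; exact: (normal_derivative_diff oOmega T0 ch fx hr u1C u2C (eqd _ hr)).
  rewrite (E1 s sT1) (E1 s' sT2).
  rewrite -opprD normrN -mulrBr normrM vE// vE// -mulrBr normrM.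
  rewrite (distrC s) (ger0_norm (_ : 0 <= s' - s)) ?subr_ge0// => h.
  have S0 : 0 <= slope zd x by apply: le_trans (slope_ge1 ch x).
  have kz : `|\sum_i k 0 i * zd i x| <= N * slope zd x.
    apply: le_trans (sum_coordM_le (L := slope zd x) _ _) _.
      move=> i; rewrite -ler_sqr ?nnegrE// real_normK ?num_real// [leRHS]expr2 (sqr_slope ch).
      rewrite (bigD1 i)//= -expr2 lerDl sumr_ge0// => j _; by rewrite -expr2 sqr_ge0.
    by rewrite ler_piMr// mulr_ge0.
  apply: le_trans (ler_wpM2r (normr_ge0 _) kz) _.
  by rewrite -!mulrA ler_wpM2l//; move: h; rewrite (ger0_norm S0).
move=> /andP[t0 tt] t'T; have [t00|tn0] := eqVneq t 0; last first.
  by apply: pos; rewrite // lt_neqAle eq_sym tn0.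
have [t'0|t'n0] := eqVneq t' 0; first by rewrite t00 t'0 !subrr normr0 mulr0.
have t'0 : 0 < t' by rewrite lt_neqAle eq_sym t'n0 (le_trans t0).
rewrite t00 subr0; apply/ler_addgt0Pr => eps eps0.
have [_ us _] := diff_C1; have [_ /cont_extP[vc _]] := us (k, 0) erefl.
have hT : 0 <= (0 : R) < T by rewrite lexx.
have [d d0 hd] := within_continuous_le vc (Qcl T0 cx hT) eps0.
pose s := Num.min d t' / 2.
have m0 : 0 < Num.min d t' by rewrite lt_min d0.
have s0 : 0 < s by rewrite divr_gt0.
have sm : s < Num.min d t' by rewrite ltr_pdivrMr// ltr_pMr// ltr1n.
move: sm; rewrite lt_min => /andP[sd st].
have h1 := pos s t' s0 (ltW st) t'T.
have h2 : `|v (x, 0) - v (x, s)| < eps.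
  apply: hd; first by apply: Qcl => //; rewrite ltW//= (lt_trans st).
  by rewrite pair_norm_lt subrr normr0 d0/= sub0r normrN gtr0_norm.
rewrite -[_ - _](subrKA (v (x, s))) addrC; apply: le_trans (ler_normD _ _) _.
apply: lerD; last exact: ltW.
apply: le_trans h1 _; rewrite ler_wpM2l//; first exact: mulr_ge0.
by rewrite gerBl ltW.
Qed.

(** Since D_k u vanishes at t = 0 on the boundary. *)
Lemma trace_bound k x t : `|k| <= 1 -> frontier Omega x -> 0 <= t < T ->
  `|cont_ext Q ('D_(k, 0) (diff u1 u2)) (x, t)| <= N * D * T.
Proof.
move=> k1 fx /andP[t0 tT]; have := trace_lip k1 fx (_ : 0 <= 0 <= t) tT.
rewrite lexx t0 => /(_ isT); rewrite (initial_derivative oOmega T0 diff_C1 diff0).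
  rewrite sub0r normrN subr0 => /le_trans; apply; rewrite ler_wpM2l ?(ltW tT)//.
  exact: mulr_ge0.
exact: frontier_closure.
Qed.

(** Close to the boundary u is at most its normal derivative times the height
    above the foot of the vertical segment. *)
Lemma near_boundary (L d : R) : 0 < D -> 1 <= L -> 0 < d ->
  (forall x, frontier Omega x -> exists e z zd zdd,
    chart Omega x d e z zd zdd /\ chart_bounded L x d z zd zdd) ->
  exists2 h0 : R, 0 < h0 & forall y x t, frontier Omega y -> closure Omega x ->
    0 <= t < T -> `|x - y| <= h0 ->
    `|u2 (x, t) - u1 (x, t)| <= L * (N * T + 1) * D * `|x - y|.
Proof.
move=> Dpos L1 d0 hL; have [F1 F2 F3 F4] := four_mul L1; have L0 : 0 < L by exact: lt_le_trans L1.
pose P (h : R) y := forall x t, closure Omega x -> 0 <= t < T -> `|x - y| <= h ->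
    `|diff u1 u2 (x, t)| <= L * (N * T + 1) * D * `|x - y|.
have [|r r0 hr] := compact_uniform (P := P) (frontier_compact bOmega); last first.
  exists (r / 2); first by rewrite divr_gt0.
  move=> y x t fy cx tT xy; rewrite -diffE; apply: (hr (r / 2)) => //.
    by rewrite divr_gt0.
  by rewrite ltr_pdivrMr// ltr_pMr// ltr1n.
move=> y0 fy0; have [e [z [zd [zdd [ch bd]]]]] := hL y0 fy0.
have [_ us _] := diff_C1; have [_ /cont_extP[vc vE]] := us (e, 0) erefl.
set v := cont_ext Q _ in vc vE.
have cQ : compact (closure Q).
  by rewrite closure_cylinder//; apply: compact_setX; [exact: closure_Omega_compact|exact: segment_compact].
have [dl dl0 hdl] := compact_unif_continuous cQ vc Dpos.
pose r := Num.min dl d / (4 * (1 + L)).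
have m0 : 0 < Num.min dl d by rewrite lt_min dl0.
have L4 : 0 < 4 * (1 + L) by rewrite mulr_gt0 ?addr_gt0.
exists r; first by rewrite divr_gt0.
have rm : 4 * (1 + L) * r <= Num.min dl d by rewrite mulrC /r mulfVK ?gt_eqF.
move: rm; rewrite le_min => /andP[rdl rd].
have r0 : 0 < r by rewrite divr_gt0.
move=> y h fy yy h0 hr x t cx tT xy.
have yd : `|y - y0| < d.
  by rewrite distrC; apply: lt_le_trans yy _; apply: le_trans rd; rewrite ler_peMl// ltW.
have zy : z y = 0 by apply/(chart_frontier ch oOmega).
have xy0 : `|x - y0| < 2 * r.
  rewrite -(subrKA y) mulr_natl mulr2n; apply: le_lt_trans (ler_normD _ _) _.
  by apply: ltrD; [exact: le_lt_trans hr|rewrite distrC].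
have r2 : 2 * r <= d.
  by apply: le_trans rd; rewrite ler_wpM2r ?(ltW r0).
have xd : `|x - y0| < d by exact: lt_le_trans xy0 r2.
have [_ _ _ _ zL] := bd.
have zx : z x <= L * `|x - y|.
  by have := zL x y (ltW xd) (ltW yd); rewrite zy subr0; apply: le_trans; exact: ler_norm.
have zx0 := chart_closure ch xd cx.
have [zx00|zxn0] := eqVneq (z x) 0.
  have fx : frontier Omega x by apply/(chart_frontier ch oOmega).
  by rewrite diff0 ?normr0//; [nonneg|left].
have zxp : 0 < z x by rewrite lt_neqAle eq_sym zxn0.
have zxr : z x < L * r by apply: le_lt_trans zx _; rewrite ltr_pM2l// (le_lt_trans xy).
have Lr : 2 * r + L * r <= d.
  by apply: le_trans rd; rewrite -mulrDl ler_wpM2r ?(ltW r0).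
have Ldl : L * r <= dl.
  by apply: le_trans rdl; rewrite ler_wpM2r ?(ltW r0).
pose p := x - z x *: e.
have pse s : p + s *: e = x - (z x - s) *: e.
  by rewrite /p scalerBl opprB addrA addrAC.
have zp s : z (p + s *: e) = s by rewrite pse -scaleNr (chart_shift ch) opprB addrC subrK.
have pr s : 0 <= s <= z x -> `|p + s *: e - y0| < d.
  move=> /andP[s0 sz]; rewrite pse addrAC; apply: le_lt_trans (ler_normB _ _) _.
  apply: lt_le_trans Lr; rewrite ltr_leD// normrZ ger0_norm ?subr_ge0//.
  apply: le_trans (_ : z x - s <= _).
    by rewrite ler_piMr ?subr_ge0// (norm_chart_e ch).
  by apply: le_trans (ltW zxr); rewrite gerBl.
have pO s : 0 < s <= z x -> Omega (p + s *: e).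
  move=> /andP[s0 sz]; have sz' : 0 <= s <= z x by rewrite ltW.
  by apply/(chart_in ch (pr s sz')); rewrite zp.
have fp : frontier Omega p.
  have h00 : (0 : R) <= 0 <= z x by rewrite lexx.
  apply/(chart_frontier ch oOmega); first by have := pr 0 h00; rewrite scale0r addr0.
  by have := zp 0; rewrite scale0r addr0.
have cp := frontier_closure fp.
have [t00|tn0] := eqVneq t 0; first by rewrite diff0 ?normr0//; [nonneg|right].
have tT' : 0 < t < T by move: tT => /andP[t0 ->]; rewrite lt_neqAle eq_sym tn0 t0.
have pO' s : 0 < s < z x -> Omega (p + s *: e).
  by move=> /andP[s0 sz]; apply: pO; rewrite s0 ltW.
have zz : 0 < z x <= z x by rewrite zxp lexx.
have [s /andP[s0 sz]] := cyl_MVT T0 diff_C1 zxp tT' cp (subset_closure (pO _ zz)) pO'.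
rewrite {1}/p subrK (diff0 cp tT (or_introl fp)) subr0 => ->.
have ssz : 0 < s <= z x by rewrite s0 ltW.
have Oy := pO s ssz.
have Qy : Q (p + s *: e, t) by exact/cylinder_in.
rewrite (vE _ Qy) normrM (gtr0_norm zxp).
have vp := trace_bound (norm_chart_e ch) fp tT.
have vd : `|v (p + s *: e, t) - v (p, t)| <= D.
  apply: ltW; apply: hdl; [exact: subset_closure|exact: Qcl|].
  rewrite pair_norm_lt subrr normr0 dl0 andbT addrAC subrr add0r normrZ gtr0_norm//.
  apply: le_lt_trans (_ : s < dl); first by rewrite ler_piMr ?(ltW s0)// (norm_chart_e ch).
  by apply: lt_le_trans sz _; apply: le_trans (ltW zxr) _.
have vb : `|v (p + s *: e, t)| <= (N * T + 1) * D.
  rewrite -[v _](subrK (v (p, t))); apply: le_trans (ler_normD _ _) _.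
  by rewrite addrC mulrDl mul1r mulrAC lerD.
rewrite mulrC; apply: le_trans (_ : L * `|x - y| * ((N * T + 1) * D) <= _).
  by apply: ler_pM.
by rewrite le_eqVlt; apply/orP; left; apply/eqP; ring.
Qed.

End TwoSolutions.

Variables (F : E * R * R * R -> R).
Hypothesis F_reg : nonlinearity_regular Omega F.
Variables (M m : R).
Hypothesis M0 : 0 <= M.
Hypothesis m0 : 0 <= m.

Definition state (sigma : R -> R) (u : E * R -> R) : Prop :=
  [/\ cyl_C1 Omega T u, solves Omega T F sigma u & bounded_by Omega T M m sigma u].

Definition source sigma1 sigma2 (u1 u2 : E * R -> R) (p : E * R) : R :=
  F (p.1, p.2, sigma2 p.2, u2 p) - F (p.1, p.2, sigma1 p.2, u1 p).

Lemma heat_diff sigma1 sigma2 u1 u2 x t : solves Omega T F sigma1 u1 ->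
  solves Omega T F sigma2 u2 -> Omega x -> 0 < t < T ->
  heat_at (diff u1 u2) x t (source sigma1 sigma2 u1 u2 (x, t)).
Proof.
move=> [_ h1] [_ h2] Ox tT; rewrite /source /= -[X in _ - X]mul1r -mulNr -[X in X + _]mul1r.
exact: (heat_atD (heat_atZ 1 (h2 x t Ox tT)) (heat_atZ (-1) (h1 x t Ox tT))).
Qed.

Section Reference.
Variables (sigma0 : R -> R) (u0 : E * R -> R).
Hypothesis s0 : state sigma0 u0.

(** Interior bounds on the increments of an arbitrary solution come from those
    of u - u0, whose source is bounded and whose data vanish. *)
Lemma state_gradient (e : E) : `|e| <= 1 -> exists2 G : R, 0 <= G &
  forall sigma u, state sigma u -> same_data Omega T u0 u ->
  forall x t (h : R), 0 < h -> (forall r, 0 <= r <= h -> Omega (x + r *: e)) ->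
    0 < t < T -> `|u (x + h *: e, t) - u (x, t)| <= G * h.
Proof.
move=> e1; have [u0C u0s u0b] := s0.
have [_ us _] := u0C; have [_ /cont_extP[vc vE]] := us (e, 0) erefl.
have cQ : compact (closure Q).
  by rewrite closure_cylinder//; apply: compact_setX; [exact: closure_Omega_compact|exact: segment_compact].
have [G0 G00 hG0] := compact_bounded cQ vc.
have [CF CF0 hCF] := F_increment_bound T bOmega F_reg M m.
pose CR := CF * (2 * M + 2 * m).
have CR0 : 0 <= CR by rewrite /CR; nonneg.
have mm : 0 <= 2 * m by rewrite mulr_ge0.
have [A [h0 [A0 h00 hA]]] := boundary_lipschitz oOmega bOmega T0 C3 CR0 mm.
have [C C0 hC] := difference_gradient_bound oOmega bOmega T0 F_reg M0 m0 (ltW G00) e1.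
have u0e x t h : 0 < h -> (forall r, 0 <= r <= h -> Omega (x + r *: e)) ->
    0 < t < T -> `|u0 (x + h *: e, t) - u0 (x, t)| <= G0 * h.
  move=> hp hO tT; have hx a : 0 < a < h -> Omega (x + a *: e).
    by move=> /andP[a0 ah]; apply: hO; rewrite !ltW.
  have Ox : Omega x by have := hO 0; rewrite scale0r addr0 lexx (ltW hp) => /(_ isT).
  have Oxh : Omega (x + h *: e) by apply: hO; rewrite lexx (ltW hp).
  have [a ah ->] := cyl_MVT T0 u0C hp tT (subset_closure Ox) (subset_closure Oxh) hx.
  have Qa : Q (x + a *: e, t) by apply/cylinder_in; split => //; exact: hx.
  by rewrite normrM (gtr0_norm hp) ler_wpM2r ?(ltW hp)// vE//; apply: hG0; exact: subset_closure.
pose G1 := (2 * A + C * (2 * M) / C) * expR (C * T) + G0.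
have G10 : 0 <= G1 by rewrite /G1 addr_ge0// ?(ltW G00)// mulr_ge0 ?expR_ge0// addr_ge0 ?mulr_ge0 ?(ltW A0) ?(ltW C0)// ?invr_ge0// ltW.
exists (G1 + 2 * m / h0); first by rewrite addr_ge0// divr_ge0// ltW.
move=> sigma u [uC us' ub] u0u x t h hp hO tT.
have tT' : 0 <= t < T by case/andP: tT => /ltW -> ->.
have Ox : Omega x by have := hO 0; rewrite scale0r addr0 lexx (ltW hp) => /(_ isT).
have Oxh : Omega (x + h *: e) by apply: hO; rewrite lexx (ltW hp).
have [hh|hh] := leP h h0; last first.
  have b1 := ub.2 (x + h *: e) t (subset_closure Oxh) tT'.
  have b2 := ub.2 x t (subset_closure Ox) tT'.
  apply: le_trans (ler_normB _ _) _; apply: le_trans (lerD b1 b2) _.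
  rewrite mulrDl ler_wpDl//; first by rewrite mulr_ge0// ltW.
  rewrite -mulr2n -[_ *+ 2]mulr_natl mulrAC ler_pdivlMr// ler_wpM2l//; exact: ltW.
have sd : forall t, 0 < t < T -> `|sigma t - sigma0 t| <= 2 * M * expR (C * t).
  move=> r rT; apply: le_trans (_ : 2 * M * 1 <= _).
    rewrite mulr1; apply: le_trans (ler_normB _ _) _; rewrite mulr_natl mulr2n.
    by apply: lerD; [exact: ub.1|exact: u0b.1].
  apply: ler_wpM2l; first by rewrite mulr_ge0.
  by rewrite -expR0 ler_expR mulr_ge0 ?(ltW C0)//; case/andP: rT => /ltW.
have wA : forall y x t, frontier Omega y -> closure Omega x -> 0 <= t < T ->
    `|x - y| <= h0 -> `|u (x, t) - u0 (x, t)| <= A * `|x - y|.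
  have dC := diff_C1 u0C uC.
  have [dc _ _] := dC.
  have wb : forall x t, closure Omega x -> 0 <= t < T -> `|diff u0 u (x, t)| <= 2 * m.
    move=> x' t' cx' tT1; rewrite diffE; apply: le_trans (ler_normB _ _) _.
    by rewrite mulr_natl mulr2n lerD//; [exact: ub.2|exact: u0b.2].
  have wh : forall x t, Omega x -> 0 < t < T -> exists2 l, heat_at (diff u0 u) x t l & `|l| <= CR.
    move=> x' t' Ox' tT1; exists (source sigma0 sigma u0 u (x', t')); first exact: heat_diff.
    have tT2 : 0 <= t' < T by case/andP: tT1 => /ltW -> ->.
    have tT3 : 0 <= t' <= T by case/andP: tT1 => /ltW -> /ltW ->.
    apply: le_trans (hCF _ _ _ _ _ _ Ox' tT3 (u0b.1 _ tT1) (ub.1 _ tT1)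
      (u0b.2 _ _ (subset_closure Ox') tT2) (ub.2 _ _ (subset_closure Ox') tT2)) _.
    rewrite ler_wpM2l ?(ltW CF0)//; apply: lerD.
      apply: le_trans (ler_normB _ _) _; rewrite mulr_natl mulr2n.
      by apply: lerD; [exact: ub.1|exact: u0b.1].
    apply: le_trans (ler_normB _ _) _; rewrite mulr_natl mulr2n.
    by apply: lerD; [apply: ub.2|apply: u0b.2]; rewrite //; exact: subset_closure.
  move=> y x' t' fy cx' tT1 xy; rewrite -diffE.
  by apply: (hA _ dc wh wb) => //; exact: diff0.
have tw : 0 <= 2 * M by rewrite mulr_ge0.
have := hC _ _ _ _ _ _ _ _ u0s us' u0b ub u0u tw (lexx C) (ltW A0) sd u0e wA x t h hp hh hO tT'.
move=> k1; have k2 := u0e x t h hp hO tT.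
have -> : u (x + h *: e, t) - u (x, t) = (u (x + h *: e, t) - u0 (x + h *: e, t) -
   (u (x, t) - u0 (x, t))) + (u0 (x + h *: e, t) - u0 (x, t)) by ring.
apply: le_trans (ler_normD _ _) _.
rewrite mulrDl ler_wpDr//; first by rewrite mulr_ge0 ?divr_ge0// ltW.
rewrite /G1 mulrDl; apply: lerD => //; apply: le_trans k1 _.
rewrite [leRHS]mulrAC ler_wpM2l//.
  by rewrite mulr_ge0 ?(ltW hp)// addr_ge0 ?mulr_ge0 ?(ltW A0) ?(ltW C0)// invr_ge0 ltW.
by rewrite ler_expR ler_wpM2l ?(ltW C0)//; case/andP: tT => _ /ltW.
Qed.

Variables (x0 : E) (delta : R).
Hypothesis fx0 : frontier Omega x0.
Hypothesis delta0 : 0 < delta.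
Hypothesis nondeg : forall t s, 0 < t < T -> `|s| <= M ->
  delta <= `|d_sigma F (x0, t, s, u0 (x0, t))|.

Lemma d_sigma_uniform (eps : R) : 0 < eps -> exists2 eta : R, 0 < eta &
  forall x t s b x' t' s' b', closure Omega x -> 0 <= t <= T -> `|s| <= M -> `|b| <= m ->
   closure Omega x' -> 0 <= t' <= T -> `|s'| <= M -> `|b'| <= m ->
   `|x - x'| < eta -> `|t - t'| < eta -> `|s - s'| < eta -> `|b - b'| < eta ->
   `|d_sigma F (x, t, s, b) - d_sigma F (x', t', s', b')| < eps.
Proof.
move=> eps0; have [_ _ [dc _] _ _] := F_reg.
have dc' : {within F_range Omega T M m, continuous (d_sigma F)}.
  exact: continuous_subspaceW (@F_range_closure R n Omega T M m) dc.
have cK : compact (F_range Omega T M m) by exact: F_range_compact.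
have [eta eta0 h] := compact_unif_continuous cK dc' eps0.
exists eta => // x t s b x' t' s' b' cx tT sM bm cx' tT' sM' bm' xx tt ss bb.
apply: h; try exact: F_range_in.
by rewrite !pair_norm_lt xx tt ss.
Qed.

Lemma sigma_MVT x t s1 s2 b : Omega x -> `|s1| <= M -> `|s2| <= M ->
  exists2 s, `|s| <= M &
    F (x, t, s2, b) - F (x, t, s1, b) = d_sigma F (x, t, s, b) * (s2 - s1).
Proof.
move=> Ox; have dF s : is_derive (s : R) (1 : R) (fun s => F (x, t, s, b)) (d_sigma F (x, t, s, b)).
  have dd : derivable F (x, t, s, b) (0, 0, 1, 0) := F_derivable F_reg Ox.
  exact: is_derive_sigma dd.
have cF a c : {within `[a, c], continuous (fun s => F (x, t, s, b))}.
  by apply: continuous_subspaceT => s; exact: is_derive_continuous (dF s).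
have le_case a c : a <= c -> `|a| <= M -> `|c| <= M -> exists2 s, `|s| <= M &
    F (x, t, c, b) - F (x, t, a, b) = d_sigma F (x, t, s, b) * (c - a).
  move=> ac aM cM; have [s sac E1] := MVT_segment ac (fun s _ => dF s) (cF a c).
  exists s => //; move: sac; rewrite in_itv/= => /andP[as_ sc].
  move: aM cM; rewrite !ler_norml => /andP[a1 _] /andP[_ c2].
  by rewrite (le_trans a1)//= (le_trans sc).
move=> s1M s2M; have [h|/ltW h] := leP s1 s2; first exact: le_case.
have [s sM E1] := le_case _ _ h s2M s1M; exists s => //.
by rewrite -opprB E1 -mulrN opprB.
Qed.

(** A continuous function without zeros has a constant sign on a connected set. *)
Lemma nondegenerate_sign : exists sg : R, (sg = 1 \/ sg = -1) /\
  forall t s, 0 < t < T -> `|s| <= M -> delta <= sg * d_sigma F (x0, t, s, u0 (x0, t)).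
Proof.
have [u0C _ [_ u0m]] := s0; have [uc _ _] := u0C.
have cx0 : closure Omega x0 by have [] := (frontierE oOmega x0).1 fx0.
pose phi t s := d_sigma F (x0, t, s, u0 (x0, t)).
have th0 : 0 < T / 2 < T by rewrite divr_gt0//= ltr_pdivrMr// ltr_pMr// ltr1n.
have z0 : `|0 : R| <= M by rewrite normr0.
pose sg : R := if 0 < phi (T / 2) 0 then 1 else -1.
have sg1 : sg = 1 \/ sg = -1 by rewrite /sg; case: ifP => _; [left|right].
have sgn : `|sg| = 1 by case: sg1 => ->; rewrite ?normrN normr1.
have start : 0 <= sg * phi (T / 2) 0.
  rewrite /sg; case: ifP; first by move=> /ltW; rewrite mul1r.
  by move=> /negbT; rewrite -leNgt mulN1r oppr_ge0.
exists sg; split => // t s tT sM; rewrite leNgt; apply/negP => lt.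
have big r a : 0 < r < T -> `|a| <= M -> delta <= `|sg * phi r a|.
  by move=> rT aM; rewrite normrM sgn mul1r; exact: nondeg.
have neg : sg * phi t s <= 0.
  rewrite leNgt; apply/negP => h; have := big t s tT sM.
  by rewrite gtr0_norm// leNgt lt.
pose tr r := T / 2 + r * (t - T / 2).
have trT r : 0 <= r <= 1 -> 0 < tr r < T.
  by move=> r01; exact: convex_between.
have srM r : 0 <= r <= 1 -> `|r * s| <= M.
  by move=> /andP[r0 r1]; rewrite normrM ger0_norm//; apply: le_trans sM; rewrite ler_piMl.
pose psi r := sg * phi (tr r) (r * s).
have psic : {within `[0, 1], continuous psi}.
  apply: le_within_continuous => r; rewrite /= in_itv/= => r01 eps eps0.
  have [eta eta0 heta] := d_sigma_uniform eps0.
  have trT' : 0 <= tr r < T by case/andP: (trT r r01) => /ltW -> ->.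
  have [d d0 hd] := within_continuous_le uc (Qcl T0 cx0 trT') eta0.
  pose K := `|t - T / 2| + `|s| + 1.
  have K0 : 0 < K by rewrite ltr_wpDl// addr_ge0.
  exists (Num.min eta d / K); first by rewrite divr_gt0// lt_min eta0.
  move=> r'; rewrite /= in_itv/= => r'01; rewrite ltr_pdivlMr// lt_min => /andP[re rd].
  have trT'' : 0 <= tr r' < T by case/andP: (trT r' r'01) => /ltW -> ->.
  have e1 : `|tr r - tr r'| <= `|r - r'| * K.
    have -> : tr r - tr r' = (r - r') * (t - T / 2) by rewrite /tr; ring.
    by rewrite normrM ler_wpM2l// /K -addrA lerDl addr_ge0.
  have e2 : `|r * s - r' * s| <= `|r - r'| * K.
    rewrite -mulrBl normrM ler_wpM2l// /K addrAC lerDr addr_ge0//.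
  rewrite /psi -mulrBr normrM sgn mul1r; apply: heta; rewrite ?subrr ?normr0//.
  - by case/andP: trT' => -> /ltW.
  - exact: srM.
  - exact: u0m.
  - by case/andP: trT'' => -> /ltW.
  - exact: srM.
  - exact: u0m.
  - exact: le_lt_trans re.
  - exact: le_lt_trans re.
  - apply: hd; first exact: Qcl.
    by rewrite pair_norm_lt subrr normr0 d0/=; exact: le_lt_trans rd.
have p0 : 0 <= psi 0 by rewrite /psi /tr !mul0r addr0.
have p1 : psi 1 <= 0 by rewrite /psi /tr !mul1r addrC subrK.
have [|r] := IVT (v := 0) ler01 psic.
  by rewrite ge_min p1 orbT le_max p0.
rewrite in_itv/= => r01; rewrite /psi => E0.
have := big (tr r) (r * s) (trT r r01) (srM r r01).
by rewrite E0 normr0 leNgt delta0.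
Qed.

(** Uniform continuity of the sigma-derivative spreads the condition from x0 to its
    neighbours on the boundary. *)
Lemma nondegenerate_near : exists sg rho1 : R, [/\ sg = 1 \/ sg = -1, 0 < rho1 &
  forall x t s, frontier Omega x -> `|x - x0| <= rho1 -> 0 < t < T -> `|s| <= M ->
    delta / 2 <= sg * d_sigma F (x, t, s, u0 (x, t))].
Proof.
have [sg [sg1 hsg]] := nondegenerate_sign.
have [u0C _ [_ u0m]] := s0; have [uc _ _] := u0C.
have cx0 : closure Omega x0 by have [] := (frontierE oOmega x0).1 fx0.
have sgn : `|sg| = 1 by case: sg1 => ->; rewrite ?normrN normr1.
have d20 : 0 < delta / 2 by rewrite divr_gt0.
have [eta eta0 heta] := d_sigma_uniform d20.
have cQ : compact (closure Q).
  by rewrite closure_cylinder//; apply: compact_setX; [exact: closure_Omega_compact|exact: segment_compact].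
have [d dpos hd] := compact_unif_continuous cQ uc eta0.
have m00 : 0 < Num.min eta d by rewrite lt_min eta0.
exists sg, (Num.min eta d / 2); split => //; first by rewrite divr_gt0.
move=> x t s fx xx tT sM.
have : `|x - x0| < Num.min eta d by apply: le_lt_trans xx _; rewrite ltr_pdivrMr// ltr_pMr// ltr1n.
rewrite lt_min => /andP[xe xd].
have cx : closure Omega x by have [] := (frontierE oOmega x).1 fx.
have tT1 : 0 <= t < T by case/andP: tT => /ltW -> ->.
have tT2 : 0 <= t <= T by case/andP: tT => /ltW -> /ltW ->.
have h : `|d_sigma F (x0, t, s, u0 (x0, t)) - d_sigma F (x, t, s, u0 (x, t))| < delta / 2.
  apply: heta; rewrite ?subrr ?normr0 1?distrC//; [exact: u0m|exact: u0m|].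
  by apply: hd; [exact: Qcl|exact: Qcl|rewrite pair_norm_lt subrr normr0 dpos xd].
have h1 := hsg t s tT sM.
have : sg * (d_sigma F (x0, t, s, u0 (x0, t)) - d_sigma F (x, t, s, u0 (x, t))) < delta / 2.
  by apply: le_lt_trans (ler_norm _) _; rewrite normrM sgn mul1r.
rewrite mulrBr ltrBlDr => h2; have := le_lt_trans h1 h2.
by rewrite {1}(splitr delta) ltrD2l => /ltW.
Qed.

(** The source of u has the sign of the sigma-derivative near the boundary,
    up to the vanishing contribution of u itself. *)
Lemma source_near sg sigma1 sigma2 u1 u2 tau xh : sg = 1 \/ sg = -1 ->
  state sigma1 u1 -> state sigma2 u2 -> same_data Omega T u0 u1 -> same_data Omega T u0 u2 ->
  0 < tau < T -> frontier Omega xh ->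
  (forall s, `|s| <= M -> delta / 2 <= sg * d_sigma F (xh, tau, s, u0 (xh, tau))) ->
  sg * (sigma2 tau - sigma1 tau) <= 0 ->
  forall eps : R, 0 < eps -> exists2 d : R, 0 < d & forall x, Omega x -> `|x - xh| < d ->
    source sigma1 sigma2 u1 u2 (x, tau) <= - (delta / 2 * `|sigma2 tau - sigma1 tau|) + eps.
Proof.
move=> sg1 [u1C u1s u1b] [u2C u2s u2b] s01 s02 tauT fxh hsg neg eps eps0.
have sgn : `|sg| = 1 by case: sg1 => ->; rewrite ?normrN normr1.
have sgsg : sg * sg = 1 by case: sg1 => ->; rewrite ?mulrNN mulr1.
have cxh : closure Omega xh by have [] := (frontierE oOmega xh).1 fxh.
have tT1 : 0 <= tau < T by case/andP: tauT => /ltW -> ->.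
have tT2 : 0 <= tau <= T by case/andP: tauT => /ltW -> /ltW ->.
have s12 : same_data Omega T u1 u2 by move=> x t cx tT xt; rewrite -s01// s02.
have [CF CF0 hCF] := F_increment_bound T bOmega F_reg M m.
have M20 : 0 < 2 * M + 1 by rewrite ltr_wpDl// mulr_ge0.
pose e1 := eps / 2 / (2 * M + 1).
have e20 : 0 < eps / 2 by rewrite divr_gt0.
have e10 : 0 < e1 by rewrite divr_gt0.
have eC0 : 0 < eps / 2 / CF by rewrite divr_gt0.
have [eta eta0 heta] := d_sigma_uniform e10.
have [uc1 _ _] := u1C; have [dc _ _] := diff_C1 u1C u2C.
have [d1 d10 hd1] := within_continuous_le uc1 (Qcl T0 cxh tT1) eta0.
have [d2 d20 hd2] := within_continuous_le dc (Qcl T0 cxh tT1) eC0.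
have mpos : 0 < Num.min eta (Num.min d1 d2) by rewrite !lt_min eta0 d10.
exists (Num.min eta (Num.min d1 d2)) => // x Ox; rewrite !lt_min => /and3P[xe x1 x2].
have cx := subset_closure Ox.
have s1M := u1b.1 tau tauT; have s2M := u2b.1 tau tauT.
have u1m := u1b.2 x tau cx tT1; have u2m := u2b.2 x tau cx tT1.
have p1 : F (x, tau, sigma2 tau, u2 (x, tau)) - F (x, tau, sigma2 tau, u1 (x, tau)) <= eps / 2.
  apply: le_trans (ler_norm _) _.
  apply: le_trans (hCF x tau _ _ _ _ Ox tT2 s2M s2M u1m u2m) _.
  rewrite subrr normr0 add0r -diffE mulrC -ler_pdivlMr//; apply: ltW.
  have := hd2 (x, tau) (Qcl T0 cx tT1); rewrite (diff0 s12 cxh tT1 (or_introl fxh)).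
  rewrite sub0r normrN; apply.
  by rewrite pair_norm_lt subrr normr0 d20 andbT distrC.
have [s sM E1] := sigma_MVT tau (u1 (x, tau)) Ox s1M s2M.
have p2 : sg * (d_sigma F (xh, tau, s, u0 (xh, tau)) - d_sigma F (x, tau, s, u1 (x, tau))) <= e1.
  apply: le_trans (ler_norm _) _; rewrite normrM sgn mul1r; apply: ltW.
  rewrite (s01 xh tau cxh tT1 (or_introl fxh)).
  apply: heta => //; rewrite ?subrr ?normr0 1?distrC//; first exact: u1b.2.
  rewrite distrC; apply: hd1; first exact: Qcl.
  by rewrite pair_norm_lt subrr normr0 d10 andbT distrC.
have p3 := hsg s sM.
have p4 : delta / 2 - e1 <= sg * d_sigma F (x, tau, s, u1 (x, tau)).
  by move: p2; rewrite mulrBr lerBlDr => /(le_trans p3); rewrite lerBlDr addrC.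
have sabs : `|sigma2 tau - sigma1 tau| = - (sg * (sigma2 tau - sigma1 tau)).
  by rewrite -(ler0_norm neg) normrM sgn mul1r.
have p5 : d_sigma F (x, tau, s, u1 (x, tau)) * (sigma2 tau - sigma1 tau) <=
    - (delta / 2 * `|sigma2 tau - sigma1 tau|) + eps / 2.
  have -> : d_sigma F (x, tau, s, u1 (x, tau)) * (sigma2 tau - sigma1 tau) =
     - (sg * d_sigma F (x, tau, s, u1 (x, tau)) * `|sigma2 tau - sigma1 tau|).
    by rewrite sabs mulrN opprK mulrACA sgsg mul1r.
  apply: le_trans (_ : - ((delta / 2 - e1) * `|sigma2 tau - sigma1 tau|) <= _).
    by rewrite lerN2 ler_wpM2r.
  rewrite mulrBl opprB addrC lerD2l.
  apply: le_trans (_ : e1 * (2 * M + 1) <= _); last by rewrite /e1 mulfVK ?gt_eqF.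
  rewrite ler_wpM2l ?(ltW e10)//; apply: le_trans (ler_normB _ _) _.
  by rewrite mulr_natl mulr2n ler_wpDr// lerD.
rewrite /source /=; rewrite -(subrKA (F (x, tau, sigma2 tau, u1 (x, tau)))) E1 addrC.
by apply: le_trans (lerD p5 p1) _; rewrite -addrA -splitr.
Qed.

Section Constants.
Variables (e : E) (L d : R) (z : E -> R) (zd zdd : 'I_n.+1 -> E -> R).
Hypothesis d0 : 0 < d.
Hypothesis hL : forall x, frontier Omega x -> exists e z zd zdd,
    chart Omega x d e z zd zdd /\ chart_bounded L x d z zd zdd.
Hypothesis ch : chart Omega x0 d e z zd zdd.
Hypothesis bd : chart_bounded L x0 d z zd zdd.

(** With weight exp(t / rho^2) the increments of u along e are of size rho^2 W
    and those of the source of size W, where W bounds sigma2 - sigma1 at tau;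
    the local estimate then leaves a small multiple rho W. *)
Lemma ordered_estimate : exists C1 C2 C3 : R, [/\ 0 < C1, 0 < C2, 0 < C3 &
  forall sg sigma1 sigma2 u1 u2 (D tau W rho : R), sg = 1 \/ sg = -1 ->
  state sigma1 u1 -> state sigma2 u2 -> same_data Omega T u0 u1 -> same_data Omega T u0 u2 ->
  0 < D -> normal_jump_lip D u1 u2 -> 0 < tau < T -> 0 < rho -> rho <= 1 -> 4 * rho <= d ->
  3 * L ^+ 2 * rho <= 1 -> C1 * rho <= 1 -> C2 * rho <= 1 -> 0 <= W ->
  (forall x s, frontier Omega x -> `|x - x0| <= rho -> `|s| <= M ->
    delta / 2 <= sg * d_sigma F (x, tau, s, u0 (x, tau))) ->
  sg * (sigma2 tau - sigma1 tau) <= 0 ->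
  (forall t, 0 < t < T -> `|sigma2 t - sigma1 t| <= W * expR (rho ^- 2 * (t - tau))) ->
  forall J, J = 2 * (L * (N * T + 1) * D) * expR (rho ^- 2 * T) + C2 * rho ^+ 2 * W + N * D ->
  delta / 2 * `|sigma2 tau - sigma1 tau| <=
    @source_const R n T L * (L * rho * (C3 * (W + C1 * rho ^+ 2 * W + J)) + J / rho)].
Proof.
have e1 := norm_chart_e ch; have [L1 _ _ _ _] := bd; have L0 : 0 < L by exact: lt_le_trans L1.
have [G G0 hG] := state_gradient e1.
have [C1 C10 hC1] := difference_sup_bound oOmega bOmega T0 F_reg M m.
have [C2 C20 hC2] := difference_gradient_bound oOmega bOmega T0 F_reg M0 m0 G0 e1.
have [C3' C30 hC3] := F_increment_lipschitz T bOmega F_reg e M0 m0 G0.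
exists C1, C2, C3'; split => //.
move=> sg sigma1 sigma2 u1 u2 D tau W rho sg1 st1 st2 s01 s02 D0 jump tauT rho0 rho1 rhod rhoL
  rC1 rC2 W0 near neg sW J JE.
have [u1C u1s u1b] := st1; have [u2C u2s u2b] := st2.
have s12 : same_data Omega T u1 u2 by move=> x t cx tT xt; rewrite -s01// s02.
have /andP[tau0 tauT'] := tauT.
set lam := rho ^- 2 in sW JE *.
have r20 : 0 < rho ^+ 2 by rewrite exprn_gt0.
have lam0 : 0 < lam by rewrite invr_gt0.
have r2r : rho ^+ 2 <= rho by rewrite expr2 ler_piMl// ltW.
have lamC C : 0 < C -> C * rho <= 1 -> C <= lam.
  move=> C00 h; rewrite -[C]mulr1 -[lam]mul1r /lam ler_pdivlMr// mulr1.
  by apply: le_trans h; rewrite ler_wpM2l// ltW.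
pose W0' := W * expR (- (lam * tau)).
have W0'0 : 0 <= W0' by rewrite mulr_ge0 ?expR_ge0.
have sW' t : 0 < t < T -> `|sigma2 t - sigma1 t| <= W0' * expR (lam * t).
  by move=> tT; rewrite /W0' -mulrA -expRD [X in expR X]addrC -mulrBr; exact: sW.
have W0E : W0' * expR (lam * tau) = W by rewrite /W0' -mulrA -expRD addNr expR0 mulr1.
have leW t : t <= tau -> W0' * expR (lam * t) <= W.
  by move=> tt; rewrite -W0E ler_wpM2l// ler_expR ler_wpM2l// ltW.
have sq C t : 0 < C -> t <= tau -> C * W0' / lam * expR (lam * t) <= C * rho ^+ 2 * W.
  move=> C00 tt; have -> : C * W0' / lam * expR (lam * t) = C * rho ^+ 2 * (W0' * expR (lam * t)).
    have -> : lam^-1 = rho ^+ 2 by rewrite /lam invrK.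
    by ring.
  by apply: ler_wpM2l; [rewrite mulr_ge0// ltW|exact: leW].
have in_T t : 0 <= t <= tau -> 0 <= t < T by move=> /andP[-> h]; exact: le_lt_trans tauT'.
have ub x t : closure Omega x -> 0 <= t <= tau -> `|u2 (x, t) - u1 (x, t)| <= C1 * rho ^+ 2 * W.
  move=> cx tt; apply: le_trans (hC1 _ _ _ _ _ _ u1s u2s u1b u2b s12 W0'0 (lamC _ C10 rC1) sW' x t cx (in_T t tt)) _.
  by apply: sq => //; case/andP: tt.
have [h0 h00 hnear] := near_boundary u1C u2C s12 (ltW D0) jump D0 L1 d0 hL.
pose B := L * (N * T + 1) * D.
have B0 : 0 <= B by rewrite /B !mulr_ge0 ?(ltW L0) ?(ltW D0)// addr_ge0// mulr_ge0// ltW.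
have ND0 : 0 < N * D by rewrite mulr_gt0.
have J1 : 2 * B * expR (lam * T) + C2 * rho ^+ 2 * W <= J by rewrite JE lerDl ltW.
have J0 : 0 < J.
  rewrite JE ltr_wpDl// addr_ge0//; first by rewrite mulr_ge0 ?expR_ge0// mulr_ge0.
  by rewrite mulr_ge0// mulr_ge0// ltW.
have ulip x t h : 0 < h -> h <= h0 -> (forall r, 0 <= r <= h -> Omega (x + r *: e)) ->
   0 <= t <= tau ->
   `|(u2 (x + h *: e, t) - u1 (x + h *: e, t)) - (u2 (x, t) - u1 (x, t))| <= J * h.
  move=> hp hh hO tt.
  apply: le_trans (hC2 _ _ _ _ _ _ _ _ u1s u2s u1b u2b s12 W0'0 (lamC _ C20 rC2) B0 sW'
    (hG _ _ st1 s01) hnear x t h hp hh hO (in_T t tt)) _.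
  rewrite mulrAC ler_wpM2r ?(ltW hp)//; apply: le_trans J1; rewrite mulrDl.
  apply: lerD.
    apply: ler_wpM2l; first exact: mulr_ge0.
    rewrite ler_expR; apply: ler_wpM2l; first exact: ltW.
    by apply: ltW; case/andP: (in_T t tt).
  by apply: sq => //; case/andP: tt.
pose Y := C3' * (W + C1 * rho ^+ 2 * W + J).
have Y0 : 0 <= Y.
  by rewrite mulr_ge0 ?(ltW C30)// addr_ge0 ?(ltW J0)// addr_ge0// mulr_ge0// mulr_ge0 // ltW.
have rhod2 : 2 * rho < d.
  by apply: lt_le_trans rhod; rewrite ltr_pM2r// ltr_nat.
apply: (source_bound oOmega bOmega T0 ch bd fx0 (u := diff u1 u2)
  (Rs := source sigma1 sigma2 u1 u2) (tau := tau) (D := N * D) (M := J) (Y := Y) (rho := rho)) => //.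
- exact: diff_C1.
- by move=> x t Ox tT; exact: heat_diff.
- exact: diff0.
- by rewrite JE lerDr addr_ge0//; [rewrite mulr_ge0 ?expR_ge0// mulr_ge0|rewrite mulr_ge0// mulr_ge0// ltW].
- move=> x t fx /andP[t0 tt].
  by apply: (trace_lip u1C u2C s12 (ltW D0) jump e1 fx) => //; rewrite t0.
- exists h0 => // x t h hp hh hO tt; rewrite !diffE; exact: ulip.
- exists h0 => // x t h hp hh hO /andP[t0 tt].
  have tt' : 0 <= t <= tau by rewrite ltW.
  have tT : 0 < t < T by rewrite t0 (le_lt_trans tt).
  have tT1 : 0 <= t < T by exact: in_T.
  have tT2 : 0 <= t <= T by case/andP: tT => /ltW -> /ltW ->.
  have Ox : Omega x by have := hO 0; rewrite scale0r addr0 lexx (ltW hp) => /(_ isT).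
  have Oxh : Omega (x + h *: e) by apply: hO; rewrite lexx (ltW hp).
  have cx := subset_closure Ox; have cxh := subset_closure Oxh.
  rewrite /source /=.
  apply: le_trans (hC3 x h t _ _ _ _ _ _ hp hO tT2 (u1b.1 t tT) (u2b.1 t tT)
    (u1b.2 x t cx tT1) (u2b.2 x t cx tT1) (u1b.2 _ t cxh tT1) (u2b.2 _ t cxh tT1)
    (hG _ _ st1 s01 x t h hp hO tT)) _.
  rewrite /Y -mulrA ler_wpM2l ?(ltW C30)// !mulrDl; apply: lerD; last exact: ulip.
  apply: lerD; rewrite ler_wpM2r ?(ltW hp)//; last exact: ub.
  by apply: le_trans (sW' t tT) (leW t tt).
- move=> xh fxh qxh; apply: (source_near sg1 st1 st2 s01 s02 tauT fxh) => // s sM.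
  apply: near => //; apply: dot_norm; [exact: ltW|exact: ltW].
Qed.

End Constants.

(** The weighted maximum of |sigma2 - sigma1| is nearly attained at some tau;
    the sign of sigma2 - sigma1 there tells which order of the two solutions
    makes the source nonpositive near x0. *)
Lemma stability : exists2 C : R, 0 < C & forall sigma1 sigma2 u1 u2 (D : R),
  state sigma1 u1 -> state sigma2 u2 -> same_data Omega T u0 u1 -> same_data Omega T u0 u2 ->
  0 < D -> normal_jump_lip D u1 u2 ->
  forall t, 0 < t < T -> `|sigma2 t - sigma1 t| <= C * D.
Proof.
have [L [d [L1 d0 hL]]] := uniform_charts bOmega C3.
have [e [z [zd [zdd [ch bd]]]]] := hL x0 fx0.
have L0 : 0 < L by exact: lt_le_trans L1.
have [C1 [C2 [C3' [C10 C20 C30 hC]]]] := ordered_estimate d0 hL ch bd.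
have [sg [rho1 [sg1 rho10 near]]] := nondegenerate_near.
pose S := @source_const R n T L.
have T00 := ltW T0; have L00 := ltW L0; have C100 := ltW C10; have C200 := ltW C20.
have C300 := ltW C30; have d00 := ltW delta0.
have S0 : 0 <= S by rewrite /S /source_const; nonneg.
pose K3 := 8 * (S * (L * C3' * (1 + C1) + (L * C3' + 1) * C2)) / delta.
have K30 : 0 <= K3 by rewrite /K3; nonneg.
have [rho [rho0 rhole rhod rhoL [rC1 rC2 rr1 rK]]] := small_radius L d0 C10 C20 rho10 K30.
pose lam := rho ^- 2.
have lam0 : 0 < lam by rewrite invr_gt0 exprn_gt0.
pose A := 2 * (L * (N * T + 1)) * expR (lam * T) + N.
pose K := 8 / delta * (S * (L * C3' + 1) * A / rho).
have A0 : 0 <= A by rewrite /A addr_ge0// !mulr_ge0 ?expR_ge0 ?(ltW L0)// addr_ge0// mulr_ge0// ltW.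
have K0 : 0 <= K.
  by rewrite /K !mulr_ge0 ?invr_ge0 ?(ltW rho0) ?(ltW delta0)// addr_ge0// mulr_ge0// ltW.
have CE0 : 0 <= K * expR (lam * T) by rewrite mulr_ge0 ?expR_ge0.
exists (K * expR (lam * T) + 1); first by rewrite ltr_wpDl.
move=> sigma1 sigma2 u1 u2 D st1 st2 s01 s02 D0 jump t tT.
have [_ _ [s1M _]] := st1; have [_ _ [s2M _]] := st2.
pose wt s := expR (- (lam * s)) * `|sigma2 s - sigma1 s|.
pose X := [set wt s | s in [set s : R | 0 < s < T]].
have wtX s : 0 < s < T -> X (wt s) by move=> sT; exists s.
have Xub : has_ubound X.
  exists (2 * M) => _ [s sT <-]; rewrite /wt -[leRHS]mul1r ler_pM ?expR_ge0//.
    rewrite -expR0 ler_expR oppr_le0 mulr_ge0 ?(ltW lam0)//.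
    by case/andP: sT => /ltW.
  by apply: le_trans (ler_normB _ _) _; rewrite mulr_natl mulr2n lerD ?s1M ?s2M.
have wt0 s : 0 <= wt s by rewrite mulr_ge0 ?expR_ge0.
have wsup s : 0 < s < T -> wt s <= sup X by move=> sT; apply: ub_le_sup => //; exact: wtX.
have sup0 : 0 <= sup X := le_trans (wt0 t) (wsup t tT).
have unwt s : `|sigma2 s - sigma1 s| = wt s * expR (lam * s).
  by rewrite /wt mulrAC -expRD addNr expR0 mul1r.
rewrite mulrDl mul1r; apply: le_trans (_ : K * expR (lam * T) * D <= _); last by rewrite lerDl ltW.
have eT s : 0 < s < T -> expR (lam * s) <= expR (lam * T).
  by move=> /andP[_ /ltW sT]; rewrite ler_expR ler_wpM2l// ltW.
have [sup00|supn0] := eqVneq (sup X) 0.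
  have -> : `|sigma2 t - sigma1 t| = 0.
    by rewrite unwt; have := wsup t tT; rewrite sup00 => h; rewrite (le_anti (_ : wt t <= 0 <= wt t)) ?mul0r// h wt0.
  by rewrite mulr_ge0// ltW.
have supp : 0 < sup X by rewrite lt_neqAle eq_sym supn0.
have hX : has_sup X by split => //; exists (wt t); exact: wtX.
have s20 : 0 < sup X / 2 by rewrite divr_gt0.
(* The supremum over the open interval need not be attained; half of it is. *)
have [_ [tau tauT <-] htau] := sup_adherent s20 hX.
have {}htau : sup X / 2 <= wt tau.
  by apply: ltW; move: htau; rewrite {1}(splitr (sup X)) addrK.
pose W := sup X * expR (lam * tau).
have W0 : 0 <= W by rewrite mulr_ge0 ?expR_ge0.
have half : W / 2 <= `|sigma2 tau - sigma1 tau|.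
  by rewrite unwt /W mulrAC ler_wpM2r ?expR_ge0.
have sW s : 0 < s < T -> `|sigma2 s - sigma1 s| <= W * expR (lam * (s - tau)).
  move=> sT; rewrite unwt /W -mulrA -expRD mulrBr addrC subrK.
  by rewrite ler_wpM2r ?expR_ge0// wsup.
have near' x s : frontier Omega x -> `|x - x0| <= rho -> `|s| <= M ->
    delta / 2 <= sg * d_sigma F (x, tau, s, u0 (x, tau)).
  by move=> fx xx sM; apply: near => //; exact: le_trans xx rr1.
pose J := 2 * (L * (N * T + 1) * D) * expR (lam * T) + C2 * rho ^+ 2 * W + N * D.
have JE : J = A * D + C2 * rho ^+ 2 * W by rewrite /J /A; ring.
have J0 : 0 <= J.
  by rewrite JE addr_ge0// !mulr_ge0 ?(ltW D0) ?(ltW C20)// ltW.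
have est : delta / 2 * `|sigma2 tau - sigma1 tau| <=
    S * (L * rho * (C3' * (W + C1 * rho ^+ 2 * W + J)) + J / rho).
  have [neg|pos] := leP (sg * (sigma2 tau - sigma1 tau)) 0.
    exact: (hC sg sigma1 sigma2 u1 u2 D tau W rho).
  (* The other order of the two solutions. *)
  have jump' : normal_jump_lip D u2 u1.
    by move=> x r r' fx rT r'T; rewrite !(normal_jumpN u1) -opprD normrN; exact: jump.
  have neg : sg * (sigma1 tau - sigma2 tau) <= 0 by rewrite -opprB mulrN oppr_le0 ltW.
  have sW' s : 0 < s < T -> `|sigma1 s - sigma2 s| <= W * expR (lam * (s - tau)).
    by rewrite distrC; exact: sW.
  rewrite distrC.
  exact: (hC sg sigma2 sigma1 u2 u1 D tau W rho sg1 st2 st1 s02 s01 D0 jump' tauT rho0 rhole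
    rhod rhoL rC1 rC2 W0 near' neg sW' J erefl).
have WK : W <= K * D.
  apply: (absorb S0 (ltW L0) (ltW C10) (ltW C30) W0 J0 rho0 rhole delta0 JE rK erefl).
  by apply: le_trans est; rewrite ler_wpM2l// divr_ge0// ltW.
have tau1 : sup X <= W.
  rewrite /W ler_peMr// -expR0 ler_expR mulr_ge0 ?(ltW lam0)//.
  by case/andP: tauT => /ltW.
have wK := le_trans (wsup t tT) (le_trans tau1 WK).
by rewrite unwt [leRHS]mulrAC; exact: ler_pM (wt0 t) (expR_ge0 _) wK (eT t tT).
Qed.

End Reference.

End Stability.

(** * Application to the solutions of the problem *)

Section Solutions.
Context {R : realType} {n : nat}.
Local Notation E := 'rV[R]_n.+1.

Lemma sup_norm_ge0 (X : set R) : (forall x, X x -> 0 <= x) -> 0 <= sup X.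
Proof.
move=> X0; have [hX|nX] := pselect (has_sup X); last by rewrite sup_out.
by have [[x Xx] ub] := hX; apply: le_trans (X0 x Xx) _; exact: ub_le_sup.
Qed.

Lemma C1_ball_le (T M : R) sigma : 0 < T -> C1_ball T M sigma ->
  forall t, 0 < t < T -> `|sigma t| <= M.
Proof.
move=> T0 [[sc _] sM] t /andP[t0 tT].
rewrite closure_segment// in sc.
have [B B0 hB] := compact_bounded (segment_compact (a := 0) (b := T)) sc.
apply: le_trans sM; rewrite /C1_norm ler_wpDr//.
  by apply: sup_norm_ge0 => _ [s _ <-].
apply: ub_le_sup; first by exists B => _ [s sT <-]; exact: hB.
by exists t => //; rewrite /= in_itv/= !ltW.
Qed.

Variables (Omega : set E) (T : R).
Hypothesis oOmega : open Omega.
Hypothesis bOmega : bounded_set Omega.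
Hypothesis T0 : 0 < T.
Hypothesis C3 : class_C 3 Omega.
Local Notation Q := (cylinder Omega T).
Variables (a : R) (F : E * R * R * R -> R) (h : E -> R) (g : E * R -> R).

Lemma solution_solves sigma u : is_solution Omega T a F h g sigma u ->
  cyl_C1 Omega T u /\ solves Omega T F sigma u.
Proof.
move=> [up ueq _ _]; have uC := parabolic_cyl_C1 up; split => //; split; first by case: uC.
by move=> x t Ox tT; rewrite -ueq//; exact: (parabolic_heat oOmega up).
Qed.

(** Initial and boundary values coincide, also at the corner frontier x {0}, by
    continuity of the initial value. *)
Lemma solutions_same_data sigma1 sigma2 u1 u2 : is_solution Omega T a F h g sigma1 u1 ->
  is_solution Omega T a F h g sigma2 u2 -> same_data Omega T u1 u2.
Proof.
move=> s1 s2 x t cx tT; have [_ _ i1 b1] := s1; have [_ _ i2 b2] := s2.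
have [[c1 _ _] _] := solution_solves s1; have [[c2 _ _] _] := solution_solves s2.
have t0 : u1 (x, 0) = u2 (x, 0).
  apply/eqP; rewrite -subr_eq0 -normr_eq0 eq_le normr_ge0 andbT.
  apply/ler_addgt0Pr => eps eps0; rewrite add0r.
  have e20 : 0 < eps / 2 by rewrite divr_gt0.
  have T00 : 0 <= (0 : R) < T by rewrite lexx.
  have [d1 d10 h1] := within_continuous_le c1 (Qcl T0 cx T00) e20.
  have [d2 d20 h2] := within_continuous_le c2 (Qcl T0 cx T00) e20.
  have m0 : 0 < Num.min d1 d2 by rewrite lt_min d10.
  have [y [Oy]] := (closure_normP Omega x).1 cx _ m0.
  rewrite lt_min => /andP[y1 y2].
  have cy := Qcl T0 (subset_closure Oy) T00.
  have k1 : `|u1 (x, 0) - u1 (y, 0)| < eps / 2.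
    by apply: h1; rewrite // pair_norm_lt y1 subrr normr0.
  have k2 : `|u2 (x, 0) - u2 (y, 0)| < eps / 2.
    by apply: h2; rewrite // pair_norm_lt y2 subrr normr0.
  have -> : u1 (x, 0) - u2 (x, 0) = (u1 (x, 0) - u1 (y, 0)) - (u2 (x, 0) - u2 (y, 0)).
    by rewrite (i1 y)// (i2 y)//; ring.
  by rewrite (le_trans (ler_normB _ _))// (splitr eps) lerD// ltW.
have [->|tn0] := eqVneq t 0; first by [].
case=> [fx|/eqP]; last by rewrite (negbTE tn0).
have tT' : 0 < t < T by move: tT => /andP[p ->]; rewrite lt_neqAle eq_sym tn0 p.
by rewrite b1// b2.
Qed.

Variable M : R.
Hypothesis M0 : 0 < M.
Hypothesis F_reg : nonlinearity_regular Omega F.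
Hypothesis F_nondeg : exists x0, frontier Omega x0 /\
  0 < inf [set `|d_sigma F (x0, p.1, p.2, g (x0, p.1))| | p in `[0, T] `*` `[- M, M]].
Hypothesis F_growth : exists c d : R, [/\ 0 <= c, 0 <= d &
  forall sigma : R -> R, C1_itv T sigma -> forall (t : R) (x : E) (u : R),
    0 <= t <= T -> closure Omega x -> u * F (x, t, sigma t, u) <= c * u ^+ 2 + d].

(** Any solution in the ball serves as reference for the constants. *)
Lemma pointwise_stability : exists2 C : R, 0 < C &
  forall sigma1 sigma2 u1 u2 (D : R), C1_ball T M sigma1 -> C1_ball T M sigma2 ->
  is_solution Omega T a F h g sigma1 u1 -> is_solution Omega T a F h g sigma2 u2 ->
  0 < D -> normal_jump_lip Omega T D u1 u2 ->
  forall t, 0 < t < T -> `|sigma2 t - sigma1 t| <= C * D.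
Proof.
have [[[sigma0 u0] /= [b0 s0]]|none] := pselect (exists p : (R -> R) * (E * R -> R),
    C1_ball T M p.1 /\ is_solution Omega T a F h g p.1 p.2); last first.
  exists 1 => // sigma1 sigma2 u1 u2 D b1 _ s1; exfalso; apply: none; by exists (sigma1, u1).
have [x0 [fx0 inf0]] := F_nondeg.
have [c [d [c0 d0 grow]]] := F_growth.
have [[uc0 _ _] _] := solution_solves s0.
have cQ : compact (closure Q).
  by rewrite closure_cylinder//; apply: compact_setX; [exact: closure_Omega_compact|exact: segment_compact].
have [m0 m00 hm0] := compact_bounded cQ uc0.
pose m := (1 + m0) * expR ((c + d) * T).
have mpos : 0 <= m by rewrite mulr_ge0 ?expR_ge0// addr_ge0// ltW.
have st sigma u : C1_ball T M sigma -> is_solution Omega T a F h g sigma u ->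
    state Omega T F M m sigma u.
  move=> b s; have [uC us] := solution_solves s; split => //; split.
    exact: (C1_ball_le T0 b).
  apply: (solution_sup_bound oOmega bOmega T0 c0 d0 (ltW m00) _ us.1 us.2).
    by move=> x t v cx tT; apply: grow => //; case: b.
  move=> x t cx tT xt; rewrite -(solutions_same_data s0 s cx tT xt).
  by apply: hm0; exact: Qcl.
have nondeg : forall t s, 0 < t < T -> `|s| <= M ->
    inf [set `|d_sigma F (x0, p.1, p.2, g (x0, p.1))| | p in `[0, T] `*` `[- M, M]]
    <= `|d_sigma F (x0, t, s, u0 (x0, t))|.
  move=> t s tT sM; have [_ _ _ gb] := s0; rewrite gb//.
  apply: ge_inf; first by exists 0 => _ [p _ <-].
  exists (t, s) => //; split; rewrite /= in_itv/=; last by rewrite -ler_norml.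
  by case/andP: tT => /ltW -> /ltW ->.
have [C C0 hC] := stability oOmega bOmega T0 C3 F_reg (ltW M0) mpos (st _ _ b0 s0) fx0 inf0 nondeg.
exists C => // sigma1 sigma2 u1 u2 D b1 b2 s1 s2 D0 jump.
apply: (hC sigma1 sigma2 u1 u2 D) => //; [exact: st|exact: st| |].
  exact: solutions_same_data s0 s1.
exact: solutions_same_data s0 s2.
Qed.

End Solutions.

(** * Smooth test functions *)

Section Flat.
Context {R : realType}.
Implicit Types t : R.

(** This family contains the derivatives of its members, hence its members are
    smooth. *)
Definition flat (n : nat) t : R := if 0 < t then t^-1 ^+ n * expR (- t^-1) else 0.

Lemma flat_ge0 n t : 0 <= flat n t.
Proof.
rewrite /flat; case: ifPn => // t0.
by rewrite mulr_ge0 ?expR_ge0// exprn_ge0// invr_ge0 ltW.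
Qed.

Lemma flat_gt0 n t : 0 < t -> 0 < flat n t.
Proof. by move=> t0; rewrite /flat t0 mulr_gt0 ?expR_gt0// exprn_gt0// invr_gt0. Qed.

Lemma flat_eq0 n t : t <= 0 -> flat n t = 0.
Proof. by rewrite /flat leNgt => /negbTE ->. Qed.

Lemma flat_le n t : flat n t <= n`!%:R.
Proof.
rewrite /flat; case: ifPn => // t0; set y := t^-1.
have y0 : 0 <= y by rewrite invr_ge0 ltW.
rewrite expRN ler_pdivrMr ?expR_gt0//; case: n => [|n].
  by rewrite expr0 fact0 mul1r -expR0 ler_expR.
have f0 : 0 < (n.+1)`!%:R :> R by rewrite ltr0n fact_gt0.
rewrite mulrC -ler_pdivrMr//; apply: le_trans (expR_ge1Dxn n y0).
by rewrite lerDr.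
Qed.

Lemma flat_shift n t : flat n t = t * flat n.+1 t.
Proof.
rewrite /flat; case: ifPn => [t0|]; last by rewrite mulr0.
by rewrite exprS !mulrA divff ?mul1r// gt_eqF.
Qed.

Lemma is_derive_flat n t :
  is_derive (t : R) (1 : R) (flat n) (- n%:R * flat n.+1 t + flat n.+2 t).
Proof.
have [t0|t0|->] := ltgtP t 0.
- rewrite !(flat_eq0 _ (ltW t0)) mulr0 addr0.
  apply/is_derive_epsP => e e0; exists (- t); first by rewrite oppr_gt0.
  move=> h ht; rewrite !(flat_eq0 n) ?(ltW t0)//.
    by rewrite !(subr0, mulr0) normr0 mulr_ge0// ltW.
  by rewrite /GRing.scale/= mulr1; have := ler_norm h; move: ht; clear; lra.
- pose f (s : R) := s^-1 ^+ n * expR (- s^-1).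
  have tn0 : t != 0 by rewrite gt_eqF.
  have dV : is_derive (t : R) (1 : R) (fun s : R => s^-1) (- t ^- 2 *: (1 : R)).
    exact: (is_deriveV (f := id)).
  have dX : is_derive (t : R) (1 : R) (fun s : R => s^-1 ^+ n)
      (n%:R * t^-1 ^+ n.-1 * (- t ^- 2)).
    have -> : (fun s : R => s^-1 ^+ n) = (fun s : R => s^-1) ^+ n.
      by apply/funext => s; rewrite exprfctE.
    by apply: (is_derive_congr (is_deriveX n dV)); rewrite /GRing.scale/= mulr1.
  have dE : is_derive (t : R) (1 : R) (fun s : R => expR (- s^-1)) (t ^- 2 * expR (- t^-1)).
    have dN : is_derive (t : R) (1 : R) (fun s : R => - s^-1) (t ^- 2).
      by apply: (is_derive_congr (is_deriveN dV)); rewrite scaleNr opprK /GRing.scale/= mulr1.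
    apply: (is_derive_congr (is_derive1_comp (f := expR) (g := fun s : R => - s^-1)
      (is_derive_expR (- t^-1)) dN)).
    by rewrite mulrC.
  have df : is_derive (t : R) (1 : R) f _ := is_deriveM dX dE.
  have E1 : \forall s \near t, f s = flat n s.
    near=> s; rewrite /flat ifT//; near: s; exact: lt_nbhsr.
  apply: (near_eq_is_derive E1); apply: (is_derive_congr df).
  rewrite /flat t0 /GRing.scale/=; set y := expR _.
  case: n {f E1 df dX} => [|m]; first by rewrite mulr0n; field.
  have -> : t ^- 2 = t^-1 ^+ 2 by rewrite exprVn.
  by rewrite -[m.+1.-1]/m; set x := t^-1; rewrite !exprS; ring.
- rewrite !flat_eq0// mulr0 addr0.
  apply/is_derive_epsP => e e0; exists (e / (n.+2)`!%:R).
    by rewrite divr_gt0// ltr0n fact_gt0.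
  move=> h ht; rewrite /GRing.scale/= mulr1 add0r (flat_eq0 n (lexx 0)) subr0 mulr0 subr0.
  rewrite flat_shift flat_shift !normrM mulrA (ger0_norm (flat_ge0 _ _)).
  rewrite mulrAC ler_wpM2r//; apply: le_trans (_ : `|h| * (n.+2)`!%:R <= _).
    by rewrite ler_wpM2l// flat_le.
  by apply: ltW; rewrite -ltr_pdivlMr// ltr0n fact_gt0.
Unshelve. all: by end_near. Qed.

End Flat.

Section Smooth.
Context {R : realType} {V : normedModType R}.
Implicit Types (f g : V -> R).

Definition smooth f : Prop := forall k, C_upto k setT setT f.

Lemma continuous_uptoT f : continuous f -> continuous_upto setT f.
Proof. by move=> fc; exists f; split => //; exact: continuous_subspaceT. Qed.

Lemma C_upto_weaken k f : C_upto k.+1 setT setT f -> C_upto k setT setT f.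
Proof.
elim: k f => [|k IH] f [fc fd]; split => // v _.
by have [d1 d2] := fd v I; split => //; exact: IH.
Qed.

Lemma C_uptoD k f g : C_upto k setT setT f -> C_upto k setT setT g ->
  C_upto k setT setT (fun x => f x + g x).
Proof.
elim: k f g => [|k IH] f g [fc fd] [gc gd]; (split; last first).
- by [].
- apply: continuous_uptoT => x.
  by apply: cvgD; [exact: continuous_upto_setT fc x|exact: continuous_upto_setT gc x].
- move=> v _; have [f1 f2] := fd v I; have [g1 g2] := gd v I.
  have dD x : is_derive x v (fun x => f x + g x) ('D_v f x + 'D_v g x).
    exact: (is_deriveD (DeriveDef (f1 x I) erefl) (DeriveDef (g1 x I) erefl)).
  split; first by move=> x _; case: (dD x).
  have -> : 'D_v (fun x => f x + g x) = (fun x => 'D_v f x + 'D_v g x).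
    by apply/funext => x; rewrite (derive_val (is_derive := dD x)).
  exact: IH.
- apply: continuous_uptoT => x.
  by apply: cvgD; [exact: continuous_upto_setT fc x|exact: continuous_upto_setT gc x].
Qed.

Lemma C_uptoM k f g : C_upto k setT setT f -> C_upto k setT setT g ->
  C_upto k setT setT (fun x => f x * g x).
Proof.
elim: k f g => [|k IH] f g Cf Cg; have [fc fd] := Cf; have [gc gd] := Cg; (split; last first).
- by [].
- apply: continuous_uptoT => x.
  by apply: cvgM; [exact: continuous_upto_setT fc x|exact: continuous_upto_setT gc x].
- move=> v _; have [f1 f2] := fd v I; have [g1 g2] := gd v I.
  have dD x : is_derive x v (fun x => f x * g x) (f x * 'D_v g x + g x * 'D_v f x).
    exact: (is_deriveM (DeriveDef (f1 x I) erefl) (DeriveDef (g1 x I) erefl)).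
  split; first by move=> x _; case: (dD x).
  have -> : 'D_v (fun x => f x * g x) = (fun x => f x * 'D_v g x + g x * 'D_v f x).
    by apply/funext => x; rewrite (derive_val (is_derive := dD x)).
  by apply: C_uptoD; apply: IH => //; exact: C_upto_weaken.
- apply: continuous_uptoT => x.
  by apply: cvgM; [exact: continuous_upto_setT fc x|exact: continuous_upto_setT gc x].
Qed.

Lemma C_upto_cst k (c : R) : C_upto k setT setT (fun _ : V => c).
Proof.
elim: k c => [|k IH] c; split=> //; try exact: (continuous_uptoT (@cst_continuous _ _ c)).
move=> v _; have dD x := is_derive_cst c x v.
split; first by move=> x _; case: (dD x).
have -> : 'D_v (fun _ : V => c) = (fun=> 0).
  by apply/funext => x; rewrite (derive_val (is_derive := dD x)).
exact: IH.
Qed.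

Section Affine.
Variables (l : V -> R) (l' : V -> R).
Hypothesis lc : continuous l.
Hypothesis lE : forall x v s, l (x + s *: v) = l x + s * l' v.

Lemma is_derive_flat_affine n x v : is_derive x v (fun x => flat n (l x))
  (l' v * (- n%:R * flat n.+1 (l x) + flat n.+2 (l x))).
Proof.
apply: line_is_derive.
have -> : (fun s => flat n (l (x + s *: v))) = flat n \o (fun s => l x + s * l' v).
  by apply/funext => s /=; rewrite lE.
have d1 : is_derive (0 : R) (1 : R) (fun s : R => l x + s * l' v) (l' v).
  have := is_deriveD (is_derive_cst (l x) (0 : R) 1)
    (is_deriveZ (l' v) (is_derive_id (0 : R) 1)).
  rewrite add0r /GRing.scale/= mulr1; congr is_derive.
  by apply/funext => s /=; rewrite mulrC.
have d2 := is_derive_flat n (l x + 0 * l' v); rewrite mul0r addr0 in d2 *.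
have := @is_derive1_comp R (flat n) (fun s : R => l x + s * l' v) 0 _ _ _ d1.
rewrite mul0r addr0 => /(_ _ d2) h; apply: (is_derive_congr h).
by rewrite mulrC.
Qed.

Lemma C_upto_flat k n : C_upto k setT setT (fun x => flat n (l x)).
Proof.
have cont m : continuous (fun x => flat m (l x)).
  move=> x; apply: continuous_comp; first exact: lc.
  exact: is_derive_continuous (is_derive_flat m (l x)).
elim: k n => [|k IH] n; (split; first exact: continuous_uptoT) => // v _.
have dD x := is_derive_flat_affine n x v.
split; first by move=> x _; case: (dD x).
have -> : 'D_v (fun x => flat n (l x)) =
    (fun x => l' v * (- n%:R * flat n.+1 (l x) + flat n.+2 (l x))).
  by apply/funext => x; rewrite (derive_val (is_derive := dD x)).
apply: C_uptoM; first exact: C_upto_cst.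
by apply: C_uptoD; [apply: C_uptoM; [exact: C_upto_cst|exact: IH]|exact: IH].
Qed.

End Affine.
End Smooth.

Section Hat.
Context {R : realType}.
Implicit Types (r u k : R).

Definition hat r u : R := flat 0 (r - u) * flat 0 (r + u).
Definition hat_d r u : R := flat 0 (r - u) * flat 2 (r + u) - flat 2 (r - u) * flat 0 (r + u).
Definition hat_dd r u : R :=
  flat 0 (r - u) * (- 2 * flat 3 (r + u) + flat 4 (r + u)) - 2 * (flat 2 (r - u) * flat 2 (r + u)) +
  (- 2 * flat 3 (r - u) + flat 4 (r - u)) * flat 0 (r + u).

Lemma hat_ge0 r u : 0 <= hat r u. Proof. by rewrite mulr_ge0 ?flat_ge0. Qed.

Lemma hat_gt0 r u : `|u| < r -> 0 < hat r u.
Proof.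
move=> /ltr_normlP[u1 u2].
by rewrite mulr_gt0 ?flat_gt0// ?subr_gt0// -(opprK u) subr_gt0.
Qed.

Lemma hat_eq0 r u : r <= `|u| -> hat r u = 0.
Proof.
rewrite ler_normr /hat => /orP[h|h]; first by rewrite flat_eq0 ?mul0r// subr_le0.
by rewrite [X in _ * X]flat_eq0 ?mulr0// -(opprK u) subr_le0.
Qed.

Lemma hat_d_eq0 r u : r <= `|u| -> hat_d r u = 0.
Proof.
rewrite ler_normr /hat_d => /orP[h|h].
  by rewrite !(flat_eq0 _ (t := r - u)) ?subr_le0// !mul0r subrr.
by rewrite !(flat_eq0 _ (t := r + u)) ?mulr0 ?subrr// -(opprK u) subr_le0.
Qed.

Lemma hat_le1 r u : hat r u <= 1.
Proof.
rewrite -[leRHS]mulr1 ler_pM ?flat_ge0//; exact: flat_le.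
Qed.

Lemma is_derive_flatB n r u : is_derive (u : R) (1 : R) (fun u => flat n (r - u))
  (- (- n%:R * flat n.+1 (r - u) + flat n.+2 (r - u))).
Proof.
have d : is_derive (u : R) (1 : R) (fun u : R => r - u) (-1).
  have := is_deriveB (is_derive_cst r (u : R) (1 : R)) (is_derive_id (u : R) 1).
  by rewrite sub0r.
apply: (is_derive_congr (is_derive1_comp (f := flat n) (g := fun u : R => r - u)
  (is_derive_flat n (r - u)) d)).
by rewrite mulrN1.
Qed.

Lemma is_derive_flatD n r u : is_derive (u : R) (1 : R) (fun u => flat n (r + u))
  (- n%:R * flat n.+1 (r + u) + flat n.+2 (r + u)).
Proof.
have d : is_derive (u : R) (1 : R) (fun u : R => r + u) 1.
  have := is_deriveD (is_derive_cst r (u : R) (1 : R)) (is_derive_id (u : R) 1).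
  by rewrite add0r.
apply: (is_derive_congr (is_derive1_comp (f := flat n) (g := fun u : R => r + u)
  (is_derive_flat n (r + u)) d)).
by rewrite mulr1.
Qed.

Lemma is_derive_hat r u : is_derive (u : R) (1 : R) (hat r) (hat_d r u).
Proof.
apply: (is_derive_congr (is_deriveM (is_derive_flatB 0 r u) (is_derive_flatD 0 r u))).
rewrite /hat_d /GRing.scale/=; ring.
Qed.

Lemma is_derive_hat_d r u : is_derive (u : R) (1 : R) (hat_d r) (hat_dd r u).
Proof.
apply: (is_derive_congr (is_deriveB (is_deriveM (is_derive_flatB 0 r u) (is_derive_flatD 2 r u))
  (is_deriveM (is_derive_flatB 2 r u) (is_derive_flatD 0 r u)))).
rewrite /hat_dd /GRing.scale/=; ring.
Qed.

(** flat n is at most n!; the value 1000 is a crude bound. *)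
Lemma hat_dd_bound r u : `|hat_dd r u| <= 1000.
Proof.
have a n (t : R) : `|flat n t| <= n`!%:R by rewrite ger0_norm ?flat_ge0// flat_le.
have b t : `|- 2 * flat 3 t + flat 4 t| <= 36 :> R.
  apply: le_trans (ler_normD _ _) _; rewrite normrM normrN normr_nat.
  have a3 : `|flat 3 t| <= 6 := a 3%N t; have a4 : `|flat 4 t| <= 24 := a 4%N t.
  lra.
have m (x y c d : R) : `|x| <= c -> `|y| <= d -> `|x * y| <= c * d.
  by move=> h1 h2; rewrite normrM ler_pM.
apply: le_trans (ler_normD _ _) _; apply: le_trans (lerD (ler_normB _ _) (lexx _)) _.
have h1 := m _ _ _ _ (a 0%N (r - u)) (b (r + u)).
have h2 := m _ _ _ _ (b (r - u)) (a 0%N (r + u)).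
have h3 : `|2 * (flat 2 (r - u) * flat 2 (r + u))| <= 2 * (2 * 2).
  have h4 := m _ _ _ _ (a 2%N (r - u)) (a 2%N (r + u)).
  by apply: (m _ _ 2 (2 * 2)); [rewrite normr_nat|exact: h4].
by apply: le_trans (lerD (lerD h1 h3) h2) _; rewrite fact0; lra.
Qed.

Lemma line_MVT1 (f f' : R -> R) u k : (forall x : R, is_derive (x : R) (1 : R) f (f' x)) ->
  exists2 c, `|c| <= `|k| & f (u + k) - f u = f' (u + c) * k.
Proof.
move=> df; have [|c ck] := line_MVT_sym (f := f) (x := u) (v := 1) (h := k).
  by move=> s _; case: (df (u + s *: 1)).
rewrite /GRing.scale/= !mulr1 (derive_val (is_derive := df (u + c))) => E.
by exists c.
Qed.

Lemma hat_taylor r u k : `|hat r (u + k) - hat r u - k * hat_d r u| <= 1000 * `|k| ^+ 2.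
Proof.
have [c ck ->] := line_MVT1 u k (is_derive_hat r).
have [c' _ E] := line_MVT1 u c (is_derive_hat_d r).
have -> : hat_d r (u + c) * k - k * hat_d r u = (hat_d r (u + c) - hat_d r u) * k by ring.
rewrite E !normrM expr2 mulrA ler_wpM2r// ler_pM//; exact: hat_dd_bound.
Qed.

End Hat.

Section TestFunctions.
Context {R : realType} {n : nat}.
Local Notation E := 'rV[R]_n.+1.
Variables (c : E) (r h rt : R).

Definition eta (x : E) : R := \prod_i hat r (x 0 i - c 0 i).
Definition bump (p : E * R) : R := eta p.1 * hat rt (p.2 - h).

Lemma eta_ge0 x : 0 <= eta x. Proof. by apply: prodr_ge0 => i _; exact: hat_ge0. Qed.

Lemma eta_gt0 x : `|x - c| < r -> 0 < eta x.
Proof.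
move=> xc; apply: prodr_gt0 => i _; apply: hat_gt0; apply: le_lt_trans xc.
by have := le_coord_norm (x - c) i; rewrite !mxE.
Qed.

Lemma eta_le1 x : eta x <= 1.
Proof.
by apply: prodr_ile1 => i _; rewrite hat_ge0 hat_le1.
Qed.

Lemma eta_eq0 x : 0 < r -> r <= `|x - c| -> eta x = 0.
Proof.
move=> r0 xc; have [i hi] : exists i, r <= `|(x - c) 0 i|.
  apply: contrapT => nh; have : `|x - c| < r; last by rewrite ltNge xc.
  rewrite [ltLHS]/Num.norm/= mx_normrE; apply: bigmax_lt => // -[i j] _ /=.
  by rewrite ord1 ltNge; apply/negP => h'; apply: nh; exists j.
by rewrite /eta (bigD1 i)//= hat_eq0 ?mul0r//; move: hi; rewrite !mxE.
Qed.

Lemma bump_ge0 p : 0 <= bump p. Proof. by rewrite mulr_ge0 ?eta_ge0 ?hat_ge0. Qed.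

Lemma C_upto_hat k (l l' : E * R -> R) rr : continuous l ->
  (forall x v s, l (x + s *: v) = l x + s * l' v) ->
  C_upto k setT setT (fun p => hat rr (l p)).
Proof.
move=> lc lE; apply: C_uptoM.
  apply: (C_upto_flat (l := fun p => rr - l p) (l' := fun p => - l' p)).
    by move=> x; exact: (cvgB (cvg_cst rr) (lc x)).
  by move=> x v s; rewrite lE; ring.
apply: (C_upto_flat (l := fun p => rr + l p) (l' := l')).
  by move=> x; exact: (cvgD (cvg_cst rr) (lc x)).
by move=> x v s; rewrite lE; ring.
Qed.

Lemma bump_smooth : smooth bump.
Proof.
move=> k; apply: C_uptoM.
  rewrite /eta; elim: (index_enum _) => [|i s IH].
    under eq_fun do rewrite big_nil; exact: C_upto_cst.
  under eq_fun do rewrite big_cons.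
  apply: C_uptoM => //; apply: (@C_upto_hat k (fun p => p.1 0 i - c 0 i) (fun p => p.1 0 i) r).
    move=> p; apply: cvgB; last exact: cvg_cst.
    apply: (@continuous_comp _ _ _ fst (fun x : E => x 0 i) p); first exact: cvg_fst.
    exact: coord_continuous.
  by move=> x v t; rewrite !mxE; ring.
apply: (@C_upto_hat k (fun p => p.2 - h) snd rt).
  by move=> p; apply: cvgB; [exact: cvg_snd|exact: cvg_cst].
by move=> x v t /=; rewrite /GRing.scale/=; ring.
Qed.

Lemma bump_dt x t : 'D_time_vec bump (x, t) = eta x * hat_d rt (t - h).
Proof.
suff dD : is_derive ((x, t) : E * R) (time_vec : E * R) bump (eta x * hat_d rt (t - h)).
  by rewrite (derive_val (is_derive := dD)).
apply: line_is_derive.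
have -> : (fun s : R => bump ((x, t) + s *: time_vec)) =
    (fun s : R => eta x * hat rt (s + (t - h))).
  apply/funext => s; rewrite /bump /time_vec /= scaler0 addr0; congr (_ * hat _ _).
  by rewrite /GRing.scale/=; ring.
apply: (is_derive_congr (is_deriveZ (eta x) (_ : is_derive (0 : R) (1 : R)
  (fun s : R => hat rt (s + (t - h))) (hat_d rt (t - h))))) => //.
have d : is_derive (0 : R) (1 : R) (fun s : R => s + (t - h)) 1.
  have := is_deriveD (is_derive_id (0 : R) 1) (is_derive_cst (t - h) (0 : R) (1 : R)).
  by rewrite addr0.
have d2 := is_derive_hat rt (0 + (t - h)); rewrite add0r in d2.
have := @is_derive1_comp R (hat rt) (fun s : R => s + (t - h)) 0 _ _ _ d.
by rewrite add0r => /(_ _ d2) d3; apply: (is_derive_congr d3); rewrite mulr1.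
Qed.

Definition bump_support : set (E * R) :=
  [set x | `|x - c| <= r] `*` [set t | `|t - h| <= rt].

Lemma bump_support_compact : compact bump_support.
Proof.
apply: compact_setX; first exact: closed_ball_compact.
have -> : [set t | `|t - h| <= rt] = `[h - rt, h + rt]%classic.
  by apply/seteqP; split => t /=; rewrite in_itv/= ler_distl.
exact: segment_compact.
Qed.

Lemma bump_out p : 0 < r -> ~ bump_support p -> bump p = 0.
Proof.
move=> r0 np; rewrite /bump; have [xr|xr] := leP r `|p.1 - c|.
  by rewrite eta_eq0// mul0r.
rewrite hat_eq0 ?mulr0// leNgt; apply/negP => tr; apply: np.
by split; rewrite /= ltW.
Qed.

Lemma bump_test T : 0 < r -> rt < h -> h + rt < T -> test_function T bump.
Proof.
move=> r0 hr hT; split; first exact: bump_smooth.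
exists bump_support; split; [exact: bump_support_compact| |by move=> p; exact: bump_out].
move=> p [_ /=]; rewrite ler_distl => /andP[t1 t2]; apply/andP; split.
  by apply: lt_le_trans t1; rewrite subr_gt0.
exact: le_lt_trans t2 hT.
Qed.

End TestFunctions.

(** * Caratheodory measurability of closed sets for the Hausdorff measure *)

Lemma sum_double (R : realType) (f : nat -> \bar R) m :
  (\sum_(i < m.*2) f i = \sum_(i < m) f i.*2 + \sum_(i < m) f i.*2.+1)%E.
Proof.
elim: m => [|m IH]; first by rewrite !big_ord0 adde0.
by rewrite doubleS !big_ord_recr/= IH -!addeA; congr (_ + _)%E; rewrite addeCA.
Qed.

Section HausdorffTheory.
Context {R : realType} {V : normedModType R}.
Variables (d : V -> V -> R) (s : nat).
Hypothesis d_norm : forall x y, `|x - y| <= d x y.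
Implicit Types (A B X : set V) (F : nat -> set V) (delta : {posnum R}).
Local Open Scope ereal_scope.

Definition pre_hausdorff delta A : \bar R :=
  ereal_inf [set \sum_(k <oo) hdiam d (F k) ^+ s.+1 | F in
    [set F : nat -> set V | (forall k, hdiam d (F k) <= delta%:num%:E) /\ A `<=` \bigcup_k F k]].
Local Notation pre := pre_hausdorff.
Local Notation H := (hausdorff d s).

Lemma hausdorffE A : H A = ereal_sup [set pre delta A | delta in [set: {posnum R}]].
Proof. by []. Qed.

Lemma hdiam_exp_ge0 A : 0 <= hdiam d A ^+ s.+1.
Proof. exact/expe_ge0/hdiam_ge0. Qed.

Lemma hdiam_exp0 : hdiam d set0 ^+ s.+1 = 0.
Proof. by rewrite hdiam0 expeS mul0e. Qed.

Lemma pre_le delta A F : (forall k, hdiam d (F k) <= delta%:num%:E) ->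
  A `<=` \bigcup_k F k -> pre delta A <= \sum_(k <oo) hdiam d (F k) ^+ s.+1.
Proof. by move=> Fd AF; apply: ereal_inf_lbound; exists F. Qed.

Lemma pre_ge delta A c : (forall F, (forall k, hdiam d (F k) <= delta%:num%:E) ->
  A `<=` \bigcup_k F k -> c <= \sum_(k <oo) hdiam d (F k) ^+ s.+1) -> c <= pre delta A.
Proof. by move=> h; apply: le_ereal_inf_tmp => _ [F [Fd AF] <-]; exact: h. Qed.

Lemma pre_ge0 delta A : 0 <= pre delta A.
Proof. by apply: pre_ge => F _ _; apply: nneseries_ge0 => k _ _; exact: hdiam_exp_ge0. Qed.

Lemma pre_le_hausdorff delta A : pre delta A <= H A.
Proof. by rewrite hausdorffE; apply: ereal_sup_ubound; exists delta. Qed.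

Lemma hausdorff_le A c : (forall delta, pre delta A <= c) -> H A <= c.
Proof. by move=> h; rewrite hausdorffE; apply: ge_ereal_sup => _ [delta _ <-]; exact: h. Qed.

Lemma hdiam_ge A x y : A x -> A y -> (d x y)%:E <= hdiam d A.
Proof. by move=> Ax Ay; apply: ereal_sup_ubound; right; exists (x, y). Qed.

Lemma hdiam_le A (c : R) : (0 <= c)%R -> (forall x y, A x -> A y -> (d x y <= c)%R) ->
  hdiam d A <= c%:E.
Proof.
move=> c0 h; apply: ge_ereal_sup => _ [->|[[x y] [Ax Ay] <-]]; first by rewrite lee_fin.
by rewrite lee_fin; exact: h.
Qed.

Lemma pre_separated A B (e : R) (delta1 delta2 : {posnum R}) : (0 < e)%R ->
  (forall x y, A x -> B y -> (e <= d x y)%R) ->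
  pre delta1 A + pre delta2 B <= H (A `|` B).
Proof.
move=> e0 sep; have m0 : (0 < Num.min (e / 2) (Num.min delta1%:num delta2%:num))%R.
  have h1 : (0 < e / 2)%R by rewrite divr_gt0.
  by rewrite !lt_min h1 !gt0.
pose delta := PosNum m0.
apply: le_trans (pre_le_hausdorff delta _); apply: pre_ge => F Fd AF.
pose F1 k := if pselect (F k `&` A !=set0) then F k else set0.
pose F2 k := if pselect (F k `&` B !=set0) then F k else set0.
have dm : delta%:num%:E <= (e / 2)%:E /\ delta%:num%:E <= delta1%:num%:E /\
    delta%:num%:E <= delta2%:num%:E.
  by rewrite !lee_fin !ge_min !lexx !orbT.
have F1d k : hdiam d (F1 k) <= delta1%:num%:E.
  rewrite /F1; case: pselect => _ /=; last by rewrite hdiam0 lee_fin.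
  by apply: le_trans (Fd k) _; case: dm => _ [].
have F2d k : hdiam d (F2 k) <= delta2%:num%:E.
  rewrite /F2; case: pselect => _ /=; last by rewrite hdiam0 lee_fin.
  by apply: le_trans (Fd k) _; case: dm => _ [].
have AF1 : A `<=` \bigcup_k F1 k.
  move=> x Ax; have [k _ Fx] := AF x (or_introl Ax); exists k => //.
  by rewrite /F1; case: pselect => //= n; exfalso; apply: n; exists x.
have BF2 : B `<=` \bigcup_k F2 k.
  move=> x Bx; have [k _ Fx] := AF x (or_intror Bx); exists k => //.
  by rewrite /F2; case: pselect => //= n; exfalso; apply: n; exists x.
apply: le_trans (leeD (pre_le F1d AF1) (pre_le F2d BF2)) _.
rewrite -nneseriesD; [|by move=> *; exact: hdiam_exp_ge0|by move=> *; exact: hdiam_exp_ge0].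
apply: lee_nneseries => [k _ _|k _].
  by rewrite adde_ge0// hdiam_exp_ge0.
pose w U := hdiam d U ^+ s.+1; change (w (F1 k) + w (F2 k) <= w (F k)).
have w0 : w set0 = 0 by exact: hdiam_exp0.
rewrite /F1 /F2; case: pselect => [h1|h1]; case: pselect => [h2|h2] /=.
- exfalso; have [x [Fx Ax]] := h1; have [y [Fy By]] := h2.
  have := le_trans (hdiam_ge Fx Fy) (le_trans (Fd k) dm.1).
  rewrite lee_fin => h3; have := le_trans (sep x y Ax By) h3.
  by rewrite leNgt ltr_pdivrMr// ltr_pMr// ltr1n.
- by rewrite w0 adde0.
- by rewrite w0 add0e.
- by rewrite w0 adde0 hdiam_exp_ge0.
Qed.

(** Hausdorff measure is additive on sets at positive distance: a set of small
    diameter cannot meet both. *)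
Lemma hausdorff_separated A B (e : R) : (0 < e)%R ->
  (forall x y, A x -> B y -> (e <= d x y)%R) -> H A + H B <= H (A `|` B).
Proof.
move=> e0 sep; have [->|Hlt] := eqVneq (H (A `|` B)) +oo; first exact: leey.
have HA : H A <= H (A `|` B) by apply: le_hausdorff => x; left.
have HB : H B <= H (A `|` B) by apply: le_hausdorff => x; right.
have fin (x : \bar R) : 0 <= x -> x <= H (A `|` B) -> x \is a fin_num.
  by move=> x0 xH; rewrite ge0_fin_numE//; apply: le_lt_trans xH _; rewrite ltey.
have fA := fin _ (hausdorff_ge0 d s A) HA.
have fp delta : pre delta B \is a fin_num.
  by apply: fin (pre_ge0 _ _) (le_trans (pre_le_hausdorff _ _) HB).
have h1 delta2 : H A + pre delta2 B <= H (A `|` B).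
  rewrite -leeBrDr//; apply: hausdorff_le => delta1.
  by rewrite leeBrDr//; exact: pre_separated sep.
rewrite addeC -leeBrDr//; apply: hausdorff_le => delta2.
by rewrite leeBrDr// addeC.
Qed.

Section ClosedSets.
Variables (C : set V) (X : set V).
Hypothesis closedC : closed C.

Let A := X `&` ~` C.
Let far (k : nat) := A `&` [set x | forall c, C c -> (k.+1%:R^-1 <= `|x - c|)%R].
Let ring (k : nat) := far k.+1 `&` ~` far k.

Let inv_lt (j k : nat) : (j < k)%N -> (k.+1%:R^-1 < j.+1%:R^-1 :> R)%R.
Proof. by move=> jk; rewrite ltf_pV2 ?posrE// ltr_nat. Qed.

Let far_mono j k : (j <= k)%N -> far j `<=` far k.
Proof.
move=> jk x [Ax h]; split => // c Cc; apply: le_trans (h c Cc).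
by rewrite lef_pV2 ?posrE// ler_nat.
Qed.

Let far_ring j k : (j < k)%N -> H (far j) + H (ring k) <= H (far k.+1).
Proof.
move=> jk; apply: le_trans (hausdorff_separated (e := j.+1%:R^-1 - k.+1%:R^-1) _ _) _.
- by rewrite subr_gt0 inv_lt.
- move=> x y [Ax hx] [[Ay _] ny].
  have [c Cc yc] : exists2 c, C c & (`|y - c| < k.+1%:R^-1)%R.
    apply: contrapT => n; apply: ny; split => // c Cc; rewrite leNgt; apply/negP => h.
    by apply: n; exists c.
  apply: le_trans (d_norm x y); rewrite lerBlDr.
  apply: le_trans (hx c Cc) _; rewrite -(subrKA y); apply: le_trans (ler_normD _ _) _.
  by rewrite lerD2l ltW.
- apply: le_hausdorff => x [|[] //]; apply: far_mono; exact: (leq_trans (ltnW jk)).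
Qed.

Let HX_far k : H (far k) <= H X.
Proof. by apply: le_hausdorff => x [[]]. Qed.

Let rings (b m : nat) : \sum_(i < m) H (ring (i.*2 + b.+1)) <= H (far (m.*2 + b)).
Proof.
elim: m => [|m IH]; first by rewrite big_ord0 hausdorff_ge0.
rewrite big_ord_recr/=; apply: le_trans (leeD IH (lexx _)) _.
apply: le_trans (far_ring _) _; first by rewrite addnS.
by rewrite doubleS !addnS addSn.
Qed.

Let rings2 (m : nat) : \sum_(i < m.*2) H (ring i.+1) <= H X + H X.
Proof.
rewrite (sum_double (fun i => H (ring i.+1))).
have r b : \sum_(i < m) H (ring (i.*2 + b.+1)) <= H X := le_trans (rings b m) (HX_far _).
by have := leeD (r 0%N) (r 1%N); under eq_bigr do rewrite addn1; under [X in _ + X]eq_bigr do rewrite addn2.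
Qed.

(** Caratheodory splitting: the part of X outside C is exhausted by the points
    at distance at least 1/k from C; the rings between two consecutive such
    sets have finite total measure because every other one is separated. *)
Lemma closed_split : H (X `&` C) + H (X `&` ~` C) <= H X.
Proof.
have [->|HX] := eqVneq (H X) +oo; first exact: leey.
have fX : H X \is a fin_num by rewrite ge0_fin_numE ?hausdorff_ge0// ltey.
have r0 i : 0 <= H (ring i.+1) by exact: hausdorff_ge0.
have sumle : \sum_(0 <= i <oo) H (ring i.+1) <= H X + H X.
  apply: lime_le; first by apply: is_cvg_nneseries => *; exact: r0.
  apply: nearW => m; apply: le_trans (rings2 m); rewrite -(big_mkord xpredT (fun i => H (ring i.+1))).
  by apply: lee_sum_nneg_natr => //; rewrite -addnn leq_addr.
have sumfin : \sum_(0 <= i <oo) H (ring i.+1) < +oo.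
  by apply: le_lt_trans sumle _; rewrite lte_add_pinfty// ltey.
have tail := nneseries_tail_cvg sumfin (fun i _ => r0 i).
have key k : H (X `&` C) + H A <= H X + \sum_(k <= i <oo) H (ring i.+1).
  have sub : H A <= H (far k.+1) + \sum_(k <= i <oo) H (ring i.+1).
    apply: le_trans (leeD (lexx _) (outer_measure_sigma_subadditive_tail (H : {outer_measure set V -> \bar R}) k (fun i => ring i.+1))).
    apply: le_trans (outer_measureU2 _ _ _); apply: le_outer_measure => x Ax.
    have [e e0 he] : exists2 e : R, (0 < e)%R & forall c, C c -> (e <= `|x - c|)%R.
      have : nbhs x (~` C) by apply: open_nbhs_nbhs; split; [exact: closed_openC|case: Ax].
      move=> /nbhs_normP[e /= e0 he]; exists e => // c Cc; rewrite leNgt; apply/negP => h.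
      by have := he c h.
    have exK : exists K, `[< far K x >].
      exists (Num.bound e^-1); apply/asboolP; split => // c Cc; apply: le_trans (he c Cc).
      rewrite -[leRHS]invrK lef_pV2 ?posrE ?invr_gt0//; apply: ltW.
      apply: lt_le_trans (archi_boundP _) _; first by rewrite invr_ge0 ltW.
      by rewrite ler_nat.
    case: (ex_minnP exK) => K /asboolP farK minK.
    have [Kk|kK] := leqP K k.+1; first by left; exact: far_mono farK.
    right; case: K kK farK minK => [//|[//|i]] ki farK minK; exists i.
      by rewrite /=; apply/negP; rewrite -leqNgt.
    split => //.
    by move=> nf; have := minK i.+1 (asboolT nf); rewrite ltnn.
  apply: le_trans (leeD (lexx _) sub) _; rewrite addeA; apply: leeD => //.
  apply: le_trans (hausdorff_separated (e := k.+2%:R^-1) _ _) _.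
  - by rewrite invr_gt0.
  - move=> x y [_ Cx] [_ hy]; apply: le_trans (hy x Cx) _.
    by rewrite distrC; exact: d_norm.
  - by apply: le_hausdorff => x [[]//|[[]]].
have c1 : (fun k => H X + \sum_(k <= i <oo) H (ring i.+1)) @ \oo --> H X + 0.
  by apply: cvgeD; [rewrite fin_num_adde_defr|exact: cvg_cst|exact: tail].
rewrite adde0 in c1; rewrite -(cvg_lim _ c1)//; apply: lime_ge; first by apply/cvg_ex; exists (H X).
exact: nearW.
Qed.

End ClosedSets.

Lemma hausdorff_image_le (tau : V -> V) A : (forall x y, d (tau x) (tau y) = d x y) ->
  H (tau @` A) <= H A.
Proof.
move=> iso; apply: hausdorff_le => delta; apply: le_trans (pre_le_hausdorff delta A).
have hd U : hdiam d (tau @` U) = hdiam d U.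
  congr (ereal_sup (_ `|` _)); apply/seteqP; split => [_ [[_ _] [[x Ux <-] [y Uy <-]] <-]|].
    by exists (x, y) => //=; rewrite iso.
  move=> _ [[x y] [Ux Uy] <-]; exists (tau x, tau y); last by rewrite /= iso.
  by split; [exists x|exists y].
apply: pre_ge => F Fd AF; under eq_eseriesr do rewrite -hd.
apply: pre_le => [k|_ [x Ax <-]]; first by rewrite hd.
by have [k _ Fx] := AF x Ax; exists k => //; exists x.
Qed.

End HausdorffTheory.

(** * Hausdorff measure and bi-Lipschitz coordinates *)

Section Grid.
Context {R : realType}.
Implicit Types (a b l : R).

Lemma unit_cell (N : nat) (v : R) : (0 < N)%N -> 0 <= v <= 1 ->
  exists k : 'I_N, k%:R / N%:R <= v <= k.+1%:R / N%:R.
Proof.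
move=> N0 /andP[v0 v1]; have NR : 0 < N%:R :> R by rewrite ltr0n.
have w0 : 0 <= v * N%:R by rewrite mulr_ge0// ltW.
have /andP[h1 h2] := truncn_itv w0; set k := Num.trunc _ in h1 h2.
have kN : (k <= N)%N by rewrite -(ler_nat R) (le_trans h1)// ler_piMl// ltW.
have [kN'|kN'] := ltnP k N.
  exists (Ordinal kN'); rewrite ler_pdivrMr// h1 ler_pdivlMr//; exact: ltW.
have kE : k = N by apply/eqP; rewrite eqn_leq kN.
have pN : (N.-1 < N)%N by rewrite prednK.
exists (Ordinal pN); rewrite /= prednK// divff ?gt_eqF// v1 andbT ler_pdivrMr//.
by apply: le_trans h1; rewrite kE ler_nat leq_pred.
Qed.

Lemma count_between (N : nat) a b : a <= b ->
  \sum_(j < N) ((a < j%:R) && (j%:R < b))%:R <= b - a + 1.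
Proof.
move=> ab; set c := fun N => \sum_(j < N) ((a < j%:R) && (j%:R < b))%:R : R.
suff : c N = 0 \/ (c N <= N%:R - a /\ c N <= b - a + 1).
  by rewrite -/(c N) => -[->|[]//]; rewrite addr_ge0// subr_ge0.
elim: N => [|N IH]; first by left; rewrite /c big_ord0.
have -> : c N.+1 = c N + ((a < N%:R) && (N%:R < b))%:R by rewrite /c big_ord_recr.
have S1 : N.+1%:R = N%:R + 1 :> R by rewrite -natr1.
case: (ltP a N%:R) => aN /=; last first.
  rewrite addr0; case: IH => [->|[h1 h2]]; [by left|right; split => //].
  by apply: le_trans h1 _; rewrite S1; lra.
case: (ltP N%:R b) => Nb /=; last first.
  rewrite addr0; case: IH => [->|[h1 h2]]; [by left|right; split => //].
  by apply: le_trans h1 _; rewrite S1; lra.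
by right; rewrite S1; case: IH => [->|[h1 h2]]; split; lra.
Qed.

(** Volume comparison by counting the points of a fine regular grid in a cube
    and in balls that cover it. *)
Lemma cube_cover (m K : nat) (y0 : 'rV[R]_m) l (c : 'I_K -> 'rV[R]_m) (r : 'I_K -> R) :
  0 < l -> (forall k, 0 < r k) ->
  (forall y, `|y - y0| <= l -> exists k, `|y - c k| < r k) ->
  l ^+ m <= \sum_k (2 * r k) ^+ m.
Proof.
move=> l0 r0 cover.
have [N N0 hN] : exists2 N : nat, (0 < N)%N & forall k, l <= r k * N%:R.
  pose B := \sum_k l / r k.
  have B0 : 0 <= B by apply: sumr_ge0 => k _; rewrite divr_ge0// ltW.
  exists (Num.bound B).+1 => // k; rewrite mulrC -ler_pdivrMr//.
  apply: le_trans (_ : B <= _).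
    by rewrite /B (bigD1 k)//= lerDl; apply: sumr_ge0 => j _; rewrite divr_ge0// ltW.
  by apply: ltW; apply: lt_trans (archi_boundP B0) _; rewrite ltr_nat.
have NR : 0 < N%:R :> R by rewrite ltr0n.
pose x (j : 'I_N) : R := - l + 2 * l * j%:R / N%:R.
have xl j : `|x j| <= l.
  have jN : j%:R / N%:R <= 1 :> R by rewrite ler_pdivrMr// mul1r ler_nat ltnW.
  have j0 : 0 <= j%:R / N%:R :> R by rewrite divr_ge0.
  have h1 : 0 <= l * (j%:R / N%:R) by rewrite mulr_ge0// ltW.
  have h2 : l * (j%:R / N%:R) <= l by rewrite ler_piMr// ltW.
  have -> : x j = - l + 2 * (l * (j%:R / N%:R)) by rewrite /x; ring.
  by rewrite ler_norml; lra.
pose P k i (j : 'I_N) := `|y0 0 i + x j - c k 0 i| < r k.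
have cnt k i : \sum_j (P k i j)%:R <= 2 * r k * (N%:R / l).
  pose q := N%:R / (2 * l); have q0 : 0 < q by rewrite divr_gt0// mulr_gt0.
  pose a := (c k 0 i - y0 0 i + l - r k) * q; pose b := (c k 0 i - y0 0 i + l + r k) * q.
  have ab : a <= b by rewrite ler_pM2r// lerD2l; have := r0 k; clear; lra.
  have ba : b - a + 1 <= 2 * r k * (N%:R / l).
    have -> : b - a = r k * N%:R / l.
      by rewrite /a /b /q; field; rewrite gt_eqF.
    have h : 1 <= r k * N%:R / l by rewrite ler_pdivlMr// mul1r.
    have -> : 2 * r k * (N%:R / l) = 2 * (r k * N%:R / l) by ring.
    by move: h; clear; lra.
  apply: le_trans ba; apply: le_trans (count_between N ab).
  apply: ler_sum => j _; case: (boolP (P k i j)) => [|_]; last by [].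
  rewrite /P => /ltr_normlP[h1 h2].
  have jE : j%:R = (x j + l) * q by rewrite /x /q; field; rewrite !gt_eqF.
  rewrite jE /a /b !ltr_pM2r// (_ : _ && _ = true)//; apply/andP; split.
    by move: h1; clear; lra.
  by move: h2; clear; lra.
have N_m : N%:R ^+ m = \sum_(f : {ffun 'I_m -> 'I_N}) (1 : R).
  by rewrite sumr_const card_ffun !card_ord -natrX.
have main : N%:R ^+ m <= \sum_k (2 * r k * (N%:R / l)) ^+ m.
  rewrite N_m; apply: le_trans (_ : \sum_(f : {ffun 'I_m -> 'I_N}) \sum_k \prod_i (P k i (f i))%:R <= _).
    apply: ler_sum => f _.
    have [k hk] : exists k, `|(\row_i (y0 0 i + x (f i))) - c k| < r k.
      apply: cover; apply: norm_le_coord => [|i]; first exact: ltW.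
      by rewrite !mxE addrAC subrr add0r.
    rewrite (bigD1 k)//= big1 ?lerDl => [|i _].
      by apply: sumr_ge0 => j _; apply: prodr_ge0.
    have -> : P k i (f i) = true; last by [].
    apply: le_lt_trans hk; have := le_coord_norm (\row_i (y0 0 i + x (f i)) - c k) i.
    by rewrite !mxE.
  rewrite exchange_big/=; apply: ler_sum => k _.
  rewrite -(bigA_distr_bigA (fun i j => (P k i j)%:R)).
  rewrite -[m in leRHS]card_ord -prodr_const; apply: ler_prod => i _.
  by rewrite cnt sumr_ge0.
have lN : 0 < (N%:R / l) ^+ m by rewrite exprn_gt0// divr_gt0.
rewrite -(ler_pM2r lN) -exprMn mulrCA divff ?gt_eqF// mulr1 mulr_suml.
by under eq_bigr do rewrite -exprMn.
Qed.

Lemma unit_fraction (u a : R) : 0 < a -> `|u| <= a -> 0 <= (u + a) / (2 * a) <= 1.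
Proof.
move=> a0; rewrite ler_norml => /andP[h1 h2]; have a2 : 0 < 2 * a by rewrite mulr_gt0.
rewrite divr_ge0 ?(ltW a2)//= ?ler_pdivrMr//; lra.
Qed.

Lemma power_sum (m : nat) a b : 0 <= a -> 0 <= b ->
  (2 * (a + b)) ^+ m <= 4 ^+ m * (a ^+ m + b ^+ m).
Proof.
move=> a0 b0; wlog ab : a b a0 b0 / a <= b.
  by move=> h; have [/h|/ltW/h] := leP a b; [exact|rewrite addrC [b ^+ _ + _]addrC; exact].
apply: le_trans (_ : (4 * b) ^+ m <= _).
  by rewrite lerXn2r// ?nnegrE ?mulr_ge0 ?addr_ge0//; lra.
by rewrite exprMn ler_wpM2l ?exprn_ge0// lerDr exprn_ge0.
Qed.

End Grid.

Section LipschitzImages.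
Context {R : realType} {V : normedModType R}.
Variables (d : V -> V -> R) (s : nat) (c : R).
Hypothesis c0 : 0 < c.
Hypothesis d_norm : forall x y, `|x - y| <= d x y.
Hypothesis norm_d : forall x y, d x y <= c * `|x - y|.
Variables (S : set V) (kappa : V -> 'rV[R]_s.+1) (L : R).
Hypothesis L0 : 0 < L.

Lemma finite_series (f : nat -> \bar R) (m : nat) : (forall k, 0 <= f k)%E ->
  (forall k, (m <= k)%N -> f k = 0%E) ->
  (\sum_(k <oo) f k = \sum_(k < m) f k)%E.
Proof.
move=> f0 fm; rewrite (nneseries_split 0 m) => [|k _]; last exact: f0.
by rewrite add0n eseries0 ?adde0 ?big_mkord// => k mk _; exact: fm.
Qed.

(** The preimages of the N^(s+1) cells of a cube have diameter of order 1/N. *)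
Lemma lipschitz_finite (y0 : 'rV[R]_s.+1) (a : R) : 0 < a ->
  (forall p, S p -> `|kappa p - y0| <= a) ->
  (forall p q, S p -> S q -> `|p - q| <= L * `|kappa p - kappa q|) ->
  (hausdorff d s S < +oo)%E.
Proof.
move=> a0 Sa SL; pose C := c * L * (2 * a).
have C0 : 0 < C by rewrite !mulr_gt0.
suff : (hausdorff d s S <= (C ^+ s.+1)%:E)%E by move/le_lt_trans; apply; exact: ltry.
apply: hausdorff_le => delta.
pose N := (Num.bound (C / delta%:num)).+1.
have NR : 0 < N%:R :> R by rewrite ltr0n.
have CN : C / N%:R <= delta%:num.
  rewrite ler_pdivrMr// mulrC -ler_pdivrMr//; apply: ltW.
  have B0 : 0 <= C / delta%:num by rewrite divr_ge0// ltW.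
  by apply: lt_trans (archi_boundP B0) _; rewrite ltr_nat.
pose cell (f : {ffun 'I_s.+1 -> 'I_N}) := S `&` [set p | forall i,
  (f i)%:R / N%:R <= ((kappa p - y0) 0 i + a) / (2 * a) <= (f i).+1%:R / N%:R].
pose T := {ffun 'I_s.+1 -> 'I_N}.
pose F (k : nat) : set V := nth set0 [seq cell f | f <- enum T] k.
have cellD f : (hdiam d (cell f) <= (C / N%:R)%:E)%E.
  apply: hdiam_le => [|p q [Sp hp] [Sq hq]]; first by rewrite divr_ge0// ltW.
  apply: le_trans (norm_d p q) _.
  have -> : C / N%:R = c * (L * (2 * a / N%:R)) by rewrite /C; ring.
  rewrite ler_wpM2l ?(ltW c0)//; apply: le_trans (SL p q Sp Sq) _.
  rewrite ler_wpM2l ?(ltW L0)//; apply: norm_le_coord => [|i].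
    by rewrite divr_ge0 ?mulr_ge0// ltW.
  move: (hp i) (hq i); rewrite !mxE; set u := kappa p 0 i; set v := kappa q 0 i.
  have a2 : 0 < 2 * a by rewrite mulr_gt0.
  rewrite -(natr1 (f i)) [((f i)%:R + 1) / _]mulrDl mul1r => /andP[p1 p2] /andP[q1 q2].
  rewrite -ler_pdivrMl// -[(2 * a)^-1]gtr0_norm ?invr_gt0// -normrM.
  have -> : (2 * a)^-1 * (u - v) = (u - y0 0 i + a) / (2 * a) - (v - y0 0 i + a) / (2 * a).
    by field; rewrite gt_eqF.
  by rewrite ler_norml; move: p1 p2 q1 q2; clear; lra.
have sz : size [seq cell f | f <- enum T] = (N ^ s.+1)%N.
  by rewrite size_map -cardE card_ffun !card_ord.
have Fnth k : (k < N ^ s.+1)%N -> exists f, F k = cell f.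
  move=> kN; have f0 : T := [ffun=> ord0].
  exists (nth f0 (enum T) k); rewrite /F (nth_map f0)//.
  by rewrite -(size_map cell) sz.
have Fout k : (N ^ s.+1 <= k)%N -> F k = set0 by move=> kN; rewrite /F nth_default// sz.
have Fsmall k : (hdiam d (F k) <= delta%:num%:E)%E.
  have [kN|kN] := ltnP k (N ^ s.+1); last by rewrite Fout// hdiam0 lee_fin.
  by have [f ->] := Fnth k kN; apply: le_trans (cellD f) _; rewrite lee_fin.
have SF : S `<=` \bigcup_k F k.
  move=> p Sp; have h i : exists k : 'I_N,
      k%:R / N%:R <= ((kappa p - y0) 0 i + a) / (2 * a) <= k.+1%:R / N%:R.
    apply: unit_cell => //; have := le_trans (le_coord_norm (kappa p - y0) i) (Sa p Sp).
    exact: unit_fraction.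
  have [g hg] := choice h; pose f : T := [ffun i => g i].
  exists (index f (enum T)) => //; rewrite /F (nth_map f) ?index_mem ?mem_enum//.
  by rewrite nth_index ?mem_enum//; split => // i; rewrite ffunE.
apply: le_trans (@pre_le R V d s delta S F Fsmall SF) _.
rewrite (finite_series (m := (N ^ s.+1)%N)) => [|k|k kN]; last 2 first.
- exact: hdiam_exp_ge0.
- by rewrite Fout// hdiam_exp0.
apply: le_trans (_ : \sum_(k < N ^ s.+1) ((C / N%:R) ^+ s.+1)%:E <= _)%E.
  apply: lee_sum => k _; have [f ->] := Fnth k (ltn_ord k).
  rewrite EFin_expe; elim: s.+1 => [|m IH]; first by rewrite !expe0.
  by rewrite !expeS; apply: lee_pmul => //; [exact: hdiam_ge0|exact/expe_ge0/hdiam_ge0].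
rewrite sumEFin lee_fin sumr_const card_ord exprMn -[_ *+ (N ^ _)]mulr_natr natrX -mulrA -exprMn.
by rewrite mulVf ?gt_eqF// expr1n mulr1.
Qed.

(** Any cover of S by small sets projects to a cover of a cube, hence by
    compactness to a finite cover by slightly larger balls. *)
Lemma lipschitz_positive (y0 : 'rV[R]_s.+1) (l : R) : 0 < l ->
  (forall y, `|y - y0| <= l -> exists2 p, S p & kappa p = y) ->
  (forall p q, S p -> S q -> `|kappa p - kappa q| <= L * `|p - q|) ->
  (0 < hausdorff d s S)%E.
Proof.
move=> l0 onto lip; pose m := s.+1.
pose e : R := Num.min 1 ((l / 4) ^+ m / 2).
have lm0 : 0 < (l / 4) ^+ m by rewrite exprn_gt0// divr_gt0.
have e0 : 0 < e by rewrite lt_min ltr01 divr_gt0.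
have e1 : e <= 1 by rewrite ge_min lexx.
have el : e <= (l / 4) ^+ m / 2 by rewrite ge_min lexx orbT.
pose b := (l / 4) ^+ m / 2 / L ^+ m.
have b0 : 0 < b by rewrite !divr_gt0// exprn_gt0.
suff : (b%:E <= hausdorff d s S)%E by apply: lt_le_trans; rewrite lte_fin.
apply: le_trans (pre_le_hausdorff d s (PosNum (@ltr01 R)) S).
apply: pre_ge => F Fd SF.
pose dk k := fine (hdiam d (F k)).
have dkE k : ((dk k)%:E = hdiam d (F k))%E.
  by rewrite fineK// ge0_fin_numE ?hdiam_ge0// (le_lt_trans (Fd k))// ltry.
have dk0 k : 0 <= dk k by rewrite -lee_fin dkE hdiam_ge0.
pose ek k : R := e / 2 ^+ k.+1.
have ek0 k : 0 < ek k by rewrite divr_gt0// exprn_gt0.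
have ek1 k : ek k <= 1.
  rewrite ler_pdivrMr ?exprn_gt0// mul1r; apply: le_trans e1 _.
  by rewrite exprn_ege1// ler1n.
have eksum K : \sum_(k < K) ek k <= e.
  suff : \sum_(k < K) ek k = e - e / 2 ^+ K.
    by move=> ->; rewrite gerBl divr_ge0 ?exprn_ge0// ltW.
  elim: K => [|K IH]; first by rewrite big_ord0 expr0 divr1 subrr.
  by rewrite big_ord_recr/= IH /ek exprS; field; rewrite expf_neq0// pnatr_eq0.
pose r k := L * dk k + ek k.
have r0 k : 0 < r k by rewrite ltr_wpDl// mulr_ge0// ltW.
have y00 : `|y0 - y0| <= l by rewrite subrr normr0 ltW.
have [p0 Sp0 _] := onto y0 y00.
pose ck k := kappa (xget p0 (F k `&` S)).
have cball p k : S p -> F k p -> `|kappa p - ck k| < r k.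
  move=> Sp Fp; rewrite /ck; case: xgetP => [q _ [Fq Sq]|h]; last by case: (h p).
  apply: le_lt_trans (lip p q Sp Sq) _; rewrite /r ltr_pwDr// ler_wpM2l ?(ltW L0)//.
  apply: le_trans (d_norm p q) _; rewrite -lee_fin dkE; exact: hdiam_ge.
have cK : compact [set y : 'rV[R]_s.+1 | `|y - y0| <= l] by exact: closed_ball_compact.
have [K hK] : exists K : nat, forall y, `|y - y0| <= l -> exists2 k, (k < K)%N & `|y - ck k| < r k.
  rewrite compact_cover in cK.
  have [|y yl|D _ hD] := cK nat setT (fun k => [set y | `|y - ck k| < r k]).
  - move=> k _; have -> : [set y | `|y - ck k| < r k] = ball (ck k) (r k).
      by apply/seteqP; split => y /=; rewrite -ball_normE /ball_/= distrC.
    exact: ball_open.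
  - have [p Sp <-] := onto y yl; have [k _ Fk] := SF p Sp.
    by exists k => //=; exact: cball.
  exists (\max_(k <- finmap.enum_fset D) k).+1 => y yl; have [k kD hk] := hD y yl.
  by exists k => //; rewrite ltnS; apply: leq_bigmax_seq.
have vol := cube_cover (K := K) (y0 := y0) (c := fun k => ck k) (r := fun k => r k) l0 (fun k => r0 k).
have {}vol : l ^+ m <= \sum_(k < K) (2 * r k) ^+ m.
  apply: vol => y yl; have [k kK hk] := hK y yl; by exists (Ordinal kK).
have h1 : l ^+ m <= 4 ^+ m * (L ^+ m * \sum_(k < K) dk k ^+ m + e).
  apply: le_trans vol _; rewrite mulr_sumr.
  apply: le_trans (_ : \sum_(k < K) 4 ^+ m * (L ^+ m * dk k ^+ m + ek k) <= _).
    apply: ler_sum => k _; apply: le_trans (power_sum m (mulr_ge0 (ltW L0) (dk0 k)) (ltW (ek0 k))) _.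
    rewrite ler_wpM2l ?exprn_ge0// exprMn lerD2l.
    by rewrite /m exprS ler_piMr ?(ltW (ek0 k))// exprn_ile1// ltW.
  by rewrite -[leLHS]mulr_sumr big_split/= ler_wpM2l ?exprn_ge0// lerD2l; exact: eksum.
have h2 : b <= \sum_(k < K) dk k ^+ m.
  rewrite /b ler_pdivrMr ?exprn_gt0// mulrC.
  have : (l / 4) ^+ m <= L ^+ m * \sum_(k < K) dk k ^+ m + e.
    by rewrite expr_div_n ler_pdivrMr ?exprn_gt0// mulrC.
  by move: el; clear; lra.
apply: le_trans (_ : (\sum_(k < K) dk k ^+ m)%:E <= _)%E; first by rewrite lee_fin.
rewrite -sumEFin; under eq_bigr do rewrite EFin_expe dkE.
rewrite -(big_mkord xpredT (fun k => (hdiam d (F k) ^+ m)%E)).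
apply: nneseries_lim_ge => k _ _; exact: hdiam_exp_ge0.
Qed.

End LipschitzImages.

(** * Coordinates on the lateral boundary *)

Section BoundaryCoordinates.
Context {R : realType} {n : nat}.
Local Notation E := 'rV[R]_n.+1.
Variables (Omega : set E).
Hypothesis oOmega : open Omega.

Definition join (t : R) (y : 'rV[R]_n) : E := row_mx (t%:M : 'rV_1) y.

Lemma norm_join t y (c : R) : `|t| <= c -> `|y| <= c -> `|join t y| <= c.
Proof.
move=> tc yc; apply: norm_le_coord => [|i]; first exact: le_trans tc.
rewrite /join mxE; case: splitP => j _; first by rewrite ord1 mxE.
exact: le_trans (le_coord_norm y j) yc.
Qed.

Lemma norm_joinl t y : `|t| <= `|join t y|.
Proof.
have := le_coord_norm (join t y : 'rV_(1 + n)) (lshift n ord0).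
by rewrite /join row_mxEl mxE.
Qed.

Lemma norm_joinr t y : `|y| <= `|join t y|.
Proof.
apply: norm_le_coord => // i.
have := le_coord_norm (join t y : 'rV_(1 + n)) (rshift 1 i).
by rewrite /join row_mxEr.
Qed.

Lemma joinB t y t' y' : join t y - join t' y' = join (t - t') (y - y').
Proof.
by apply/matrixP => i j; rewrite !mxE; case: splitP => k _; rewrite !mxE ?mulrnBl.
Qed.

Lemma join_surj (y : E) : exists t z, y = join t z.
Proof.
exists ((lsubmx (y : 'rV_(1 + n))) 0 0), (rsubmx (y : 'rV_(1 + n))).
rewrite /join -[LHS](@hsubmxK _ 1 1 n) -mx11_scalar.
by [].
Qed.

(** A boundary point is determined by its base coordinates in a graph chart,
    with Lipschitz dependence in both directions. *)
Lemma boundary_coordinates x0 (a : R) : class_C 3 Omega -> frontier Omega x0 ->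
  exists (kappa : E * R -> E) (L r0 : R), [/\ 0 < L, 0 < r0,
  (forall p q, frontier Omega p.1 -> frontier Omega q.1 -> `|p.1 - x0| < r0 ->
     `|q.1 - x0| < r0 -> `|p - q| <= L * `|kappa p - kappa q|),
  (forall p q, `|kappa p - kappa q| <= L * `|p - q|) &
  forall r : R, 0 < r -> exists2 rho : R, 0 < rho & forall y, `|y - kappa (x0, a)| <= rho ->
    exists p, [/\ frontier Omega p.1, `|p.1 - x0| < r, `|p.2 - a| < r & kappa p = y]].
Proof.
move=> C3 fx0; have [ O [gamma [r gc]]] := C3 x0 fx0.
have ch := graph_chart_chart gc; set r1 := r / _ in ch.
have r10 : 0 < r1 := chart_r ch.
have [L1 [L11 _ _ _ zL]] := chart_bounds ch.
have [OOT Cg _ _] := gc; have OTO : O^T *m O = 1%:M := mulmx1C OOT.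
have gcont : continuous gamma by have [gc0 _] := Cg; exact: continuous_upto_setT.
pose be (x : E) : 'rV[R]_n := base O x; pose le (x : E) := level O x.
have L10 : 0 < L1 by exact: lt_le_trans L11.
have dec (x : E) : x = join (le x) (be x) *m O.
  rewrite /join /le /be /level /base -mx11_scalar hsubmxK -mulmxA OTO mulmx1.
  by [].
have beB x y : be (x - y) = be x - be y.
  by rewrite /be -[x - y]addrC -scaleN1r addrC base_line scaleN1r.
have leB x y : le (x - y) = le x - le y.
  by rewrite /le -scaleN1r level_line mulN1r.
pose m : R := n.+1%:R * `|(O^T : 'M[R]_(n.+1, n.+1))| + n.+1%:R * `|(O : 'M[R]_(n.+1, n.+1))| + 1.
have m1 : 1 <= m by rewrite lerDr addr_ge0// mulr_ge0.
have m0 : 0 < m by exact: lt_le_trans m1.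
have xm (x : E) : `|(x : 'rV_(1 + n)) *m O^T| <= m * `|x|.
  apply: le_trans (norm_mulmxr_le _ _) _; rewrite ler_wpM2r//.
  by rewrite /m -addrA lerDl addr_ge0// mulr_ge0.
have bem x : `|be x| <= m * `|x|.
  apply: le_trans (xm x); apply: norm_le_coord => // i; rewrite /be /base mxE.
  exact: le_coord_norm.
have lem x : `|le x| <= m * `|x|.
  apply: le_trans (xm x); rewrite /le /level mxE; exact: le_coord_norm.
have nm x : `|x| <= m * (`|le x| + `|be x|).
  rewrite {1}(dec x); apply: le_trans (norm_mulmxr_le (join (le x) (be x) : 'rV_(1 + n)) O) _.
  apply: ler_pM; rewrite ?mulr_ge0//.
    by rewrite /m addrAC lerDr addr_ge0// mulr_ge0.
  by apply: norm_join; rewrite ?lerDl ?lerDr.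
have zE x : height O gamma x = le x - gamma (be x) by [].
have fr x : `|x - x0| < r1 -> (frontier Omega x <-> le x = gamma (be x)).
  move=> xr; rewrite (chart_frontier ch oOmega xr) zE.
  by split => [/subr0_eq|->]//; rewrite subrr.
pose kappa (p : E * R) : E := join p.2 (be p.1).
pose r0 := r1 / (1 + 2 * m).
have m20 : 0 < 1 + 2 * m by rewrite addr_gt0// mulr_gt0.
have r00 : 0 < r0 by rewrite divr_gt0.
have r0E : r0 + 2 * m * r0 = r1 by rewrite /r0; field; rewrite gt_eqF.
pose L := m * (L1 * m + 1) + 1.
have LL : 1 <= L by rewrite lerDr mulr_ge0 ?addr_ge0 ?mulr_ge0// ltW.
have Lm : m <= L.
  by rewrite /L mulrDr mulr1 -addrA addrCA lerDl addr_ge0// mulr_ge0 ?(ltW m0)// mulr_ge0// ltW.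
have L0 : 0 < L by exact: lt_le_trans LL.
exists kappa, L, r0; split => //.
- move=> [x t] [y u] /= fx fy xr yr; rewrite prod_normE /= ge_max /kappa /= joinB.
  apply/andP; split; last first.
    by apply: le_trans (norm_joinl (t - u) (be x - be y)) _; rewrite ler_peMl.
  have mr : 0 <= 2 * m * r0.
    by apply: mulr_ge0; [apply: mulr_ge0 => //; exact: ltW|exact: ltW].
  have r01 : r0 <= r1 by apply: le_trans (_ : r0 + 2 * m * r0 <= _); [rewrite lerDl|rewrite r0E].
  have lx := (fr x (lt_le_trans xr r01)).1 fx.
  have ly := (fr y (lt_le_trans yr r01)).1 fy.
  pose s := le y - le x; pose x' := x + s *: vertical O.
  have zx' : height O gamma x' = s by rewrite (chart_shift ch) zE lx subrr add0r.
  have zy : height O gamma y = 0 by rewrite zE ly subrr.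
  have sb : `|s| <= 2 * m * r0.
    rewrite /s -leB; apply: le_trans (lem _) _; rewrite mulrAC [leRHS]mulrC ler_wpM2l ?(ltW m0)//.
    rewrite -(subrKA x0) mulr_natl mulr2n; apply: le_trans (ler_normD _ _) _.
    by apply: lerD; [exact: ltW|rewrite distrC ltW].
  have x'r : `|x' - x0| <= r1.
    rewrite /x' addrAC -r0E; apply: le_trans (ler_normD _ _) _; apply: lerD; first exact: ltW.
    by rewrite normrZ; apply: le_trans sb; rewrite ler_piMr// (norm_chart_e ch).
  have lx' : le x' = le y.
    by rewrite /le level_line (level_vertical gc) mulr1 /s addrC subrK.
  have bx' : be x' = be x by rewrite /be base_line (base_vertical gc) scaler0 addr0.
  have h1 : `|x' - y| <= m * `|be x - be y|.
    by apply: le_trans (nm _) _; rewrite leB beB lx' bx' subrr normr0 add0r.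
  have h2 : `|s| <= L1 * (m * `|be x - be y|).
    have := zL x' y x'r (ltW (lt_le_trans yr r01)); rewrite zx' zy subr0 => h.
    by apply: le_trans h _; rewrite ler_wpM2l// ltW.
  apply: le_trans (_ : L * `|be x - be y| <= _); last by rewrite ler_wpM2l ?(ltW L0)// norm_joinr.
  apply: le_trans (nm _) _; rewrite leB beB distrC -/s.
  apply: le_trans (_ : m * (L1 * (m * `|be x - be y|) + `|be x - be y|) <= _).
    by rewrite ler_wpM2l ?(ltW m0)// lerD2r.
  have -> : m * (L1 * (m * `|be x - be y|) + `|be x - be y|) =
    m * (L1 * m + 1) * `|be x - be y| by ring.
  by rewrite ler_wpM2r// /L lerDl.
- move=> [x t] [y u]; rewrite /kappa /= joinB; apply: norm_join.
    rewrite prod_normE /=; apply: le_trans (_ : `|t - u| <= _) => //.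
    by apply: le_trans (_ : 1 * `|t - u| <= _); [rewrite mul1r|rewrite ler_pM// le_max lexx orbT].
  rewrite -beB; apply: le_trans (bem _) _; rewrite prod_normE /=.
  by rewrite ler_pM ?(ltW m0)// le_max lexx.
- move=> r2 r20; pose r3 := Num.min r2 r1.
  have r30 : 0 < r3 by rewrite lt_min r20.
  have lx0 : le x0 = gamma (be x0) by apply/fr => //; rewrite subrr normr0.
  have q0 : 0 < r3 / (4 * m) by rewrite divr_gt0// mulr_gt0.
  have /cvgrPdist_lt/(_ _ q0)/nbhs_normP[d /= d0 hd] := gcont (be x0).
  pose rho := Num.min (d / 2) (Num.min (r3 / (4 * m)) (r2 / 2)).
  have rho0 : 0 < rho by rewrite !lt_min q0 !divr_gt0.
  exists rho => // y yr; have [t [z yE]] := join_surj y.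
  rewrite yE /kappa /= joinB in yr.
  have tr := le_trans (norm_joinl _ _) yr; have zr := le_trans (norm_joinr _ _) yr.
  move: tr zr; rewrite /rho !le_min => /and3P[_ _ tr] /and3P[zd zq _].
  pose x : E := join (gamma z) z *m O.
  have bx : be x = z.
    by rewrite /be /base /x -mulmxA OOT mulmx1 /join row_mxKr.
  have lx : le x = gamma z.
    by rewrite /le /level /x -mulmxA OOT mulmx1 /join row_mxKl mxE.
  have gz : `|gamma z - gamma (be x0)| <= r3 / (4 * m).
    rewrite distrC; apply: ltW; apply: hd; rewrite /= distrC.
    by apply: le_lt_trans zd _; rewrite ltr_pdivrMr// ltr_pMr// ltr1n.
  have xx : `|x - x0| < r3.
    apply: le_lt_trans (nm _) _; rewrite leB beB lx bx lx0.
    apply: le_lt_trans (_ : m * (r3 / (4 * m) + r3 / (4 * m)) < _).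
      by rewrite ler_wpM2l ?(ltW m0)// lerD.
    have -> : m * (r3 / (4 * m) + r3 / (4 * m)) = r3 / 2 by field; rewrite gt_eqF.
    by rewrite ltr_pdivrMr// ltr_pMr// ltr1n.
  move: xx; rewrite lt_min => /andP[xr2 xr1].
  exists (x, t); split => //=.
  + by apply/fr => //; rewrite bx.
  + by apply: le_lt_trans tr _; rewrite ltr_pdivrMr// ltr_pMr// ltr1n.
  + by rewrite yE /kappa /= bx.
Qed.

End BoundaryCoordinates.

(** * Integration on the lateral boundary *)

Section SurfaceMeasure.
Context {R : realType} {n : nat}.
Local Notation E := 'rV[R]_n.+1.
Local Notation X := (@surface_type R n).
Local Notation mu := (@surface_measure R n).
Local Notation d := (@edist_xt R n.+1).
Implicit Types (K : set (E * R)) (g : E * R -> R).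

Lemma edist_norm (p q : E * R) : `|p - q| <= d p q.
Proof.
case: p q => [x t] [y s]; rewrite prod_normE /= ge_max /edist_xt /=.
apply/andP; split.
  apply: le_trans (norm_le_enorm _) _.
  by rewrite -[leLHS]ger0_norm ?enorm_ge0// -sqrtr_sqr ler_wsqrtr// lerDl sqr_ge0.
by rewrite -sqrtr_sqr ler_wsqrtr// lerDr sqr_ge0.
Qed.

Lemma edist_le (p q : E * R) : d p q <= (n.+2%:R + 1) * `|p - q|.
Proof.
case: p q => [x t] [y s]; rewrite /edist_xt /=.
have le1 : `|x - y| <= `|(x, t) - (y, s)| by rewrite prod_normE /= le_max lexx.
have le2 : `|t - s| <= `|(x, t) - (y, s)| by rewrite prod_normE /= le_max lexx orbT.
have e1 : enorm (x - y) <= n.+2%:R * `|(x, t) - (y, s)|.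
  by apply: le_trans (enorm_le_norm _) _; rewrite ler_wpM2l.
apply: le_trans (_ : enorm (x - y) + `|t - s| <= _); last by rewrite mulrDl mul1r lerD.
have e0 := enorm_ge0 (x - y).
rewrite -[leRHS]ger0_norm ?addr_ge0// -sqrtr_sqr ler_wsqrtr//.
rewrite -(real_normK (num_real (t - s))) [leRHS]sqrrD addrAC lerDl.
by rewrite mulrn_wge0// mulr_ge0.
Qed.

Lemma edist_c0 : 0 < n.+2%:R + 1 :> R. Proof. exact: addr_gt0. Qed.

(** Caratheodory's criterion for a metric outer measure, the norm being dominated by
    the Euclidean distance. *)
Lemma closed_surface K : closed K -> measurable (K : set X).
Proof.
move=> cK; apply: le_caratheodory_measurable => A.
exact: (closed_split n edist_norm A cK).
Qed.

Lemma continuous_measurable K g : closed K -> {within K, continuous g} ->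
  measurable_fun (K : set X) (g : X -> R).
Proof.
move=> cK gc; apply: (measurability _ (RGenCInfty.measurableE R)).
move=> _ [_ [c ->] <-]; apply: closed_surface => p cp.
have Kp : K p by apply: cK; apply: closure_subset cp => q [].
split => //=; rewrite in_itv/= andbT leNgt; apply/negP => h.
have h0 : 0 < c - g p by rewrite subr_gt0.
have [e e0 he] := within_continuous_le gc Kp h0.
have [q [[Kq /=]]] := (closure_normP _ p).1 cp e e0.
rewrite in_itv/= andbT => cq pq; have := he q Kq pq; rewrite distrC => /ltr_normlP[_].
by rewrite ltrD2r => /(le_lt_trans cq); rewrite ltxx.
Qed.

Lemma compact_integrable K g : compact K -> (mu K < +oo)%E ->
  {within K, continuous g} -> mu.-integrable (K : set X) (EFin \o (g : X -> R)).
Proof.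
move=> cK fK gc; have clK : closed K by apply: compact_closed cK; exact: norm_hausdorff.
apply: measurable_bounded_integrable => //; [exact: closed_surface|exact: continuous_measurable|].
have [B B0 hB] := compact_bounded cK gc.
exists B; split; first exact: num_real.
by move=> M BM p Kp /=; apply: le_trans (hB p Kp) _; exact: ltW.
Qed.

Definition shift_t (s : R) (p : E * R) : E * R := (p.1, p.2 + s).

Lemma shift_tK s : cancel (shift_t s) (shift_t (- s)).
Proof. by move=> [x t]; rewrite /shift_t /= addrK. Qed.

Lemma shift_iso s p q : d (shift_t s p) (shift_t s q) = d p q.
Proof. by rewrite /edist_xt /shift_t /= opprD addrACA subrr addr0. Qed.

Lemma shift_measure s (A : set (E * R)) :
  surface_outer (shift_t s @` A) = surface_outer A.
Proof.
apply/eqP; rewrite eq_le; apply/andP; split; first exact: hausdorff_image_le (shift_iso s).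
have E1 : shift_t (- s) @` (shift_t s @` A) = A.
  rewrite image_comp; apply/seteqP; split => [_ [p Ap <-]|p Ap]; first by rewrite /= shift_tK.
  by exists p => //=; rewrite shift_tK.
rewrite -{1}E1; exact: hausdorff_image_le (shift_iso (- s)).
Qed.

Lemma shift_preimage s (A : set (E * R)) : shift_t s @^-1` A = shift_t (- s) @` A.
Proof.
apply/seteqP; split => [p Ap|_ [p Ap <-] /=].
  by exists (shift_t s p) => //; rewrite shift_tK.
by have := shift_tK (- s) p; rewrite opprK => ->.
Qed.

Lemma shift_measurable s : measurable_fun [set: X] (shift_t s : X -> X).
Proof.
move=> _ Y mY; rewrite setTI; apply: le_caratheodory_measurable => A.
have sI B : surface_outer (A `&` shift_t s @^-1` B) = surface_outer (shift_t s @` A `&` B).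
  rewrite -(shift_measure s (A `&` _)).
  suff -> : shift_t s @` (A `&` shift_t s @^-1` B) = shift_t s @` A `&` B by [].
  apply/seteqP; split; first by move=> _ [p [Ap Bp] <-]; split => //; exists p.
  by move=> _ [[p Ap <-] Bp]; exists p.
rewrite preimage_setC !sI -(shift_measure s A).
by have := mY (shift_t s @` A); move=> <-.
Qed.

(** A translation in time is an isometry, so it preserves the Hausdorff measure. *)
Lemma shift_integral s K (g : E * R -> R) : closed K -> (shift_t s @^-1` K = K) ->
  continuous g -> (forall p, 0 <= g p) ->
  \int[mu]_(p in (K : set X)) g p = \int[mu]_(p in (K : set X)) g (shift_t s p).
Proof.
move=> cK sK gc g0; rewrite /Rintegral; congr fine.
have mK := closed_surface cK.
have gK : {within K, continuous g} by exact: continuous_subspaceT.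
have /measurable_EFinP mg := continuous_measurable cK gK.
rewrite -[in RHS]sK -(ge0_integral_pushforward (shift_measurable s) mu mK mg); last first.
  by move=> p _; rewrite lee_fin.
apply: eq_measure_integral; first exact: shift_measurable.
move=> mphi A mA _.
transitivity (surface_outer (shift_t s @^-1` A)); last by [].
by rewrite shift_preimage shift_measure.
Qed.

End SurfaceMeasure.

(** * Bounded weak time derivatives are slopes *)

Section WeakSlope.
Context {R : realType} {n : nat}.
Local Notation E := 'rV[R]_n.+1.
Local Notation X := (@surface_type R n).
Local Notation mu := (@surface_measure R n).

(** The quadratic remainder disappears when the interval is subdivided. *)
Lemma lipschitz_of_quadratic (F : R -> R) (a b A C : R) : a <= b -> 0 <= C ->
  (forall h h', a <= h -> h <= h' -> h' <= b -> `|F h' - F h| <= A * (h' - h) + C * (h' - h) ^+ 2) ->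
  `|F b - F a| <= A * (b - a).
Proof.
move=> ab C0 hF; apply/ler_addgt0Pr => e e0.
have B0 : 0 <= C * (b - a) ^+ 2 / e by rewrite divr_ge0 ?(ltW e0)// mulr_ge0// sqr_ge0.
pose N := (Num.bound (C * (b - a) ^+ 2 / e)).+1.
have NR : 0 < N%:R :> R by rewrite ltr0n.
have eN : C * (b - a) ^+ 2 / N%:R <= e.
  rewrite ler_pdivrMr// [e * _]mulrC -ler_pdivrMr//; apply: ltW.
  by apply: lt_trans (archi_boundP B0) _; rewrite ltr_nat.
pose dl := (b - a) / N%:R.
have dl0 : 0 <= dl by rewrite divr_ge0 ?subr_ge0// ltW.
have Ndl : N%:R * dl = b - a by rewrite /dl mulrC divfK// gt_eqF.
have step m : (m <= N)%N -> `|F (a + m%:R * dl) - F a| <= m%:R * (A * dl + C * dl ^+ 2).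
  elim: m => [|m IH] mN; first by rewrite !mul0r addr0 subrr normr0.
  have mb : a + m.+1%:R * dl <= b.
    by rewrite -lerBrDl -Ndl ler_wpM2r// ler_nat.
  have am : a <= a + m%:R * dl by rewrite lerDl mulr_ge0.
  have mm : a + m.+1%:R * dl - (a + m%:R * dl) = dl by rewrite -natr1; ring.
  have := hF (a + m%:R * dl) (a + m.+1%:R * dl) am _ mb; rewrite mm.
  move=> /(_ _)/wrap[|h]; first by rewrite lerD2l ler_wpM2r// ler_nat.
  rewrite -(subrKA (F (a + m%:R * dl))); apply: le_trans (ler_normD _ _) _.
  apply: le_trans (lerD h (IH (ltnW mN))) _.
  by rewrite [leLHS]addrC -natr1 mulrDl mul1r.
have bE : a + (b - a) = b by rewrite addrC subrK.
have := step N (leqnn N); rewrite Ndl bE => /le_trans; apply.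
rewrite mulrDr mulrCA Ndl lerD2l.
have -> : N%:R * (C * dl ^+ 2) = C * (b - a) ^+ 2 / N%:R.
  by rewrite /dl; field; rewrite gt_eqF.
exact: eN.
Qed.

Lemma span_le (a b q t : R) : 0 < q -> a <= b -> a - q <= t -> t <= b + q -> `|t - a| <= q + (b - a + q).
Proof. by move=> q0 ab t1 t2; rewrite ler_norml; apply/andP; split; lra. Qed.

Variables (Omega : set E) (T D : R) (f w : E * R -> R).
Hypothesis oOmega : open Omega.
Hypothesis bOmega : bounded_set Omega.
Hypothesis C3 : class_C 3 Omega.
Hypothesis D0 : 0 <= D.
Local Notation Sigma := (cylinder (frontier Omega) T).
Hypothesis fc : {within Sigma, continuous f}.
Hypothesis wdt : bounded_weak_dt Omega T f w.
Hypothesis wD : (Linf_norm mu Sigma w <= D%:E)%E.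

Lemma frontier_closed : closed (frontier Omega).
Proof. by apply: compact_closed; [exact: norm_hausdorff|exact: frontier_compact]. Qed.

Lemma Sigma_in x t : Sigma (x, t) <-> frontier Omega x /\ 0 < t < T.
Proof. by split => -[fx tT]; split => //; move: tT; rewrite /= in_itv/=. Qed.

Let side := [set p : E * R | frontier Omega p.1].

Let side_closed : closed side.
Proof. by apply: (preimage_closed (f := fst)) frontier_closed => p _; exact: cvg_fst. Qed.

Lemma Sigma_measurable : measurable (Sigma : set X).
Proof.
have -> : Sigma = side `&` ~` ([set p | p.2 <= 0] `|` [set p | T <= p.2]).
  apply/seteqP; split => [[x t] /Sigma_in[fx /andP[t0 tT]]|[x t] [fx /not_orP[/= t0 tT]]].
    by split => //= -[]; rewrite leNgt ?t0 ?tT.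
  by apply/Sigma_in; split => //; rewrite !ltNge; apply/andP; split; apply/negP.
have c1 : closed [set p : E * R | p.2 <= 0].
  have -> : [set p : E * R | p.2 <= 0] = snd @^-1` [set s | s <= 0] by [].
  by apply: preimage_closed; [move=> p _; exact: cvg_snd|exact: closed_le].
have c2 : closed [set p : E * R | T <= p.2].
  have -> : [set p : E * R | T <= p.2] = snd @^-1` [set s | T <= s] by [].
  by apply: preimage_closed; [move=> p _; exact: cvg_snd|exact: closed_ge].
apply: measurableI; first exact: closed_surface.
by apply: measurableC; apply: measurableU; exact: closed_surface.
Qed.

Lemma weak_ae : {ae mu, forall p : X, Sigma p -> (`|(w p)%:E| <= D%:E)%E}.
Proof.
have h : {ae mu, forall p : X, (`|(EFin \o (w \_ Sigma)) p| <= D%:E)%E}.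
  move: wD; rewrite /Linf_norm unlock; case: ifPn => [_|]; first by move/ess_supP.
  rewrite -leNgt => m0 _; exists [set: X]; split => //.
  by apply/eqP; rewrite eq_le m0 measure_ge0.
apply: filterS h => p + Sp; by rewrite /= patchE mem_set.
Qed.

Section Patch.
Variables (x0 : E) (a b r rt : R).
Hypothesis fx0 : frontier Omega x0.
Hypothesis ab : a <= b.
Hypothesis r0 : 0 < r.
Hypothesis rt0 : 0 < rt.
Hypothesis rta : rt < a.
Hypothesis rtb : b + rt < T.

(** A part of Sigma that contains the supports in Sigma of all the bumps centred at the
    points (x0, h) with a <= h <= b. *)
Definition patch_set : set (E * R) :=
  (frontier Omega `&` [set x | `|x - x0| <= r]) `*` `[a - rt, b + rt].
Local Notation K := patch_set.
Hypothesis muK : (mu K < +oo)%E.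
Local Notation J g := (\int[mu]_(p in (K : set X)) g p).
Let B h : E * R -> R := bump x0 r h rt.
Let G h (p : E * R) : R := eta x0 r p.1 * hat_d rt (p.2 - h).

Let cK : compact K.
Proof.
apply: compact_setX; last exact: segment_compact.
apply: (subclosed_compact _ (frontier_compact bOmega)); last by move=> x [].
apply: closedI; first exact: frontier_closed.
by apply: compact_closed; [exact: norm_hausdorff|exact: closed_ball_compact].
Qed.

Let clK : closed K. Proof. by apply: compact_closed cK; exact: norm_hausdorff. Qed.
Let mK : measurable (K : set X). Proof. exact: closed_surface. Qed.

Let K_Sigma : K `<=` Sigma.
Proof.
move=> [x t] [[/= fx _]]; rewrite /= in_itv/= => /andP[t1 t2]; apply/Sigma_in; split => //.
by rewrite (lt_le_trans _ t1) ?subr_gt0//= (le_lt_trans t2).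
Qed.

Let fK : {within K, continuous f}. Proof. exact: continuous_subspaceW K_Sigma fc. Qed.

Let Bc h : continuous (B h).
Proof. by have [c _] := bump_smooth x0 r h rt 0; exact: continuous_upto_setT. Qed.

Let Gc h : continuous (G h).
Proof.
have [_ d] := bump_smooth x0 r h rt 1; have [_ [c _]] := d time_vec I.
have -> : G h = 'D_time_vec (bump x0 r h rt).
  by apply/funext => -[x t]; rewrite bump_dt.
exact: continuous_upto_setT.
Qed.

Let withinM (g1 g2 : E * R -> R) : {within K, continuous g1} -> {within K, continuous g2} ->
  {within K, continuous (fun p => g1 p * g2 p)}.
Proof.
move=> /within_continuousP h1 /within_continuousP h2; apply/within_continuousP => p Kp.
exact: cvgM (h1 p Kp) (h2 p Kp).
Qed.

Let int g : {within K, continuous g} -> mu.-integrable (K : set X) (EFin \o (g : X -> R)).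
Proof. exact: compact_integrable. Qed.

Let Bint h : mu.-integrable (K : set X) (EFin \o (B h : X -> R)).
Proof. by apply: int; exact: continuous_subspaceT. Qed.

Let fBint h : mu.-integrable (K : set X) (EFin \o ((fun p => f p * B h p) : X -> R)).
Proof. by apply: int; apply: withinM => //; exact: continuous_subspaceT. Qed.

Let fGint h : mu.-integrable (K : set X) (EFin \o ((fun p => f p * G h p) : X -> R)).
Proof. by apply: int; apply: withinM => //; exact: continuous_subspaceT. Qed.

Let out h x t : a <= h <= b -> frontier Omega x -> ~ K (x, t) ->
  B h (x, t) = 0 /\ G h (x, t) = 0.
Proof.
move=> /andP[ah hb] fx nK; rewrite /B /bump /G /=.
have [xr|xr] := leP r `|x - x0|; first by rewrite eta_eq0// !mul0r.
have tr : rt <= `|t - h|.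
  rewrite leNgt; apply/negP; rewrite ltr_distl => /andP[t1 t2]; apply: nK.
  split; first by split => //=; exact: ltW.
  rewrite /= in_itv/=; apply/andP; split; apply: ltW.
    by apply: le_lt_trans t1; rewrite lerD2r.
  by apply: lt_le_trans t2 _; rewrite lerD2r.
by rewrite hat_eq0// hat_d_eq0// !mulr0.
Qed.

Let restrict (S : set (E * R)) (g : E * R -> R) : K `<=` S ->
  (forall p, S p -> ~ K p -> g p = 0) ->
  \int[mu]_(p in (S : set X)) g p = J g.
Proof.
move=> KS g0; rewrite Rintegral_mkcond [RHS]Rintegral_mkcond; congr Rintegral.
apply/funext => p; rewrite !patchE; case: ifPn => Sp; case: ifPn => Kp //.
  by rewrite g0//; [exact: set_mem|move=> Kp'; move/negP : Kp; apply; exact: mem_set].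
by move/negP : Sp; case; apply: mem_set; apply: KS; exact: set_mem.
Qed.

(** G h is the time derivative of the test function B h. *)
Let weak h : a <= h <= b -> J (fun p => f p * G h p) = - J (fun p => w p * B h p).
Proof.
move=> hab; have /andP[ah hb] := hab; have [_ _ hw] := wdt.
have := hw (B h) (bump_test x0 r0 (lt_le_trans rta ah) (le_lt_trans (_ : h + rt <= b + rt) rtb)).
rewrite lerD2r => /(_ hb).
have -> : (fun p : X => f p * 'D_time_vec (B h) p) = (fun p : X => f p * G h p).
  by apply/funext => -[x t]; rewrite /B bump_dt.
rewrite -(restrict (S := Sigma) (g := fun p => f p * G h p) K_Sigma); last first.
  by move=> [x t] /Sigma_in[fx _] nK; have [_ ->] := out hab fx nK; rewrite mulr0.
rewrite -(restrict (S := Sigma) (g := fun p => w p * B h p) K_Sigma) => [->//|].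
by move=> [x t] /Sigma_in[fx _] nK; have [-> _] := out hab fx nK; rewrite mulr0.
Qed.

Let weak_bound h : `|J (fun p => w p * B h p)| <= D * J (B h).
Proof.
have [mw _ _] := wdt.
have mS := Sigma_measurable.
have mwK : measurable_fun (K : set X) (w : X -> R).
  exact: measurable_funS mS K_Sigma mw.
have mB : measurable_fun (K : set X) (B h : X -> R).
  by apply: continuous_measurable => //; exact: continuous_subspaceT.
have mwB := measurable_funM mwK mB.
have DB := integrableZl mK D (Bint h).
rewrite -RintegralZl//.
have le1 : (`|\int[mu]_(p in (K : set X)) (w p * B h p)%:E| <=
    \int[mu]_(p in (K : set X)) (D * B h p)%:E)%E.
  apply: le_trans (le_abse_integral mu mK _) _; first exact/measurable_EFinP.
  apply: (@ae_ge0_le_integral _ X R mu K mK (fun p => `|(w p * B h p)%:E|%E)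
    (fun p => (D * B h p)%:E)).
  - by [].
  - apply/measurable_EFinP; exact: (measurableT_comp (@normr_measurable R setT) mwB).
  - by move=> p _; rewrite lee_fin mulr_ge0// bump_ge0.
  - by apply/measurable_EFinP; apply: measurable_funM.
  - apply: filterS weak_ae => p hp Kp; have := hp (K_Sigma Kp).
    rewrite !abse_EFin !lee_fin normrM (ger0_norm (bump_ge0 _ _ _ _ _)) => h1.
    by rewrite ler_wpM2r// bump_ge0.
have fin : (\int[mu]_(p in (K : set X)) (D * B h p)%:E)%E \is a fin_num.
  exact: integrable_fin_num DB.
have fin2 : (\int[mu]_(p in (K : set X)) (w p * B h p)%:E)%E \is a fin_num.
  by rewrite -abse_fin_num ge0_fin_numE// (le_lt_trans le1)// ltey_eq fin.
by rewrite /Rintegral -lee_fin -abse_EFin fineK// fineK.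
Qed.

Let I := J (B a).

(** B h is a translate in time of B a. *)
Let J_translate h : a <= h <= b -> J (B h) = I.
Proof.
move=> hab; have aab : a <= a <= b by rewrite lexx.
have KS : K `<=` side by move=> p [[]].
have toS h' : a <= h' <= b -> \int[mu]_(p in (side : set X)) B h' p = J (B h').
  by move=> h'ab; apply: restrict => // -[x t] fx nK; have [] := out h'ab fx nK.
rewrite /I -toS// -toS// (shift_integral (s := h - a) side_closed) //; last first.
  by move=> p; exact: bump_ge0.
congr Rintegral; apply/funext => -[x t]; rewrite /B /bump /shift_t /=.
by congr (_ * hat _ _); ring.
Qed.

(** J (f B h) has the h-derivative - J (f G h) = J (w B h), at most D I in absolute
    value; the remainder is uniform in h because that of Taylor's formula for the bump
    is. *)
Let quadratic : exists2 V : R, 0 <= V & forall h h', a <= h -> h <= h' -> h' <= b ->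
  `|J (fun p => f p * B h' p) - J (fun p => f p * B h p)| <= D * I * (h' - h) + V * (h' - h) ^+ 2.
Proof.
have [Bf Bf0 hBf] := compact_bounded cK fK.
have [m mE m0] : exists2 m, fine (mu K) = m & 0 <= m.
  by exists (fine (mu K)) => //; apply: fine_ge0; exact: measure_ge0.
exists (1000 * Bf * m); first exact: mulr_ge0 (mulr_ge0 (ler0n _ 1000) (ltW Bf0)) m0.
move=> h h' ah hh hb; set k := h' - h.
have k0 : 0 <= k by rewrite subr_ge0.
have hab : a <= h <= b by rewrite ah (le_trans hh hb).
pose g p := f p * B h' p - f p * B h p + k * (f p * G h p).
have kG : mu.-integrable (K : set X) (EFin \o ((fun p => k * (f p * G h p)) : X -> R)).
  exact: (integrableZl mK k (fGint h)).
have dB := integrableB mK (fBint h') (fBint h).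
have gint : mu.-integrable (K : set X) (EFin \o (g : X -> R)) := integrableD mK dB kG.
have Jg : J g = J (fun p => f p * B h' p) - J (fun p => f p * B h p) + k * J (fun p => f p * G h p).
  rewrite (RintegralD mK dB kG) (RintegralB mK (fBint h') (fBint h)).
  by rewrite (RintegralZl k mK (fGint h)).
have cint c : mu.-integrable (K : set X) (EFin \o ((fun=> c) : X -> R)).
  by apply: int; apply: continuous_subspaceT => p; exact: cvg_cst.
have gle : `|J g| <= 1000 * Bf * m * k ^+ 2.
  apply: le_trans (le_normr_Rintegral mK gint) _.
  have -> : 1000 * Bf * m * k ^+ 2 = J (fun=> 1000 * Bf * k ^+ 2).
    by rewrite (Rintegral_cst mu mK) mE; ring.
  apply: (le_Rintegral mK _ (cint _)); first exact: integrable_norm gint.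
  move=> [x t] Kp; rewrite /g /B /bump /G /=.
  have hT := hat_taylor rt (t - h) (- k).
  have tE : t - h + - k = t - h' by rewrite /k; ring.
  rewrite tE normrN (ger0_norm k0) in hT.
  have -> : f (x, t) * (eta x0 r x * hat rt (t - h')) - f (x, t) * (eta x0 r x * hat rt (t - h)) +
      k * (f (x, t) * (eta x0 r x * hat_d rt (t - h))) =
    (f (x, t) * eta x0 r x) * (hat rt (t - h') - hat rt (t - h) - - k * hat_d rt (t - h)) by ring.
  rewrite normrM [1000 * Bf]mulrC -mulrA; apply: ler_pM => //.
  rewrite normrM -[leRHS]mulr1; apply: ler_pM => //; first exact: hBf.
  by rewrite ger0_norm ?eta_ge0// eta_le1.
have GE : J (fun p => f p * G h p) = - J (fun p => w p * B h p) := weak hab.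
have wle : `|J (fun p => w p * B h p)| <= D * I by rewrite -(J_translate hab); exact: weak_bound.
move: Jg; rewrite GE mulrN => Jg.
have -> : J (fun p => f p * B h' p) - J (fun p => f p * B h p) =
  J g + k * J (fun p => w p * B h p) by rewrite Jg subrK.
apply: le_trans (ler_normD _ _) _; rewrite addrC; apply: lerD; last exact: gle.
by rewrite normrM (ger0_norm k0) mulrC ler_wpM2r.
Qed.

(** J (f B h) / I is a weighted average of f near (x0, h). *)
Let average h c e : a <= h <= b -> (forall p, K p -> `|p.2 - h| <= rt -> `|f p - c| <= e) ->
  `|J (fun p => f p * B h p) - c * I| <= e * I.
Proof.
move=> hab he; rewrite -(J_translate hab).
have cB := integrableZl mK c (Bint h); have eB := integrableZl mK e (Bint h).
rewrite -(RintegralZl c mK (Bint h)) -(RintegralZl e mK (Bint h)).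
rewrite -(RintegralB mK (fBint h) cB).
have dB := integrableB mK (fBint h) cB.
apply: le_trans (le_normr_Rintegral mK dB) _.
apply: (le_Rintegral mK _ eB); first exact: integrable_norm dB.
move=> p Kp; rewrite -mulrBl normrM (ger0_norm (bump_ge0 _ _ _ _ _)).
have [pr|pr] := leP `|p.2 - h| rt; first by apply: ler_wpM2r; [exact: bump_ge0|exact: he].
by rewrite /B /bump hat_eq0 ?(ltW pr)// !mulr0.
Qed.

Definition patch_core : set (E * R) :=
  (frontier Omega `&` [set x | `|x - x0| <= r / 2]) `*` `[a - rt / 2, a + rt / 2].
Hypothesis muU : (0 < mu patch_core)%E.

Let I_gt0 : 0 < I.
Proof.
have r2 : r / 2 < r by rewrite ltr_pdivrMr// ltr_pMr// ltr1n.
have rt2 : rt / 2 < rt by rewrite ltr_pdivrMr// ltr_pMr// ltr1n.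
have UK : patch_core `<=` K.
  move=> [x t] [[/= fx xr]]; rewrite /= in_itv/= => /andP[t1 t2]; split.
    by split => //=; exact: le_trans xr (ltW r2).
  rewrite /= in_itv/=; apply/andP; split.
    by apply: le_trans t1; rewrite lerD2l lerN2 ltW.
  by apply: le_trans t2 _; rewrite lerD// ltW.
have cU : compact patch_core.
  apply: compact_setX; last exact: segment_compact.
  apply: (subclosed_compact _ (frontier_compact bOmega)); last by move=> x [].
  apply: closedI; first exact: frontier_closed.
  by apply: compact_closed; [exact: norm_hausdorff|exact: closed_ball_compact].
have mU : measurable (patch_core : set X).
  by apply: closed_surface; apply: compact_closed cU; exact: norm_hausdorff.
have neU : patch_core !=set0.
  exists (x0, a); split; first by split => //=; rewrite subrr normr0 divr_ge0// ltW.
  by rewrite /= in_itv/= gerBl lerDl divr_ge0// ltW.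
have BU : {within patch_core, continuous (B a)} by exact: continuous_subspaceT.
have [[xm tm] /set_mem[[/= fxm xmr]]] := compact_EVT_min neU cU BU.
rewrite /= in_itv/= => tmr minB.
have b0 : 0 < B a (xm, tm).
  rewrite /B /bump /= mulr_gt0// ?eta_gt0 ?hat_gt0//; first exact: le_lt_trans xmr r2.
  by apply: le_lt_trans rt2; rewrite ler_distl.
have mBK : measurable_fun (K : set X) (EFin \o (B a : X -> R)).
  exact: (measurable_int mu (Bint a)).
have le1 : ((B a (xm, tm))%:E * mu patch_core <= \int[mu]_(p in (K : set X)) (B a p)%:E)%E.
  apply: le_trans (ge0_subset_integral mu mU mK mBK _ UK); last first.
    by move=> p _; rewrite lee_fin; exact: bump_ge0.
  rewrite -(integral_cst mu mU); apply: ge0_le_integral => //.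
  - by move=> p _; rewrite lee_fin; exact: bump_ge0.
  - exact: measurable_funS mK UK mBK.
  - by move=> p Up; rewrite lee_fin; apply: minB; exact: mem_set.
rewrite /I /Rintegral; apply: fine_gt0; apply/andP; split.
  by apply: lt_le_trans le1; apply: mule_gt0; rewrite ?lte_fin.
by rewrite ltey_eq (integrable_fin_num mK (Bint a)).
Qed.

(** ca and cb stand for the values of f at (x0, a) and (x0, b). *)
Lemma patch_slope ca cb e :
  (forall p, K p -> `|p.2 - a| <= rt -> `|f p - ca| <= e) ->
  (forall p, K p -> `|p.2 - b| <= rt -> `|f p - cb| <= e) ->
  `|cb - ca| <= D * (b - a) + 2 * e.
Proof.
move=> ha hb; have aab : a <= a <= b by rewrite lexx.
have bab : a <= b <= b by rewrite lexx andbT.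
have [V V0 hV] := quadratic.
have jump := lipschitz_of_quadratic (F := fun h => J (fun p => f p * B h p)) ab V0 hV.
have := average aab ha; have := average bab hb; move: jump.
move: (J (fun p => f p * B b p)) (J (fun p => f p * B a p)) => jb ja jump avb ava.
rewrite -(ler_pM2r I_gt0) -[X in `|_| * X]gtr0_norm// -normrM.
have -> : (cb - ca) * I = (cb * I - jb) + (jb - ja) + (ja - ca * I) by ring.
apply: le_trans (ler_normD _ _) _.
apply: le_trans (lerD (ler_normD _ _) (lexx _)) _.
rewrite (distrC (cb * I)).
apply: le_trans (lerD (lerD avb jump) ava) _.
by rewrite le_eqVlt; apply/orP; left; apply/eqP; ring.
Qed.

End Patch.

(** Averages over shrinking patches tend to the values of the continuous function f.
    The patches have finite and positive measure, by bi-Lipschitz coordinates. *)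
Lemma slope_bound x0 a b : frontier Omega x0 -> 0 < a -> a <= b -> b < T ->
  `|f (x0, b) - f (x0, a)| <= D * (b - a).
Proof.
move=> fx0 a0 ab bT; apply/ler_addgt0Pr => e e0.
have e20 : 0 < e / 2 by rewrite divr_gt0.
have cont h : 0 < h < T -> exists2 dl : R, 0 < dl & forall p, Sigma p ->
    `|p.1 - x0| < dl -> `|p.2 - h| < dl -> `|f p - f (x0, h)| <= e / 2.
  move=> hT; have Sh : Sigma (x0, h) by apply/Sigma_in.
  move/within_continuousP: fc => /(_ (x0, h) Sh) /cvgrPdist_le /(_ _ e20) /nbhs_ballP[dl /= dl0 hdl].
  exists dl => // -[x t] Sp /= xd td; rewrite distrC; apply: hdl => //.
  by split; rewrite -ball_normE /ball_ /= distrC.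
have aT : 0 < a < T by rewrite a0 (le_lt_trans ab bT).
have bT' : 0 < b < T by rewrite bT (lt_le_trans a0 ab).
have [da da0 hda] := cont a aT.
have [db db0 hdb] := cont b bT'.
have [kappa [L [r0 [L0 r00 lo hi onto]]]] := boundary_coordinates oOmega a C3 fx0.
have Tb0 : 0 < T - b by rewrite subr_gt0.
pose q := Num.min (Num.min a (T - b)) (Num.min (Num.min da db) r0) / 2.
have m0 : 0 < Num.min (Num.min a (T - b)) (Num.min (Num.min da db) r0).
  by rewrite !lt_min a0 Tb0 da0 db0.
have q0 : 0 < q by rewrite divr_gt0.
have : q < Num.min (Num.min a (T - b)) (Num.min (Num.min da db) r0).
  by rewrite /q ltr_pdivrMr// ltr_pMr// ltr1n.
rewrite !lt_min => /andP[/andP[qa qT] /andP[/andP[qda qdb] qr]].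
have qbT : b + q < T by rewrite -ltrBrDl.
set K := patch_set x0 a b q q.
have Kin p : K p -> [/\ frontier Omega p.1, `|p.1 - x0| <= q & a - q <= p.2 <= b + q].
  by case: p => x t [[/= fx xq]]; rewrite /= in_itv.
have muK : (mu K < +oo)%E.
  have A0 : 0 < L * (q + (b - a + q)).
    by apply: mulr_gt0 => //; apply: ltr_pwDl => //; rewrite addr_ge0 ?subr_ge0// ltW.
  change (hausdorff (@edist_xt R n.+1) n K < +oo)%E.
  apply: (lipschitz_finite (@edist_c0 R n) (@edist_le R n) L0 (y0 := kappa (x0, a)) A0).
    move=> [x t] /Kin[/= fx xq /andP[t1 t2]].
    apply: le_trans (hi _ _) _; rewrite ler_wpM2l ?(ltW L0)// prod_normE /= ge_max.
    apply/andP; split; first by rewrite ler_wpDr// addr_ge0 ?subr_ge0// ltW.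
    exact: (span_le q0 ab t1 t2).
  move=> p p' /Kin[fp pq _] /Kin[fp' pq' _].
  by apply: lo => //; [exact: le_lt_trans pq qr|exact: le_lt_trans pq' qr].
have muU : (0 < mu (patch_core x0 a q q))%E.
  have q20 : 0 < q / 2 by rewrite divr_gt0.
  have [rho rho0 hrho] := onto (q / 2) q20.
  change (0 < hausdorff (@edist_xt R n.+1) n (patch_core x0 a q q))%E.
  apply: (lipschitz_positive (@edist_norm R n) L0 rho0 (kappa := kappa) (y0 := kappa (x0, a))).
    move=> y /hrho[[x t] [/= fx xq tq ky]]; exists (x, t) => //.
    split; first by split => //=; exact: ltW.
    by rewrite /= in_itv/= -ler_distl; exact: ltW.
  by move=> p p' _ _; exact: hi.
have -> : D * (b - a) + e = D * (b - a) + 2 * (e / 2) by rewrite [2 * _]mulrC divfK// pnatr_eq0.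
apply: (patch_slope fx0 ab q0 q0 qa qbT muK muU).
  move=> p Kp pa; have [fp pq /andP[p1 p2]] := Kin p Kp; apply: hda.
  - case: p Kp pa fp pq p1 p2 => x t /= _ _ fx _ t1 t2; apply/Sigma_in; split => //.
    by rewrite (lt_le_trans _ t1) ?subr_gt0//= (le_lt_trans t2).
  - exact: le_lt_trans pq qda.
  - exact: le_lt_trans pa qda.
move=> p Kp pb; have [fp pq /andP[p1 p2]] := Kin p Kp; apply: hdb.
- case: p Kp pb fp pq p1 p2 => x t /= _ _ fx _ t1 t2; apply/Sigma_in; split => //.
  by rewrite (lt_le_trans _ t1) ?subr_gt0//= (le_lt_trans t2).
- exact: le_lt_trans pq qdb.
- exact: le_lt_trans pb qdb.
Qed.

End WeakSlope.

(** * The jump of the normal derivatives *)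

Section Conclusion.
Context {R : realType} {n : nat}.
Local Notation E := 'rV[R]_n.+1.

(** The essential supremum is at most the supremum. *)
Lemma Linf_itv_le (T B : R) (f : R -> R) : 0 <= B ->
  (forall t, 0 < t < T -> `|f t| <= B) -> (Linf_norm_itv T f <= B%:E)%E.
Proof.
move=> B0 fB; rewrite /Linf_norm_itv /Linf_norm unlock; case: ifPn => _; last by rewrite lee_fin.
apply/ess_supP; apply: aeW => t /=; rewrite patchE; case: ifPn => [/set_mem|_]; last first.
  by rewrite lee_fin normr0.
by rewrite /= in_itv/= lee_fin => /fB.
Qed.

Variables (Omega : set E) (T : R).
Hypothesis oOmega : open Omega.
Hypothesis bOmega : bounded_set Omega.
Hypothesis T0 : 0 < T.
Hypothesis C3 : class_C 3 Omega.

Lemma slope_continuous c r e z zd zdd : chart Omega c r e z zd zdd ->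
  continuous (slope zd : E -> R).
Proof.
move=> ch x; rewrite /slope.
have sc s : continuous (fun y : E => \sum_(i <- s) zd i y * zd i y : R).
  elim: s => [|i s IH] y.
    have -> : (fun y : E => \sum_(i <- [::]) zd i y * zd i y) = fun=> 0.
      by apply/funext => y'; rewrite big_nil.
    exact: cst_continuous.
  have -> : (fun y : E => \sum_(j <- i :: s) zd j y * zd j y) =
      fun y => zd i y * zd i y + \sum_(j <- s) zd j y * zd j y.
    by apply/funext => y'; rewrite big_cons.
  by apply: cvgD (IH y); apply: cvgM; exact: (chart_zdc ch).
apply: (@continuous_comp _ _ _ (fun x => \sum_i zd i x * zd i x) Num.sqrt); last exact: sqrt_continuous.
exact: sc.
Qed.

(** One chart serves all the boundary points near a given one. *)
Lemma normal_jump_continuous u1 u2 : cyl_C1 Omega T u1 -> cyl_C1 Omega T u2 ->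
  same_data Omega T u1 u2 ->
  {within cylinder (frontier Omega) T, continuous (normal_jump Omega T u1 u2)}.
Proof.
move=> u1C u2C u12; apply/within_continuousP => -[x t] /Sigma_in[fx tT].
have [L [d [_ d0 hL]]] := uniform_charts bOmega C3.
have [e [z [zd [zdd [ch _]]]]] := hL x fx.
have [_ us _] := diff_C1 u1C u2C; have [_ /cont_extP[vc _]] := us (e, 0) erefl.
set v := cont_ext _ _ in vc.
have d20 : 0 < d / 2 by rewrite divr_gt0.
have jE y s : frontier Omega y -> 0 < s < T -> `|y - x| < d / 2 ->
    normal_jump Omega T u1 u2 (y, s) = - (slope zd y * v (y, s)).
  move=> fy sT yx; have chy : chart Omega y (d / 2) e z zd zdd.
    by apply: (chart_recenter ch) => //; rewrite [leRHS](splitr d) lerD2r ltW.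
  apply: (normal_derivative_diff oOmega T0 chy fy sT u1C u2C) => w fw.
  case/andP: sT => s0 sT; rewrite u12 ?(ltW s0)//; [exact: (frontier_closure oOmega)|by left].
have xx : `|x - x| < d / 2 by rewrite subrr normr0.
rewrite (jE x t fx tT xx).
have vt : v p @[p --> within (cylinder (frontier Omega) T) (nbhs (x, t))] --> v (x, t).
  have sub : cylinder (frontier Omega) T `<=` closure (cylinder Omega T).
    move=> [y s] /Sigma_in[fy /andP[s0 sT]]; apply: (Qcl T0) => /=; last by rewrite ltW.
    exact: (frontier_closure oOmega).
  have /within_continuousP := continuous_subspaceW sub vc.
  by apply; apply/Sigma_in.
have st : slope zd p.1 @[p --> within (cylinder (frontier Omega) T) (nbhs (x, t))] --> slope zd x.
  apply: cvg_within_filter.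
  apply: (@continuous_comp _ _ _ fst (slope zd) (x, t)); first exact: cvg_fst.
  exact: (slope_continuous ch).
apply: cvg_trans (cvgN (cvgM st vt)); apply: near_eq_cvg.
have nx : nbhs (x, t) [set p : E * R | `|p.1 - x| < d / 2].
  apply/nbhs_ballP; exists (d / 2) => // -[y s] [/= + _].
  by rewrite -ball_normE /ball_ /= distrC.
apply: (filterS _ nx) => -[y s] /= yx /Sigma_in[fy sT].
by rewrite (jE y s fy sT yx).
Qed.

(** The supremum norm of a weak time derivative of the jump of the normal
    derivatives is a Lipschitz constant of that jump. *)
Lemma weak_jump_lip u1 u2 w (D D' : R) : cyl_C1 Omega T u1 -> cyl_C1 Omega T u2 ->
  same_data Omega T u1 u2 -> bounded_weak_dt Omega T (normal_jump Omega T u1 u2) w ->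
  0 <= D -> (Linf_norm surface_measure (cylinder (frontier Omega) T) w <= D%:E)%E -> D <= D' ->
  normal_jump_lip Omega T D' u1 u2.
Proof.
move=> u1C u2C u12 wdt D0 wD DD x t t' fx tT t'T.
have jc := normal_jump_continuous u1C u2C u12.
have pos s s' : 0 < s < T -> 0 < s' < T -> s <= s' ->
    `|normal_jump Omega T u1 u2 (x, s') - normal_jump Omega T u1 u2 (x, s)| <= D' * (s' - s).
  move=> /andP[s0 _] /andP[_ sT] ss.
  apply: le_trans (slope_bound oOmega bOmega C3 D0 jc wdt wD fx s0 ss sT) _.
  by rewrite ler_wpM2r ?subr_ge0.
have [tt|/ltW tt] := leP t t'; last by rewrite (ger0_norm (_ : 0 <= t - t')) ?subr_ge0//; exact: pos.
by rewrite distrC (distrC t) (ger0_norm (_ : 0 <= t' - t)) ?subr_ge0//; exact: pos.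
Qed.

End Conclusion.

Theorem theorem2 (R : realType) (n : nat) (n_ge2 : (2 <= n.+1)%N)
    (Omega : set 'rV[R]_n.+1) (T alpha M : R)
    (h : 'rV[R]_n.+1 -> R) (g : 'rV[R]_n.+1 * R -> R)
    (F : 'rV[R]_n.+1 * R * R * R -> R)
    (dom_Omega : is_domain Omega) (bnd_Omega : bounded_set Omega)
    (C3_Omega : class_C 3 Omega)
    (T_gt0 : 0 < T) (alpha01 : 0 < alpha < 1)
    (h_reg : C2_holder_closure alpha Omega h)
    (g_reg : lateral_C2holder Omega T alpha g)
    (F_reg : nonlinearity_regular Omega F)
    (M_gt0 : 0 < M)
    (F_nondeg : exists x0, frontier Omega x0 /\
      0 < inf [set `|d_sigma F (x0, p.1, p.2, g (x0, p.1))|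
              | p in `[0, T] `*` `[- M, M]])
    (F_growth : exists c d : R, [/\ 0 <= c, 0 <= d &
      forall sigma : R -> R, C1_itv T sigma ->
      forall (t : R) (x : 'rV[R]_n.+1) (u : R),
        0 <= t <= T -> closure Omega x ->
        u * F (x, t, sigma t, u) <= c * u ^+ 2 + d]) :
  exists C : R, 0 < C /\
    forall (sigma1 sigma2 : R -> R) (u1 u2 : 'rV[R]_n.+1 * R -> R),
      C1_ball T M sigma1 -> C1_ball T M sigma2 ->
      compatible Omega T F h g sigma1 -> compatible Omega T F h g sigma2 ->
      is_solution Omega T alpha F h g sigma1 u1 ->
      is_solution Omega T alpha F h g sigma2 u2 ->
      (Linf_norm_itv T (fun t => sigma2 t - sigma1 t)%R
       <= C%:E * dt_Linf_norm Omega T (fun p => (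
            normal_derivative Omega T u2 p - normal_derivative Omega T u1 p)%R))%E.
Proof.
have [oOmega _ _] := dom_Omega.
have [C C0 hC] := pointwise_stability oOmega bnd_Omega T_gt0 C3_Omega alpha h M_gt0 F_reg F_nondeg F_growth.
exists C; split => // sigma1 sigma2 u1 u2 b1 b2 _ _ s1 s2.
have [u1C _] := solution_solves oOmega s1; have [u2C _] := solution_solves oOmega s2.
have u12 := solutions_same_data oOmega T_gt0 s1 s2.
rewrite -lee_pdivrMl//; apply: le_ereal_inf_tmp => _ [w wdt <-]; rewrite lee_pdivrMl//.
have [_ wfin _] := wdt.
set N := Linf_norm _ _ _ in wfin *.
have N0 : (0 <= N)%E by exact: Lnorm_ge0.
have NE : N = (fine N)%:E by rewrite fineK// ge0_fin_numE.
have D0 : 0 <= fine N by exact: fine_ge0.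
rewrite NE -EFinM; apply: Linf_itv_le; first by rewrite mulr_ge0// ltW.
move=> t tT; apply/ler_addgt0Pr => e e0.
(* The norm may vanish whereas the Lipschitz constant is taken positive. *)
have eC : 0 < e / C by rewrite divr_gt0.
have wN : (N <= (fine N)%:E)%E by rewrite -NE.
have lip : normal_jump_lip Omega T (fine N + e / C) u1 u2.
  by apply: (weak_jump_lip oOmega bnd_Omega T_gt0 C3_Omega u1C u2C u12 wdt D0 wN); rewrite lerDl ltW.
have -> : C * fine N + e = C * (fine N + e / C) by rewrite mulrDr [C * (e / C)]mulrC divfK// gt_eqF.
by apply: (hC sigma1 sigma2 u1 u2) => //; rewrite ltr_pwDr.
Qed.
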